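(* Let $m\ge2$ and let $\psi:M^m\to\bar M^{n+1}=I\times_hP$ be a complete mean curvature flow soliton with respect to $X=h(t)\partial_t$, with constant $c$. Assume that $P$ has constant sectional curvature $\kappa$. Let $II$ be the second fundamental form of the immersion and suppose that $$\Lambda=\frac{1}{m-1}\sup_M\Big(|II|^2+c\,h'(\pi\circ\psi)-(m-1)\,\varkappa(\pi\circ\psi)\Big)<+\infty,$$ where $$\varkappa(t)=\min\Big\{-\frac{h''(t)}{h(t)},\ \frac{\kappa}{h^2(t)}-\frac{h'(t)^2}{h^2(t)}\Big\},\qquad t\in I.$$ Then the weak maximum principle holds for the operator $\Delta_{-c\eta}$ on $M$.
   Context: $I\subset\mathbb R$ is an open interval, $h:I\to(0,\infty)$ is smooth, $(P^n,g_0)$ is a Riemannian manifold, and $\bar M^{n+1}=I\times_hP$ is $I\times P$ with metric $dt^2+h(t)^2g_0$; $\pi(t,p)=t$. An isometric immersion $\psi:M^m\to\bar M^{n+1}$ is a mean curvature flow soliton with respect to $X$ if $c\,X^\perp=\mathbf H$ along $\psi$ for some constant $c\in\mathbb R$, where $\perp$ is projection on the normal bundle and $\mathbf H$ is the non-normalized mean curvature vector (the trace of $II$). It is complete if $M$ with the induced metric is complete. Fix $t_0\in I$ and put $\eta(x)=\int_{t_0}^{\pi(\psi(x))}h(s)\,ds$; $\Delta_{-c\eta}u=\Delta u+c\langle\nabla\eta,\nabla u\rangle$. The weak maximum principle holds for an operator $L$ (here $L=\Delta_{-c\eta}$) on $M$ if for every $u\in C^2(M)$ with $u^*=\sup_Mu<\infty$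 and every $\gamma<u^*$ one has $\inf_{\Omega_\gamma}Lu\le0$, where $\Omega_\gamma=\{x\in M:u(x)>\gamma\}$. *)

(* Defs.v *)
From HB Require Import structures.
From mathcomp Require Import all_boot all_order all_algebra.
From mathcomp Require Import all_classical all_reals all_analysis.

Set Implicit Arguments.
Unset Strict Implicit.
Unset Printing Implicit Defensive.

Import Order.TTheory GRing.Theory Num.Theory.
Import numFieldNormedType.Exports.

Local Open Scope classical_set_scope.
Local Open Scope ring_scope.

(* Tangent vectors are coordinate row vectors; the Jacobian of F at y is the
   library's [jacobian F y], whose i-th row is the derivative of F along the
   i-th coordinate vector. *)

Section Coordinates.
Context {R : realType}.

Definition partial d (i : 'I_d) (f : 'rV[R]_d -> R) (y : 'rV[R]_d) : R :=
  'D_(delta_mx 0 i) f y.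

Fixpoint Ck_on (k : nat) d (U : set 'rV[R]_d) (f : 'rV[R]_d -> R) : Prop :=
  (forall y, U y -> {for y, continuous f}) /\
  if k is k'.+1 then
    forall i : 'I_d,
      (forall y, U y -> derivable f y (delta_mx 0 i)) /\
      Ck_on k' U (partial i f)
  else True.

Definition smooth_on d (U : set 'rV[R]_d) (f : 'rV[R]_d -> R) : Prop :=
  forall k, Ck_on k U f.

Definition smooth_map_on d e (U : set 'rV[R]_d) (F : 'rV[R]_d -> 'rV[R]_e) :=
  forall a : 'I_e, smooth_on U (fun y => F y 0 a).

Definition inner d (G : 'M[R]_d) (u v : 'rV[R]_d) : R :=
  (u *m G *m v^T) 0 0.

Definition pullback d e (F : 'rV[R]_d -> 'rV[R]_e) (G : 'rV[R]_e -> 'M[R]_e)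
    (y : 'rV[R]_d) : 'M[R]_d :=
  jacobian F y *m G (F y) *m (jacobian F y)^T.

(* Gamma^k_ij *)
Definition christoffel d (G : 'rV[R]_d -> 'M[R]_d) (k i j : 'I_d)
    (y : 'rV[R]_d) : R :=
  2^-1 * \sum_(l < d) invmx (G y) k l *
    (partial i (fun z => G z j l) y + partial j (fun z => G z i l) y
     - partial l (fun z => G z i j) y).

(* l-th component of R(e_i, e_j) e_k, with the sign convention
   R(X, Y) = [nabla_X, nabla_Y] - nabla_[X, Y] *)
Definition curvature_coef d (G : 'rV[R]_d -> 'M[R]_d) (l i j k : 'I_d)
    (y : 'rV[R]_d) : R :=
  partial i (christoffel G l j k) y - partial j (christoffel G l i k) y
  + \sum_(p < d) (christoffel G p j k y * christoffel G l i p y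
                  - christoffel G p i k y * christoffel G l j p y).

Definition curvature d (G : 'rV[R]_d -> 'M[R]_d) (y u v w : 'rV[R]_d) :
    'rV[R]_d :=
  \row_l \sum_(i < d) \sum_(j < d) \sum_(k < d)
    u 0 i * v 0 j * w 0 k * curvature_coef G l i j k y.

Definition sectional d (G : 'rV[R]_d -> 'M[R]_d) (y u v : 'rV[R]_d) : R :=
  inner (G y) (curvature G y u v v) u /
  (inner (G y) u u * inner (G y) v v - inner (G y) u v ^+ 2).

Definition grad d (G : 'rV[R]_d -> 'M[R]_d) (f : 'rV[R]_d -> R)
    (y : 'rV[R]_d) : 'rV[R]_d :=
  (\row_i partial i f y) *m invmx (G y).

Definition hessian d (G : 'rV[R]_d -> 'M[R]_d) (f : 'rV[R]_d -> R)
    (i j : 'I_d) (y : 'rV[R]_d) : R :=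
  partial i (partial j f) y
  - \sum_(k < d) christoffel G k i j y * partial k f y.

(* orthogonal projection, for the scalar product G, onto the orthogonal
   complement of the row space of J *)
Definition normal_part d e (G : 'M[R]_e) (J : 'M[R]_(d, e)) (v : 'rV[R]_e) :
    'rV[R]_e :=
  v - v *m G *m J^T *m invmx (J *m G *m J^T) *m J.

(* covariant derivative in direction e_i, for the Levi-Civita connection of G,
   of the vector field dF(e_j) along F *)
Definition cov_deriv d e (F : 'rV[R]_d -> 'rV[R]_e) (G : 'rV[R]_e -> 'M[R]_e)
    (i j : 'I_d) (y : 'rV[R]_d) : 'rV[R]_e :=
  \row_a (partial i (partial j (fun z => F z 0 a)) y
    + \sum_(b < e) \sum_(c < e)
        christoffel G a b c (F y) * jacobian F y i b * jacobian F y j c).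

(* II(e_i, e_j) *)
Definition second_ff d e (F : 'rV[R]_d -> 'rV[R]_e)
    (G : 'rV[R]_e -> 'M[R]_e) (i j : 'I_d) (y : 'rV[R]_d) : 'rV[R]_e :=
  normal_part (G (F y)) (jacobian F y) (cov_deriv F G i j y).

End Coordinates.

(* A topological space with an indexed family of charts (mg_dom i, mg_map i),
   of inverse mg_inv i, and with the coefficients mg_metric i of a metric in
   each chart, as functions of the coordinates. Values of mg_map and mg_inv
   outside mg_dom i and its image are irrelevant. mg_at x is the index of a
   preferred chart around x, in which pointwise quantities are evaluated. *)
Record metric_charts (R : realType) (d : nat) := MetricCharts {
  mg_space :> topologicalType ;
  mg_index : Type ;
  mg_dom : mg_index -> set mg_space ;
  mg_map : mg_index -> mg_space -> 'rV[R]_d ;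
  mg_inv : mg_index -> 'rV[R]_d -> mg_space ;
  mg_metric : mg_index -> 'rV[R]_d -> 'M[R]_d ;
  mg_at : mg_space -> mg_index }.

Arguments mg_dom {R d m} i.
Arguments mg_map {R d m} i.
Arguments mg_inv {R d m} i.
Arguments mg_metric {R d m} i.
Arguments mg_at {R d m} x.

Section Manifold.
Context {R : realType} {d : nat}.
Implicit Type M : metric_charts R d.

Definition mg_image M (i : mg_index M) : set 'rV[R]_d := mg_map i @` mg_dom i.

Definition is_chart M (i : mg_index M) : Prop :=
  [/\ open (mg_dom i), open (mg_image i),
      forall x, mg_dom i x -> mg_inv i (mg_map i x) = x,
      forall x, mg_dom i x -> {for x, continuous (mg_map i)} &
      forall y, mg_image i y -> {for y, continuous (mg_inv i)}].

Definition is_metric M (i : mg_index M) : Prop :=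
  [/\ forall k l, smooth_on (mg_image i) (fun y => mg_metric i y k l),
      forall y, mg_image i y -> (mg_metric i y)^T = mg_metric i y &
      forall y, mg_image i y -> forall u, u != 0 ->
        0 < inner (mg_metric i y) u u].

Definition chart_change M (i j : mg_index M) (y : 'rV[R]_d) : 'rV[R]_d :=
  mg_map j (mg_inv i y).

Definition compatible M (i j : mg_index M) : Prop :=
  let U := mg_map i @` (mg_dom i `&` mg_dom j) in
  smooth_map_on U (chart_change i j) /\
  forall y, U y -> mg_metric i y = pullback (chart_change i j) (mg_metric j) y.

Definition is_riemannian M : Prop :=
  [/\ hausdorff_space M, @second_countable M,
      forall x : M, mg_dom (mg_at x) x,
      forall i : mg_index M, is_chart i /\ is_metric i &
      forall i j : mg_index M, compatible i j].

End Manifold.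

Record riemannian_manifold (R : realType) (d : nat) := RiemannianManifold {
  rm_charts :> metric_charts R d ;
  rm_riemannian : is_riemannian rm_charts }.

Section Geometry.
Context {R : realType} {d : nat}.
Variable M : metric_charts R d.

Definition C2 (u : M -> R) : Prop :=
  forall i : mg_index M, Ck_on 2 (mg_image i) (u \o mg_inv i).

Definition grad_inner (f u : M -> R) (x : M) : R :=
  let i := mg_at x in let y := mg_map i x in let g := mg_metric i in
  inner (g y) (grad g (f \o mg_inv i) y) (grad g (u \o mg_inv i) y).

Definition laplacian (u : M -> R) (x : M) : R :=
  let i := mg_at x in let y := mg_map i x in let g := mg_metric i in
  \sum_(k < d) \sum_(l < d)
    invmx (g y) k l * hessian g (u \o mg_inv i) k l y.

Definition constant_sectional_curvature (kappa : R) : Prop :=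
  forall (x : M) (u v : 'rV[R]_d), row_free (col_mx u v) ->
    sectional (mg_metric (mg_at x)) (mg_map (mg_at x) x) u v = kappa.

(* Any piecewise C^1 curve has a C^1 reparametrisation (not necessarily
   regular), at rest at its corners and endpoints; so the infimum of lengths
   may be taken over C^1 curves, restricted to [0, 1]. *)
Definition C1_curve (gam : R -> M) : Prop :=
  continuous gam /\
  forall (i : mg_index M) (s : R), mg_dom i (gam s) ->
    derivable (mg_map i \o gam) s 1 /\
    {for s, continuous (derive1 (mg_map i \o gam))}.

Definition speed (gam : R -> M) (s : R) : R :=
  let i := mg_at (gam s) in
  let v := derive1 (mg_map i \o gam) s in
  Num.sqrt (inner (mg_metric i (mg_map i (gam s))) v v).

Definition curve_length (gam : R -> M) : \bar R :=
  (\int[lebesgue_measure]_(s in `[0%R, 1%R]) (speed gam s)%:E)%E.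

(* +oo between points of distinct connected components *)
Definition distance (x y : M) : \bar R :=
  ereal_inf [set curve_length gam |
    gam in [set gam : R -> M | [/\ C1_curve gam, gam 0 = x & gam 1 = y]]].

Definition complete_manifold : Prop :=
  forall u : nat -> M,
    (forall e : R, 0 < e -> exists N : nat, forall i j : nat,
       (N <= i)%N -> (N <= j)%N -> (distance (u i) (u j) < e%:E)%E) ->
    exists l : M, forall e : R, 0 < e -> exists N : nat, forall i : nat,
       (N <= i)%N -> (distance (u i) l < e%:E)%E.

Definition weak_maximum_principle (L : (M -> R) -> M -> R) : Prop :=
  forall u : M -> R, C2 u ->
    (ereal_sup [set (u x)%:E | x in [set: M]] < +oo)%E ->
    forall gam : R, (gam%:E < ereal_sup [set (u x)%:E | x in [set: M]])%E ->
      (ereal_inf [set (L u x)%:E | x in [set x : M | gam < u x]%R] <= 0)%E.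

End Geometry.

Section Immersion.
Context {R : realType} {d e : nat}.
Variables (M : metric_charts R d) (N : metric_charts R e).

Definition in_charts (psi : M -> N) (i : mg_index M) (j : mg_index N)
    (y : 'rV[R]_d) : 'rV[R]_e :=
  mg_map j (psi (mg_inv i y)).

Definition in_charts_at (psi : M -> N) (x : M) : 'rV[R]_d -> 'rV[R]_e :=
  in_charts psi (mg_at x) (mg_at (psi x)).

Definition smooth_map (psi : M -> N) : Prop :=
  continuous psi /\
  forall (i : mg_index M) (j : mg_index N),
    smooth_map_on (mg_map i @` (mg_dom i `&` psi @^-1` mg_dom j))
      (in_charts psi i j).

Definition isometric_immersion (psi : M -> N) : Prop :=
  smooth_map psi /\
  forall x : M,
    let y := mg_map (mg_at x) x in
    row_free (jacobian (in_charts_at psi x) y) /\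
    mg_metric (mg_at x) y =
      pullback (in_charts_at psi x) (mg_metric (mg_at (psi x))) y.

Definition second_ff_at (psi : M -> N) (x : M) (i j : 'I_d) : 'rV[R]_e :=
  second_ff (in_charts_at psi x) (mg_metric (mg_at (psi x))) i j
    (mg_map (mg_at x) x).

Definition second_ff_sqnorm (psi : M -> N) (x : M) : R :=
  let g := invmx (mg_metric (mg_at x) (mg_map (mg_at x) x)) in
  let G := mg_metric (mg_at (psi x)) (mg_map (mg_at (psi x)) (psi x)) in
  \sum_(i < d) \sum_(j < d) \sum_(k < d) \sum_(l < d)
    g i k * g j l * inner G (second_ff_at psi x i j) (second_ff_at psi x k l).

Definition mean_curvature (psi : M -> N) (x : M) : 'rV[R]_e :=
  let g := invmx (mg_metric (mg_at x) (mg_map (mg_at x) x)) in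
  \sum_(i < d) \sum_(j < d) g i j *: second_ff_at psi x i j.

(* X z is the coordinate vector of the field at z in the chart mg_at z *)
Definition mcf_soliton (X : N -> 'rV[R]_e) (c : R) (psi : M -> N) : Prop :=
  isometric_immersion psi /\
  forall x : M,
    c *: normal_part (mg_metric (mg_at (psi x)) (mg_map (mg_at (psi x)) (psi x)))
           (jacobian (in_charts_at psi x) (mg_map (mg_at x) x)) (X (psi x))
    = mean_curvature psi x.

End Immersion.

Section WarpedProduct.
Context {R : realType} {n : nat}.
Variables (I : set R) (h : R -> R) (P : metric_charts R n).

(* I * P as an open subset of R * P: its charts (t, p) |-> (t, chart p) cover
   exactly I * P. *)
Definition warped_product : metric_charts R n.+1 :=
  @MetricCharts R n.+1 (R * P)%type (mg_index P)
    (fun i => [set z | I z.1 /\ mg_dom i z.2])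
    (fun i z => row_mx (z.1)%:M (mg_map i z.2) : 'rV[R]_(1 + n))
    (fun i (y : 'rV[R]_(1 + n)) => (lsubmx y 0 0, mg_inv i (rsubmx y)))
    (fun i (y : 'rV[R]_(1 + n)) =>
       block_mx 1%:M 0 0 (h (lsubmx y 0 0) ^+ 2 *: mg_metric i (rsubmx y))
       : 'M[R]_(1 + n))
    (fun z => mg_at z.2).

(* the vector field h(t) d/dt *)
Definition warped_field (z : warped_product) : 'rV[R]_n.+1 :=
  (row_mx (h z.1)%:M 0 : 'rV[R]_(1 + n)).

End WarpedProduct.

Definition smooth1_on {R : realType} (I : set R) (h : R -> R) : Prop :=
  forall (k : nat) (t : R), I t -> derivable (derive1n k h) t 1.

(* integral of h from a to b, also for b < a *)
Definition oriented_integral {R : realType} (h : R -> R) (a b : R) : R :=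
  if a <= b then \int[lebesgue_measure]_(s in `[a, b]) h s
  else - (\int[lebesgue_measure]_(s in `[b, a]) h s).

Definition warped_curvature_bound {R : realType} (h : R -> R) (kappa t : R) : R :=
  Num.min (- (derive1n 2 h t / h t))
          (kappa / h t ^+ 2 - derive1 h t ^+ 2 / h t ^+ 2).

(* Delta u + c <nabla eta, nabla u>, that is Delta_{- c eta} u *)
Definition drift_laplacian {R : realType} {d : nat} (M : metric_charts R d)
    (c : R) (eta u : M -> R) (x : M) : R :=
  laplacian u x + c * grad_inner eta u x.

(* Main.v *)
(** With [phi = c eta], the Gauss equation, the soliton equation and
  [Hess eta = h' g + <X, II>] give
  [Ric - Hess phi >= (m - 1) varkappa - c h' - |II|^2], so the hypothesis says that the
  Bakry-Emery tensor of [Delta + <grad phi, grad>] is bounded below by some [-K].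

  Suppose that [Delta u + <grad phi, grad u> >= e0 > 0] where [u > gamma]. A step from [x]
  is a motion by [+s] or [-s] along a vector [v] of an orthonormal frame, with acceleration
  [grad phi / m]; the sum of the increments of [u] over the [2 m] steps is [s^2] times the
  operator, up to [o(s^2)]. Steps from two points [q], [x] are coupled by transporting the
  frame at [x] to [q] along a chain of intermediate points. In each link the second
  variation of length brings in [Hess phi - Ric], whence
  [sum d(step q, step x) <= (2 m + (K + 1/2) s^2) d(q, x) + o(s^2)], with neither geodesics
  nor a discussion of the cut locus.

  Fix [o] with [u o > gamma]. As closed balls are compact by completeness,
  [u x - delta (A |z q - z o|^2 + ln (1 + d(q, x)))], with [q] in a chart [z] around [o],
  has a maximum over [(q, x)], at which [u x > gamma]. Since [ln] is concave and
  [D / (1 + D) <= 1], the coupled steps from there yield [e0 <= C delta] with [C]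
  independent of [delta], a contradiction for small [delta]. *)

From HB Require Import structures.
Require Import Defs.
From mathcomp Require Import all_boot all_order all_algebra.
From mathcomp Require Import all_classical all_reals all_analysis.
From mathcomp Require Import ring lra.

Set Implicit Arguments.
Unset Strict Implicit.
Unset Printing Implicit Defensive.

Import Order.TTheory GRing.Theory Num.Theory.
Import numFieldNormedType.Exports.

Local Open Scope classical_set_scope.
Local Open Scope ring_scope.

(** * Calculus in coordinates *)

(** The coupling bounds the distance of two points that both move, so [q] cannot be kept at [o]. The
    term [A |z q - z o|^2] pays for the motion of [q]; with [A r^2 > C r] on a coordinate ball of
    radius [r] it also forces the maximising [q] into the interior, where all steps are admissible.
    The logarithm is what tolerates [K > 0]: the coupled distance [D] may grow at a rate
    proportional to [D], which the slope [1 / (1 + D)] compensates however far away [x] is.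

    Transport along the chain is only approximately isometric. This is harmless: the frame is
    exactly orthonormal at [x], where the operator is evaluated, whereas at [q] only its size
    matters, for the bound on the penalty. The defect that the local estimate tolerates has to be
    fixed first, then the accuracy of the transport, then the length of the links.

    In the final argument the radius, the rate of the penalty and [A] are chosen first, then
    [delta], then the error of the expansions. The step size comes last, once the maximiser and the
    chain are known, so that it need not be uniform in them. *)

Section PointwiseDerivatives.
Context {R : realType} {V : normedModType R}.
Implicit Types (f g : V -> R) (x v : V).

Lemma der_add f g x v a b : is_derive x v f a -> is_derive x v g b ->
  is_derive x v (fun s => f s + g s) (a + b).
Proof. exact: is_deriveD. Qed.

Lemma der_sub f g x v a b : is_derive x v f a -> is_derive x v g b ->
  is_derive x v (fun s => f s - g s) (a - b).
Proof. exact: is_deriveB. Qed.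

Lemma der_opp f x v a : is_derive x v f a -> is_derive x v (fun s => - f s) (- a).
Proof. exact: is_deriveN. Qed.

Lemma der_mul f g x v a b : is_derive x v f a -> is_derive x v g b ->
  is_derive x v (fun s => f s * g s) (a * g x + f x * b).
Proof.
move=> fa gb; rewrite addrC [a * _]mulrC.
exact: (@is_deriveM _ _ f g x v a b).
Qed.

Lemma der_cst x v c : is_derive x v (fun=> c : R) 0.
Proof. exact: is_derive_cst. Qed.

Lemma der_eq f x v a b : is_derive x v f a -> a = b -> is_derive x v f b.
Proof. by move=> ? <-. Qed.

Lemma der_sum (J : Type) (r : seq J) (P : pred J) (f : J -> V -> R) x v
    (a : J -> R) : (forall j, P j -> is_derive x v (f j) (a j)) ->
  is_derive x v (fun s => \sum_(j <- r | P j) f j s) (\sum_(j <- r | P j) a j).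
Proof.
move=> fa; elim: r => [|j r IH].
  rewrite big_nil (_ : (fun _ => _) = (fun=> 0 : R)); first exact: der_cst.
  by apply/funext => s; rewrite big_nil.
rewrite big_cons; under eq_fun do rewrite big_cons.
by case: ifPn => // Pj; apply: der_add => //; exact: fa.
Qed.

Lemma der_mulc f x v a c : is_derive x v f a ->
  is_derive x v (fun s => c * f s) (c * a).
Proof.
move=> fa; apply: (der_eq (der_mul (der_cst x v c) fa)).
by rewrite mul0r add0r.
Qed.

Lemma der_near f g x v a : (\near x, f x = g x) -> is_derive x v f a ->
  is_derive x v g a.
Proof. exact: near_eq_is_derive. Qed.

Lemma der_val f x v a : is_derive x v f a -> 'D_v f x = a.
Proof. by move=> fa; rewrite derive_val. Qed.

Lemma der_line f x v s a : is_derive (x + s *: v) v f a ->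
  is_derive s 1 (fun r : R => f (x + r *: v)) a.
Proof.
have E : (fun h : R => h^-1 *: ((f \o shift (x + s *: v)) (h *: v) - f (x + s *: v)))
  = (fun h : R => h^-1 *: (((fun r : R => f (x + r *: v)) \o shift s) (h *: 1) - f (x + s *: v))).
  apply/funext => h; rewrite (_ : (h *: 1 : R) = h); last exact: mulr1.
  by congr (_ *: (f _ - _)); rewrite /= scalerDl addrCA.
move=> [da va]; split.
  by rewrite /derivable -E.
by rewrite /derive -E.
Qed.

(** A directional derivative only sees the restriction to a line, so chain rules on normed spaces
    reduce to functions of one real variable at 0. *)
Lemma der_lineV f x v a : is_derive (0 : R) 1 (fun r : R => f (x + r *: v)) a ->
  is_derive x v f a.
Proof.
have E : (fun h : R => h^-1 *: ((f \o shift x) (h *: v) - f x))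
  = (fun h : R => h^-1 *: (((fun r : R => f (x + r *: v)) \o shift 0) (h *: 1) - f (x + 0 *: v))).
  apply/funext => h; rewrite (_ : (h *: 1 : R) = h); last exact: mulr1.
  by rewrite /= scale0r !addr0; congr (_ *: (f _ - _)); rewrite addrC.
move=> [da va]; split.
  by rewrite /derivable E.
by rewrite /derive E.
Qed.

End PointwiseDerivatives.

Section RealDerivatives.
Context {R : realType}.

Lemma der_id (x : R) : is_derive x 1 (fun s : R => s) 1.
Proof. exact: is_derive_id. Qed.

Lemma der_comp (V : normedModType R) (h : R -> R) (f : V -> R) x v a b :
  is_derive x v f a -> is_derive (f x) 1 h b ->
  is_derive x v (fun s => h (f s)) (b * a).
Proof.
move=> fa hb; apply: der_lineV.
have fa0 : is_derive (0 : R) 1 (fun r : R => f (x + r *: v)) a.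
  by apply: der_line; rewrite scale0r addr0.
have hb0 : is_derive (f (x + (0 : R) *: v)) 1 h b by rewrite scale0r addr0.
have dh : derivable h (f (x + (0 : R) *: v)) 1 by apply: ex_derive.
have df : derivable (fun r : R => f (x + r *: v)) 0 1 by apply: ex_derive.
split.
  apply/derivable1_diffP; apply: (@differentiable_comp _ _ _ _ (fun r : R => f (x + r *: v)) h).
    by apply/derivable1_diffP.
  by apply/derivable1_diffP.
rewrite -derive1E (derive1_comp df dh) !derive1E.
by rewrite (der_val hb0) (der_val fa0).
Qed.

Lemma der_compR (h f : R -> R) (x a b : R) :
  is_derive x 1 f a -> is_derive (f x) 1 h b ->
  is_derive x 1 (fun s => h (f s)) (b * a).
Proof. exact: der_comp. Qed.

End RealDerivatives.

Section MatrixContinuity.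
Context {R : realType}.

Lemma cvg_mx (T : Type) (F : set_system T) {FF : Filter F} m n
    (f : T -> 'M[R]_(m, n)) (l : 'M[R]_(m, n)) :
  (forall i j, (fun x => f x i j) @ F --> l i j) -> f @ F --> l.
Proof.
move=> fl; apply/cvgrPdist_le => e e0; near=> x.
rewrite /Num.Def.normr/= mx_normrE (bigmax_le _ (ltW e0))//= => i _.
rewrite !mxE; move: i; near: x; apply: filter_forall => /= i.
exact: ((cvgrPdist_le _ _).1 (fl i.1 i.2)).
Unshelve. all: by end_near. Qed.

Lemma cvg_coord (T : Type) (F : set_system T) {FF : Filter F} m n
    (f : T -> 'M[R]_(m, n)) (l : 'M[R]_(m, n)) i j :
  f @ F --> l -> (fun x => f x i j) @ F --> l i j.
Proof.
move=> fl; apply: (cvg_comp f (fun M : 'M[R]_(m, n) => M i j) fl).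
exact: coord_continuous.
Qed.

Lemma norm_coord m n (A : 'M[R]_(m, n)) i j : `|A i j| <= `|A|.
Proof.
by rewrite [leRHS]/Num.Def.normr/= mx_normrE; exact: (le_bigmax _ (fun ij => `|A ij.1 ij.2|) (i, j)).
Qed.

Lemma norm_mx_le m n (A : 'M[R]_(m, n)) c : 0 <= c ->
  (forall i j, `|A i j| <= c) -> `|A| <= c.
Proof.
move=> c0 Ac; rewrite /Num.Def.normr/= mx_normrE.
by apply: bigmax_le => // -[i j] _; exact: Ac.
Qed.

End MatrixContinuity.

Section ContinuityHelpers.
Context {R : realType}.

Lemma cvg_bigsum (T : Type) (F : set_system T) {FF : Filter F} (J : Type)
    (r : seq J) (P : pred J) (f : J -> T -> R) (l : J -> R) :
  (forall j, P j -> f j @ F --> l j) ->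
  (fun x => \sum_(j <- r | P j) f j x) @ F --> \sum_(j <- r | P j) l j.
Proof.
move=> fl; elim: r => [|j r IH].
  rewrite big_nil (_ : (fun _ => _) = (fun=> 0 : R)); first exact: cvg_cst.
  by apply/funext => s; rewrite big_nil.
rewrite big_cons; under eq_fun do rewrite big_cons.
by case: ifPn => // Pj; apply: cvgD => //; exact: fl.
Qed.

Lemma near_line (d : nat) (U : set 'rV[R]_d) (y v : 'rV[R]_d) : open U -> U y ->
  \forall s \near (0 : R), U (y + s *: v).
Proof.
move=> oU Uy.
have c : (fun s : R => y + s *: v) @ (0 : R) --> y + 0 *: v.
  by apply: cvgD; [exact: cvg_cst | apply: cvgZr_tmp; exact: cvg_id].
apply: c; rewrite scale0r addr0; exact: open_nbhs_nbhs.
Qed.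

Lemma near0_norm (d : nat) (r : R) : 0 < r -> \forall h \near (0 : 'rV[R]_d), `|h| < r.
Proof. by move=> r0; exact: (@nbhs0_lt R 'rV[R]_d). Qed.

Lemma diff_of_increment (V W : normedModType R) (f : V -> W)
    (df : {linear V -> W}) (x : V) : continuous df ->
  (forall e, 0 < e -> \forall h \near (0 : V), `|f (x + h) - f x - df h| <= e * `|h|) ->
  differentiable f x /\ 'd f x = df :> (V -> W).
Proof.
move=> cdf inc.
have E : f \o shift x = cst (f x) + df +o_ 0 id.
  apply/eqaddoP => e e0; near=> h.
  rewrite (_ : (_ - _) h = f (x + h) - f x - df h); last first.
    by rewrite !fctE /= [h + x]addrC opprD addrA.
  by near: h; exact: inc.
have dE := diff_unique cdf E.
by split => //; apply/diff_locallyP; rewrite dE; split.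
Unshelve. all: by end_near. Qed.

End ContinuityHelpers.

(** * Differentiability from continuous partial derivatives *)

Section ContinuousPartials.
Context {R : realType} {d : nat}.
Implicit Types (U : set 'rV[R]_d) (f : 'rV[R]_d -> R) (g y v : 'rV[R]_d).

Definition dot (g : 'rV[R]_d) (h : 'rV[R]_d) : R := \sum_k g 0 k * h 0 k.

Lemma dot_is_linear g : linear (dot g).
Proof.
move=> a u v; rewrite /dot scaler_sumr -big_split/=.
by apply: eq_bigr => k _; rewrite !mxE mulrDr mulrCA.
Qed.
HB.instance Definition _ g :=
  GRing.isLinear.Build R 'rV[R]_d R _ (dot g) (dot_is_linear g).

Lemma dot_continuous g : continuous (dot g).
Proof.
move=> x; apply: (@cvg_bigsum _ _ (nbhs x)) => k _.
apply: cvgM; first exact: cvg_cst.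
exact: coord_continuous.
Qed.

Lemma Ck_on_cont k U f y : Ck_on k U f -> U y -> {for y, continuous f}.
Proof. by case: k => [|k] [H _]; exact: H. Qed.

Lemma Ck_on_der k U f i y : Ck_on k.+1 U f -> U y ->
  is_derive y (delta_mx 0 i) f (partial i f y).
Proof. by move=> [_ H] Uy; apply: derivableP; exact: (H i).1. Qed.

Lemma Ck_onW k U f : Ck_on k.+1 U f -> Ck_on k U f.
Proof.
elim: k f => [|k IH] f [cf H]; first by split.
by split => // i; have [dfi Hi] := H i; split => //; exact: IH.
Qed.

Lemma Ck_on_le k k' U f : (k' <= k)%N -> Ck_on k U f -> Ck_on k' U f.
Proof.
move=> /subnK <-; elim: (k - k')%N => // j IH; rewrite addSn => /Ck_onW; exact: IH.
Qed.

Lemma Ck_onS k U f i : Ck_on k.+1 U f -> Ck_on k U (partial i f).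
Proof. by move=> [_ H]; exact: (H i).2. Qed.

(** Passing from [trunc k h] to [trunc k.+1 h] moves a single coordinate, so each difference of [f]
    along this sequence is an increment in one variable. *)
Definition trunc (k : nat) (h : 'rV[R]_d) : 'rV[R]_d :=
  \row_j (if (j < k)%N then h 0 j else 0).

Lemma trunc0 h : trunc 0 h = 0.
Proof. by apply/rowP => j; rewrite !mxE. Qed.

Lemma truncd h : trunc d h = h.
Proof. by apply/rowP => j; rewrite !mxE ltn_ord. Qed.

Lemma truncS (k : 'I_d) h : trunc k.+1 h = trunc k h + h 0 k *: delta_mx 0 k.
Proof.
apply/rowP => j; rewrite !mxE eqxx/=.
have [->|jk] := eqVneq j k; first by rewrite ltnS leqnn ltnn add0r mulr1.
by rewrite ltnS leq_eqVlt (negbTE jk : (j == k :> nat) = false)/= mulr0 addr0.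
Qed.

(* The increment is telescoped along the coordinate axes. *)
Lemma C1_increment U f y (e : R) : open U -> Ck_on 1 U f -> U y -> 0 < e ->
  \forall h \near (0 : 'rV[R]_d),
    `|f (y + h) - f y - dot (\row_k partial k f y) h| <= e * `|h|.
Proof.
move=> oU Cf Uy e0.
(* Each of the [d] coordinates gets an equal share of [e]; the successor keeps the quotient
   meaningful for [d = 0]. *)
have e1 : 0 < e / d.+1%:R by rewrite divr_gt0.
have near_part : \forall z \near y, U z /\
    forall k, `|partial k f z - partial k f y| <= e / d.+1%:R.
  near=> z; split; near: z; first exact: open_nbhs_nbhs.
  apply: filter_forall => k.
  have /cvgrPdist_le/(_ _ e1) := Ck_on_cont (Ck_onS k Cf) Uy.
  by apply: filterS => z; rewrite distrC.
have [r /= r0 Br] := (@nbhs_ballP _ _ _ _).1 near_part.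
near=> h.
have hr : `|h| < r by near: h; exact: near0_norm.
have P k (a : R) : 0 <= a <= 1 -> U (y + (trunc k h + a *: (trunc k.+1 h - trunc k h))) /\
    forall j, `|partial j f (y + (trunc k h + a *: (trunc k.+1 h - trunc k h))) - partial j f y| <= e / d.+1%:R.
  move=> /andP[a0 a1]; apply: Br.
  rewrite -ball_normE /= opprD addNKr normrN.
  apply: le_lt_trans hr; apply: norm_mx_le => // i j; rewrite !mxE.
  have := norm_coord h i j; rewrite (ord1 i) => hj.
  have [jk|jk] := ltnP j k; first by rewrite (ltnW jk : (j < k.+1)%N) subrr mulr0 addr0.
  rewrite add0r subr0; case: ifP => _; last by rewrite mulr0 normr0.
  by rewrite normrM (ger0_norm a0); apply: le_trans hj; rewrite ler_piMl.
have key (k : 'I_d) : `|f (y + trunc k.+1 h) - f (y + trunc k h) - partial k f y * h 0 k|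
    <= e / d.+1%:R * `|h|.
  pose L (s : R) := f (y + trunc k h + s *: (h 0 k *: delta_mx 0 k)).
  have Udiff : trunc k.+1 h - trunc k h = h 0 k *: delta_mx 0 k.
    by rewrite truncS addrC addKr.
  have dL (s : R) : 0 <= s <= 1 -> is_derive s 1 L (h 0 k * partial k f (y + (trunc k h + s *: (trunc k.+1 h - trunc k h)))).
    move=> s01; have [Us _] := P k s s01.
    rewrite mulrC; pose L1 (r : R) := f (y + trunc k h + r *: delta_mx 0 k).
    rewrite (_ : L = (fun s => L1 (s * h 0 k))); last first.
      by apply/funext => r'; rewrite /L /L1 scalerA.
    apply: (@der_compR _ L1 (fun s => s * h 0 k)).
      by apply: (der_eq (der_mul (der_id s) (der_cst _ _ _))); rewrite mul1r mulr0 addr0.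
    apply: der_line; rewrite -scalerA -Udiff -addrA; exact: Ck_on_der Cf Us.
  have dL' (x : R) : x \in `]0, 1[%R -> is_derive x 1 L (h 0 k * partial k f (y + (trunc k h + x *: (trunc k.+1 h - trunc k h)))).
    by rewrite in_itv/= => /andP[x0 x1]; apply: dL; rewrite !ltW.
  have cL : {within `[0, 1], continuous L}.
    apply: derivable_within_continuous => x; rewrite in_itv/= => xI.
    by have [] := dL x xI.
  have [c] := MVT_segment ler01 dL' cL.
  rewrite in_itv/= => c01.
  rewrite /L scale1r scale0r addr0 -addrA -truncS subr0 mulr1 => ->.
  rewrite mulrC -mulrBl normrM.
  have [_ /(_ k) Pk] := P k c c01.
  by apply: ler_pM => //; exact: norm_coord.
have -> : f (y + h) - f y - dot (\row_k partial k f y) h =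
    \sum_(k < d) (f (y + trunc k.+1 h) - f (y + trunc k h) - partial k f y * h 0 k).
  rewrite sumrB; congr (_ - _); last by apply: eq_bigr => k _; rewrite mxE.
  rewrite -(big_mkord xpredT (fun k => f (y + trunc k.+1 h) - f (y + trunc k h))).
  by rewrite telescope_sumr// truncd trunc0 addr0.
apply: (le_trans (ler_norm_sum _ _ _)).
apply: (@le_trans _ _ (\sum_(k < d) (e / d.+1%:R * `|h|))); first exact: ler_sum.
rewrite sumr_const card_ord -[leLHS]mulr_natr mulrAC; apply: ler_wpM2r => //.
by rewrite -mulrA ger_pMr// mulrC ler_pdivrMr// mul1r ler_nat.
Unshelve. all: by end_near. Qed.

Lemma C1_diff U f y : open U -> Ck_on 1 U f -> U y ->
  differentiable f y /\ 'd f y = dot (\row_k partial k f y) :> ('rV[R]_d -> R).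
Proof.
move=> oU Cf Uy.
apply: diff_of_increment; first exact: dot_continuous.
by move=> e e0; exact: C1_increment Cf Uy e0.
Qed.

Lemma der_chain (V : normedModType R) U f (phi : V -> 'rV[R]_d) (dphi : 'I_d -> R)
    (x v : V) : open U -> Ck_on 1 U f -> U (phi x) ->
  (forall k, is_derive x v (fun s => phi s 0 k) (dphi k)) ->
  is_derive x v (fun s => f (phi s)) (\sum_k partial k f (phi x) * dphi k).
Proof.
move=> oU Cf Ux dphik; apply: der_lineV.
pose psi (r : R) := phi (x + r *: v).
have dk k : is_derive (0 : R) 1 (fun r => psi r 0 k) (dphi k).
  by apply: (@der_line _ _ (fun s => phi s 0 k)); rewrite scale0r addr0.
have dpsi : derivable psi 0 1.
  apply/derivable_mxP => i k; rewrite (ord1 i); have [] // := dk k.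
have psi0 : psi 0 = phi x by rewrite /psi scale0r addr0.
have [df dfE] := C1_diff oU Cf Ux.
have dpsi' : differentiable psi 0 by apply/derivable1_diffP.
have df' : differentiable f (psi 0) by rewrite psi0.
have dc : differentiable (f \o psi) 0 by exact: differentiable_comp.
split; first by apply/derivable1_diffP.
rewrite (_ : 'D_1 (fun r : R => f (phi (x + r *: v))) 0 = 'D_1 (f \o psi) 0)//.
rewrite deriveE// diff_comp//= psi0 dfE -deriveE//.
rewrite derive_mx// /dot; apply: eq_bigr => k _; rewrite !mxE.
by rewrite (der_val (dk k)).
Qed.

End ContinuousPartials.

(** * Stability of the classes [Ck_on] *)

Section CkClosure.
Context {R : realType} {d : nat}.
Implicit Types (U : set 'rV[R]_d) (f g : 'rV[R]_d -> R) (y v : 'rV[R]_d).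

Lemma cont_near f g y : (\near y, f y = g y) -> {for y, continuous f} ->
  {for y, continuous g}.
Proof.
move=> fg cf; rewrite /prop_for /continuous_at -(nbhs_singleton fg).
by apply: cvg_trans cf; exact: (near_eq_cvg fg).
Qed.

Lemma Ck_on_ext k U f g : open U -> (forall y, U y -> f y = g y) ->
  Ck_on k U f -> Ck_on k U g.
Proof.
move=> oU; elim: k f g => [|k IH] f g fg [cf H]; have near_fg y : U y -> \forall z \near y, f z = g z.
- by move=> Uy; near=> z; apply: fg; near: z; exact: open_nbhs_nbhs.
- by split => // y Uy; apply: cont_near (cf y Uy); exact: near_fg.
- by move=> Uy; near=> z; apply: fg; near: z; exact: open_nbhs_nbhs.
split; first by move=> y Uy; apply: cont_near (cf y Uy); exact: near_fg.
move=> i; have [dfi Hi] := H i; split.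
  by move=> y Uy; apply: near_eq_derivable (dfi y Uy); exact: near_fg.
apply: IH Hi => y Uy; rewrite /partial; apply: near_eq_derive; exact: near_fg.
Unshelve. all: by end_near. Qed.

(** The values of [partial] outside [U] are arbitrary. It is enough to exhibit functions that are
    the partial derivatives on [U], which lets the closure rules work with explicit formulas. *)
Lemma Ck_onSI k U f (df : 'I_d -> 'rV[R]_d -> R) : open U ->
  (forall y, U y -> {for y, continuous f}) ->
  (forall i y, U y -> is_derive y (delta_mx 0 i) f (df i y)) ->
  (forall i, Ck_on k U (df i)) -> Ck_on k.+1 U f.
Proof.
move=> oU cf dfi H; split => // i; split.
  by move=> y Uy; have [] := dfi i y Uy.
apply: (Ck_on_ext oU _ (H i)) => y Uy.
by rewrite /partial (der_val (dfi i y Uy)).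
Qed.

Lemma Ck_on_cst k U (c : R) : open U -> Ck_on k U (fun=> c).
Proof.
move=> oU; elim: k c => [|k IH] c; first by split => // y _; exact: cst_continuous.
apply: (Ck_onSI (df := fun _ _ => 0)) => //.
- by move=> y _; exact: cst_continuous.
Qed.

Lemma Ck_on_add k U f g : open U -> Ck_on k U f -> Ck_on k U g ->
  Ck_on k U (fun y => f y + g y).
Proof.
move=> oU; elim: k f g => [|k IH] f g Cf Cg.
  by split => // y Uy; exact: cvgD (Ck_on_cont Cf Uy) (Ck_on_cont Cg Uy).
apply: (Ck_onSI (df := fun i y => partial i f y + partial i g y)) => //.
- by move=> y Uy; exact: cvgD (Ck_on_cont Cf Uy) (Ck_on_cont Cg Uy).
- by move=> i y Uy; apply: der_add; apply: Ck_on_der Uy; eassumption.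
- by move=> i; apply: IH; exact: Ck_onS.
Qed.

Lemma Ck_on_mul k U f g : open U -> Ck_on k U f -> Ck_on k U g ->
  Ck_on k U (fun y => f y * g y).
Proof.
move=> oU; elim: k f g => [|k IH] f g Cf Cg.
  by split => // y Uy; exact: cvgM (Ck_on_cont Cf Uy) (Ck_on_cont Cg Uy).
apply: (Ck_onSI (df := fun i y => partial i f y * g y + f y * partial i g y)) => //.
- by move=> y Uy; exact: cvgM (Ck_on_cont Cf Uy) (Ck_on_cont Cg Uy).
- by move=> i y Uy; apply: der_mul; apply: Ck_on_der Uy; eassumption.
- move=> i; apply: Ck_on_add => //; apply: IH => //.
  + exact: Ck_onS.
  + exact: Ck_onW.
  + exact: Ck_onW.
  + exact: Ck_onS.
Qed.

Lemma Ck_on_mulc k U f c : open U -> Ck_on k U f -> Ck_on k U (fun y => c * f y).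
Proof. by move=> oU Cf; apply: Ck_on_mul => //; exact: Ck_on_cst. Qed.

Lemma Ck_on_opp k U f : open U -> Ck_on k U f -> Ck_on k U (fun y => - f y).
Proof.
move=> oU Cf; apply: (Ck_on_ext oU _ (Ck_on_mulc (-1) oU Cf)) => y _.
by rewrite mulN1r.
Qed.

Lemma Ck_on_sub k U f g : open U -> Ck_on k U f -> Ck_on k U g ->
  Ck_on k U (fun y => f y - g y).
Proof. by move=> oU Cf Cg; apply: Ck_on_add => //; exact: Ck_on_opp. Qed.

Lemma Ck_on_sum k U (J : Type) (r : seq J) (P : pred J) (f : J -> 'rV[R]_d -> R) :
  open U -> (forall j, P j -> Ck_on k U (f j)) ->
  Ck_on k U (fun y => \sum_(j <- r | P j) f j y).
Proof.
move=> oU Cf; elim: r => [|j r IH].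
  apply: (Ck_on_ext oU _ (Ck_on_cst k 0 oU)) => y _; by rewrite big_nil.
have E : Ck_on k U (fun y => (if P j then f j y else 0) + \sum_(j <- r | P j) f j y).
  apply: Ck_on_add => //; have [Pj|_] := boolP (P j); last exact: Ck_on_cst.
  exact: Cf.
apply: (Ck_on_ext oU _ E) => y _; rewrite big_cons; case: ifP => //.
by rewrite add0r.
Qed.

Lemma Ck_on_prod k U (J : Type) (r : seq J) (P : pred J) (f : J -> 'rV[R]_d -> R) :
  open U -> (forall j, P j -> Ck_on k U (f j)) ->
  Ck_on k U (fun y => \prod_(j <- r | P j) f j y).
Proof.
move=> oU Cf; elim: r => [|j r IH].
  apply: (Ck_on_ext oU _ (Ck_on_cst k 1 oU)) => y _; by rewrite big_nil.
have E : Ck_on k U (fun y => (if P j then f j y else 1) * \prod_(j <- r | P j) f j y).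
  apply: Ck_on_mul => //; have [Pj|_] := boolP (P j); last exact: Ck_on_cst.
  exact: Cf.
apply: (Ck_on_ext oU _ E) => y _; rewrite big_cons; case: ifP => //.
by rewrite mul1r.
Qed.

Lemma der_coord y v j : is_derive y v (fun z : 'rV[R]_d => z 0 j) (v 0 j).
Proof.
apply: der_lineV; rewrite [X in is_derive _ _ X _](_ : _ = (fun r => y 0 j + r * v 0 j)).
  apply: (der_eq (der_add (der_cst _ _ _) (der_mul (der_id _) (der_cst _ _ _)))).
  by rewrite mul1r mulr0 addr0 add0r.
by apply/funext => r; rewrite !mxE.
Qed.

Lemma Ck_on_coord k U j : open U -> Ck_on k U (fun y => y 0 j).
Proof.
move=> oU; case: k => [|k].
  by split => // y _; exact: coord_continuous.
apply: (Ck_onSI (df := fun i _ => (delta_mx 0 i : 'rV[R]_d) 0 j)) => //.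
- by move=> y _; exact: coord_continuous.
- by move=> i y _; exact: der_coord.
- by move=> i; exact: Ck_on_cst.
Qed.

Lemma Ck_on_inv k U f : open U -> (forall y, U y -> f y != 0) -> Ck_on k U f ->
  Ck_on k U (fun y => (f y)^-1).
Proof.
move=> oU f0; elim: k => [|k IH] Cf.
  by split => // y Uy; exact: cvgV (f0 y Uy) (Ck_on_cont Cf Uy).
have Ci := IH (Ck_onW Cf).
apply: (Ck_onSI (df := fun i y => - ((f y)^-1 * (f y)^-1 * partial i f y))) => //.
- by move=> y Uy; exact: cvgV (f0 y Uy) (Ck_on_cont Cf Uy).
- move=> i y Uy; have dfy := Ck_on_der i Cf Uy.
  have dfy' : derivable f y (delta_mx 0 i) by [].
  split; first by apply: derivableV => //; exact: f0.
  rewrite (deriveV (f0 y Uy) dfy') (der_val dfy).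
  by rewrite -[LHS]/(_ * _) expr2 invfM mulNr.
- move=> i; apply: Ck_on_opp => //; apply: Ck_on_mul => //; last exact: Ck_onS.
  exact: Ck_on_mul.
Qed.

(** All derivatives of [h] are treated together, because the chain rule replaces [derive1n n h] by
    [derive1n n.+1 h] in the induction on [k]. *)
Lemma Ck_on_comp1 k n U (I : set R) (h : R -> R) f : open U ->
  (forall k t, I t -> derivable (derive1n k h) t 1) ->
  (forall y, U y -> I (f y)) -> Ck_on k U f ->
  Ck_on k U (fun y => derive1n n h (f y)).
Proof.
move=> oU sh UI; elim: k n => [|k IH] n Cf.
  split => // y Uy; apply: continuous_comp; first exact: Ck_on_cont Cf Uy.
  by apply: differentiable_continuous; apply/derivable1_diffP; apply: sh; exact: UI.
apply: (Ck_onSI (df := fun i y => derive1n n.+1 h (f y) * partial i f y)) => //.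
- move=> y Uy; apply: continuous_comp; first exact: Ck_on_cont Cf Uy.
  by apply: differentiable_continuous; apply/derivable1_diffP; apply: sh; exact: UI.
- move=> i y Uy; apply: der_comp; first exact: Ck_on_der Cf Uy.
  by rewrite derive1nS derive1E; apply: derivableP; apply: sh; exact: UI.
- move=> i; apply: Ck_on_mul => //; last exact: Ck_onS.
  by apply: IH; exact: Ck_onW.
Qed.

End CkClosure.

Section CkComposition.
Context {R : realType} {d e : nat}.
Variables (U : set 'rV[R]_d) (V : set 'rV[R]_e).
Hypotheses (oU : open U) (oV : open V).
Variable F : 'rV[R]_d -> 'rV[R]_e.
Hypothesis UV : forall y, U y -> V (F y).

Lemma rV_cont (y : 'rV[R]_d) : (forall a, {for y, continuous (fun z => F z 0 a)}) ->
  {for y, continuous F}.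
Proof. by move=> cF; apply: (@cvg_mx _ _ (nbhs y)) => i j; rewrite (ord1 i); exact: cF. Qed.

Lemma partial_comp f (y : 'rV[R]_d) i : Ck_on 1 V f ->
  (forall a, Ck_on 1 U (fun z => F z 0 a)) -> U y ->
  is_derive y (delta_mx 0 i) (fun z => f (F z))
    (\sum_a partial a f (F y) * partial i (fun z => F z 0 a) y).
Proof.
move=> Cf CF Uy; apply: (der_chain oV Cf (UV Uy)) => a.
exact: Ck_on_der (CF a) Uy.
Qed.

Lemma Ck_on_comp k f : Ck_on k V f -> (forall a, Ck_on k U (fun z => F z 0 a)) ->
  Ck_on k U (fun z => f (F z)).
Proof.
elim: k f => [|k IH] f Cf CF.
  split => // y Uy; apply: continuous_comp; last exact: Ck_on_cont Cf (UV Uy).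
  by apply: rV_cont => a; exact: Ck_on_cont (CF a) Uy.
apply: (Ck_onSI (df := fun i y => \sum_a partial a f (F y) * partial i (fun z => F z 0 a) y)) => //.
- move=> y Uy; apply: continuous_comp; last exact: Ck_on_cont Cf (UV Uy).
  by apply: rV_cont => a; exact: Ck_on_cont (CF a) Uy.
- move=> i y Uy; apply: partial_comp => //; first exact: Ck_on_le Cf.
  by move=> a; exact: Ck_on_le (CF a).
- move=> i; apply: Ck_on_sum => // a _; apply: Ck_on_mul => //; last exact: Ck_onS.
  by apply: IH => [|b]; [exact: Ck_onS | exact: Ck_onW].
Qed.

(** [jacobian] is defined from the differential, so it is the matrix of partial derivatives only
    once the first-order increments of all components are controlled. *)
Lemma jacobianE (y : 'rV[R]_d) i a : (forall a, Ck_on 1 U (fun z => F z 0 a)) -> U y ->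
  jacobian F y i a = partial i (fun z => F z 0 a) y.
Proof.
move=> CF Uy.
pose J := \matrix_(i, a) partial i (fun z => F z 0 a) y.
have cJ : continuous (mulmxr J : 'rV[R]_d -> 'rV[R]_e).
  move=> z; apply: (@cvg_mx _ _ (nbhs z)) => r c; rewrite (ord1 r).
  rewrite (_ : (fun x => _) = dot (\row_k J k c)); last first.
    by apply/funext => x; rewrite !mxE /dot; apply: eq_bigr => k _; rewrite !mxE mulrC.
  rewrite (_ : mulmxr J z 0 c = dot (\row_k J k c) z); last first.
    by rewrite !mxE /dot; apply: eq_bigr => k _; rewrite !mxE mulrC.
  exact: dot_continuous.
have inc e0 : 0 < e0 -> \forall h \near (0 : 'rV[R]_d),
    `|F (y + h) - F y - mulmxr J h| <= e0 * `|h|.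
  move=> e00; near=> h; apply: norm_mx_le; first by rewrite mulr_ge0// ltW.
  move=> r c; rewrite (ord1 r); move: c; near: h; apply: filter_forall => c.
  apply: filterS (C1_increment oU (CF c) Uy e00) => h; apply: le_trans.
  rewrite !mxE le_eqVlt; apply/orP; left; apply/eqP; congr (`| _ - _ |).
  by rewrite /dot; apply: eq_bigr => k _; rewrite !mxE mulrC.
have [_ dF] := diff_of_increment cJ inc.
by rewrite /jacobian /lin1_mx mxE dF /= -rowE !mxE.
Unshelve. all: by end_near. Qed.

End CkComposition.

Lemma cont_dist (R : realType) (T : topologicalType) (f : T -> R) y (e : R) :
  {for y, continuous f} -> 0 < e -> \forall z \near y, `|f y - f z| <= e.
Proof. by move=> cf e0; have /cvgrPdist_le := cf; apply. Qed.

Section MatrixSmoothness.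
Context {R : realType} {d : nat}.
Variables (U : set 'rV[R]_d).
Hypothesis oU : open U.

Lemma Ck_on_det k n (A : 'rV[R]_d -> 'M[R]_n) :
  (forall i j, Ck_on k U (fun y => A y i j)) -> Ck_on k U (fun y => \det (A y)).
Proof.
move=> CA; rewrite /determinant; apply: Ck_on_sum => // s _.
by apply: Ck_on_mul => //; [exact: Ck_on_cst | exact: Ck_on_prod].
Qed.

(** Cramer's rule: an entry of the inverse is a polynomial in the entries divided by the
    determinant. *)
Lemma Ck_on_invmx k n (A : 'rV[R]_d -> 'M[R]_n) i j :
  (forall y, U y -> A y \in unitmx) ->
  (forall i j, Ck_on k U (fun y => A y i j)) ->
  Ck_on k U (fun y => invmx (A y) i j).
Proof.
move=> uA CA.
have CadjA : Ck_on k U (fun y => (\det (A y))^-1 * (\adj (A y)) i j).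
  apply: Ck_on_mul => //.
    apply: Ck_on_inv => //; last exact: Ck_on_det.
    by move=> y Uy; have := uA y Uy; rewrite unitmxE unitfE.
  apply: (@Ck_on_ext _ _ k U (fun y => (-1) ^+ (j + i) * \det (row' j (col' i (A y))))) => //.
    by move=> y _; rewrite mxE /cofactor.
  apply: Ck_on_mul => //; first exact: Ck_on_cst.
  apply: Ck_on_det => a b; apply: Ck_on_ext (CA (lift j a) (lift i b)) => //.
  by move=> y _; rewrite !mxE.
apply: Ck_on_ext CadjA => // y Uy.
by rewrite /invmx (uA y Uy) [RHS]mxE.
Qed.

End MatrixSmoothness.

Lemma dist_half (R : realType) (p q p' q' e : R) :
  `|p - q| <= e / 2 -> `|p' - q'| <= e / 2 -> q = q' -> `|p - p'| <= e.
Proof.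
move=> h1 h2 qq; rewrite -(subrKA q) [leRHS]splitr.
by apply: le_trans (ler_normD _ _) _; apply: lerD; rewrite // qq distrC.
Qed.

Section Schwarz.
Context {R : realType} {d : nat}.

Lemma MVT_der (L dL : R -> R) : (forall s : R, 0 <= s <= 1 -> is_derive s 1 L (dL s)) ->
  exists2 c, 0 <= c <= 1 & L 1 - L 0 = dL c.
Proof.
move=> H.
have H' (x : R) : x \in `]0, 1[%R -> is_derive x 1 L (dL x).
  by rewrite in_itv/= => /andP[x0 x1]; apply: H; rewrite !ltW.
have cL : {within `[0, 1], continuous L}.
  apply: derivable_within_continuous => x; rewrite in_itv/= => xI.
  by have [] := H x xI.
have [c] := MVT_segment ler01 H' cL.
by rewrite in_itv/= subr0 mulr1 => cI E; exists c.
Qed.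

(** Mean value theorem twice: along the [i]-th axis for the difference in the [j]-th direction, then
    along the [j]-th axis. *)
Lemma mixed_difference U (f : 'rV[R]_d -> R) (y : 'rV[R]_d) i j (s : R) :
  open U -> Ck_on 2 U f ->
  (forall a b, 0 <= a <= 1 -> 0 <= b <= 1 ->
    U (y + (a * s) *: delta_mx 0 i + (b * s) *: delta_mx 0 j)) ->
  exists a b, [/\ 0 <= a <= 1, 0 <= b <= 1 &
   f (y + s *: delta_mx 0 i + s *: delta_mx 0 j) - f (y + s *: delta_mx 0 i)
   - f (y + s *: delta_mx 0 j) + f y =
   s * s * partial j (partial i f) (y + (a * s) *: delta_mx 0 i + (b * s) *: delta_mx 0 j)].
Proof.
move=> oU Cf Us.
pose L (a : R) := f (y + (a * s) *: delta_mx 0 i + s *: delta_mx 0 j) - f (y + (a * s) *: delta_mx 0 i).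
have dline (g : 'rV[R]_d -> R) (z : 'rV[R]_d) k (a : R) : Ck_on 1 U g -> U (z + (a * s) *: delta_mx 0 k) ->
    is_derive a 1 (fun a => g (z + (a * s) *: delta_mx 0 k)) (s * partial k g (z + (a * s) *: delta_mx 0 k)).
  move=> Cg Uz; rewrite mulrC.
  apply: (@der_compR _ (fun r => g (z + r *: delta_mx 0 k)) (fun a => a * s)).
    by apply: (der_eq (der_mul (der_id _) (der_cst _ _ _))); rewrite mul1r mulr0 addr0.
  by apply: der_line; exact: Ck_on_der Cg Uz.
have [a a01 Ea] : exists2 a, 0 <= a <= 1 & L 1 - L 0 =
    s * (partial i f (y + (a * s) *: delta_mx 0 i + s *: delta_mx 0 j)
       - partial i f (y + (a * s) *: delta_mx 0 i)).
  apply: (@MVT_der _ (fun a => s * (partial i f (y + (a * s) *: delta_mx 0 i + s *: delta_mx 0 j)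
       - partial i f (y + (a * s) *: delta_mx 0 i)))) => a a01.
  rewrite mulrBr; apply: der_sub.
    under eq_fun do rewrite addrAC.
    rewrite addrAC; apply: dline; first exact: Ck_onW.
    by rewrite addrAC; have := Us a 1 a01; rewrite mul1r; apply; rewrite ler01 lexx.
  apply: dline; first exact: Ck_onW.
  by have := Us a 0 a01; rewrite mul0r scale0r addr0; apply; rewrite ler01 lexx.
pose L2 (b : R) := partial i f (y + (a * s) *: delta_mx 0 i + (b * s) *: delta_mx 0 j).
have [b b01 Eb] : exists2 b, 0 <= b <= 1 & L2 1 - L2 0 =
    s * partial j (partial i f) (y + (a * s) *: delta_mx 0 i + (b * s) *: delta_mx 0 j).
  apply: (@MVT_der _ (fun b => s * partial j (partial i f) (y + (a * s) *: delta_mx 0 i + (b * s) *: delta_mx 0 j))) => b b01.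
  by apply: dline; [exact: Ck_onS | exact: Us].
exists a, b; split => //.
rewrite -mulrA -Eb /L2 mul1r mul0r scale0r addr0 -Ea /L !mul1r !mul0r !scale0r !addr0.
by rewrite opprB addrA addrAC.
Qed.

(** The second difference is symmetric in [i] and [j], so both mixed derivatives take a common
    value, each at some point of a small parallelogram; continuity at [y] does the rest. *)
Lemma schwarz U (f : 'rV[R]_d -> R) (y : 'rV[R]_d) i j :
  open U -> Ck_on 2 U f -> U y ->
  partial i (partial j f) y = partial j (partial i f) y.
Proof.
move=> oU Cf Uy; apply/eqP; rewrite -subr_eq0 -normr_eq0; apply/eqP.
apply/le_anti; rewrite normr_ge0 andbT; apply/ler_addgt0Pl => e e0; rewrite addr0.
have e2 : 0 < e / 2 by rewrite divr_gt0.
have n1 : \forall z \near y, U z by exact: open_nbhs_nbhs.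
have n2 := cont_dist (Ck_on_cont (Ck_onS i (Ck_onS j Cf)) Uy) e2.
have n3 := cont_dist (Ck_on_cont (Ck_onS j (Ck_onS i Cf)) Uy) e2.
have nearU : \forall z \near y, [/\ U z, `|partial i (partial j f) y - partial i (partial j f) z| <= e / 2
   & `|partial j (partial i f) y - partial j (partial i f) z| <= e / 2].
  by apply: filterS3 n1 n2 n3 => z; split.
have [r /= r0 Br] := (@nbhs_ballP _ _ _ _).1 nearU.
have [s s0 sr] : exists2 s, 0 < s & s + s < r by exists (r / 4); [rewrite divr_gt0|lra].
have small a b k l : 0 <= a <= 1 -> 0 <= b <= 1 ->
    ball y r (y + (a * s) *: delta_mx 0 k + (b * s) *: delta_mx 0 l).
  move=> /andP[a0 a1] /andP[b0 b1]; rewrite -ball_normE /= -addrA opprD addNKr normrN.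
  apply: (@le_lt_trans _ _ (s + s)); last exact: sr.
  apply: le_trans (ler_normD _ _) _; rewrite !normrZ.
  have nd q : `|delta_mx 0 q : 'rV[R]_d| <= 1.
    by apply: norm_mx_le => // p q'; rewrite !mxE; case: (_ && _); rewrite ?normr0 ?normr1.
  rewrite !ger0_norm ?mulr_ge0// ?(ltW s0)//.
  apply: lerD; rewrite -[leRHS]mulr1; apply: ler_pM => //.
  - by rewrite mulr_ge0// ltW.
  - by rewrite ler_piMl// ltW.
  - by rewrite mulr_ge0// ltW.
  - by rewrite ler_piMl// ltW.
have [a [b [a01 b01 E1]]] := mixed_difference oU Cf (fun a b a01 b01 => let: And3 u _ _ := Br _ (small a b i j a01 b01) in u).
have [a' [b' [a01' b01' E2]]] := mixed_difference oU Cf (fun a b a01 b01 => let: And3 u _ _ := Br _ (small a b j i a01 b01) in u).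
have EE : partial i (partial j f) (y + (a' * s) *: delta_mx 0 j + (b' * s) *: delta_mx 0 i) =
          partial j (partial i f) (y + (a * s) *: delta_mx 0 i + (b * s) *: delta_mx 0 j).
  apply: (@mulfI _ (s * s)); first by rewrite mulf_neq0// gt_eqF.
  apply: etrans (esym E2) (etrans _ E1).
  by rewrite (addrAC y (s *: delta_mx 0 j)); congr (_ + _); exact: addrAC.
have [_ h1 _] := Br _ (small a' b' j i a01' b01').
have [_ _ h2] := Br _ (small a b i j a01 b01).
exact: dist_half h1 h2 EE.
Unshelve. all: by end_near. Qed.

End Schwarz.

(** * Metrics, charts and curves *)

Section InnerProduct.
Context {R : realType} {d : nat}.
Implicit Types (G : 'M[R]_d) (u v w : 'rV[R]_d).

Lemma innerE G u v : inner G u v = \sum_i \sum_j u 0 i * G i j * v 0 j.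
Proof.
rewrite /inner mxE exchange_big; apply: eq_bigr => j _.
by rewrite !mxE mulr_suml.
Qed.

Lemma innerDl G u v w : inner G (u + v) w = inner G u w + inner G v w.
Proof. by rewrite /inner !mulmxDl mxE. Qed.

Lemma innerDr G u v w : inner G w (u + v) = inner G w u + inner G w v.
Proof. by rewrite /inner linearD/= mulmxDr mxE. Qed.

Lemma innerZl G a u v : inner G (a *: u) v = a * inner G u v.
Proof. by rewrite /inner -!scalemxAl mxE. Qed.

Lemma innerZr G a u v : inner G u (a *: v) = a * inner G u v.
Proof. by rewrite /inner linearZ/= -!scalemxAr mxE. Qed.

Lemma inner0l G v : inner G 0 v = 0.
Proof. by rewrite /inner !mul0mx mxE. Qed.

Lemma inner0r G v : inner G v 0 = 0.
Proof. by rewrite /inner trmx0 mulmx0 mxE. Qed.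

Lemma innerNl G u v : inner G (- u) v = - inner G u v.
Proof. by rewrite -scaleN1r innerZl mulN1r. Qed.

Lemma innerNr G u v : inner G u (- v) = - inner G u v.
Proof. by rewrite -scaleN1r innerZr mulN1r. Qed.

Lemma innerBl G u v w : inner G (u - v) w = inner G u w - inner G v w.
Proof. by rewrite innerDl innerNl. Qed.

Lemma innerBr G u v w : inner G w (u - v) = inner G w u - inner G w v.
Proof. by rewrite innerDr innerNr. Qed.

Lemma inner_suml (J : Type) (r : seq J) (P : pred J) G (f : J -> 'rV[R]_d) v :
  inner G (\sum_(j <- r | P j) f j) v = \sum_(j <- r | P j) inner G (f j) v.
Proof.
elim/big_rec2: _ => [|j x y _ <-]; [exact: inner0l | exact: innerDl].
Qed.

Lemma inner_sumr (J : Type) (r : seq J) (P : pred J) G (f : J -> 'rV[R]_d) v :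
  inner G v (\sum_(j <- r | P j) f j) = \sum_(j <- r | P j) inner G v (f j).
Proof.
elim/big_rec2: _ => [|j x y _ <-]; [exact: inner0r | exact: innerDr].
Qed.

Lemma innerC G u v : G^T = G -> inner G u v = inner G v u.
Proof.
move=> GT; rewrite /inner -[u *m G *m v^T]trmxK mxE trmx_mul trmxK trmx_mul GT.
by rewrite mulmxA.
Qed.

Lemma inner_pullback e (J : 'M[R]_(d, e)) (G : 'M[R]_e) u v :
  inner (J *m G *m J^T) u v = inner G (u *m J) (v *m J).
Proof. by rewrite /inner trmx_mul !mulmxA. Qed.

Lemma inner_delta G i j : inner G (delta_mx 0 i) (delta_mx 0 j) = G i j.
Proof. by rewrite /inner trmx_delta -mulmxA -rowE -colE !mxE. Qed.

Definition posdef G := forall u, u != 0 -> 0 < inner G u u.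

Lemma posdef_ge0 G u : posdef G -> 0 <= inner G u u.
Proof.
move=> pG; have [->|u0] := eqVneq u 0; first by rewrite inner0l.
by rewrite ltW// pG.
Qed.

Lemma posdef_unit G : posdef G -> G \in unitmx.
Proof.
move=> pG; rewrite -row_free_unit -kermx_eq0; apply/eqP/row_matrixP => i.
rewrite row0; apply/eqP/negPn/negP => ki.
have := pG _ ki; rewrite /inner (_ : row i (kermx G) *m G = 0) ?mul0mx ?mxE ?ltxx//.
by rewrite -row_mul mulmx_ker row0.
Qed.

(** Positivity at [<v, v> u - <u, v> v], divided by [<v, v>]. *)
Lemma posdef_CS G u v : G^T = G -> posdef G ->
  inner G u v ^+ 2 <= inner G u u * inner G v v.
Proof.
move=> GT pG; have [->|v0] := eqVneq v 0; first by rewrite !inner0r expr0n mulr0.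
have vv := pG v v0.
have := posdef_ge0 (inner G v v *: u - inner G u v *: v) pG.
rewrite !(innerBl, innerBr, innerZl, innerZr) (innerC v u GT) => H.
rewrite -(ler_pM2l vv) -subr_ge0; apply: le_trans H _.
by rewrite le_eqVlt; apply/orP; left; apply/eqP; ring.
Qed.

Lemma cont_inner (T : topologicalType) (G : T -> 'M[R]_d) (u v : T -> 'rV[R]_d) x :
  (forall i j, {for x, continuous (fun t => G t i j)}) ->
  (forall i, {for x, continuous (fun t => u t 0 i)}) ->
  (forall i, {for x, continuous (fun t => v t 0 i)}) ->
  {for x, continuous (fun t => inner (G t) (u t) (v t))}.
Proof.
move=> cG cu cv; rewrite /prop_for/continuous_at innerE; under eq_fun do rewrite innerE.
apply: (@cvg_bigsum _ _ (nbhs x)) => i _; apply: (@cvg_bigsum _ _ (nbhs x)) => j _.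
by apply: cvgM; [apply: cvgM; [exact: cu|exact: cG]|exact: cv].
Qed.

End InnerProduct.

Section VectorCurves.
Context {R : realType} {d : nat}.

Definition vder (y : R -> 'rV[R]_d) (s : R) (v : 'rV[R]_d) :=
  forall k, is_derive s 1 (fun r => y r 0 k) (v 0 k).

Lemma vderP (y : R -> 'rV[R]_d) (s : R) : derivable y s 1 -> vder y s (derive1 y s).
Proof.
move=> dy k; have dk := (derivable_mxP y s 1).1 dy 0 k.
by rewrite derive1E derive_mx// mxE; exact: derivableP.
Qed.

Lemma vder_derivable (y : R -> 'rV[R]_d) (s : R) v : vder y s v ->
  derivable y s 1 /\ derive1 y s = v.
Proof.
move=> yv; have dy : derivable y s 1.
  by apply/derivable_mxP => i k; rewrite (ord1 i); have [] := yv k.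
split=> //; apply/rowP => k; rewrite derive1E derive_mx// mxE.
exact: der_val (yv k).
Qed.

Lemma vder_cont (y : R -> 'rV[R]_d) (s : R) v : vder y s v -> {for s, continuous y}.
Proof.
move=> yv; apply: differentiable_continuous; apply/derivable1_diffP.
by have [] := vder_derivable yv.
Qed.

Lemma vder_near (y z : R -> 'rV[R]_d) (s : R) v : (\near s, y s = z s) ->
  vder y s v -> vder z s v.
Proof.
by move=> yz yv k; apply: der_near (yv k); apply: filterS yz => r ->.
Qed.

End VectorCurves.

Section Charts.
Context {R : realType} {d : nat}.
Variable M : riemannian_manifold R d.
Implicit Types (i j : mg_index M) (x : M) (y : 'rV[R]_d).

Lemma at_dom x : mg_dom (mg_at x) x.
Proof. by have [_ _ + _ _] := rm_riemannian M; apply. Qed.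

Lemma M_hausdorff : hausdorff_space M.
Proof. by have [] := rm_riemannian M. Qed.

Lemma dom_open i : open (mg_dom i).
Proof. by have [_ _ _ /(_ i)[[]]] := rm_riemannian M. Qed.

Lemma image_open i : open (mg_image i).
Proof. by have [_ _ _ /(_ i)[[]]] := rm_riemannian M. Qed.

Lemma inv_map i x : mg_dom i x -> mg_inv i (mg_map i x) = x.
Proof. by have [_ _ _ /(_ i)[[_ _ + _ _] _] _] := rm_riemannian M; apply. Qed.

Lemma map_cont i x : mg_dom i x -> {for x, continuous (mg_map i)}.
Proof. by have [_ _ _ /(_ i)[[_ _ _ + _] _] _] := rm_riemannian M; apply. Qed.

Lemma inv_cont i y : mg_image i y -> {for y, continuous (mg_inv i)}.
Proof. by have [_ _ _ /(_ i)[[_ _ _ _ +] _] _] := rm_riemannian M; apply. Qed.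

Lemma image_map i x : mg_dom i x -> mg_image i (mg_map i x).
Proof. by move=> ix; exists x. Qed.

Lemma dom_inv i y : mg_image i y -> mg_dom i (mg_inv i y).
Proof. by move=> [x ix <-]; rewrite inv_map. Qed.

Lemma map_inv i y : mg_image i y -> mg_map i (mg_inv i y) = y.
Proof. by move=> [x ix <-]; rewrite inv_map. Qed.

Lemma metric_smooth i k l : smooth_on (mg_image i) (fun y => mg_metric i y k l).
Proof. by have [_ _ _ /(_ i)[_ [+ _ _]] _] := rm_riemannian M; apply. Qed.

Lemma metric_sym i y : mg_image i y -> (mg_metric i y)^T = mg_metric i y.
Proof. by have [_ _ _ /(_ i)[_ [_ + _]] _] := rm_riemannian M; apply. Qed.

Lemma metric_pos i y : mg_image i y -> posdef (mg_metric i y).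
Proof. by have [_ _ _ /(_ i)[_ [_ _ +]] _] := rm_riemannian M => H /H. Qed.

Definition overlap i j : set 'rV[R]_d := mg_map i @` (mg_dom i `&` mg_dom j).

Lemma overlapP i j y : overlap i j y <-> mg_image i y /\ mg_dom j (mg_inv i y).
Proof.
split; first by move=> [x [ix jx] <-]; rewrite inv_map//; split => //; exact: image_map.
by move=> [iy jy]; exists (mg_inv i y); [split => //; exact: dom_inv|rewrite map_inv].
Qed.

Lemma overlap_open i j : open (overlap i j).
Proof.
rewrite openE => y /overlapP[iy jy].
have n1 : \forall z \near y, mg_image i z by apply: open_nbhs_nbhs; split => //; exact: image_open.
have n2 : \forall z \near y, mg_dom j (mg_inv i z).
  by apply: (inv_cont iy); apply: open_nbhs_nbhs; split => //; exact: dom_open.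
by apply: filterS2 n1 n2 => z ? ?; apply/overlapP.
Qed.

Lemma change_smooth i j : smooth_map_on (overlap i j) (chart_change i j).
Proof. by have [_ _ _ _ /(_ i j)[]] := rm_riemannian M. Qed.

Lemma change_metric i j y : overlap i j y ->
  mg_metric i y = pullback (chart_change i j) (mg_metric j) y.
Proof. by have [_ _ _ _ /(_ i j)[_ +]] := rm_riemannian M; apply. Qed.

Lemma change_image i j y : overlap i j y -> mg_image j (chart_change i j y).
Proof. by move=> /overlapP[iy jy]; exact: image_map. Qed.

Lemma change_inv i j y : overlap i j y -> mg_inv j (chart_change i j y) = mg_inv i y.
Proof. by move=> /overlapP[iy jy]; exact: inv_map. Qed.

Lemma overlap_map i j x : mg_dom i x -> mg_dom j x -> overlap i j (mg_map i x).
Proof. by move=> ix jx; exists x. Qed.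

Lemma change_map i j x : mg_dom i x -> chart_change i j (mg_map i x) = mg_map j x.
Proof. by move=> ix; rewrite /chart_change inv_map. Qed.

Definition Jch i j y := jacobian (chart_change i j : 'rV[R]_d -> 'rV[R]_d) y.

Lemma JchE i j y k a : overlap i j y ->
  Jch i j y k a = partial k (fun z => chart_change i j z 0 a) y.
Proof.
move=> yU; rewrite /Jch (jacobianE (overlap_open (i := i) (j := j)) _ _ _ yU)// => b.
exact: (@change_smooth i j b 1%N).
Qed.

Lemma change_inner i j y u v : overlap i j y ->
  inner (mg_metric i y) u v =
  inner (mg_metric j (chart_change i j y)) (u *m Jch i j y) (v *m Jch i j y).
Proof. by move=> yU; rewrite (change_metric yU) /pullback inner_pullback. Qed.

Lemma change_vder i j (y : R -> 'rV[R]_d) s v : overlap i j (y s) -> vder y s v ->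
  vder (fun r => chart_change i j (y r)) s (v *m Jch i j (y s)).
Proof.
move=> yU yv a; rewrite mxE.
have Ca : Ck_on 1 (overlap i j) (fun z => chart_change i j z 0 a).
  exact: (@change_smooth i j a 1%N).
apply: der_eq (der_chain (@overlap_open i j) Ca yU yv) _.
by apply: eq_bigr => k _; rewrite JchE// mulrC.
Qed.

Lemma near_dom i x : mg_dom i x -> \forall z \near x, mg_dom i z.
Proof. by move=> ix; apply: open_nbhs_nbhs; split => //; exact: dom_open. Qed.

Lemma near_image i y : mg_image i y -> \forall z \near y, mg_image i z.
Proof. by move=> iy; apply: open_nbhs_nbhs; split => //; exact: image_open. Qed.

Lemma metric_cont i y k l : mg_image i y ->
  {for y, continuous (fun z => mg_metric i z k l)}.
Proof. by move=> iy; exact: Ck_on_cont (metric_smooth i k l 0%N) iy. Qed.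

End Charts.

(** * Primitives, and a [C^1] clamp onto the unit interval *)

Section RealPrimitives.
Context {R : realType}.

(** Integrating from -1, on a segment that ends at 2, makes the derivative two-sided on all of
    [[0, 1]], where curves are measured. *)
Lemma primitive (f : R -> R) : continuous f ->
  exists F : R -> R, forall s : R, -1 < s < 2 -> is_derive s 1 F (f s).
Proof.
move=> cf; exists (fun x => \int[lebesgue_measure]_(t in `[(-1), x]) f t) => s /andP[s1 s2].
have If : lebesgue_measure.-integrable `[(-1), 2] (EFin \o f).
  apply: continuous_compact_integrable; first exact: segment_compact.
  exact: continuous_subspaceT.
have [d1 d2] := continuous_FTC1_closed s2 If s1 (cf s).
by apply: (DeriveDef d1); rewrite -derive1E; exact: d2.
Qed.

Lemma integral_primitive (f F : R -> R) : continuous f ->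
  (forall s : R, 0 <= s <= 1 -> is_derive s 1 F (f s)) ->
  (\int[lebesgue_measure]_(s in `[0%R, 1%R]) (f s)%:E = (F 1 - F 0)%:E)%E.
Proof.
move=> cf dF; rewrite EFinB.
have cF (s : R) : 0 <= s <= 1 -> {for s, continuous F}.
  move=> s01; apply: differentiable_continuous; apply/derivable1_diffP.
  by have [] := dF s s01.
apply: continuous_FTC2 => //.
- exact: continuous_subspaceT.
- split.
  + move=> x; rewrite in_itv/= => /andP[x0 x1].
    by have [] := dF x; rewrite ?ltW.
  + by apply: cvg_at_right_filter; apply: cF; rewrite lexx ler01.
  + by apply: cvg_at_left_filter; apply: cF; rewrite lexx ler01.
- move=> x; rewrite in_itv/= => /andP[x0 x1].
  by rewrite derive1E (der_val (dF x _))// !ltW.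
Qed.

Lemma der_ge0_ndecr (F f : R -> R) (a b : R) : a <= b ->
  (forall s : R, a <= s <= b -> is_derive s 1 F (f s)) ->
  (forall s, a <= s <= b -> 0 <= f s) -> F a <= F b.
Proof.
move=> ab dF f0.
have dF' (x : R) : x \in `]a, b[%R -> is_derive x 1 F (f x).
  by rewrite in_itv/= => /andP[x0 x1]; apply: dF; rewrite !ltW.
have cF : {within `[a, b], continuous F}.
  apply: derivable_within_continuous => x; rewrite in_itv/= => xI.
  by have [] := dF x xI.
have [c] := MVT_segment ab dF' cF.
rewrite in_itv/= => cI E; rewrite -subr_ge0 E mulr_ge0 ?subr_ge0//; exact: f0.
Qed.

(** The square of the positive part: a simple [C^1] function that vanishes on a half line. *)
Definition ppart2 (s : R) : R := Num.max s 0 * s.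

Lemma ppart2_der (s : R) : is_derive s 1 ppart2 (2 * Num.max s 0).
Proof.
rewrite /ppart2; have [s0|s0|->] := ltgtP s 0.
- apply: (@der_near _ _ (fun=> 0 : R)); last by apply: (der_eq (der_cst _ _ _)); rewrite mulr0.
  near=> r; have r0 : r < 0 by near: r; exact: lt_nbhsl.
  by rewrite /Num.max r0 mul0r.
- apply: (@der_near _ _ (fun r : R => r * r)); last first.
    by apply: (der_eq (der_mul (der_id _) (der_id _))); lra.
  near=> r; have r0 : 0 < r by near: r; exact: lt_nbhsr.
  by rewrite /Num.max ltNge (ltW r0).
rewrite mulr0; apply: DeriveDef; last first.
  rewrite /derive; apply: cvg_lim => //.
  under eq_fun do rewrite /= mulr0 subr0 addr0.
  apply/cvgrPdist_le => e e0; near=> h.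
  have hn0 : h != 0 by near: h; exact: nbhs_dnbhs_neq.
  rewrite sub0r normrN -[h%:A]/(h * 1) mulr1 -[_ *: _]/(h^-1 * (Num.max h 0 * h)).
  rewrite mulrCA mulrA mulfVK//.
  have he : `|h| <= e by near: h; exact: dnbhs0_le.
  rewrite /Num.max; case: ifP => h0; rewrite ?normr0//.
  exact: ltW.
apply/cvg_ex; exists 0.
  under eq_fun do rewrite /= mulr0 subr0 addr0.
  apply/cvgrPdist_le => e e0; near=> h.
  have hn0 : h != 0 by near: h; exact: nbhs_dnbhs_neq.
  rewrite sub0r normrN -[h%:A]/(h * 1) mulr1 -[_ *: _]/(h^-1 * (Num.max h 0 * h)).
  rewrite mulrCA mulrA mulfVK//.
  have he : `|h| <= e by near: h; exact: dnbhs0_le.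
  rewrite /Num.max; case: ifP => h0; rewrite ?normr0//.
  exact: ltW.
Unshelve. all: by end_near. Qed.

Lemma ppart2_ge0 (s : R) : 0 <= ppart2 s.
Proof.
rewrite /ppart2 /Num.max; case: ltP => s0; first by rewrite mul0r.
exact: mulr_ge0.
Qed.

Lemma max0_cont : continuous (fun s : R => Num.max s 0).
Proof.
move=> s; apply: (@continuous_max _ _ (fun s : R => s) (fun=> 0)); first exact: cvg_id.
exact: cst_continuous.
Qed.

Lemma clamp_exists : exists tau dtau : R -> R,
  [/\ forall s : R, is_derive s 1 tau (dtau s), continuous dtau,
      (forall s, 0 <= dtau s) /\ (forall s, 0 <= tau s <= 1),
      forall s : R, s <= 0 -> tau s = 0 & forall s, 1 <= s -> tau s = 1].
Proof.
pose a := ppart2; pose b s := ppart2 (1 - s).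
have ab0 s : 0 < a s + b s.
  by rewrite /a /b /ppart2 /Num.max; case: (ltP s 0) => s0; case: (ltP (1 - s) 0) => s1; nra.
pose da (s : R) := 2 * Num.max s 0; pose db (s : R) := - (2 * Num.max (1 - s) 0).
have dera (s : R) : is_derive s 1 a (da s) by exact: ppart2_der.
have derb (s : R) : is_derive s 1 b (db s).
  have d1 := der_sub (der_cst s (1 : R) (1 : R)) (der_id s).
  by apply: (der_eq (der_compR d1 (ppart2_der (1 - s)))); rewrite /db sub0r mulrN1.
pose dtau (s : R) := (da s * b s - a s * db s) / (a s + b s) ^+ 2.
have cs (F f : R -> R) (s : R) : is_derive s 1 F (f s) -> {for s, continuous F}.
  by move=> [dF _]; apply: differentiable_continuous; apply/derivable1_diffP.
exists (fun s => a s / (a s + b s)), dtau; split.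
- move=> s.
  have dv : is_derive s 1 (fun s => (a s + b s)^-1) (- (da s + db s) / (a s + b s) ^+ 2).
    have d1 := der_add (dera s) (derb s).
    have d2 : derivable (fun s => a s + b s) s 1 by have [] := d1.
    split; first by apply: derivableV => //; rewrite gt_eqF.
    rewrite deriveV ?gt_eqF// (der_val d1) -[LHS]/(_ * _) mulNr mulrC.
    by rewrite mulNr.
  apply: (der_eq (der_mul (dera s) dv)); rewrite /dtau.
  by have := ab0 s; move: (a s) (b s) (da s) (db s) => p q p' q' pq; field; rewrite gt_eqF.
- move=> s.
  have cm : {for s, continuous (fun r : R => Num.max (1 - r) 0)}.
    have c1 : {for s, continuous (fun r : R => 1 - r)}.
      exact: (cvgB (@cst_continuous _ _ (1 : R) s) (@cvg_id _ _)).
    exact: (continuous_comp c1 (@max0_cont (1 - s))).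
  apply: cvgM.
    apply: cvgB; apply: cvgM.
    + by apply: cvgM; [exact: cst_continuous|exact: max0_cont].
    + exact: cs (derb s).
    + exact: cs (dera s).
    + apply: cvgN; apply: cvgM; first exact: cst_continuous.
      exact: cm.
  apply: cvgV; first by rewrite gt_eqF// exprn_gt0.
  by under eq_fun do rewrite expr2; apply: cvgM; apply: cvgD; [exact: cs (dera s)|exact: cs (derb s)|exact: cs (dera s)|exact: cs (derb s)].
- have a0 s : 0 <= a s by exact: ppart2_ge0.
  have b0 s : 0 <= b s by exact: ppart2_ge0.
  split=> s.
    apply: mulr_ge0; last by rewrite invr_ge0 exprn_ge0// ltW.
    rewrite subr_ge0; apply: (@le_trans _ _ 0).
      rewrite mulrN oppr_le0 mulr_ge0// mulr_ge0// le_max lexx orbT//.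
    by rewrite mulr_ge0// mulr_ge0// le_max lexx orbT.
  rewrite divr_ge0//=; last exact: ltW.
  by rewrite ler_pdivrMr// mul1r lerDl.
- by move=> s s0; rewrite /a /ppart2 (_ : Num.max s 0 = 0) ?mul0r//; apply/max_idPr.
- move=> s s1; have b0 : b s = 0.
    by rewrite /b /ppart2 (_ : Num.max (1 - s) 0 = 0) ?mul0r//; apply/max_idPr; lra.
  by rewrite b0 addr0 divff//; have := ab0 s; rewrite b0 addr0 => /gt_eqF ->.
Qed.

End RealPrimitives.

Lemma near_continuous (T W : topologicalType) (f g : T -> W) (x : T) :
  (\near x, f x = g x) -> {for x, continuous f} -> {for x, continuous g}.
Proof.
move=> fg cf; rewrite /prop_for /continuous_at -(nbhs_singleton fg).
by apply: cvg_trans cf; exact: (near_eq_cvg fg).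
Qed.

Section Curves.
Context {R : realType} {d : nat}.
Variable M : riemannian_manifold R d.
Implicit Types (i j : mg_index M) (x p q : M) (gam : R -> M).

Definition nrm i (y v : 'rV[R]_d) : R := Num.sqrt (inner (mg_metric i y) v v).

Lemma near_curve_dom gam i (s : R) : {for s, continuous gam} -> mg_dom i (gam s) ->
  \forall r \near s, mg_dom i (gam r).
Proof. by move=> cg ix; apply: cg; exact: near_dom. Qed.

(** [speed] uses the preferred chart at each instant, which may jump along the curve. Chart changes
    are isometric, so any chart around the point gives the same value. *)
Lemma speed_chart gam i (s : R) v : {for s, continuous gam} -> mg_dom i (gam s) ->
  vder (mg_map i \o gam) s v -> speed gam s = nrm i (mg_map i (gam s)) v.
Proof.
move=> cg ix yv; rewrite /speed /nrm; set j := mg_at (gam s).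
have jx : mg_dom j (gam s) by exact: at_dom.
have ov : overlap i j (mg_map i (gam s)) by exact: overlap_map.
have := change_vder ov yv; set w := v *m _ => zw.
have zw' : vder (mg_map j \o gam) s w.
  apply: vder_near zw; apply: filterS (near_curve_dom cg ix) => r rx.
  by rewrite /= change_map.
by rewrite (vder_derivable zw').2 (change_inner v v ov) change_map.
Qed.

Lemma C1_vder gam i (s : R) : C1_curve gam -> mg_dom i (gam s) ->
  vder (mg_map i \o gam) s (derive1 (mg_map i \o gam) s).
Proof. by move=> [_ H] ix; apply: vderP; exact: (H i s ix).1. Qed.

Lemma C1_chart_cont gam i (s : R) : C1_curve gam -> mg_dom i (gam s) ->
  {for s, continuous (mg_map i \o gam)}.
Proof. by move=> Cg ix; exact: vder_cont (C1_vder Cg ix). Qed.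

Lemma nrm_cont (T : topologicalType) i (y v : T -> 'rV[R]_d) (x : T) :
  mg_image i (y x) -> {for x, continuous y} ->
  (forall k, {for x, continuous (fun t => v t 0 k)}) ->
  {for x, continuous (fun t => nrm i (y t) (v t))}.
Proof.
move=> iy cy cv.
have ci : {for x, continuous (fun t => inner (mg_metric i (y t)) (v t) (v t))}.
  apply: cont_inner => // k l.
  exact: (continuous_comp cy (@metric_cont _ _ M i _ k l iy)).
exact: (continuous_comp ci (@sqrt_continuous R _)).
Qed.

Lemma speed_cont gam : C1_curve gam -> continuous (speed gam).
Proof.
move=> Cg s; pose i := mg_at (gam s).
have ix : mg_dom i (gam s) by exact: at_dom.
have cg : {for s, continuous gam} by exact: Cg.1.
have cn : {for s, continuous (fun r => nrm i (mg_map i (gam r)) (derive1 (mg_map i \o gam) r))}.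
  apply: nrm_cont; first exact: image_map.
    exact: C1_chart_cont Cg ix.
  by move=> k; apply: cvg_coord; exact: (Cg.2 i s ix).2.
have E : \forall r \near s, nrm i (mg_map i (gam r)) (derive1 (mg_map i \o gam) r) = speed gam r.
  apply: filterS (near_curve_dom cg ix) => r rx.
  by rewrite -(speed_chart (Cg.1 r) rx (C1_vder Cg rx)).
exact: near_continuous E cn.
Qed.

Lemma C1_intro gam (dg : mg_index M -> R -> 'rV[R]_d) : continuous gam ->
  (forall i (s : R), mg_dom i (gam s) -> \forall r \near s, vder (mg_map i \o gam) r (dg i r)) ->
  (forall i (s : R), mg_dom i (gam s) -> forall k, {for s, continuous (fun r => dg i r 0 k)}) ->
  C1_curve gam.
Proof.
move=> cg vd cd; split => // i s ix.
have n1 := vd i s ix.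
have [d1 d2] := vder_derivable (nbhs_singleton n1); split; first exact: d1.
have cdg : {for s, continuous (dg i)}.
  by apply: (@cvg_mx _ _ (nbhs s)) => a b; rewrite (ord1 a); exact: cd.
apply: near_continuous cdg.
by apply: filterS n1 => r rv; rewrite (vder_derivable rv).2.
Qed.

Lemma chart_C1 i (y v : R -> 'rV[R]_d) : (forall s, mg_image i (y s)) ->
  (forall s : R, vder y s (v s)) -> (forall k, continuous (fun s => v s 0 k)) ->
  C1_curve (mg_inv i \o y) /\ forall s, speed (mg_inv i \o y) s = nrm i (y s) (v s).
Proof.
move=> iy yv cv.
have cy s : {for s, continuous y} by exact: vder_cont (yv s).
have cg : continuous (mg_inv i \o y).
  by move=> s; apply: continuous_comp; [exact: cy | exact: inv_cont].
have vd j (s : R) : mg_dom j (mg_inv i (y s)) ->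
    vder (mg_map j \o (mg_inv i \o y)) s (v s *m Jch i j (y s)).
  by move=> jx; apply: (change_vder (i := i)) => //; apply/overlapP.
split.
  apply: (C1_intro (dg := fun j s => v s *m Jch i j (y s))) => //.
    move=> j s jx; apply: filterS (near_curve_dom (cg s) jx) => r rx.
    exact: vd.
  move=> j s jx k.
  have ov r : mg_dom j (mg_inv i (y r)) -> overlap i j (y r) by move=> ?; apply/overlapP.
  pose D r := \sum_a v r 0 a * partial a (fun z => chart_change i j z 0 k) (y r).
  have E : \forall r \near s, D r = (v r *m Jch i j (y r)) 0 k.
    apply: filterS (near_curve_dom (cg s) jx) => r rx.
    by rewrite mxE; apply: eq_bigr => a _; rewrite JchE//; exact: ov.
  apply: (near_continuous E).
  apply: (@cvg_bigsum _ _ (nbhs s)) => a _; apply: cvgM; first exact: cv.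
  have cp := Ck_on_cont (Ck_onS a (@change_smooth _ _ M i j k 1%N)) (ov s jx).
  exact: (continuous_comp (cy s) cp).
move=> s.
have ix : mg_dom i (mg_inv i (y s)) by exact: dom_inv.
rewrite (@speed_chart _ i s (v s) (cg s)) ?map_inv//.
apply: vder_near (yv s); near=> r; by rewrite /= map_inv.
Unshelve. all: by end_near. Qed.

Lemma reparam gam (tau dtau : R -> R) : C1_curve gam ->
  (forall s : R, is_derive s 1 tau (dtau s)) -> continuous dtau ->
  C1_curve (gam \o tau) /\ forall s, speed (gam \o tau) s = `|dtau s| * speed gam (tau s).
Proof.
move=> Cg dt ct.
have ctau s : {for s, continuous tau}.
  by apply: differentiable_continuous; apply/derivable1_diffP; have [] := dt s.
have cg : continuous (gam \o tau).
  by move=> s; apply: continuous_comp; [exact: ctau|exact: Cg.1].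
have vd i (s : R) : mg_dom i (gam (tau s)) ->
    vder (mg_map i \o (gam \o tau)) s (dtau s *: derive1 (mg_map i \o gam) (tau s)).
  move=> ix k; rewrite mxE mulrC.
  exact: (der_compR (dt s) (C1_vder Cg ix k)).
split.
  apply: (C1_intro (dg := fun i s => dtau s *: derive1 (mg_map i \o gam) (tau s))) => //.
    move=> i s ix; apply: filterS (near_curve_dom (cg s) ix) => r rx; exact: vd.
  move=> i s ix k; rewrite /prop_for/continuous_at mxE; under eq_fun do rewrite mxE.
  apply: cvgM; first exact: ct.
  by apply: cvg_coord; exact: (continuous_comp (ctau s) (Cg.2 i _ ix).2).
move=> s; have ix := at_dom (gam (tau s)).
rewrite (speed_chart (cg s) ix (vd _ _ ix)) (speed_chart (Cg.1 (tau s)) ix (C1_vder Cg ix)).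
by rewrite /nrm innerZl innerZr mulrA -expr2 sqrtrM ?sqr_ge0// sqrtr_sqr.
Qed.

Lemma glue gam1 gam2 p : C1_curve gam1 -> C1_curve gam2 ->
  (forall s, 1 <= s -> gam1 s = p) -> (forall s, s <= 1 -> gam2 s = p) ->
  exists gam, [/\ C1_curve gam, forall s, s <= 1 -> gam s = gam1 s &
    forall s, 1 <= s -> gam s = gam2 s].
Proof.
move=> C1 C2 g1 g2; pose gam s := if s <= 1 then gam1 s else gam2 s.
have E1 s : s <= 1 -> gam s = gam1 s by rewrite /gam => ->.
have E2 s : 1 <= s -> gam s = gam2 s.
  move=> s2; rewrite /gam; case: (leP s 1) => // s1.
  have -> : s = 1 by apply/le_anti; rewrite s1 s2.
  by rewrite g1// g2.
exists gam; split => //.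
have C1c s : {for s, continuous gam1} by exact: C1.1.
have C2c s : {for s, continuous gam2} by exact: C2.1.
have cg : continuous gam.
  move=> s; have [s1|s1|s1] := ltgtP s 1.
  - apply: near_continuous (C1c s); near=> r; rewrite E1// ltW//.
    by near: r; exact: lt_nbhsl.
  - apply: near_continuous (C2c s); near=> r; rewrite E2// ltW//.
    by near: r; exact: lt_nbhsr.
  - move=> A nA.
    have n1 : \forall r \near s, A (gam1 r) by apply: C1c; rewrite -E1// s1.
    have n2 : \forall r \near s, A (gam2 r) by apply: C2c; rewrite -E2// s1.
    apply: (@filterS2 _ (nbhs s) _ _ _ _ _ n1 n2) => r Ar1 Ar2.
    by rewrite /= /gam; case: ifP.
split => // i s ix.
have [s1|s1|s1] := ltgtP s 1.
- have E : \forall r \near s, (mg_map i \o gam1) r = (mg_map i \o gam) r.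
    near=> r; rewrite /= E1// ltW//; near: r; exact: lt_nbhsl.
  have ix1 : mg_dom i (gam1 s) by rewrite -E1// ltW.
  split; first by apply: near_eq_derivable E (C1.2 i s ix1).1.
  have E' : \forall r \near s, derive1 (mg_map i \o gam1) r = derive1 (mg_map i \o gam) r.
    have := near_join E; apply: filterS => r; rewrite !derive1E; exact: near_eq_derive.
  exact: near_continuous E' (C1.2 i s ix1).2.
- have E : \forall r \near s, (mg_map i \o gam2) r = (mg_map i \o gam) r.
    near=> r; rewrite /= E2// ltW//; near: r; exact: lt_nbhsr.
  have ix1 : mg_dom i (gam2 s) by rewrite -E2// ltW.
  split; first by apply: near_eq_derivable E (C2.2 i s ix1).1.
  have E' : \forall r \near s, derive1 (mg_map i \o gam2) r = derive1 (mg_map i \o gam) r.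
    have := near_join E; apply: filterS => r; rewrite !derive1E; exact: near_eq_derive.
  exact: near_continuous E' (C2.2 i s ix1).2.
have ix1 : mg_dom i (gam1 s) by rewrite -E1// s1.
have ix2 : mg_dom i (gam2 s) by rewrite -E2// s1.
(* Each curve rests at [p] on the other's side of 1, so near the junction the glued curve is, in the
   chart, the sum of both minus the coordinates of [p]: no one-sided derivatives are needed. *)
pose f r := (mg_map i \o gam1) r + ((mg_map i \o gam2) r - mg_map i p).
have E : \forall r \near s, f r = (mg_map i \o gam) r.
  near=> r; rewrite /f /=; have [r1|r1] := leP r 1.
    by rewrite E1// (g2 r r1) subrr addr0.
  by rewrite E2 ?(ltW r1)// (g1 r (ltW r1)) addrC subrK.
have df (r : R) : mg_dom i (gam1 r) -> mg_dom i (gam2 r) ->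
    vder f r (derive1 (mg_map i \o gam1) r + derive1 (mg_map i \o gam2) r).
  move=> r1 r2 k; rewrite mxE -[X in _ + X]subr0.
  rewrite (_ : (fun r => f r 0 k) = (fun r => (mg_map i \o gam1) r 0 k +
    ((mg_map i \o gam2) r 0 k - mg_map i p 0 k))); last by apply/funext => t; rewrite !mxE.
  apply: der_add (C1_vder C1 r1 k) _; apply: der_sub (C1_vder C2 r2 k) _.
split; first exact: near_eq_derivable E (vder_derivable (df s ix1 ix2)).1.
have n1 := near_curve_dom (C1c s) ix1; have n2 := near_curve_dom (C2c s) ix2.
have E' : \forall r \near s, derive1 (mg_map i \o gam1) r + derive1 (mg_map i \o gam2) r
    = derive1 (mg_map i \o gam) r.
  have E2' := near_join E; apply: filterS3 n1 n2 E2' => r r1 r2 Er.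
  rewrite -(vder_derivable (df r r1 r2)).2 !derive1E; exact: near_eq_derive.
apply: (near_continuous E').
apply: cvgD; [exact: (C1.2 i s ix1).2|exact: (C2.2 i s ix2).2].
Unshelve. all: by end_near. Qed.

End Curves.

(** * The Riemannian distance *)

Lemma eq_off_point (R : realType) (f g : R -> R) (c : R) : continuous f ->
  continuous g -> (forall s, s != c -> f s = g s) -> f =1 g.
Proof.
move=> cf cg fg s; have [->|/fg//] := eqVneq s c.
apply/eqP; rewrite -subr_eq0 -normr_eq0; apply/eqP/le_anti; rewrite normr_ge0 andbT.
apply/ler_addgt0Pl => e e0; rewrite addr0.
have cF : {for c, continuous (fun s => f s - g s)} by exact: cvgB (cf c) (cg c).
have : \forall r \near c^', `|f c - g c| <= e.
  near=> r; have rc : r != c by near: r; exact: nbhs_dnbhs_neq.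
  rewrite -[f c - g c]subr0 -(subrr (f r)) {2}(fg r rc).
  by near: r; apply: nbhs_dnbhs; exact: cont_dist cF e0.
by move=> /filter_ex[].
Unshelve. all: by end_near. Qed.

Section Distance.
Context {R : realType} {d : nat}.
Variable M : riemannian_manifold R d.
Implicit Types (i j : mg_index M) (x y z p q : M) (gam : R -> M) (a b : R).

Lemma speed_ge0 gam (s : R) : 0 <= speed gam s.
Proof. exact: sqrtr_ge0. Qed.

Lemma speed_near gam1 gam2 (s : R) : (\near s, gam1 s = gam2 s) ->
  speed gam1 s = speed gam2 s.
Proof.
move=> E; rewrite /speed (nbhs_singleton E) !derive1E.
suff -> : 'D_1 (mg_map (mg_at (gam2 s)) \o gam1) s = 'D_1 (mg_map (mg_at (gam2 s)) \o gam2) s by [].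
by apply: near_eq_derive; apply: filterS E => r /= ->.
Qed.

Lemma speed_const gam p (s : R) : (\near s, gam s = p) -> speed gam s = 0.
Proof.
move=> E; rewrite (speed_near (gam2 := fun=> p) E) /speed.
rewrite (_ : derive1 _ s = 0) ?inner0l ?sqrtr0//.
by rewrite derive1E derive_cst.
Qed.

(** Length is carried as a primitive [ell] of the speed, so that lengths are compared by
    monotonicity instead of integrals. Resting outside [[0, 1]] is what makes concatenation
    [C^1]. *)
Record path x y gam (ell : R -> R) : Prop := Path {
  path_C1 : C1_curve gam;
  path_src : forall s, s <= 0 -> gam s = x;
  path_tgt : forall s, 1 <= s -> gam s = y;
  path_len : forall s : R, is_derive s 1 ell (speed gam s) }.

Lemma distance_ge0 x y : (0 <= distance x y)%E.
Proof.
apply: le_ereal_inf_tmp => _ [gam _ <-].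
by apply: integral_ge0 => s _; rewrite lee_fin; exact: speed_ge0.
Qed.

Lemma distance_le gam (ell : R -> R) : C1_curve gam ->
  (forall s : R, 0 <= s <= 1 -> is_derive s 1 ell (speed gam s)) ->
  (distance (gam 0%R) (gam 1%R) <= (ell 1 - ell 0)%:E)%E.
Proof.
move=> Cg dl; rewrite -(integral_primitive (speed_cont Cg) dl).
by apply: ereal_inf_lbound; exists gam.
Qed.

Lemma path_exists x y a : (distance x y < a%:E)%E ->
  exists gam (ell : R -> R), path x y gam ell /\ ell 1 - ell 0 < a.
Proof.
move=> /ereal_inf_lt[_ [gam [Cg g0 g1] <-] La].
have [ell dl] := primitive (speed_cont Cg).
have dl' (s : R) : 0 <= s <= 1 -> is_derive s 1 ell (speed gam s).
  by move=> /andP[s0 s1]; apply: dl; lra.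
move: La; rewrite /curve_length (integral_primitive (speed_cont Cg) dl') lte_fin => La.
have [tau [dtau [dt ct [dt0 t01] tl tr]]] := clamp_exists (R := R).
have [Cgt sgt] := reparam Cg dt ct.
exists (gam \o tau), (ell \o tau); split; last by rewrite /= (tl 0)// (tr 1).
split => //.
- by move=> s s0; rewrite /= tl.
- by move=> s s1; rewrite /= tr.
- move=> s; rewrite sgt ger0_norm// mulrC; exact: (der_compR (dt s) (dl' _ (t01 s))).
Qed.

Lemma dlt_refl x a : 0 < a -> (distance x x < a%:E)%E.
Proof.
move=> a0; apply: (@le_lt_trans _ _ 0%E); last by rewrite lte_fin.
have Cg : C1_curve (fun=> x : M).
  apply: (C1_intro (dg := fun _ _ => 0)); first by move=> s; exact: cst_continuous.
    by move=> i s ix; near=> r => k; rewrite mxE; exact: is_derive_cst.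
  by move=> i s ix k; exact: cst_continuous.
have := @distance_le (fun=> x : M) (fun=> 0) Cg; rewrite subrr; apply => s _.
rewrite (@speed_const _ x); first exact: is_derive_cst.
by near=> r.
Unshelve. all: by end_near. Qed.

Lemma dlt_sym x y a : (distance x y < a%:E)%E -> (distance y x < a%:E)%E.
Proof.
move=> /path_exists[gam [ell [[Cg gx gy dl] La]]].
have d1 (s : R) : is_derive s 1 (fun s : R => 1 - s) (-1).
  by apply: (der_eq (der_sub (is_derive_cst _ _ _) (der_id s))); rewrite sub0r.
have [Cr sr] := reparam Cg d1 (@cst_continuous _ _ _).
have := @distance_le (gam \o (fun s => 1 - s)) (fun s => - ell (1 - s)) Cr.
rewrite /= subr0 subrr (gy 1)// (gx 0)// opprK addrC => H; apply: le_lt_trans (H _) _.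
  move=> s _; rewrite sr normrN1 mul1r.
  by apply: (der_eq (der_opp (der_compR (d1 s) (dl (1 - s))))); rewrite mulrN1 opprK.
by rewrite lte_fin.
Qed.

(** The two curves are run one after the other on [[0, 2]], and the result is rescaled to the unit
    interval. *)
Lemma dlt_tri x y z a b : (distance x y < a%:E)%E -> (distance y z < b%:E)%E ->
  (distance x z < (a + b)%:E)%E.
Proof.
move=> /path_exists[g1 [l1 [[C1 g1x g1y dl1] La]]] /path_exists[g2 [l2 [[C2 g2x g2y dl2] Lb]]].
have ds (s : R) : is_derive s 1 (fun s : R => s - 1) 1.
  by apply: (der_eq (der_sub (der_id s) (is_derive_cst _ _ _))); rewrite subr0.
have [C2' s2'] := reparam C2 ds (@cst_continuous _ _ _).
have h1 s : s <= 1 -> (g2 \o (fun s => s - 1)) s = y by move=> s1; apply: g2x; rewrite subr_le0.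
have [gam [Cg ga gb]] := glue C1 C2' g1y h1.
have sp0 (s : R) : s != 1 -> speed gam s = speed g1 s + speed (g2 \o (fun s => s - 1)) s.
  rewrite neq_lt => /orP[s1|s1].
    rewrite (@speed_near gam g1) ?(@speed_const (g2 \o _) y) ?addr0//.
    - near=> r; apply: h1; apply: ltW; near: r; exact: lt_nbhsl.
    - near=> r; apply: ga; apply: ltW; near: r; exact: lt_nbhsl.
  rewrite (@speed_near gam (g2 \o (fun s => s - 1))) ?(@speed_const g1 y) ?add0r//.
  - near=> r; apply: g1y; apply: ltW; near: r; exact: lt_nbhsr.
  - near=> r; apply: gb; apply: ltW; near: r; exact: lt_nbhsr.
have sp (s : R) : speed gam s = speed g1 s + speed (g2 \o (fun s => s - 1)) s.
  apply: (@eq_off_point _ (speed gam) (fun s => speed g1 s + speed (g2 \o (fun s => s - 1)) s) 1) => //.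
    exact: speed_cont.
  by move=> t; apply: cvgD; exact: speed_cont.
have d2 (s : R) : is_derive s 1 (fun s : R => 2 * s) 2.
  by apply: (der_eq (der_mulc 2 (der_id s))); rewrite mulr1.
have [Cr sr] := reparam Cg d2 (@cst_continuous _ _ _).
have dl : forall s : R, is_derive s 1 (fun s => l1 (2 * s) + l2 (2 * s - 1)) (speed (gam \o (fun s => 2 * s)) s).
  move=> s.
  have d3 : is_derive s 1 (fun s : R => 2 * s - 1) 2.
    by apply: (der_eq (der_sub (d2 s) (is_derive_cst _ _ _))); rewrite subr0.
  apply: (der_eq (der_add (der_compR (d2 s) (dl1 (2 * s))) (der_compR d3 (dl2 (2 * s - 1))))).
  rewrite sr sp s2' normr1 mul1r ger0_norm//.
  by move: (speed g1 _) (speed g2 _) => u v; rewrite -mulrDl mulrC.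
have := @distance_le _ _ Cr (fun s _ => dl s).
rewrite /= mulr0 mulr1 ga// gb ?ler1n// g1x//= g2y; last by lra.
move=> H; apply: le_lt_trans H _; rewrite lte_fin sub0r.
(* [ell] does not grow where a path rests; this removes the stretch [[1, 2]] of the first path and
   [[-1, 0]] of the second from the total. *)
have flat (g : R -> M) (l : R -> R) a0 b0 : a0 < b0 -> (forall s : R, is_derive s 1 l (speed g s)) ->
    (forall s, a0 < s < b0 -> \forall r \near s, g r = y) -> l b0 = l a0.
  move=> ab dl' gc.
  have cl : {within `[a0, b0], continuous l}.
    by apply: derivable_within_continuous => s _; have [] := dl' s.
  have [] := MVT ab (fun s _ => dl' s) cl.
  by move=> c; rewrite in_itv/= => cI /eqP; rewrite (speed_const (gc c cI)) mul0r subr_eq0 => /eqP.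
have lt12 : (1 : R) < 2 by lra.
have ltN10 : (-1 : R) < 0 by lra.
have e1 : l1 2 = l1 1.
  apply: (flat g1 l1 1 2 lt12 dl1) => s /andP[s1 _].
  by near=> r; apply: g1y; apply: ltW; near: r; exact: lt_nbhsr.
have e2 : l2 0 = l2 (-1).
  apply: (flat g2 l2 (-1) 0 ltN10 dl2) => s /andP[_ s1].
  by near=> r; apply: g2x; apply: ltW; near: r; exact: lt_nbhsl.
by rewrite e1 -e2 (_ : 2 - 1 = 1)//; lra.
Unshelve. all: by end_near. Qed.

(** Substitute for a point of a minimising geodesic: a curve shorter than [a + b] is cut at the
    fraction [a / (a + b)] of its length. *)
Lemma dlt_split x y a b : 0 < a -> 0 < b -> (distance x y < (a + b)%:E)%E ->
  exists p, (distance x p < a%:E)%E /\ (distance p y < b%:E)%E.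
Proof.
move=> a0 b0 /path_exists[g [l [[C gx gy dl] La]]].
pose T := l 1 - l 0.
have T0 : 0 <= T.
  by rewrite subr_ge0; apply: (der_ge0_ndecr (f := speed g)) => // s _; exact: speed_ge0.
have ab : 0 < a + b by exact: addr_gt0.
pose t := T * a / (a + b).
have cl : {within `[0, 1], continuous l}.
  apply: derivable_within_continuous => s _; by have [] := dl s.
have tT : 0 <= t <= T.
  rewrite /t divr_ge0 ?mulr_ge0 ?(ltW a0) ?(ltW ab)//= ler_pdivrMr//.
  by apply: ler_wpM2l => //; rewrite lerDl ltW.
have [] := @IVT _ l 0 1 (l 0 + t) ler01 cl.
  have l01 : l 0 <= l 1 by rewrite -subr_ge0.
  rewrite (min_idPl l01) (max_idPr l01) lerDl.
  by move: tT => /andP[-> /= tT]; rewrite -lerBrDl.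
move=> c; rewrite in_itv/= => /andP[c0 c1] lc.
exists (g c).
have ta : t < a.
  by rewrite /t ltr_pdivrMr// mulrC ltr_pM2l.
have tb : T - t < b.
  have -> : T - t = T * b / (a + b) by rewrite /t; field; rewrite gt_eqF.
  by rewrite ltr_pdivrMr// mulrC ltr_pM2l.
have d1 (s : R) : is_derive s 1 (fun s : R => c * s) c.
  by apply: (der_eq (der_mulc c (der_id s))); rewrite mulr1.
have d2 (s : R) : is_derive s 1 (fun s : R => c + (1 - c) * s) (1 - c).
  by apply: (der_eq (der_add (is_derive_cst _ _ _) (der_mulc (1 - c) (der_id s)))); rewrite mulr1 add0r.
split.
  have [Cr sr] := reparam C d1 (@cst_continuous _ _ _).
  have := @distance_le _ (fun s => l (c * s)) Cr; rewrite /= mulr0 mulr1 gx//.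
  move=> H; apply: le_lt_trans (H _) _; last by rewrite lte_fin lc addrAC subrr add0r.
  move=> s _; rewrite sr ger0_norm// mulrC; exact: der_compR (d1 s) (dl _).
have [Cr sr] := reparam C d2 (@cst_continuous _ _ _).
have := @distance_le _ (fun s => l (c + (1 - c) * s)) Cr; rewrite /= mulr0 mulr1 addr0 subrKC (gy 1)//.
move=> H; apply: le_lt_trans (H _) _; last by rewrite lte_fin lc opprD addrA.
move=> s _; rewrite sr ger0_norm ?subr_ge0// mulrC; exact: der_compR (d2 s) (dl _).
Qed.

End Distance.

Lemma dist_cont (R : realType) (T : topologicalType) (f : T -> R) (x : T) :
  (forall e : R, 0 < e -> \forall t \near x, `|f x - f t| <= e) ->
  {for x, continuous f}.
Proof. by move=> H; apply/cvgrPdist_le. Qed.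

Section RealDistance.
Context {R : realType} {d : nat}.
Variable M : riemannian_manifold R d.
Implicit Types (i j : mg_index M) (x y z p q : M) (gam : R -> M) (a b : R).

(** The distance is infinite between components. [dd] is meaningful under [conn] only: it is 0 for
    points that are not connected. *)
Definition conn x y : Prop := (distance x y < +oo)%E.
Definition dd x y : R := fine (distance x y).

Lemma distE x y : conn x y -> distance x y = (dd x y)%:E.
Proof.
by move=> c; rewrite /dd fineK// ge0_fin_numE//; exact: distance_ge0.
Qed.

Lemma lt_conn x y a : (distance x y < a%:E)%E -> conn x y.
Proof. by move=> H; apply: lt_trans H _; exact: ltry. Qed.

Lemma dd_lt x y a : conn x y -> (distance x y < a%:E)%E = (dd x y < a).
Proof. by move=> c; rewrite distE// lte_fin. Qed.

Lemma lt_dd x y a : (distance x y < a%:E)%E -> dd x y < a.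
Proof. by move=> H; rewrite -dd_lt//; exact: lt_conn H. Qed.

Lemma dd_ge0 x y : 0 <= dd x y.
Proof. by apply: fine_ge0; exact: distance_ge0. Qed.

Lemma dd_adherent x y e : conn x y -> 0 < e -> (distance x y < (dd x y + e)%:E)%E.
Proof. by move=> c e0; rewrite dd_lt// ltrDl. Qed.

Lemma conn_refl x : conn x x.
Proof. exact: lt_conn (dlt_refl x (@ltr01 R)). Qed.

Lemma dd_refl x : dd x x = 0.
Proof.
apply/le_anti; rewrite dd_ge0 andbT; apply/ler_addgt0Pl => e e0; rewrite addr0 ltW//.
by apply: lt_dd; exact: dlt_refl.
Qed.

Lemma conn_sym x y : conn x y -> conn y x.
Proof. by move=> c; exact: lt_conn (dlt_sym (dd_adherent c ltr01)). Qed.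

Lemma dd_sym x y : conn x y -> dd x y = dd y x.
Proof.
have le (a b : M) : conn a b -> dd b a <= dd a b.
  move=> c; apply/ler_addgt0Pr => e e0; apply: ltW; apply: lt_dd; apply: dlt_sym.
  exact: dd_adherent.
by move=> c; apply/le_anti; rewrite !le//; exact: conn_sym.
Qed.

Lemma conn_tri x y z : conn x y -> conn y z -> conn x z.
Proof.
by move=> c1 c2; exact: lt_conn (dlt_tri (dd_adherent c1 ltr01) (dd_adherent c2 ltr01)).
Qed.

Lemma dd_tri x y z : conn x y -> conn y z -> dd x z <= dd x y + dd y z.
Proof.
move=> c1 c2; apply/ler_addgt0Pr => e e0; have e2 : 0 < e / 2 by rewrite divr_gt0.
have := lt_dd (dlt_tri (dd_adherent c1 e2) (dd_adherent c2 e2)).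
by rewrite addrACA -splitr => /ltW.
Qed.

End RealDistance.

(** * Riemannian distance against coordinates *)

Section LocalComparison.
Context {R : realType} {d : nat}.
Variable M : riemannian_manifold R d.
Implicit Types (i j : mg_index M) (x y p q : M) (gam : R -> M) (a b : R) (z w : 'rV[R]_d).

Definition good_ball i (c0 : 'rV[R]_d) (rho C : R) :=
  [/\ 0 < rho, 1 <= C & forall z, `|z - c0| <= rho -> mg_image i z /\
    forall w, `|w| <= C * nrm i z w /\ nrm i z w <= C * `|w|].

Lemma compact_sphere : compact [set w : 'rV[R]_d | `|w| = 1].
Proof.
apply: bounded_closed_compact.
  by exists 1; split => // r r1 w /= ->; exact: ltW.
rewrite (_ : [set w | _] = (fun w : 'rV[R]_d => `|w|) @^-1` [set 1])//.
by apply: closed_comp => [w _|]; [exact: norm_continuous | exact: closed_eq].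
Qed.

Lemma subr_norm_cont (c0 : 'rV[R]_d) : continuous (fun z : 'rV[R]_d => `|z - c0|).
Proof.
move=> z; apply: dist_cont => e e0.
apply: filterS (@nbhsx_ballx R 'rV[R]_d z e e0) => t; rewrite -ball_normE /= => h.
apply: le_trans (ler_dist_dist _ _) _.
by rewrite opprB addrA subrK ltW.
Qed.

Lemma compact_ball_rV (c0 : 'rV[R]_d) (r : R) : compact [set z : 'rV[R]_d | `|z - c0| <= r].
Proof.
apply: bounded_closed_compact.
  exists (`|c0| + r); split; first exact: num_real.
  move=> r' rr z /= zr; apply: ltW; apply: le_lt_trans rr.
  by rewrite -(subrK c0 z) addrC; apply: le_trans (ler_normD _ _) _; rewrite lerD2l.
rewrite (_ : [set z | _] = (fun z : 'rV[R]_d => `|z - c0|) @^-1` [set t | t <= r])//.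
by apply: closed_comp => [z _|]; [exact: subr_norm_cont|exact: closed_le].
Qed.

Lemma inner_bound (A : 'M[R]_d) (w : 'rV[R]_d) :
  `|inner A w w| <= (\sum_k \sum_l `|A k l|) * `|w| ^+ 2.
Proof.
rewrite innerE mulr_suml; apply: le_trans (ler_norm_sum _ _ _) _; apply: ler_sum => k _.
rewrite mulr_suml; apply: le_trans (ler_norm_sum _ _ _) _; apply: ler_sum => l _.
rewrite !normrM [`|w 0 k| * _]mulrC -mulrA expr2; apply: ler_wpM2l => //.
by apply: ler_pM => //; exact: norm_coord.
Qed.

Lemma inner_subm (A B : 'M[R]_d) (u v : 'rV[R]_d) :
  inner (A - B) u v = inner A u v - inner B u v.
Proof. by rewrite /inner mulmxBr mulmxBl !mxE. Qed.

Lemma posdef_lower (G : 'M[R]_d) : posdef G ->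
  exists2 mu, 0 < mu & forall w, mu * `|w| ^+ 2 <= inner G w w.
Proof.
move=> pG.
have [mu mu0 low] : exists2 mu, 0 < mu & forall w : 'rV[R]_d, `|w| = 1 -> mu <= inner G w w.
  have [ne|ne] := pselect ([set w : 'rV[R]_d | `|w| = 1] !=set0); last first.
    by exists 1 => // w w1; case: ne; exists w.
  have ci : continuous (fun w : 'rV[R]_d => inner G w w).
    move=> w; apply: cont_inner => [k l|k|k].
    - exact: cst_continuous.
    - exact: coord_continuous.
    - exact: coord_continuous.
  have [c] := compact_EVT_min ne compact_sphere (continuous_subspaceT ci).
  rewrite inE /= => c1 cmin; exists (inner G c c).
    by apply: pG; rewrite -normr_eq0 c1 oner_neq0.
  by move=> w w1; apply: cmin; rewrite inE.
exists mu => // w; have [->|w0] := eqVneq w 0; first by rewrite normr0 expr0n mulr0 inner0l.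
have nw : 0 < `|w| by rewrite normr_gt0.
have := low (`|w|^-1 *: w); rewrite normrZ normfV normr_id mulVf ?gt_eqF// => /(_ erefl).
rewrite innerZl innerZr mulrA -expr2 exprVn mulrC ler_pdivlMr ?exprn_gt0//.
Qed.

(** At [c0] the lower bound comes from the unit sphere and the upper one from the entries. Nearby
    the quadratic form moves by at most [Num.min (mu / 2) 1] times [|w|^2], which costs half the
    lower bound and adds 1 to the upper one. One [C] serves every small radius. *)
Lemma metric_bounds i c0 : mg_image i c0 -> exists C, 1 <= C /\
  \forall rho \near (0 : R)^'+, good_ball i c0 rho C.
Proof.
move=> ic.
have [mu mu0 low] := posdef_lower (metric_pos ic).
pose B := \sum_k \sum_l `|mg_metric i c0 k l|.
have B0 : 0 <= B by apply: sumr_ge0 => k _; apply: sumr_ge0.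
have mu2 : 0 < mu / 2 by rewrite divr_gt0.
pose C := 1 + Num.sqrt (B + 1) + (Num.sqrt (mu / 2))^-1.
have s1 : 0 <= Num.sqrt (B + 1) by exact: sqrtr_ge0.
have s2 : 0 < (Num.sqrt (mu / 2))^-1 by rewrite invr_gt0 sqrtr_gt0.
exists C; split; first by rewrite /C -addrA lerDl addr_ge0// ltW.
have cD : {for c0, continuous (fun z => \sum_k \sum_l `|mg_metric i z k l - mg_metric i c0 k l|)}.
  apply: (@cvg_bigsum _ _ (nbhs c0)) => k _; apply: (@cvg_bigsum _ _ (nbhs c0)) => l _.
  apply: cvg_norm; apply: cvgB; last exact: cst_continuous.
  exact: metric_cont.
have e0 : 0 < Num.min (mu / 2) 1 by rewrite lt_min mu2 ltr01.
have near1 := cont_dist cD e0.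
have near2 : \forall z \near c0, mg_image i z /\ \sum_k \sum_l `|mg_metric i z k l - mg_metric i c0 k l| <= Num.min (mu / 2) 1.
  apply: filterS2 near1 (near_image ic) => z H iz; split => //.
  move: H; rewrite (_ : \sum_k \sum_l `|mg_metric i c0 k l - _| = 0); last first.
    by apply: big1 => k _; apply: big1 => l _; rewrite subrr normr0.
  by rewrite sub0r normrN; apply: le_trans; exact: ler_norm.
have [r /= r0 Br] := (@nbhs_ballP _ _ _ _).1 near2.
near=> rho; split; first by near: rho; exact: nbhs_right_gt.
  by rewrite /C -addrA lerDl addr_ge0// ltW.
move=> z zr; have [|iz Dz] := Br z.
  rewrite -ball_normE /= distrC; apply: le_lt_trans zr _.
  by near: rho; exact: nbhs_right_lt.
split => // w.
have Iz : `|inner (mg_metric i z) w w - inner (mg_metric i c0) w w| <= Num.min (mu / 2) 1 * `|w| ^+ 2.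
  rewrite -inner_subm; apply: le_trans (inner_bound _ _) _; apply: ler_wpM2r; first exact: exprn_ge0.
  by apply: le_trans Dz; apply: ler_sum => k _; apply: ler_sum => l _; rewrite !mxE.
have w2 : 0 <= `|w| ^+ 2 by exact: exprn_ge0.
have lowz : mu / 2 * `|w| ^+ 2 <= inner (mg_metric i z) w w.
  have := low w; move: Iz; rewrite ler_norml => /andP[+ _].
  have := ge_min (mu / 2) (mu / 2) 1; rewrite lexx /= => m1 h1 h2.
  have : Num.min (mu / 2) 1 * `|w| ^+ 2 <= mu / 2 * `|w| ^+ 2 by exact: ler_wpM2r.
  lra.
have upz : inner (mg_metric i z) w w <= (B + 1) * `|w| ^+ 2.
  have := inner_bound (mg_metric i c0) w; rewrite -/B => /(le_trans (ler_norm _)) h1.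
  move: Iz; rewrite ler_norml => /andP[_ h2].
  have m1 : Num.min (mu / 2) 1 <= 1 by rewrite ge_min lexx orbT.
  have : Num.min (mu / 2) 1 * `|w| ^+ 2 <= 1 * `|w| ^+ 2 by exact: ler_wpM2r.
  lra.
split.
  have : Num.sqrt (mu / 2) * `|w| <= nrm i z w.
    rewrite -[`|w|]ger0_norm// -sqrtr_sqr -sqrtrM ?(ltW mu2)//.
    exact: ler_wsqrtr.
  rewrite mulrC -ler_pdivlMr ?sqrtr_gt0// => h; apply: le_trans h _; rewrite mulrC.
  by apply: ler_wpM2r; [exact: sqrtr_ge0|rewrite /C lerDr addr_ge0].
apply: (@le_trans _ _ (Num.sqrt (B + 1) * `|w|)).
  rewrite -[`|w|]ger0_norm// -sqrtr_sqr -sqrtrM ?addr_ge0//.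
  exact: ler_wsqrtr.
by apply: ler_wpM2r => //; rewrite /C addrAC lerDr addr_ge0// ltW.
Unshelve. all: by end_near. Qed.

Lemma distance_bound gam (L dL : R -> R) : C1_curve gam ->
  (forall s : R, is_derive s 1 L (dL s)) -> (forall s, speed gam s <= dL s) ->
  (distance (gam 0%R) (gam 1%R) <= (L 1 - L 0)%:E)%E.
Proof.
move=> Cg dLs sL.
have [ell dl] := primitive (speed_cont Cg).
have dl' (s : R) : 0 <= s <= 1 -> is_derive s 1 ell (speed gam s).
  by move=> /andP[s0 s1]; apply: dl; lra.
apply: le_trans (distance_le Cg dl') _; rewrite lee_fin.
have : L 0 - ell 0 <= L 1 - ell 1.
  apply: (@der_ge0_ndecr _ (fun s => L s - ell s) (fun s => dL s - speed gam s)) => //.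
    by move=> s sI; exact: (der_sub (dLs s) (dl' s sI)).
  by move=> s _; rewrite subr_ge0.
by move: (ell 1) (ell 0) (L 1) (L 0) => u v p q; lra.
Qed.

Lemma segment_in_ball (c0 z z' : 'rV[R]_d) (rho t : R) : 0 <= t <= 1 ->
  `|z - c0| <= rho -> `|z' - c0| <= rho -> `|z + t *: (z' - z) - c0| <= rho.
Proof.
move=> /andP[t0 t1] h h'.
have -> : z + t *: (z' - z) - c0 = (1 - t) *: (z - c0) + t *: (z' - c0).
  by rewrite !scalerBr !scalerBl !scale1r; apply/rowP => k; rewrite !mxE; ring.
apply: le_trans (ler_normD _ _) _; rewrite !normrZ !ger0_norm ?subr_ge0//.
have : (1 - t) * `|z - c0| <= (1 - t) * rho by apply: ler_wpM2l => //; rewrite subr_ge0.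
have : t * `|z' - c0| <= t * rho by exact: ler_wpM2l.
lra.
Qed.

Lemma dist_upper i c0 rho C z z' : good_ball i c0 rho C ->
  `|z - c0| <= rho -> `|z' - c0| <= rho ->
  (distance (mg_inv i z) (mg_inv i z') <= (C * `|z' - z|)%:E)%E.
Proof.
move=> [rho0 C1 gb] zr zr'.
have [tau [dtau [dt ct [dt0 t01] tl tr]]] := clamp_exists (R := R).
pose y (s : R) := z + tau s *: (z' - z); pose v (s : R) := dtau s *: (z' - z).
have yin s : `|y s - c0| <= rho by exact: segment_in_ball.
have yv (s : R) : vder y s (v s).
  move=> k; rewrite (_ : (fun r => y r 0 k) = (fun r => z 0 k + tau r * (z' - z) 0 k)); last first.
    by apply/funext => r; rewrite !mxE.
  apply: (der_eq (der_add (is_derive_cst _ _ _) (der_mul (dt s) (is_derive_cst _ _ _)))).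
  by rewrite mulr0 addr0 add0r [RHS]mxE.
have cv k : continuous (fun s => v s 0 k).
  move=> s; rewrite /v; under eq_fun do rewrite mxE.
  by rewrite mxE; apply: cvgM; [exact: ct|exact: cst_continuous].
have [Cg sg] := chart_C1 (fun s => (gb _ (yin s)).1) yv cv.
have := @distance_bound _ (fun s => C * `|z' - z| * tau s) (fun s => C * `|z' - z| * dtau s) Cg.
rewrite /= /y (tl 0)// (tr 1)// scale0r addr0 scale1r subrKC mulr0 mulr1 subr0; apply.
move=> s; have := sg s; rewrite /y => ->; apply: le_trans ((gb _ (yin s)).2 _).2 _.
by rewrite /v normrZ ger0_norm// mulrCA mulrC.
Qed.

Lemma chart_increment gam (ell : R -> R) i c0 rho C (r : R) : good_ball i c0 rho C ->
  C1_curve gam -> (forall s : R, is_derive s 1 ell (speed gam s)) -> 0 <= r ->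
  (forall t, 0 <= t <= r -> mg_dom i (gam t) /\ `|mg_map i (gam t) - c0| <= rho) ->
  `|mg_map i (gam r) - mg_map i (gam 0)| <= C * (ell r - ell 0).
Proof.
move=> [rho0 C1 gb] Cg dl r0 gin.
have C0 : 0 <= C by apply: le_trans C1.
have l0r : ell 0 <= ell r.
  by apply: (der_ge0_ndecr (f := speed gam)) => // s _; exact: speed_ge0.
apply: norm_mx_le; first by rewrite mulr_ge0// subr_ge0.
move=> a k; rewrite (ord1 a) !mxE {a}.
pose v t := derive1 (mg_map i \o gam) t.
have bnd t : 0 <= t <= r -> `|v t 0 k| <= C * speed gam t.
  move=> tr; have [it bt] := gin t tr.
  rewrite (speed_chart (Cg.1 t) it (C1_vder Cg it)).
  by apply: le_trans (norm_coord _ _ _) _; exact: ((gb _ bt).2 _).1.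
have H1 : C * ell 0 - mg_map i (gam 0) 0 k <= C * ell r - mg_map i (gam r) 0 k.
  apply: (@der_ge0_ndecr _ (fun t => C * ell t - mg_map i (gam t) 0 k)
    (fun t => C * speed gam t - v t 0 k)) => //.
    move=> t tr; have [it _] := gin t tr.
    exact: (der_sub (der_mulc C (dl t)) (C1_vder Cg it k)).
  by move=> t tr; rewrite subr_ge0; apply: le_trans (bnd t tr); exact: ler_norm.
have H2 : C * ell 0 + mg_map i (gam 0) 0 k <= C * ell r + mg_map i (gam r) 0 k.
  apply: (@der_ge0_ndecr _ (fun t => C * ell t + mg_map i (gam t) 0 k)
    (fun t => C * speed gam t + v t 0 k)) => //.
    move=> t tr; have [it _] := gin t tr.
    exact: (der_add (der_mulc C (dl t)) (C1_vder Cg it k)).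
  move=> t tr; rewrite -lerBlDr sub0r; apply: le_trans (bnd t tr).
  by rewrite -normrN; exact: ler_norm.
by rewrite ler_norml; apply/andP; split; lra.
Qed.

(** Continuity argument at the first bad time [b]. The chart domain is not closed, but the image [K]
    of a closed coordinate ball is compact, hence closed in the Hausdorff space; so the path is
    still good at [b], and the strict inequality carries it beyond. *)
Lemma path_stays x y gam (ell : R -> R) i c0 rho C : good_ball i c0 rho C ->
  path x y gam ell -> mg_dom i x -> `|mg_map i x - c0| + C * (ell 1 - ell 0) < rho ->
  forall s, 0 <= s <= 1 ->
  mg_dom i (gam s) /\ `|mg_map i (gam s) - mg_map i x| <= C * (ell s - ell 0).
Proof.
move=> gb [Cg gx gy dl] ix small.
have [rho0 C1 gbz] := gb.
have C0 : 0 <= C by apply: le_trans C1.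
have lmono (a b : R) : a <= b -> ell a <= ell b.
  by move=> ab; apply: (der_ge0_ndecr (f := speed gam)) => // s _; exact: speed_ge0.
set r0 := C * (ell 1 - ell 0) in small.
pose G s := mg_dom i (gam s) /\ `|mg_map i (gam s) - mg_map i x| <= r0.
have ext (r : R) : 0 <= r <= 1 -> (forall t, 0 <= t <= r -> mg_dom i (gam t) /\ `|mg_map i (gam t) - c0| <= rho) ->
    `|mg_map i (gam r) - mg_map i x| <= C * (ell r - ell 0).
  move=> /andP[r0' r1] H; rewrite -(gx 0)//; exact: chart_increment gb Cg dl r0' H.
have Gc0 s : G s -> `|mg_map i (gam s) - c0| < rho.
  move=> [_ H]; rewrite -(subrKA (mg_map i x)); apply: le_lt_trans (ler_normD _ _) _.
  by rewrite addrC; apply: le_lt_trans small; rewrite lerD2l.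
suff all s : 0 <= s <= 1 -> G s.
  move=> s s01; split; first by have [] := all s s01.
  apply: ext => // t /andP[t0 ts].
  have Gt : G t by apply: all; rewrite t0 (le_trans ts)//; case/andP: s01.
  by split; [case: Gt|rewrite ltW// Gc0].
move=> s01; apply: contrapT => nGs.
pose B := [set t : R | 0 <= t <= 1 /\ ~ G t].
have B0 : has_inf B.
  by split; [exists s|exists 0 => t [/andP[]]].
pose b := inf B.
have b0 : 0 <= b by apply: lb_le_inf; [exists s|move=> t [/andP[]]].
have b1 : b <= 1.
  by apply: le_trans (ge_inf B0.2 (conj s01 nGs : B s)) _; case/andP: s01.
have below t : 0 <= t < b -> G t.
  move=> /andP[t0 tb]; apply: contrapT => nG.
  suff : b <= t by rewrite leNgt tb.
  by apply: (ge_inf B0.2); split => //; rewrite t0 (le_trans (ltW tb) b1).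
pose K := mg_inv i @` [set z | `|z - mg_map i x| <= r0].
have imK z : `|z - mg_map i x| <= r0 -> mg_image i z.
  move=> zr; apply: (gbz _ _).1; rewrite -(subrKA (mg_map i x)).
  by apply: le_trans (ler_normD _ _) _; rewrite addrC; apply: le_trans (ltW small); rewrite lerD2l.
have cK : closed K.
  apply: compact_closed; first exact: M_hausdorff.
  apply: continuous_compact.
    by apply: continuous_in_subspaceT => z; rewrite inE /= => zr; apply: inv_cont; exact: imK.
  exact: compact_ball_rV.
have KG t : K (gam t) -> G t.
  move=> [z zr E]; have iz := imK z zr; rewrite /G -E; split; first exact: dom_inv.
  by rewrite map_inv.
have GK t : G t -> K (gam t).
  by move=> [it tr]; exists (mg_map i (gam t)) => //; rewrite inv_map.
have Gb : G b.
  have [bz|bz] := eqVneq b 0.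
    rewrite bz /G (gx 0)// subrr normr0; split => //.
    by rewrite /r0 mulr_ge0// subr_ge0 lmono.
  apply: KG; have bp : 0 < b by rewrite lt_neqAle eq_sym bz.
  apply: (@closed_cvg _ _ (b^'-) _ gam K cK _ (gam b)); last first.
    by apply: cvg_at_left_filter; exact: Cg.1.
  near=> t; apply: GK; apply: below; apply/andP; split.
    by near: t; exact: nbhs_left_ge.
  by near: t; exact: nbhs_left_lt.
have near1 : \forall t \near b, mg_dom i (gam t) /\ `|mg_map i (gam t) - c0| < rho.
  have cm := C1_chart_cont Cg Gb.1.
  have cn : {for b, continuous (fun t => `|mg_map i (gam t) - c0|)}.
    exact: (continuous_comp cm (@subr_norm_cont c0 _)).
  apply: filterS2 (near_curve_dom (Cg.1 b) Gb.1) (cn _ (lt_nbhsl (Gc0 b Gb))) => t h1 h2.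
  by split.
have [eta /= eta0 Be] := (@nbhs_ballP _ _ _ _).1 near1.
have [t [/andP[t0 t1] nGt] tb] := inf_adherent eta0 B0.
apply: nGt.
have tin u : 0 <= u <= t -> mg_dom i (gam u) /\ `|mg_map i (gam u) - c0| <= rho.
  move=> /andP[u0 ut]; have [ub|ub] := ltP u b.
    have Gu : G u by apply: below; rewrite u0 ub.
    by split; [case: Gu|rewrite ltW// Gc0].
  have [|iu ru] := Be u.
    by rewrite -ball_normE /= distrC ger0_norm ?subr_ge0// ltrBlDl; exact: le_lt_trans ut tb.
  by split => //; exact: ltW.
split; first by have [] := tin t; rewrite ?t0 ?lexx.
apply: le_trans (ext t _ tin) _; first by rewrite t0 t1.
by rewrite /r0; apply: ler_wpM2l => //; rewrite lerD2r lmono.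
Unshelve. all: by end_near. Qed.

(** Nothing is assumed about [y]: a curve too short to leave the coordinate ball has to end in the
    chart. *)
Lemma dist_lower i c0 rho C x y a : good_ball i c0 rho C -> mg_dom i x ->
  (distance x y < a%:E)%E -> `|mg_map i x - c0| + C * a < rho ->
  mg_dom i y /\ `|mg_map i y - mg_map i x| <= C * a.
Proof.
move=> gb ix /path_exists[gam [ell [P la]]] small.
have C0 : 0 < C by have [_ C1 _] := gb; apply: lt_le_trans C1.
have small' : `|mg_map i x - c0| + C * (ell 1 - ell 0) < rho.
  by apply: le_lt_trans small; rewrite lerD2l ler_pM2l// ltW.
have := path_stays gb P ix small' (s := 1); rewrite lexx ler01 => /(_ isT)[].
rewrite (path_tgt P)// => iy h; split => //; apply: le_trans h _.
by rewrite ler_pM2l// ltW.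
Qed.

End LocalComparison.

(** * Balls of a complete manifold are compact *)

Lemma filter_meet (T : Type) (F : set_system T) (A B : set T) : ProperFilter F ->
  F A -> F B -> exists z, A z /\ B z.
Proof. by move=> pF FA FB; apply: (@filter_ex _ F _ (A `&` B)); exact: filterI. Qed.

Section DistanceTopology.
Context {R : realType} {d : nat}.
Variable M : riemannian_manifold R d.
Implicit Types (i j : mg_index M) (x y p q : M) (gam : R -> M) (a b : R) (z w : 'rV[R]_d).

Lemma good_chart x : exists C rho, 1 <= C /\
  good_ball (M := M) (mg_at x) (mg_map (mg_at x) x) rho C.
Proof.
have [C [C1 nC]] := metric_bounds (image_map (at_dom x)).
by have [rho gb] := @filter_ex _ _ (at_right_proper_filter (0 : R)) _ nC; exists C, rho.
Qed.

Lemma good_ball_nearby i c0 rho C x : good_ball (M := M) i c0 rho C ->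
  mg_dom i x -> `|mg_map i x - c0| < rho -> 
  forall r, 0 < r -> \forall y \near x, (distance x y < r%:E)%E.
Proof.
move=> gb ix xr r r0; have [rho0 C1 _] := gb.
have C0 : 0 < C by apply: lt_le_trans C1.
have cm := map_cont ix.
have c1 : {for x, continuous (fun y => `|mg_map i y - c0|)}.
  exact: (continuous_comp cm (@subr_norm_cont _ _ c0 _)).
have c2 : {for x, continuous (fun y => `|mg_map i y - mg_map i x|)}.
  exact: (continuous_comp cm (@subr_norm_cont _ _ (mg_map i x) _)).
have h0 : `|mg_map i x - mg_map i x| < r / C by rewrite subrr normr0 divr_gt0.
apply: filterS3 (near_dom ix) (c1 _ (lt_nbhsl xr)) (c2 _ (lt_nbhsl h0)) => y iy h1 h2.
have := dist_upper gb (ltW xr) (ltW h1); rewrite !inv_map// => h; apply: le_lt_trans h _.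
by rewrite lte_fin mulrC -ltr_pdivlMr.
Qed.

Lemma ball_nbhs x r : 0 < r -> \forall y \near x, (distance x y < r%:E)%E.
Proof.
move=> r0; have [C [rho [C1 gb]]] := good_chart x; have [rho0 _ _] := gb.
by apply: (good_ball_nearby gb (at_dom x)) => //; rewrite subrr normr0.
Qed.

(** With [ball_nbhs] this identifies the topology of [M] with that of the distance. *)
Lemma nbhs_ball_dist x (A : set M) : nbhs x A ->
  exists2 r : R, 0 < r & forall y, (distance x y < r%:E)%E -> A y.
Proof.
move=> nA; set i := mg_at x; have ix : mg_dom i x := at_dom x.
have [C [rho [C1 gb]]] := good_chart x; have [rho0 _ _] := gb.
have C0 : 0 < C by apply: lt_le_trans C1.
have nA' : nbhs (mg_inv i (mg_map i x)) A by rewrite inv_map.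
have n1 := inv_cont (image_map ix) nA'.
have [e /= e0 Be] := (@nbhs_ballP _ _ _ _).1 n1.
exists (Num.min (rho / 2) (e / 2) / C).
  by rewrite divr_gt0// lt_min !divr_gt0.
move=> y xy.
have m1 : Num.min (rho / 2) (e / 2) <= rho / 2 by rewrite ge_min lexx.
have m2 : Num.min (rho / 2) (e / 2) <= e / 2 by rewrite ge_min lexx orbT.
have [|iy dy] := dist_lower gb ix xy.
  by rewrite subrr normr0 add0r mulrC divfK ?gt_eqF//; lra.
have := Be (mg_map i y); rewrite /preimage /= inv_map//; apply.
rewrite -ball_normE /= distrC; apply: le_lt_trans dy _.
by rewrite mulrC divfK ?gt_eqF//; lra.
Qed.

Lemma dd_cont o x : conn o x -> {for x, continuous (dd o)}.
Proof.
move=> c; apply: dist_cont => e e0.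
apply: filterS (ball_nbhs x e0) => y xy.
have cxy := lt_conn xy; have xy' := lt_dd xy.
have h1 := dd_tri c cxy; have h2 := dd_tri (conn_tri c cxy) (conn_sym cxy).
rewrite -(dd_sym cxy) in h2.
by rewrite ler_norml; apply/andP; split; lra.
Qed.

Definition cball x r : set M := [set y | (distance x y <= r%:E)%E].

Lemma dle_tri x y q a b : (distance x y <= a%:E)%E -> (distance y q < b%:E)%E ->
  conn x q /\ dd x q < a + b.
Proof.
move=> xy yz; have cxy : conn x y by apply: le_lt_trans xy _; exact: ltry.
have cyz := lt_conn yz; split; first exact: conn_tri cxy cyz.
apply: le_lt_trans (dd_tri cxy cyz) _; apply: ler_ltD; last exact: lt_dd.
by move: xy; rewrite distE// lee_fin.
Qed.

Lemma cballP x r y : cball x r y <-> conn x y /\ dd x y <= r.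
Proof.
split=> [xy|[c h]]; last by rewrite /cball /= distE// lee_fin.
have c : conn x y by apply: le_lt_trans xy _; exact: ltry.
by split => //; move: xy; rewrite /cball /= distE// lee_fin.
Qed.

Lemma cball_closed x r : closed (cball x r).
Proof.
move=> y cl; suff : forall e, 0 < e -> conn x y /\ dd x y < r + e.
  move=> H; apply/cballP; split; first by have [] := H 1 ltr01.
  by apply/ler_addgt0Pr => e e0; apply: ltW; have [] := H e e0.
move=> e e0; have [z [xz yz]] := cl _ (ball_nbhs y e0).
exact: dle_tri xz (dlt_sym yz).
Qed.

Lemma compact_ultraP (A : set M) :
  (forall F : set_system M, UltraFilter F -> F A -> exists2 l, A l & F --> l) -> compact A.
Proof.
move=> H; rewrite compact_ultra /= => F uF FA.
by have [l Al Fl] := H F uF FA; exists l.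
Qed.

Lemma ultra_compact (A : set M) (F : set_system M) : UltraFilter F -> compact A -> F A ->
  exists2 l, A l & F --> l.
Proof.
move=> uF cA FA; move: cA; rewrite compact_ultra /= => /(_ F uF FA)[l [Al Fl]].
by exists l.
Qed.

(** Push the ultrafilter to the compact set by [f]: a cluster point there is close to [F]-almost
    every point. This is total boundedness phrased with ultrafilters. *)
Lemma ultra_shadow (F : set_system M) (A B : set M) (e : R) (f : M -> M) :
  UltraFilter F -> compact B -> F A -> 0 < e ->
  (forall y, A y -> B (f y) /\ (distance (f y) y < e%:E)%E) ->
  exists2 x0, B x0 & F [set y | (distance x0 y < (e + e)%:E)%E].
Proof.
move=> uF cB FA e0 fP.
have pF : ProperFilter (f @ F) by apply: fmap_proper_filter.
have FB : F (f @^-1` B) by apply: filterS FA => y Ay; exact: (fP y Ay).1.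
have [x0 [Bx0 cl]] := cB _ pF FB; exists x0 => //.
have [//|FC] := in_ultra_setVsetC [set y | (distance x0 y < (e + e)%:E)%E] uF.
have fFC : F (f @^-1` [set p | ~ (distance x0 p < e%:E)%E]).
  apply: filterS2 FA FC => y Ay nxy h; apply: nxy; have [_ fy] := fP y Ay.
  exact: dlt_tri h fy.
have [p [np hp]] := cl _ _ fFC (ball_nbhs x0 e0).
by case: np.
Qed.

Lemma locally_compact x : exists2 r : R, 0 < r & compact (cball x r).
Proof.
have [C [rho [C1 gb]]] := good_chart x; have [rho0 _ gbz] := gb.
set i := mg_at x; have ix : mg_dom i x := at_dom x.
have C0 : 0 < C by apply: lt_le_trans C1.
exists (rho / 4 / C); first by rewrite !divr_gt0.
apply: (@subclosed_compact _ _ (mg_inv i @` [set z | `|z - mg_map i x| <= rho])).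
- exact: cball_closed.
- apply: continuous_compact; last exact: compact_ball_rV.
  by apply: continuous_in_subspaceT => z; rewrite inE /= => zr; apply: inv_cont; exact: (gbz z zr).1.
move=> y xy; have xy' : (distance x y < (rho / 2 / C)%:E)%E.
  by apply: le_lt_trans xy _; rewrite lte_fin ltr_pM2r ?invr_gt0//; lra.
have [|iy dy] := dist_lower gb ix xy'.
  by rewrite subrr normr0 add0r mulrC divfK ?gt_eqF//; lra.
exists (mg_map i y); last by rewrite inv_map.
by apply: le_trans dy _; rewrite mulrC divfK ?gt_eqF//; lra.
Qed.

Lemma cball_sub x y r s : (distance x y < s%:E)%E -> cball y r `<=` cball x (r + s).
Proof.
move=> xy z yz; have [cyz dyz] := (cballP _ _ _).1 yz; have cxy := lt_conn xy.
apply/cballP; split; first exact: conn_tri cyz.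
by apply: le_trans (dd_tri cxy cyz) _; rewrite addrC lerD// ltW// lt_dd.
Qed.

Lemma uniform_local_compact (A : set M) : compact A ->
  exists2 r : R, 0 < r & forall x, A x -> compact (cball x r).
Proof.
move=> /compact_near_coveringP cA.
have : \forall r \near (0 : R)^'+, A `<=` (fun x => compact (cball x r)).
  apply: (cA R (0 : R)^'+ (fun r x => compact (cball x r))) => x Ax.
  have [r r0 cr] := locally_compact x.
  have r2 : 0 < r / 2 by rewrite divr_gt0.
  exists ([set y | (distance x y < (r / 2)%:E)%E], [set s | s < r / 2]).
    by split; [exact: ball_nbhs|exact: nbhs_right_lt].
  move=> [y s] [/= xy sr]; apply: subclosed_compact cr _; first exact: cball_closed.
  move=> z yz; have [c h] := (cballP _ _ _).1 (cball_sub xy yz); apply/cballP; split => //.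
  by apply: le_trans h _; lra.
move=> H; have : \forall r \near (0 : R)^'+, 0 < r /\ A `<=` (fun x => compact (cball x r)).
  by apply: filterS2 (nbhs_right_gt 0) H.
by move=> /(@filter_ex _ _ (at_right_proper_filter (0 : R)))[r [r0 Hr]]; exists r.
Qed.

(** With [s] a uniform radius of local compactness on the smaller ball, every point of the larger
    ball is within [s / 2] of the smaller one. An ultrafilter on it thus lives in one of the compact
    balls of radius [s]. *)
Lemma compact_extend x r : 0 < r -> compact (cball x r) ->
  exists2 e : R, 0 < e & compact (cball x (r + e)).
Proof.
move=> r0 cr; have [s s0 cs] := uniform_local_compact cr.
exists (s / 4); first by rewrite divr_gt0.
have s3 : 0 < s / 2 by rewrite divr_gt0.
have shadow y : exists p, cball x (r + s / 4) y -> cball x r p /\ (distance p y < (s / 2)%:E)%E.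
  have [xy|nxy] := pselect (cball x (r + s / 4) y); last by exists x.
  have h : (distance x y < (r + s / 2)%:E)%E.
    by apply: le_lt_trans xy _; rewrite lte_fin; lra.
  by have [p [h1 h2]] := dlt_split r0 s3 h; exists p; split => //; exact: ltW.
have [f fP] := choice shadow.
apply: compact_ultraP => F uF FA.
have [x0 Bx0 Fx0] := ultra_shadow uF cr FA s3 fP.
have Fs : F (cball x0 s).
  by apply: filterS Fx0 => y; rewrite /cball /= -splitr => /ltW.
have [l _ Fl] := ultra_compact uF (cs x0 Bx0) Fs.
exists l => //; apply: (cball_closed (x := x)).
by move=> B nB; have [z [z1 z2]] := filter_meet _ FA (Fl _ nB); exists z.
Qed.

(** The centres of balls of radius [1 / (n + 1)] in the ultrafilter form a Cauchy sequence, since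
    two members of a filter meet; its limit attracts the ultrafilter. *)
Lemma Cauchy_ultra (F : set_system M) : complete_manifold M -> UltraFilter F ->
  (forall e, 0 < e -> exists x0, F [set y | (distance x0 y < e%:E)%E]) ->
  exists l : M, F --> l.
Proof.
move=> cM uF H.
have pos n : 0 < (n.+1%:R)^-1 :> R by rewrite invr_gt0.
have [u uP] := choice (fun n : nat => H _ (pos n)).
have meet m n : (distance (u m) (u n) < ((m.+1%:R)^-1 + (n.+1%:R)^-1)%:E)%E.
  have [z [/= z1 z2]] := filter_meet _ (uP m) (uP n).
  exact: dlt_tri z1 (dlt_sym z2).
have small e : 0 < e -> exists N : nat, forall n, (N <= n)%N -> (n.+1%:R)^-1 < e :> R.
  move=> e0; exists (Num.truncn e^-1) => n Nn.
  rewrite -[ltRHS]invrK ltf_pV2 ?posrE ?invr_gt0//.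
  apply: lt_le_trans (truncnS_gt _) _; first by rewrite ler_nat ltnS.
have [e e0|l lP] := cM u.
  have [N NP] := small (e / 2) ltac:(by rewrite divr_gt0).
  exists N => m n Nm Nn; apply: lt_trans (meet m n) _.
  by rewrite lte_fin [ltRHS]splitr ltrD// NP.
exists l => B nB; have [r r0 rB] := nbhs_ball_dist nB.
have [N NP] := lP (r / 2) ltac:(by rewrite divr_gt0).
have [N' NP'] := small (r / 2) ltac:(by rewrite divr_gt0).
apply: filterS (uP (maxn N N')) => y uy; apply: rB.
have := dlt_tri (dlt_sym (NP (maxn N N') (leq_maxl _ _))) uy.
by move=> h; apply: lt_trans h _; rewrite lte_fin [ltRHS]splitr ltrD2l NP'// leq_maxr.
Qed.

(** Completeness enters here: the points of the ball are shadowed by those of a slightly smaller,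
    compact one, so an ultrafilter on it is Cauchy. *)
Lemma compact_limit x r : complete_manifold M -> 0 < r ->
  (forall s, 0 < s < r -> compact (cball x s)) -> compact (cball x r).
Proof.
move=> cM r0 H; apply: compact_ultraP => F uF FA.
have [e e0|l Fl] := Cauchy_ultra cM uF.
  pose t := Num.min (e / 4) (r / 2).
  have t0 : 0 < t by rewrite lt_min !divr_gt0.
  have t1 : t <= e / 4 by rewrite ge_min lexx.
  have t2 : t <= r / 2 by rewrite ge_min lexx orbT.
  have e2 : 0 < e / 2 by rewrite divr_gt0.
  have rt : 0 < r - t by lra.
  have shadow y : exists p, cball x r y -> cball x (r - t) p /\ (distance p y < (e / 2)%:E)%E.
    have [xy|nxy] := pselect (cball x r y); last by exists x.
    have h : (distance x y < ((r - t) + e / 2)%:E)%E.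
      by apply: le_lt_trans xy _; rewrite lte_fin; lra.
    by have [p [h1 h2]] := dlt_split rt e2 h; exists p; split => //; exact: ltW.
  have [f fP] := choice shadow.
  have crt : compact (cball x (r - t)) by apply: H; lra.
  have [x0 _ Fx0] := ultra_shadow uF crt FA e2 fP.
  by exists x0; rewrite -splitr in Fx0.
exists l => //; apply: (cball_closed (x := x)).
by move=> B nB; have [z [z1 z2]] := filter_meet _ FA (Fl _ nB); exists z.
Qed.

(** Hopf-Rinow without geodesics: at the supremum of the radii of compact balls, [compact_limit]
    gives compactness and [compact_extend] contradicts maximality. *)
Lemma compact_cball x r : complete_manifold M -> compact (cball x r).
Proof.
move=> cM; have mono a b : a <= b -> compact (cball x b) -> compact (cball x a).
  move=> ab cb; apply: subclosed_compact cb _; first exact: cball_closed.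
  by move=> y xy; apply: le_trans xy _; rewrite lee_fin.
apply: contrapT => nc.
pose S := [set s : R | 0 < s /\ compact (cball x s)].
have hS : has_sup S.
  split; first by have [s s0 cs] := locally_compact x; exists s.
  by exists r => s [s0 cs]; rewrite leNgt; apply/negP => rs; apply: nc; apply: mono cs; exact: ltW.
have [s [s0 cs]] := hS.1.
have b0 : 0 < sup S by exact: (lt_le_trans s0 (sup_upper_bound hS (conj s0 cs))).
have cb : compact (cball x (sup S)).
  apply: compact_limit => // t /andP[t0 tb].
  have bt : 0 < sup S - t by rewrite subr_gt0.
  have [t' [t'0 ct'] tt'] := sup_adherent bt hS.
  by apply: mono ct'; apply: ltW; move: tt'; rewrite opprB addrC subrK.
have [e e0 ce] := compact_extend b0 cb.
have : sup S + e <= sup S by apply: (sup_upper_bound hS); split => //; exact: addr_gt0.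
by rewrite gerDl leNgt e0.
Qed.

(** [dlt_split] gives points at which both distances are almost right; on a compact ball the total
    error [f] attains its infimum 0. *)
Lemma intermediate_point q x s : complete_manifold M -> conn q x -> 0 <= s <= dd q x ->
  exists p, [/\ conn q p, conn p x, dd q p = s & dd p x = dd q x - s].
Proof.
move=> cM c /andP[s0 sD].
pose A := cball q (dd q x + 1).
have Aq : A !=set0 by exists q; apply/cballP; split; [exact: conn_refl|rewrite dd_refl addr_ge0// dd_ge0].
pose f p := `|dd q p - s| + `|dd x p - (dd q x - s)|.
have cf : {within A, continuous f}.
  apply: continuous_in_subspaceT => p; rewrite inE => /cballP[cp _].
  have cxp : conn x p := conn_tri (conn_sym c) cp.
  apply: cvgD; apply: cvg_norm; apply: cvgB; [exact: dd_cont cp|exact: cst_continuous|exact: dd_cont cxp|exact: cst_continuous].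
have [p] := compact_EVT_min Aq (compact_cball cM) cf.
rewrite inE => /cballP[cp _] pmin.
have cxp : conn x p by exact: conn_tri (conn_sym c) cp.
exists p.
have fp : f p <= 0.
  apply/ler_addgt0Pr => e e0; rewrite add0r.
  (* The bound 1 keeps the approximate points in the ball [A], whose radius exceeds the distance by
     1. *)
  pose e' := Num.min (e / 2) 1.
  have e'0 : 0 < e' by rewrite lt_min divr_gt0 ?ltr01.
  have e'1 : e' <= 1 by rewrite ge_min lexx orbT.
  have e'e : e' <= e / 2 by rewrite ge_min lexx.
  have h : (distance q x < ((s + e') + (dd q x - s + e'))%:E)%E by rewrite dd_lt//; lra.
  have p1 : 0 < s + e' by lra.
  have p2 : 0 < dd q x - s + e' by lra.
  have [p' [h1 h2]] := dlt_split p1 p2 h.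
  have cp' := lt_conn h1; have d1 := lt_dd h1; have d2 := lt_dd h2.
  have tri := dd_tri cp' (lt_conn h2).
  have Ap' : A p' by apply/cballP; split => //; lra.
  have := pmin p'; rewrite inE => /(_ Ap') fle; apply: le_trans fle _.
  rewrite [leRHS]splitr /f -(dd_sym (lt_conn h2)); apply: lerD; rewrite ler_norml; apply/andP; split; lra.
have n1 := normr_ge0 (dd q p - s); have n2 := normr_ge0 (dd x p - (dd q x - s)).
rewrite /f in fp.
have /normr0_eq0 E1 : `|dd q p - s| = 0 by lra.
have /normr0_eq0 E2 : `|dd x p - (dd q x - s)| = 0 by lra.
split => //; [exact: conn_sym|lra|rewrite (dd_sym (conn_sym cxp)); lra].
Qed.

End DistanceTopology.

(** * Levi-Civita connection and curvature in coordinates *)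

Section DirectionalDerivatives.
Context {R : realType} {d : nat}.
Implicit Types (U : set 'rV[R]_d) (f : 'rV[R]_d -> R) (y u v w : 'rV[R]_d).

Definition d1 f y u : R := \sum_k partial k f y * u 0 k.

Definition dmx (a b : nat) (A : 'rV[R]_d -> 'M[R]_(a, b)) y w : 'M[R]_(a, b) :=
  \matrix_(i, j) d1 (fun z => A z i j) y w.

Definition hessm f y : 'M[R]_d := \matrix_(i, j) partial i (partial j f) y.

Definition d2 f y u v : R := inner (hessm f y) u v.

Lemma d1D f y u v : d1 f y (u + v) = d1 f y u + d1 f y v.
Proof. by rewrite /d1 -big_split; apply: eq_bigr => k _; rewrite mxE mulrDr. Qed.

Lemma d1Z f y a u : d1 f y (a *: u) = a * d1 f y u.
Proof. by rewrite /d1 mulr_sumr; apply: eq_bigr => k _; rewrite mxE mulrCA. Qed.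

Lemma d10 f y : d1 f y 0 = 0.
Proof. by rewrite /d1 big1// => k _; rewrite mxE mulr0. Qed.

Lemma d1_delta f y k : d1 f y (delta_mx 0 k) = partial k f y.
Proof.
rewrite /d1 (bigD1 k)//= mxE !eqxx mulr1 big1 ?addr0// => l lk.
by rewrite mxE eqxx (negbTE lk) mulr0.
Qed.

Lemma d2E f y u v : d2 f y u v = \sum_i \sum_j partial i (partial j f) y * u 0 i * v 0 j.
Proof.
rewrite /d2 innerE; apply: eq_bigr => i _; apply: eq_bigr => j _.
by rewrite !mxE [u 0 i * _]mulrC.
Qed.

Lemma d2_delta f y i j : d2 f y (delta_mx 0 i) (delta_mx 0 j) = partial i (partial j f) y.
Proof. by rewrite /d2 inner_delta mxE. Qed.

Lemma hessm_sym U f y : open U -> Ck_on 2 U f -> U y -> (hessm f y)^T = hessm f y.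
Proof. by move=> oU Cf Uy; apply/matrixP => i j; rewrite !mxE; exact: (@schwarz _ _ U f y j i oU Cf Uy). Qed.

Lemma d2C U f y u v : open U -> Ck_on 2 U f -> U y -> d2 f y u v = d2 f y v u.
Proof. by move=> oU Cf Uy; apply: innerC; exact: hessm_sym Cf Uy. Qed.

Lemma partial_eq_near f f' y k : (\near y, f y = f' y) -> partial k f y = partial k f' y.
Proof. by move=> E; apply: near_eq_derive. Qed.

Lemma near_open U y : open U -> U y -> \forall z \near y, U z.
Proof. by move=> oU Uy; exact: open_nbhs_nbhs. Qed.

Lemma d1_eq_on U f f' y u : open U -> (forall z, U z -> f z = f' z) -> U y ->
  d1 f y u = d1 f' y u.
Proof.
move=> oU E Uy; apply: eq_bigr => k _; suff -> : partial k f y = partial k f' y by [].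
by apply: partial_eq_near; apply: filterS (near_open oU Uy) => z /E.
Qed.

Section AlongCurves.
Context {V : normedModType R}.

Definition mder (a b : nat) (A : V -> 'M[R]_(a, b)) (x v : V) (A' : 'M[R]_(a, b)) :=
  forall i j, is_derive x v (fun s => A s i j) (A' i j).

Lemma mder_chain U (a b : nat) (A : 'rV[R]_d -> 'M[R]_(a, b)) (y : V -> 'rV[R]_d) (x v : V) y' :
  open U -> (forall i j, Ck_on 1 U (fun z => A z i j)) -> U (y x) -> mder y x v y' ->
  mder (fun s => A (y s)) x v (dmx A (y x) y').
Proof.
move=> oU CA Ux yy i j; rewrite mxE; apply: (der_chain oU (CA i j) Ux) => k.
exact: yy.
Qed.

Lemma f_chain U f (y : V -> 'rV[R]_d) (x v : V) y' : open U -> Ck_on 1 U f -> U (y x) ->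
  mder y x v y' -> is_derive x v (fun s => f (y s)) (d1 f (y x) y').
Proof. by move=> oU Cf Ux yy; apply: (der_chain oU Cf Ux) => k; exact: yy. Qed.

Lemma inner_der e (A : V -> 'M[R]_e) (u w : V -> 'rV[R]_e) (x v : V) A'
    (u' w' : 'rV[R]_e) :
  mder A x v A' -> mder u x v u' -> mder w x v w' ->
  is_derive x v (fun s => inner (A s) (u s) (w s))
    (inner A' (u x) (w x) + inner (A x) u' (w x) + inner (A x) (u x) w').
Proof.
move=> AA uu ww; under eq_fun do rewrite innerE.
apply: (der_eq (a := \sum_i \sum_j ((u' 0 i * A x i j + u x 0 i * A' i j) * w x 0 j
    + u x 0 i * A x i j * w' 0 j))).
  apply: der_sum => i _; apply: der_sum => j _.
  by apply: der_mul; [apply: der_mul; [exact: uu|exact: AA]|exact: ww].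
rewrite !innerE -!big_split; apply: eq_bigr => i _ /=.
by rewrite -!big_split; apply: eq_bigr => j _ /=; ring.
Qed.

Lemma d1_der U f (y u : V -> 'rV[R]_d) (x v : V) y' u' : open U -> Ck_on 2 U f -> U (y x) ->
  mder y x v y' -> mder u x v u' ->
  is_derive x v (fun s => d1 f (y s) (u s)) (d2 f (y x) y' (u x) + d1 f (y x) u').
Proof.
move=> oU Cf Ux yy uu.
apply: (der_eq (a := \sum_k (d1 (partial k f) (y x) y' * u x 0 k + partial k f (y x) * u' 0 k))).
  apply: der_sum => k _; apply: der_mul; last exact: uu.
  by apply: (f_chain oU _ Ux yy); exact: Ck_onS.
rewrite big_split; congr (_ + _); rewrite d2E exchange_big; apply: eq_bigr => k _ /=.
by rewrite mulr_suml.
Qed.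

Lemma hessm_C1 U k f i j : open U -> Ck_on k.+2 U f -> Ck_on k U (fun z => hessm f z i j).
Proof.
move=> oU Cf; apply: (Ck_on_ext oU _ (Ck_onS i (Ck_onS j Cf))) => y _.
by rewrite mxE.
Qed.

Lemma d2_der U f (y u w : V -> 'rV[R]_d) (x v : V) y' u' w' : open U -> Ck_on 3 U f -> U (y x) ->
  mder y x v y' -> mder u x v u' -> mder w x v w' ->
  is_derive x v (fun s => d2 f (y s) (u s) (w s))
    (inner (dmx (hessm f) (y x) y') (u x) (w x) + d2 f (y x) u' (w x) + d2 f (y x) (u x) w').
Proof.
move=> oU Cf Ux yy uu ww; apply: inner_der => //.
by apply: (mder_chain oU _ Ux yy) => i j; exact: hessm_C1.
Qed.

End AlongCurves.

Lemma d3E f y u v w : inner (dmx (hessm f) y w) u v =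
  \sum_i \sum_j \sum_k d1 (fun z => hessm f z i j) y (delta_mx 0 k) * u 0 i * v 0 j * w 0 k.
Proof.
rewrite innerE; apply: eq_bigr => i _; apply: eq_bigr => j _.
rewrite !mxE /d1 mulr_sumr mulr_suml; apply: eq_bigr => k _.
by rewrite -/(d1 _ _ _) d1_delta; ring.
Qed.

(** Third partial derivatives commute, by Schwarz applied inside and outside a derivative. In the
    Gauss equation this removes the third derivatives of the immersion. *)
Lemma d3_sym U f y v w : open U -> Ck_on 3 U f -> U y ->
  inner (dmx (hessm f) y v) v w = inner (dmx (hessm f) y w) v v.
Proof.
move=> oU Cf Uy.
have E i j k : d1 (fun z => hessm f z i j) y (delta_mx 0 k) = partial k (partial i (partial j f)) y.
  rewrite d1_delta; apply: partial_eq_near; apply: filterS (near_open oU Uy) => z _.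
  by rewrite mxE.
have Cf2 : Ck_on 2 U f by exact: Ck_onW.
have s12 i j k : partial k (partial i (partial j f)) y = partial i (partial k (partial j f)) y.
  exact: (@schwarz _ _ U (partial j f) y k i oU (Ck_onS j Cf) Uy).
have s23 i j k : partial k (partial i (partial j f)) y = partial k (partial j (partial i f)) y.
  apply: partial_eq_near; apply: filterS (near_open oU Uy) => z Uz.
  exact: (@schwarz _ _ U f z i j oU Cf2 Uz).
rewrite !d3E; apply: eq_bigr => i _; rewrite [RHS]exchange_big.
apply: eq_bigr => j _; apply: eq_bigr => k _; rewrite !E.
have -> : partial k (partial i (partial j f)) y = partial j (partial i (partial k f)) y.
  by rewrite s12 s23 s12.
by ring.
Qed.

End DirectionalDerivatives.

Section LeviCivita.
Context {R : realType} {d : nat}.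
Variables (U : set 'rV[R]_d) (G : 'rV[R]_d -> 'M[R]_d).
Hypothesis oU : open U.
Hypothesis CG : forall k i j, Ck_on k U (fun y => G y i j).
Hypothesis symG : forall y, U y -> (G y)^T = G y.
Hypothesis posG : forall y, U y -> posdef (G y).
Implicit Types (y u v w x : 'rV[R]_d).

Definition chr (k : 'I_d) y : 'M[R]_d := \matrix_(i, j) christoffel G k i j y.

(** The Christoffel symbols as a vector-valued bilinear map. On fields with constant coordinates it
    is the covariant derivative, which keeps later computations free of indices. *)
Definition Gam y u v : 'rV[R]_d := \row_k inner (chr k y) u v.

Definition DG y w u v : R := inner (dmx G y w) u v.

Lemma dmx_G_sym y w : U y -> (dmx G y w)^T = dmx G y w.
Proof.
move=> Uy; apply/matrixP => i j; rewrite !mxE; apply: (d1_eq_on _ oU) => // z Uz.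
by rewrite -[in RHS](symG Uz) mxE.
Qed.

Lemma DGC y w u v : U y -> DG y w u v = DG y w v u.
Proof. by move=> Uy; apply: innerC; exact: dmx_G_sym. Qed.

Lemma DGD y w w' u v : DG y (w + w') u v = DG y w u v + DG y w' u v.
Proof.
rewrite /DG -[RHS]mulr1 !innerE -big_split mulr_suml; apply: eq_bigr => i _ /=.
rewrite -big_split mulr_suml; apply: eq_bigr => j _ /=.
by rewrite !mxE d1D; ring.
Qed.

Lemma DGZ y a w u v : DG y (a *: w) u v = a * DG y w u v.
Proof.
rewrite /DG !innerE mulr_sumr; apply: eq_bigr => i _.
rewrite mulr_sumr; apply: eq_bigr => j _.
by rewrite !mxE d1Z; ring.
Qed.

Lemma DG0 y u v : DG y 0 u v = 0.
Proof. by rewrite -(scale0r (0 : 'rV[R]_d)) DGZ mul0r. Qed.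

Lemma row_delta_sum w : w = \sum_l w 0 l *: delta_mx 0 l.
Proof. by rewrite [LHS]row_sum_delta. Qed.

Lemma DG_sum y w u v : DG y w u v = \sum_l w 0 l * DG y (delta_mx 0 l) u v.
Proof.
rewrite {1}(row_delta_sum w).
elim/big_rec2: _ => [|l a b _ <-]; last by rewrite DGD DGZ.
exact: DG0.
Qed.

Lemma christoffelE y k i j : christoffel G k i j y =
  2^-1 * \sum_l invmx (G y) k l * (partial i (fun z => G z j l) y
    + partial j (fun z => G z i l) y - partial l (fun z => G z i j) y).
Proof. by []. Qed.

Lemma GamE y u v k : Gam y u v 0 k = 2^-1 * \sum_l invmx (G y) k l *
  (DG y u v (delta_mx 0 l) + DG y v u (delta_mx 0 l) - DG y (delta_mx 0 l) u v).
Proof.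
rewrite mxE innerE mulr_sumr.
pose T i j l := partial i (fun z => G z j l) y
    + partial j (fun z => G z i l) y - partial l (fun z => G z i j) y.
have E l : DG y u v (delta_mx 0 l) + DG y v u (delta_mx 0 l) - DG y (delta_mx 0 l) u v =
    \sum_i \sum_j u 0 i * v 0 j * T i j l.
  have e1 a b : DG y a b (delta_mx 0 l) = \sum_i \sum_j a 0 i * b 0 j * partial i (fun z => G z j l) y.
    rewrite /DG innerE exchange_big /= (bigD1 l)//= [X in _ + X]big1 ?addr0; last first.
      by move=> m ml; apply: big1 => j _; rewrite [delta_mx _ _ _ _]mxE (negbTE ml) andbF mulr0.
    rewrite [RHS]exchange_big; apply: eq_bigr => j _ /=.
    rewrite [delta_mx _ _ _ _]mxE !eqxx mulr1 mxE /d1 mulr_sumr.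
    by apply: eq_bigr => i _; ring.
  rewrite !e1 [X in _ + X - _]exchange_big /= /DG innerE -big_split -sumrB.
  apply: eq_bigr => i _ /=; rewrite -big_split -sumrB; apply: eq_bigr => j _ /=.
  by rewrite mxE d1_delta /T; ring.
under [RHS]eq_bigr do rewrite E mulr_sumr mulr_sumr.
rewrite [RHS]exchange_big; apply: eq_bigr => i _ /=.
under [RHS]eq_bigr do rewrite mulr_sumr mulr_sumr.
rewrite [RHS]exchange_big; apply: eq_bigr => j _ /=.
rewrite mxE christoffelE mulr_sumr mulr_sumr mulr_suml; apply: eq_bigr => l _.
by rewrite /T; ring.
Qed.

(** Koszul's formula for fields with constant coordinates, whose brackets vanish. By positivity it
    determines [Gam], which for warped products is computed through it and not through the inverse
    matrix. *)
Lemma koszul y u v w : U y ->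
  inner (G y) (Gam y u v) w = 2^-1 * (DG y u v w + DG y v u w - DG y w u v).
Proof.
move=> Uy; pose t : 'rV[R]_d := \row_l (DG y u v (delta_mx 0 l) + DG y v u (delta_mx 0 l) - DG y (delta_mx 0 l) u v).
have -> : Gam y u v = 2^-1 *: (t *m invmx (G y)).
  apply/rowP => k; rewrite GamE !mxE; congr (_ * _); apply: eq_bigr => l _.
  by rewrite [t 0 l]mxE mulrC -[X in invmx X l k](symG Uy) -trmx_inv [in RHS]mxE.
rewrite innerZl; congr (_ * _); rewrite /inner mulmxKV ?posdef_unit//; last exact: posG.
rewrite mxE.
have e a b : DG y a b w = \sum_l w 0 l * DG y a b (delta_mx 0 l).
  rewrite /DG {1}(row_delta_sum w) inner_sumr; apply: eq_bigr => l _.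
  by rewrite innerZr.
rewrite !e (DG_sum y w) -big_split -sumrB; apply: eq_bigr => l _ /=.
by rewrite !mxE; ring.
Qed.

Lemma chr_sym y k : U y -> (chr k y)^T = chr k y.
Proof.
move=> Uy; apply/matrixP => i j; rewrite !mxE !christoffelE; congr (_ * _).
apply: eq_bigr => l _; congr (_ * _); congr (_ - _); first exact: addrC.
apply: partial_eq_near; apply: filterS (near_open oU Uy) => z Uz.
by rewrite -[in RHS](symG Uz) mxE.
Qed.

Lemma GamC y u v : U y -> Gam y u v = Gam y v u.
Proof. by move=> Uy; apply/rowP => k; rewrite !mxE; apply: innerC; exact: chr_sym. Qed.

Lemma GamDl y u v w : Gam y (u + v) w = Gam y u w + Gam y v w.
Proof. by apply/rowP => k; rewrite !mxE innerDl. Qed.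

Lemma GamDr y u v w : Gam y w (u + v) = Gam y w u + Gam y w v.
Proof. by apply/rowP => k; rewrite !mxE innerDr. Qed.

Lemma GamZl y a u v : Gam y (a *: u) v = a *: Gam y u v.
Proof. by apply/rowP => k; rewrite !mxE innerZl. Qed.

Lemma GamZr y a u v : Gam y u (a *: v) = a *: Gam y u v.
Proof. by apply/rowP => k; rewrite !mxE innerZr. Qed.

Lemma compat y w u v : U y ->
  DG y w u v = inner (G y) (Gam y w u) v + inner (G y) u (Gam y w v).
Proof.
move=> Uy; rewrite (innerC u _ (symG Uy)) !koszul//.
by rewrite (DGC w v u Uy); move: (DG _ _ _ _) (DG _ _ _ _) (DG _ _ _ _) => a b c; field.
Qed.

(** Compatibility along a curve: [u' + Gam y' u] is the covariant derivative of the field [u]. This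
    is the product rule behind the Gauss formula and the second variation. *)
Lemma cov_der (y u v : R -> 'rV[R]_d) (s : R) y' u' v' : U (y s) ->
  mder y s 1 y' -> mder u s 1 u' -> mder v s 1 v' ->
  is_derive s 1 (fun r => inner (G (y r)) (u r) (v r))
    (inner (G (y s)) (u' + Gam (y s) y' (u s)) (v s)
     + inner (G (y s)) (u s) (v' + Gam (y s) y' (v s))).
Proof.
move=> Us yy uu vv.
have GG : mder (fun r => G (y r)) s 1 (dmx G (y s) y').
  by apply: (mder_chain oU _ Us yy) => i j; exact: CG.
apply: (der_eq (inner_der GG uu vv)); rewrite -/(DG _ _ _ _) compat// innerDl innerDr.
by ring.
Qed.

Lemma chr_smooth k a i j : Ck_on k U (fun y => chr a y i j).
Proof.
apply: (Ck_on_ext (f := fun y => christoffel G a i j y) oU); first by move=> y _; rewrite mxE.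
apply: Ck_on_mulc => //; apply: Ck_on_sum => // l _; apply: Ck_on_mul => //.
  by apply: Ck_on_invmx => // y Uy; apply: posdef_unit; exact: posG.
apply: Ck_on_sub => //; last by apply: Ck_onS; exact: CG.
by apply: Ck_on_add => //; apply: Ck_onS; exact: CG.
Qed.

Definition DGam y w u v : 'rV[R]_d := \row_k inner (dmx (chr k) y w) u v.

Lemma Gam_der (y u v : R -> 'rV[R]_d) (s : R) y' u' v' : U (y s) ->
  mder y s 1 y' -> mder u s 1 u' -> mder v s 1 v' ->
  mder (fun r => Gam (y r) (u r) (v r)) s 1
    (DGam (y s) y' (u s) (v s) + Gam (y s) u' (v s) + Gam (y s) (u s) v').
Proof.
move=> Us yy uu vv a k; rewrite (ord1 a) !mxE; under eq_fun do rewrite mxE.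
apply: inner_der => //.
by apply: (mder_chain oU _ Us yy) => i j; exact: chr_smooth.
Qed.

(** The definition without indices: the commutator of the covariant derivatives in the constant
    directions [u] and [v], whose bracket vanishes. *)
Lemma curvatureE y u v w : curvature G y u v w =
  DGam y u v w - DGam y v u w + Gam y u (Gam y v w) - Gam y v (Gam y u w).
Proof.
apply/rowP => l; rewrite mxE.
have E1 a b c : DGam y a b c 0 l =
    \sum_i \sum_j \sum_k a 0 i * b 0 j * c 0 k * partial i (christoffel G l j k) y.
  rewrite mxE innerE [RHS]exchange_big; apply: eq_bigr => j _ /=.
  rewrite [RHS]exchange_big; apply: eq_bigr => k _ /=.
  rewrite mxE /d1 mulr_sumr mulr_suml; apply: eq_bigr => i _.
  have -> : partial i (fun z => chr l z j k) y = partial i (christoffel G l j k) y.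
    by congr (partial i _ y); apply/funext => z; rewrite mxE.
  by ring.
have E2 a b c : Gam y a (Gam y b c) 0 l = \sum_i \sum_j \sum_k a 0 i * b 0 j * c 0 k *
    \sum_p christoffel G p j k y * christoffel G l i p y.
  rewrite mxE innerE; apply: eq_bigr => i _.
  under eq_bigr do rewrite [Gam _ _ _ _ _]mxE innerE mulr_sumr.
  rewrite exchange_big; apply: eq_bigr => j _ /=.
  under eq_bigr do rewrite mulr_sumr.
  rewrite exchange_big; apply: eq_bigr => k _ /=.
  by rewrite mulr_sumr; apply: eq_bigr => p _; rewrite !mxE; ring.
have S (a b c : 'rV[R]_d) (F : 'I_d -> 'I_d -> 'I_d -> R) : \sum_i \sum_j \sum_k a 0 i * b 0 j * c 0 k * F i j k =
    \sum_i \sum_j \sum_k b 0 i * a 0 j * c 0 k * F j i k.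
  rewrite exchange_big; apply: eq_bigr => i _; apply: eq_bigr => j _; apply: eq_bigr => k _.
  by rewrite (mulrC (a 0 j)).
have -> : (DGam y u v w - DGam y v u w + Gam y u (Gam y v w) - Gam y v (Gam y u w)) 0 l =
  DGam y u v w 0 l - DGam y v u w 0 l + Gam y u (Gam y v w) 0 l - Gam y v (Gam y u w) 0 l.
  by rewrite !(mxE, mxE, mxE).
rewrite (E1 v) (E2 v) !(S v u w) E1 E2 -sumrB -big_split -sumrB; apply: eq_bigr => i _ /=.
rewrite -sumrB -big_split -sumrB; apply: eq_bigr => j _ /=.
rewrite -sumrB -big_split -sumrB; apply: eq_bigr => k _ /=.
by rewrite /curvature_coef sumrB -mulrBr -mulrDr -mulrBr addrA.
Qed.

End LeviCivita.

(** * Constant curvature and immersions *)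

Section ConstantCurvature.
Context {R : realType} {d : nat}.
Variables (U : set 'rV[R]_d) (G : 'rV[R]_d -> 'M[R]_d).
Hypothesis oU : open U.
Hypothesis CG : forall k i j, Ck_on k U (fun y => G y i j).
Hypothesis symG : forall y, U y -> (G y)^T = G y.
Hypothesis posG : forall y, U y -> posdef (G y).
Implicit Types (y u v w x : 'rV[R]_d).

(** Squared area of the parallelogram, the denominator of the sectional curvature. *)
Definition wedge2 (A : 'M[R]_d) u v : R := inner A u u * inner A v v - inner A u v ^+ 2.

Lemma wedge2_gt0 (A : 'M[R]_d) u v : A^T = A -> posdef A -> v != 0 ->
  (forall c, u != c *: v) -> 0 < wedge2 A u v.
Proof.
move=> AT pA v0 uv.
have vv := pA v v0.
pose w := inner A v v *: u - inner A u v *: v.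
have w0 : w != 0.
  apply/eqP => E; case/eqP: (uv (inner A u v / inner A v v)).
  have vn : inner A v v != 0 by rewrite gt_eqF.
  move/eqP: E; rewrite subr_eq0 => /eqP E.
  by rewrite mulrC -scalerA -E scalerA mulVf// scale1r.
have := pA w w0.
rewrite /w !(innerBl, innerBr, innerZl, innerZr) (innerC v u AT) => H.
rewrite -(pmulr_rgt0 _ vv) /wedge2; apply: le_lt_trans (lexx 0) _.
by apply: lt_le_trans H _; rewrite le_eqVlt; apply/orP; left; apply/eqP; ring.
Qed.

Lemma row_free_col2 u v : v != 0 -> (forall c, u != c *: v) -> row_free (col_mx u v).
Proof.
move=> v0 uv; apply/inj_row_free => a; rewrite -[a]hsubmxK mul_row_col.
rewrite (mx11_scalar (lsubmx a)) (mx11_scalar (rsubmx a)) !mul_scalar_mx; set p := lsubmx a 0 0; set q := rsubmx a 0 0 => E.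
have p0 : p = 0.
  apply/eqP/negPn/negP => pn; case/eqP: (uv (- (q / p))).
  move/eqP: E; rewrite addr_eq0 => /eqP E.
  by rewrite -[LHS]scale1r -(mulVf pn) -scalerA E scalerN scalerA scaleNr mulrC.
move: E; rewrite p0 scale0r add0r => /eqP; rewrite scaler_eq0 (negbTE v0) orbF => /eqP ->.
by rewrite -[RHS]row_mx0; congr row_mx; apply/matrixP => k l; rewrite !mxE mul0rn.
Qed.

Lemma curvature_parallel y u c : curvature G y u (c *: u) (c *: u) = 0.
Proof.
rewrite curvatureE.
have -> : DGam G y (c *: u) u (c *: u) = DGam G y u (c *: u) (c *: u).
  apply/rowP => k; rewrite !mxE !innerZr [in RHS]innerZl.
  rewrite !innerE !mulr_sumr; apply: eq_bigr => i _; rewrite !mulr_sumr.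
  by apply: eq_bigr => j _; rewrite !mxE d1Z; ring.
by rewrite subrr add0r GamZr GamZl GamZr !GamZr GamZl !scalerA subrr.
Qed.

(** The hypothesis concerns independent pairs; for dependent ones both sides vanish. This matters
    because independent vectors of a warped product may have dependent fibre components. *)
Lemma constant_curvature y kappa u v : U y ->
  (forall u v, row_free (col_mx u v) -> sectional G y u v = kappa) ->
  inner (G y) (curvature G y u v v) u = kappa * wedge2 (G y) u v.
Proof.
move=> Uy H; have [->|u0] := eqVneq u 0.
  by rewrite /wedge2 !inner0r inner0l mul0r expr0n subrr mulr0.
have [[c ->]|nc] := pselect (exists c, v = c *: u).
  rewrite curvature_parallel inner0l /wedge2 !(innerZl, innerZr); ring.
have vu c : v != c *: u by apply/eqP => E; apply: nc; exists c.
have uv c : u != c *: v.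
  apply/eqP => E; have c0 : c != 0.
    by apply: contraNneq u0 => c0; rewrite E c0 scale0r.
  by case/eqP: (vu c^-1); rewrite E scalerA mulVf// scale1r.
have v0 : v != 0 by have := vu 0; rewrite scale0r.
have w0 := wedge2_gt0 (symG Uy) (posG Uy) v0 uv.
have <- := H u v (row_free_col2 v0 uv).
by rewrite /sectional -/(wedge2 (G y) u v) divfK// gt_eqF.
Qed.

End ConstantCurvature.

Section VectorMaps.
Context {R : realType} {d e : nat}.
Variables (U : set 'rV[R]_d) (V : set 'rV[R]_e).
Hypotheses (oU : open U) (oV : open V).
Variable F : 'rV[R]_d -> 'rV[R]_e.
Hypothesis UV : forall y, U y -> V (F y).
Hypothesis CF : forall k a, Ck_on k U (fun z => F z 0 a).

Definition d1v (y u : 'rV[R]_d) : 'rV[R]_e := \row_a d1 (fun z => F z 0 a) y u.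
Definition d2v (y u v : 'rV[R]_d) : 'rV[R]_e := \row_a d2 (fun z => F z 0 a) y u v.

Lemma d1v_jacobian y u : U y -> d1v y u = u *m jacobian F y.
Proof.
move=> Uy; apply/rowP => a; rewrite !mxE; apply: eq_bigr => k _.
by rewrite (jacobianE oU _ _ (CF 1) Uy) mulrC.
Qed.

Lemma mder_line (y x : 'rV[R]_d) (s : R) : mder (fun r : R => y + r *: x) s 1 x.
Proof.
move=> i j; rewrite (ord1 i); under eq_fun do rewrite !mxE.
apply: (der_eq (der_add (der_cst _ _ _) (der_mul (der_id _) (der_cst _ _ _)))).
by rewrite mul1r mulr0 addr0 add0r.
Qed.

Lemma mder_cst (a b : nat) (A : 'M[R]_(a, b)) (s : R) : mder (fun=> A) s 1 0.
Proof. by move=> i j; rewrite mxE; exact: is_derive_cst. Qed.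

Lemma d1v_der (y u : R -> 'rV[R]_d) (s : R) y' u' : U (y s) -> mder y s 1 y' ->
  mder u s 1 u' -> mder (fun r => d1v (y r) (u r)) s 1 (d2v (y s) y' (u s) + d1v (y s) u').
Proof.
move=> Us yy uu i a; rewrite (ord1 i) !mxE; under eq_fun do rewrite mxE.
exact: d1_der oU (CF 2 a) Us yy uu.
Qed.

Lemma F_der (y : R -> 'rV[R]_d) (s : R) y' : U (y s) -> mder y s 1 y' ->
  mder (fun r => F (y r)) s 1 (d1v (y s) y').
Proof.
move=> Us yy i a; rewrite (ord1 i) !mxE.
exact: f_chain oU (CF 1 a) Us yy.
Qed.

Lemma d2vC y u v : U y -> d2v y u v = d2v y v u.
Proof. by move=> Uy; apply/rowP => a; rewrite !mxE; exact: d2C oU (CF 2 a) Uy. Qed.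

Section Metrics.
Variables (g : 'rV[R]_d -> 'M[R]_d) (G : 'rV[R]_e -> 'M[R]_e).
Hypothesis Cg : forall k i j, Ck_on k U (fun y => g y i j).
Hypothesis symg : forall y, U y -> (g y)^T = g y.
Hypothesis posg : forall y, U y -> posdef (g y).
Hypothesis CG : forall k i j, Ck_on k V (fun y => G y i j).
Hypothesis symG : forall y, V y -> (G y)^T = G y.
Hypothesis posG : forall y, V y -> posdef (G y).

Lemma DG_line y x u v : U y ->
  is_derive (0 : R) 1 (fun s : R => inner (g (y + s *: x)) u v) (DG g y x u v).
Proof.
move=> Uy; have Uy0 : U (y + (0 : R) *: x) by rewrite scale0r addr0.
have gl := @mder_chain _ _ _ U _ _ g (fun r : R => y + r *: x) 0 1 x oU (Cg 1) Uy0 (mder_line y x 0).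
have := inner_der gl (mder_cst u 0) (mder_cst v 0).
by rewrite inner0l inner0r !addr0 scale0r addr0.
Qed.

(** Covariant derivative along [F] of [dF(v)] in the direction [u], both with constant coordinates:
    the second fundamental form and the tangential part, not yet separated. *)
Definition Sff y u v : 'rV[R]_e := d2v y u v + Gam G (F y) (d1v y u) (d1v y v).

Lemma SffC y u v : U y -> Sff y u v = Sff y v u.
Proof. by move=> Uy; rewrite /Sff d2vC// (GamC oV symG)//; exact: UV. Qed.

Lemma pull_line y x u v : U y ->
  is_derive (0 : R) 1 (fun s : R => inner (G (F (y + s *: x))) (d1v (y + s *: x) u) (d1v (y + s *: x) v))
   (inner (G (F y)) (Sff y x u) (d1v y v) + inner (G (F y)) (d1v y u) (Sff y x v)).
Proof.
move=> Uy; have Uy0 : U (y + (0 : R) *: x) by rewrite scale0r addr0.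
have L := mder_line y x 0.
have VF0 : V (F (y + (0 : R) *: x)) by exact: UV.
have dF := @F_der (fun r : R => y + r *: x) 0 x Uy0 L.
have dv u' := @d1v_der (fun r : R => y + r *: x) (fun=> u') 0 x 0 Uy0 L (mder_cst u' 0).
have := cov_der oV CG symG posG VF0 dF (dv u) (dv v).
rewrite /Sff scale0r addr0.
have -> : d1v y 0 = 0 by apply/rowP => a; rewrite !mxE d10.
by rewrite !addr0.
Qed.

Hypothesis iso : forall z, U z -> forall u v,
  inner (g z) u v = inner (G (F z)) (d1v z u) (d1v z v).

Lemma DG_pull y x u v : U y ->
  DG g y x u v = inner (G (F y)) (Sff y x u) (d1v y v) + inner (G (F y)) (d1v y u) (Sff y x v).
Proof.
move=> Uy; rewrite -(der_val (DG_line x u v Uy)) -(der_val (pull_line x u v Uy)).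
apply: near_eq_derive; apply: filterS (near_line x oU Uy) => s Us; exact: iso.
Qed.

(** Gauss formula: in Koszul's formula each derivative of [g] is expanded by [DG_pull], and the
    symmetry of [Sff] leaves a single term. *)
Lemma gauss y u v w : U y ->
  inner (g y) (Gam g y u v) w = inner (G (F y)) (Sff y u v) (d1v y w).
Proof.
move=> Uy; have VF := UV Uy; rewrite (koszul symg posg)// !DG_pull//.
rewrite (SffC v u Uy) (SffC w u Uy) (SffC w v Uy).
rewrite (innerC (d1v y v) _ (symG VF)) (innerC (d1v y u) (Sff y v w) (symG VF)).
by move: (inner _ (Sff y u v) _) (inner _ (Sff y u w) _) (inner _ (Sff y v w) _) => a b c; field.
Qed.

End Metrics.

End VectorMaps.

Section LocalIsometry.
Context {R : realType} {d : nat}.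
Variables (U V : set 'rV[R]_d).
Hypotheses (oU : open U) (oV : open V).
Variable F : 'rV[R]_d -> 'rV[R]_d.
Hypothesis UV : forall y, U y -> V (F y).
Hypothesis CF : forall k a, Ck_on k U (fun z => F z 0 a).
Variables (g : 'rV[R]_d -> 'M[R]_d) (G : 'rV[R]_d -> 'M[R]_d).
Hypothesis Cg : forall k i j, Ck_on k U (fun y => g y i j).
Hypothesis symg : forall y, U y -> (g y)^T = g y.
Hypothesis posg : forall y, U y -> posdef (g y).
Hypothesis CG : forall k i j, Ck_on k V (fun y => G y i j).
Hypothesis symG : forall y, V y -> (G y)^T = G y.
Hypothesis posG : forall y, V y -> posdef (G y).
Hypothesis iso : forall z, U z -> forall u v,
  inner (g z) u v = inner (G (F z)) (d1v F z u) (d1v F z v).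

Lemma local_isometry_unit y : U y -> jacobian F y \in unitmx.
Proof.
move=> Uy; rewrite -row_free_unit -kermx_eq0; apply/eqP/row_matrixP => i; rewrite row0.
apply/eqP/negPn/negP => ki; have := posg Uy ki.
rewrite iso// (d1v_jacobian oU CF)// -row_mul mulmx_ker row0 inner0l ltxx//.
Qed.

Lemma local_isometry_onto y w : U y -> exists u, w = d1v F y u.
Proof.
move=> Uy; exists (w *m invmx (jacobian F y)).
by rewrite (d1v_jacobian oU CF)// mulmxKV//; exact: local_isometry_unit.
Qed.

(** In equal dimensions the differential is onto, so there is no normal part. This is the
    transformation law of the Christoffel symbols, to be applied to chart changes. *)
Lemma isometry_Gam y u v : U y -> Sff F G y u v = d1v F y (Gam g y u v).
Proof.
move=> Uy; have VF := UV Uy.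
apply/eqP; rewrite -subr_eq0; apply/negPn/negP => n0; have := posG VF n0.
have [x Ex] := local_isometry_onto (Sff F G y u v - d1v F y (Gam g y u v)) Uy.
rewrite {2}Ex innerBl -(gauss oU oV UV CF Cg symg posg CG symG posG iso)// iso// subrr ltxx//.
Qed.

End LocalIsometry.

Section CompositionDerivatives.
Context {R : realType} {d e : nat}.
Variables (U : set 'rV[R]_d) (V : set 'rV[R]_e).
Hypotheses (oU : open U) (oV : open V).
Variable F : 'rV[R]_d -> 'rV[R]_e.
Hypothesis UV : forall y, U y -> V (F y).
Hypothesis CF : forall k a, Ck_on k U (fun z => F z 0 a).

Lemma d1_comp f y u : Ck_on 1 V f -> U y ->
  d1 (fun z => f (F z)) y u = d1 f (F y) (d1v F y u).
Proof.
move=> Cf Uy; have Uy0 : U (y + (0 : R) *: u) by rewrite scale0r addr0.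
have L := mder_line y u 0.
have CfF : Ck_on 1 U (fun z => f (F z)) by apply: (Ck_on_comp oU oV UV) => // a; exact: CF.
have h1 := @f_chain _ _ _ U (fun z => f (F z)) (fun r : R => y + r *: u) 0 1 u oU CfF Uy0 L.
have h2 := @f_chain _ _ _ V f (fun r : R => F (y + r *: u)) 0 1 _ oV Cf (UV Uy0) (F_der oU CF Uy0 L).
by have := der_val h1; rewrite (der_val h2) scale0r addr0.
Qed.

End CompositionDerivatives.

Section VectorComposition.
Context {R : realType} {d e k : nat}.
Variables (U : set 'rV[R]_d) (V : set 'rV[R]_e).
Hypotheses (oU : open U) (oV : open V).
Variables (F : 'rV[R]_d -> 'rV[R]_e) (S : 'rV[R]_e -> 'rV[R]_k).
Hypothesis UV : forall y, U y -> V (F y).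
Hypothesis CF : forall k a, Ck_on k U (fun z => F z 0 a).
Hypothesis CS : forall k a, Ck_on k V (fun z => S z 0 a).

Lemma d1v_comp y u : U y -> d1v (fun z => S (F z)) y u = d1v S (F y) (d1v F y u).
Proof. by move=> Uy; apply/rowP => a; rewrite !mxE (d1_comp oU oV UV CF _ (CS 1 a)). Qed.

End VectorComposition.

Lemma d1v_eq_on (R : realType) d e (U : set 'rV[R]_d) (F F' : 'rV[R]_d -> 'rV[R]_e) y u :
  open U -> (forall z, U z -> F z = F' z) -> U y -> d1v F y u = d1v F' y u.
Proof.
move=> oU E Uy; apply/rowP => a; rewrite !mxE.
by apply: (@d1_eq_on _ _ U (fun z => F z 0 a) (fun z => F' z 0 a) y u oU _ Uy) => z /E ->.
Qed.

Lemma d1vD (R : realType) d e (F : 'rV[R]_d -> 'rV[R]_e) y u v :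
  d1v F y (u + v) = d1v F y u + d1v F y v.
Proof. by apply/rowP => a; rewrite !mxE d1D. Qed.

Lemma d1vZ (R : realType) d e (F : 'rV[R]_d -> 'rV[R]_e) y a u :
  d1v F y (a *: u) = a *: d1v F y u.
Proof. by apply/rowP => b; rewrite !mxE d1Z. Qed.

Section GamLine.
Context {R : realType} {d : nat}.
Variables (U : set 'rV[R]_d) (G : 'rV[R]_d -> 'M[R]_d).
Hypothesis oU : open U.
Hypothesis CG : forall k i j, Ck_on k U (fun y => G y i j).
Hypothesis symG : forall y, U y -> (G y)^T = G y.
Hypothesis posG : forall y, U y -> posdef (G y).

Lemma Gam0l y v : Gam G y 0 v = 0.
Proof. by apply/rowP => k; rewrite mxE inner0l mxE. Qed.

Lemma Gam0r y v : Gam G y v 0 = 0.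
Proof. by apply/rowP => k; rewrite mxE inner0r mxE. Qed.

Lemma DGam_line y x u v k : U y ->
  is_derive (0 : R) 1 (fun s : R => Gam G (y + s *: x) u v 0 k) (DGam G y x u v 0 k).
Proof.
move=> Uy; have Uy0 : U (y + (0 : R) *: x) by rewrite scale0r addr0.
have := Gam_der oU CG posG Uy0 (mder_line y x 0) (mder_cst u 0) (mder_cst v 0).
by move=> /(_ 0 k); rewrite scale0r addr0 Gam0l Gam0r !addr0.
Qed.

End GamLine.

(** * The warped product metric and its curvature *)

Section WarpedMetric.
Context {R : realType} {n : nat}.
Variables (I : set R) (h : R -> R).
Hypothesis oI : open I.
Hypothesis h_gt0 : forall t, I t -> 0 < h t.
Hypothesis h_smooth : smooth1_on I h.
Variables (V : set 'rV[R]_n) (gP : 'rV[R]_n -> 'M[R]_n).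
Hypothesis oV : open V.
Hypothesis CgP : forall k i j, Ck_on k V (fun y => gP y i j).
Hypothesis symgP : forall y, V y -> (gP y)^T = gP y.
Hypothesis posgP : forall y, V y -> posdef (gP y).

Definition ht (y : 'rV[R]_(1 + n)) : R := lsubmx y 0 0.
Definition hp (y : 'rV[R]_(1 + n)) : 'rV[R]_n := rsubmx y.
Definition tp (a : R) (p : 'rV[R]_n) : 'rV[R]_(1 + n) := row_mx a%:M p.

Lemma ht_tp a p : ht (tp a p) = a.
Proof. by rewrite /ht /tp row_mxKl mxE eqxx. Qed.

Lemma hp_tp a p : hp (tp a p) = p.
Proof. by rewrite /hp /tp row_mxKr. Qed.

Lemma tpE y : y = tp (ht y) (hp y).
Proof. by rewrite /tp /ht -mx11_scalar hsubmxK. Qed.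

Lemma tp_eq y y' : ht y = ht y' -> hp y = hp y' -> y = y'.
Proof. by rewrite (tpE y) (tpE y') !ht_tp !hp_tp => -> ->. Qed.

Lemma htE y : ht y = y 0 (lshift n 0).
Proof. by rewrite /ht mxE. Qed.

Lemma hpE y a : hp y 0 a = y 0 (rshift 1 a).
Proof. by rewrite /hp mxE. Qed.

Definition GN (y : 'rV[R]_(1 + n)) : 'M[R]_(1 + n) :=
  block_mx 1%:M 0 0 (h (lsubmx y 0 0) ^+ 2 *: gP (rsubmx y)).

Definition VN : set 'rV[R]_(1 + n) := [set y | I (ht y) /\ V (hp y)].

Lemma inner_GN y u v : inner (GN y) u v = ht u * ht v + h (ht y) ^+ 2 * inner (gP (hp y)) (hp u) (hp v).
Proof.
rewrite {1}(tpE u) {1}(tpE v) /inner /GN /tp mul_row_block tr_row_mx mul_row_col.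
rewrite !mulmx0 addr0 add0r mulmx1 [LHS]mxE -/(ht y) -/(hp y); congr (_ + _).
  by rewrite tr_scalar_mx -scalar_mxM mxE eqxx.
by rewrite -scalemxAr -scalemxAl mxE.
Qed.

Lemma h_der t : I t -> is_derive t 1 h (derive1 h t).
Proof. by move=> It; rewrite derive1E; apply: derivableP; have := @h_smooth 0%N t It; rewrite derive1n0. Qed.

Lemma h'_der t : I t -> is_derive t 1 (derive1 h) (derive1n 2 h t).
Proof. by move=> It; rewrite derive1nS derive1n1 derive1E; apply: derivableP; have := @h_smooth 1%N t It; rewrite derive1n1. Qed.

Lemma VN_open : open VN.
Proof.
rewrite openE => y [Iy Vy].
have c1 : {for y, continuous ht}.
  have := @coord_continuous R 1 (1 + n) 0 (lshift n 0) y.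
  by rewrite (_ : (fun M : 'M[R]_(1, 1 + n) => M 0 (lshift n 0)) = ht)//; apply/funext => z; rewrite htE.
have c2 : {for y, continuous hp}.
  apply: (@cvg_mx _ _ (nbhs y)) => a b; rewrite (ord1 a).
  have := @coord_continuous R 1 (1 + n) 0 (rshift 1 b) y.
  rewrite (_ : (fun M : 'M[R]_(1, 1 + n) => M 0 (rshift 1 b)) = (fun z => hp z 0 b))//.
  by apply/funext => z; rewrite hpE.
have n1 : \forall z \near y, I (ht z) by apply: c1; exact: open_nbhs_nbhs.
have n2 : \forall z \near y, V (hp z) by apply: c2; exact: open_nbhs_nbhs.
by apply: filterS2 n1 n2 => z.
Qed.

Lemma GN_smooth k i j : Ck_on k VN (fun y => GN y i j).
Proof.
have oVN := VN_open.
have Cb a b : Ck_on k VN (fun y => h (ht y) ^+ 2 * gP (hp y) a b).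
  apply: Ck_on_mul => //.
    have Ch : Ck_on k VN (fun y => derive1n 0 h (ht y)).
      apply: (Ck_on_comp1 0 oVN h_smooth); first by move=> y [].
      by apply: (Ck_on_ext oVN _ (@Ck_on_coord _ _ k VN (lshift n 0) oVN)) => y _; rewrite htE.
    by apply: (Ck_on_ext oVN _ (Ck_on_mul oVN Ch Ch)) => y _; rewrite derive1n0 expr2.
  have UV y : VN y -> V (hp y) by case.
  apply: (Ck_on_comp oVN oV UV (CgP k a b)).
  by move=> c; apply: (Ck_on_ext oVN _ (@Ck_on_coord _ _ k VN (rshift 1 c) oVN)) => y _; rewrite hpE.
case: (split_ordP i) => a ->; case: (split_ordP j) => b ->.
- apply: (Ck_on_ext oVN _ (Ck_on_cst k ((a == b)%:R) oVN)) => y _.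
  by rewrite /GN block_mxEul mxE.
- by apply: (Ck_on_ext oVN _ (Ck_on_cst k 0 oVN)) => y _; rewrite /GN block_mxEur mxE.
- by apply: (Ck_on_ext oVN _ (Ck_on_cst k 0 oVN)) => y _; rewrite /GN block_mxEdl mxE.
- by apply: (Ck_on_ext oVN _ (Cb a b)) => y _; rewrite /GN block_mxEdr mxE.
Qed.

Lemma GN_sym y : VN y -> (GN y)^T = GN y.
Proof. by move=> [_ Vy]; rewrite /GN tr_block_mx !trmx0 trmx1 linearZ /= symgP. Qed.

Lemma GN_pos y : VN y -> posdef (GN y).
Proof.
move=> [Iy Vy] u u0; rewrite inner_GN.
have h2 : 0 < h (ht y) ^+ 2 by rewrite exprn_gt0// h_gt0.
have p0 := posdef_ge0 (hp u) (posgP Vy).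
have [ut0|ut0] := eqVneq (ht u) 0; last first.
  have t2 : 0 < ht u * ht u by rewrite -expr2 exprn_even_gt0.
  by apply: ltr_pwDl => //; apply: mulr_ge0 => //; exact: ltW.
rewrite ut0 mul0r add0r mulr_gt0// posgP//.
apply: contraNneq u0 => up0; apply/eqP; apply: tp_eq.
  by rewrite ut0 /ht !mxE.
by rewrite up0; apply/rowP => a; rewrite hpE !mxE.
Qed.

Lemma ht_line (y x : 'rV[R]_(1 + n)) (s : R) : ht (y + s *: x) = ht y + s * ht x.
Proof. by rewrite !htE !mxE. Qed.

Lemma hp_line (y x : 'rV[R]_(1 + n)) (s : R) : hp (y + s *: x) = hp y + s *: hp x.
Proof. by apply/rowP => a; rewrite !(hpE, mxE). Qed.

Lemma DG_GN y x u v : VN y -> DG GN y x u v =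
  2 * h (ht y) * derive1 h (ht y) * ht x * inner (gP (hp y)) (hp u) (hp v)
  + h (ht y) ^+ 2 * DG gP (hp y) (hp x) (hp u) (hp v).
Proof.
move=> VNy; have [Iy Vy] := VNy.
rewrite -(der_val (DG_line VN_open GN_smooth x u v VNy)).
under eq_fun do rewrite inner_GN ht_line hp_line.
apply: der_val.
have I0 : I (ht y + 0 * ht x) by rewrite mul0r addr0.
have dt : is_derive (0 : R) 1 (fun s : R => ht y + s * ht x) (ht x).
  apply: (der_eq (der_add (der_cst _ _ _) (der_mul (der_id _) (der_cst _ _ _)))).
  by rewrite mul1r mulr0 addr0 add0r.
have dh := der_compR dt (h_der I0).
have dP := DG_line oV CgP (hp x) (hp u) (hp v) Vy.
apply: (der_eq (der_add (der_cst _ _ _) (der_mul (der_mul dh dh) dP))).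
by rewrite mul0r scale0r !addr0; ring.
Qed.

(** Both sides have the same products with every vector by [koszul], so that no block matrix has to
    be inverted. *)
Lemma Gam_GN y u v : VN y -> Gam GN y u v =
  tp (- (h (ht y) * derive1 h (ht y) * inner (gP (hp y)) (hp u) (hp v)))
     (Gam gP (hp y) (hp u) (hp v)
      + derive1 h (ht y) / h (ht y) *: (ht u *: hp v + ht v *: hp u)).
Proof.
move=> VNy; have [Iy Vy] := VNy; set rhs := tp _ _.
have hn : h (ht y) != 0 by rewrite gt_eqF// h_gt0.
have eqw w : inner (GN y) (Gam GN y u v) w = inner (GN y) rhs w.
  rewrite (koszul GN_sym GN_pos)// !DG_GN// inner_GN /rhs ht_tp hp_tp.
  rewrite innerDl innerZl innerDl !innerZl (koszul symgP posgP)//.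
  rewrite (innerC (hp v) (hp w) (symgP Vy)) (innerC (hp u) (hp w) (symgP Vy)).
  by field.
apply/eqP; rewrite -subr_eq0; apply/negPn/negP => n0; have := GN_pos VNy n0.
by rewrite innerBl eqw subrr ltxx.
Qed.

Let oVN := VN_open.

Lemma warp_line (y x : 'rV[R]_(1 + n)) : I (ht y) ->
  [/\ is_derive (0 : R) 1 (fun s : R => h (ht y + s * ht x)) (derive1 h (ht y) * ht x),
      is_derive (0 : R) 1 (fun s : R => derive1 h (ht y + s * ht x)) (derive1n 2 h (ht y) * ht x)
      & h (ht y) != 0].
Proof.
move=> Iy; have I0 : I (ht y + 0 * ht x) by rewrite mul0r addr0.
have dt : is_derive (0 : R) 1 (fun s : R => ht y + s * ht x) (ht x).
  apply: (der_eq (der_add (der_cst _ _ _) (der_mul (der_id _) (der_cst _ _ _)))).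
  by rewrite mul1r mulr0 addr0 add0r.
split; last by rewrite gt_eqF// h_gt0.
  by apply: (der_eq (der_compR dt (h_der I0))); rewrite mul0r addr0.
by apply: (der_eq (der_compR dt (h'_der I0))); rewrite mul0r addr0.
Qed.

Lemma ht_DGam_GN y x u v : VN y -> ht (DGam GN y x u v) =
  - ((derive1 h (ht y) ^+ 2 + h (ht y) * derive1n 2 h (ht y)) * ht x * inner (gP (hp y)) (hp u) (hp v)
    + h (ht y) * derive1 h (ht y) * DG gP (hp y) (hp x) (hp u) (hp v)).
Proof.
move=> VNy; have [Iy Vy] := VNy; have [dh dh' hn] := warp_line x Iy.
rewrite htE -(der_val (DGam_line oVN GN_smooth GN_pos x u v (lshift n 0) VNy)).
have dP := DG_line oV CgP (hp x) (hp u) (hp v) Vy.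
have D := der_opp (der_mul (der_mul dh dh') dP).
have E : \forall s \near (0 : R), Gam GN (y + s *: x) u v 0 (lshift n 0) =
   - (h (ht y + s * ht x) * derive1 h (ht y + s * ht x) * inner (gP (hp y + s *: hp x)) (hp u) (hp v)).
  by apply: filterS (near_line x oVN VNy) => s Vs; rewrite Gam_GN// -htE ht_tp ht_line hp_line.
rewrite (near_eq_derive (1 : R) E) (der_val D) mul0r scale0r !addr0; ring.
Qed.

Lemma hp_DGam_GN y x u v : VN y -> hp (DGam GN y x u v) = DGam gP (hp y) (hp x) (hp u) (hp v) +
  ((derive1n 2 h (ht y) * h (ht y) - derive1 h (ht y) ^+ 2) / h (ht y) ^+ 2 * ht x) *:
   (ht u *: hp v + ht v *: hp u).
Proof.
move=> VNy; have [Iy Vy] := VNy; have [dh dh' hn] := warp_line x Iy.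
apply/rowP => a; rewrite hpE -(der_val (DGam_line oVN GN_smooth GN_pos x u v (rshift 1 a) VNy)).
have dP := DGam_line oV CgP posgP (hp x) (hp u) (hp v) a Vy.
have hn0 : h (ht y + 0 * ht x) != 0 by rewrite mul0r addr0.
have D := der_add dP (der_mul (der_mul dh' (is_deriveV hn0 dh)) (der_cst (0 : R) (1 : R) ((ht u *: hp v + ht v *: hp u) 0 a))).
have E : \forall s \near (0 : R), Gam GN (y + s *: x) u v 0 (rshift 1 a) =
   Gam gP (hp y + s *: hp x) (hp u) (hp v) 0 a
   + derive1 h (ht y + s * ht x) / h (ht y + s * ht x) * (ht u *: hp v + ht v *: hp u) 0 a.
  apply: filterS (near_line x oVN VNy) => s Vs; rewrite Gam_GN// -hpE hp_tp ht_line hp_line.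
  by rewrite !mxE.
rewrite (near_eq_derive (1 : R) E) (der_val D) [RHS]mxE; congr (_ + _).
rewrite [RHS]mxE mul0r mulr0 !addr0 -[_ *: (_ * _ : R)]/(_ * _); by move: ((_ + _ : 'rV_n) 0 a) => b; field.
Qed.

(** The term with the second derivative of [h] sees only the mixed part of the plane, between [d/dt]
    and the fibre; the two others see its fibre part. Unnormalised, the identity holds for dependent
    vectors too. *)
Lemma curvature_GN y v w : VN y ->
  inner (GN y) (curvature GN y w v v) w =
   h (ht y) ^+ 2 * inner (gP (hp y)) (curvature gP (hp y) (hp w) (hp v) (hp v)) (hp w)
   - h (ht y) * derive1n 2 h (ht y) *
       inner (gP (hp y)) (ht w *: hp v - ht v *: hp w) (ht w *: hp v - ht v *: hp w)
   - h (ht y) ^+ 2 * derive1 h (ht y) ^+ 2 * wedge2 (gP (hp y)) (hp w) (hp v).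
Proof.
move=> VNy; have [Iy Vy] := VNy; have hn : h (ht y) != 0 by rewrite gt_eqF// h_gt0.
rewrite inner_GN !curvatureE.
have htD a b : ht (a + b) = ht a + ht b by rewrite !htE mxE.
have htN a : ht (- a) = - ht a by rewrite !htE mxE.
have hpD a b : hp (a + b) = hp a + hp b by apply/rowP => k; rewrite !(hpE, mxE).
have hpN a : hp (- a) = - hp a by apply/rowP => k; rewrite !(hpE, mxE).
rewrite !(htD, htN, hpD, hpN) !ht_DGam_GN// !hp_DGam_GN// !Gam_GN// !(ht_tp, hp_tp).
rewrite !(compat oV symgP posgP)//.
set wp := hp w; set vp := hp v; set G := gP (hp y).
rewrite /wedge2 -/wp -/vp -/G.
have GC a b : Gam gP (hp y) a b = Gam gP (hp y) b a by apply: (GamC oV symgP).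
have iC a b : inner G a b = inner G b a by apply: innerC; exact: symgP.
rewrite !(GamDr, GamDl, GamZr, GamZl) !(innerDl, innerDr, innerZl, innerZr, innerNl, innerNr).
rewrite (GC vp wp) (iC vp wp) ?(iC _ (Gam _ _ wp vp)) ?(iC _ (Gam _ _ vp vp)) ?(iC _ (Gam _ _ wp wp)).
move: (DGam gP _ _ _ _) (DGam gP _ _ _ _) => D1 D2.
move: (Gam gP _ wp (Gam _ _ _ _)) (Gam gP _ vp (Gam _ _ _ _)) => D3 D4.
move: (Gam gP _ wp vp) (Gam gP _ vp vp) => D5 D6.
do ?[move: (inner G _ _) => ?].
move: (h (ht y)) hn (derive1 h (ht y)) (derive1n 2 h (ht y)) (ht w) (ht v) => a an b c' e f.
by field.
Qed.

End WarpedMetric.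

(** * The Gauss equation *)

Section GaussEquation.
Context {R : realType} {d e : nat}.
Variables (U : set 'rV[R]_d) (V : set 'rV[R]_e).
Hypotheses (oU : open U) (oV : open V).
Variable F : 'rV[R]_d -> 'rV[R]_e.
Hypothesis UV : forall y, U y -> V (F y).
Hypothesis CF : forall k a, Ck_on k U (fun z => F z 0 a).
Variables (g : 'rV[R]_d -> 'M[R]_d) (G : 'rV[R]_e -> 'M[R]_e).
Hypothesis Cg : forall k i j, Ck_on k U (fun y => g y i j).
Hypothesis symg : forall y, U y -> (g y)^T = g y.
Hypothesis posg : forall y, U y -> posdef (g y).
Hypothesis CG : forall k i j, Ck_on k V (fun y => G y i j).
Hypothesis symG : forall y, V y -> (G y)^T = G y.
Hypothesis posG : forall y, V y -> posdef (G y).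
Hypothesis iso : forall z, U z -> forall u v,
  inner (g z) u v = inner (G (F z)) (d1v F z u) (d1v F z v).

(** The second fundamental form in constant directions: what is left of [Sff] after removing the
    tangential part given by the Gauss formula. *)
Definition Bff y u v := Sff F G y u v - d1v F y (Gam g y u v).

Lemma Bff_normal y u v w : U y -> inner (G (F y)) (Bff y u v) (d1v F y w) = 0.
Proof.
move=> Uy; rewrite innerBl -(gauss oU oV UV CF Cg symg posg CG symG posG iso)//.
by rewrite -iso// subrr.
Qed.

Lemma SffE y u v : Sff F G y u v = Bff y u v + d1v F y (Gam g y u v).
Proof. by rewrite subrK. Qed.

Lemma inner_Sff y u v u' v' : U y -> inner (G (F y)) (Sff F G y u v) (Sff F G y u' v') =
  inner (G (F y)) (Bff y u v) (Bff y u' v') + inner (g y) (Gam g y u v) (Gam g y u' v').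
Proof.
move=> Uy; have N1 := Bff_normal u v (Gam g y u' v') Uy; have N2 := Bff_normal u' v' (Gam g y u v) Uy.
rewrite !SffE (iso Uy); move: (Bff y u v) (Bff y u' v') N1 N2 => b b' N1 N2.
by rewrite innerDl !innerDr N1 (innerC (d1v F y _) b' (symG (UV Uy))) N2 addr0 add0r.
Qed.

Definition d3v y x u v : 'rV[R]_e := \row_a inner (dmx (hessm (fun z => F z 0 a)) y x) u v.

Lemma d2v_line y x u v : U y ->
  mder (fun s : R => d2v F (y + s *: x) u v) 0 1 (d3v y x u v).
Proof.
move=> Uy i a; rewrite (ord1 i) mxE; under eq_fun do rewrite mxE.
have Uy0 : U (y + (0 : R) *: x) by rewrite scale0r addr0.
have := @d2_der _ _ _ U (fun z => F z 0 a) (fun s : R => y + s *: x) (fun=> u) (fun=> v) 0 1 x 0 0 oU (CF 3 a) Uy0 (mder_line y x 0) (mder_cst u 0) (mder_cst v 0).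
move=> D; apply: (der_eq D).
by rewrite scale0r addr0 /d2 inner0l inner0r !addr0.
Qed.

Lemma d1v0 y : d1v F y 0 = 0.
Proof. by apply/rowP => a; rewrite !mxE d10. Qed.

Lemma F_line y x : U y -> mder (fun s : R => F (y + s *: x)) 0 1 (d1v F y x).
Proof.
move=> Uy; have Uy0 : U (y + (0 : R) *: x) by rewrite scale0r addr0.
by have := F_der oU CF Uy0 (mder_line y x 0); rewrite scale0r addr0.
Qed.

Lemma d1v_line y x u : U y -> mder (fun s : R => d1v F (y + s *: x) u) 0 1 (d2v F y x u).
Proof.
move=> Uy; have Uy0 : U (y + (0 : R) *: x) by rewrite scale0r addr0.
have := d1v_der oU CF Uy0 (mder_line y x 0) (mder_cst u 0).
by rewrite scale0r addr0 d1v0 addr0.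
Qed.

Lemma mderD (a b : nat) (A A' : R -> 'M[R]_(a, b)) s D D' :
  mder A s 1 D -> mder A' s 1 D' -> mder (fun r => A r + A' r) s 1 (D + D').
Proof.
move=> H H' i j; rewrite mxE; under eq_fun do rewrite mxE.
exact: der_add (H i j) (H' i j).
Qed.

Definition DSff y x u v : 'rV[R]_e := d3v y x u v
  + (DGam G (F y) (d1v F y x) (d1v F y u) (d1v F y v)
     + Gam G (F y) (d2v F y x u) (d1v F y v) + Gam G (F y) (d1v F y u) (d2v F y x v)).

Lemma Sff_line y x u v : U y -> mder (fun s : R => Sff F G (y + s *: x) u v) 0 1 (DSff y x u v).
Proof.
move=> Uy; apply: mderD; first exact: d2v_line.
have V0 : V (F (y + (0 : R) *: x)) by apply: UV; rewrite scale0r addr0.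
have := Gam_der oV CG posG V0 (F_line x Uy) (d1v_line x u Uy) (d1v_line x v Uy).
by rewrite scale0r addr0.
Qed.

(** The Gauss formula [<Gam u v, w> = <Sff u v, dF w>] differentiated in the direction [x], both
    sides by [cov_der]. *)
Lemma gauss_line y x u v w : U y ->
  inner (g y) (DGam g y x u v + Gam g y x (Gam g y u v)) w + inner (g y) (Gam g y u v) (Gam g y x w) =
  inner (G (F y)) (DSff y x u v + Gam G (F y) (d1v F y x) (Sff F G y u v)) (d1v F y w)
  + inner (G (F y)) (Sff F G y u v) (Sff F G y x w).
Proof.
move=> Uy; have Uy0 : U (y + (0 : R) *: x) by rewrite scale0r addr0.
have V0 := UV Uy0.
have dG : mder (fun s : R => Gam g (y + s *: x) u v) 0 1 (DGam g y x u v).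
  have := Gam_der oU Cg posg Uy0 (mder_line y x 0) (mder_cst u 0) (mder_cst v 0).
  by rewrite scale0r addr0 Gam0l Gam0r !addr0.
have hL := cov_der oU Cg symg posg Uy0 (mder_line y x 0) dG (mder_cst w 0).
have hR := cov_der oV CG symG posG V0 (F_line x Uy) (Sff_line x u v Uy) (d1v_line x w Uy).
have E : \forall s \near (0 : R), inner (g (y + s *: x)) (Gam g (y + s *: x) u v) w =
    inner (G (F (y + s *: x))) (Sff F G (y + s *: x) u v) (d1v F (y + s *: x) w).
  apply: filterS (near_line x oU Uy) => s Us.
  exact: (gauss oU oV UV CF Cg symg posg CG symG posG iso).
have := near_eq_derive (1 : R) E; rewrite (der_val hL) (der_val hR) scale0r addr0 add0r => ->.
by rewrite /Sff.
Qed.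

Lemma d3v_sym y v w : U y -> d3v y w v v = d3v y v w v.
Proof.
move=> Uy; apply/rowP => a; rewrite [LHS]mxE [RHS]mxE.
rewrite -(d3_sym v w oU (CF 3 a) Uy); apply: innerC.
apply/matrixP => i j; rewrite !mxE; apply: (d1_eq_on _ oU) => // z Uz.
by have := hessm_sym oU (CF 2 a) Uz => /matrixP/(_ i j); rewrite mxE.
Qed.

(** Subtract two instances of [gauss_line] with directions exchanged: the curvature tensors appear
    on both sides, and the third derivatives of [F] cancel by [d3v_sym]. *)
Lemma gauss_equation y v w : U y ->
  inner (g y) (curvature g y w v v) w =
  inner (G (F y)) (curvature G (F y) (d1v F y w) (d1v F y v) (d1v F y v)) (d1v F y w)
  + inner (G (F y)) (Bff y v v) (Bff y w w) - inner (G (F y)) (Bff y w v) (Bff y w v).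
Proof.
move=> Uy; have Vy := UV Uy.
have h1 := gauss_line w v v w Uy; have h2 := gauss_line v w v w Uy.
rewrite !inner_Sff// in h1 h2.
have SC := SffC oU oV UV CF symG.
have GC a b : Gam g y a b = Gam g y b a by apply: (GamC oU symg).
have BC a b : Bff y a b = Bff y b a by rewrite /Bff SC// GC.
rewrite (GC v w) (BC v w) in h2.
have e1 : inner (g y) (curvature g y w v v) w =
  inner (g y) (DGam g y w v v + Gam g y w (Gam g y v v)) w
  - inner (g y) (DGam g y v w v + Gam g y v (Gam g y w v)) w.
  rewrite curvatureE !(innerDl, innerNl); ring.
have e2 : curvature G (F y) (d1v F y w) (d1v F y v) (d1v F y v) =
  (DSff y w v v + Gam G (F y) (d1v F y w) (Sff F G y v v))
  - (DSff y v w v + Gam G (F y) (d1v F y v) (Sff F G y w v)).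
  rewrite curvatureE /DSff /Sff (d3v_sym v w Uy) !GamDr.
  rewrite (d2vC oU CF v w Uy) (GamC oV symG _ (d1v F y v) Vy).
  move: (Gam _ _ _ _) (Gam _ _ _ (d2v F y v v)) (Gam _ _ _ (Gam _ _ _ _)) (Gam _ _ _ (Gam _ _ _ (d1v F y v))).
  move=> a b c' d'; apply/rowP => k; rewrite !mxE; ring.
rewrite e2 innerBl e1; move: h1 h2.
do ?[move: (inner _ _ _) => ?]; move=> h1 h2; lra.
Qed.

End GaussEquation.

(** * The Bakry-Emery bound along the soliton *)

Section Orthonormal.
Context {R : realType} {d : nat}.

Lemma linear_sum (f : 'rV[R]_d -> R) : (forall a u v, f (a *: u + v) = a * f u + f v) ->
  forall w, f w = \sum_i w 0 i * f (delta_mx 0 i).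
Proof.
move=> fl w; have f0 : f 0 = 0.
  by have := fl 1 0 0; rewrite scale1r addr0 mul1r; lra.
have fD u v : f (u + v) = f u + f v by rewrite -[u]scale1r fl mul1r scale1r.
rewrite {1}(row_delta_sum w) (big_morph f fD f0); apply: eq_bigr => i _.
by rewrite -[_ *: _]addr0 fl f0 addr0.
Qed.

Lemma bilinear_sum (f : 'rV[R]_d -> 'rV[R]_d -> R) :
  (forall a u u' v, f (a *: u + u') v = a * f u v + f u' v) ->
  (forall a u v v', f u (a *: v + v') = a * f u v + f u v') ->
  forall u v, f u v = \sum_i \sum_j u 0 i * v 0 j * f (delta_mx 0 i) (delta_mx 0 j).
Proof.
move=> fl fr u v; rewrite (@linear_sum (fun u => f u v)) //; apply: eq_bigr => i _.
rewrite (@linear_sum (fun v => f (delta_mx 0 i) v)) // mulr_sumr; apply: eq_bigr => j _.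
by rewrite mulrA.
Qed.

Variables (g : 'M[R]_d) (E : 'M[R]_d).
Hypotheses (gT : g^T = g) (pg : posdef g) (EE : E^T *m E = invmx g).

(** [EE] says that the rows of [E] are [g]-orthonormal, in the form of an expansion of the inverse
    metric, which is what a trace contracts with. *)
Lemma frame_trace (f : 'rV[R]_d -> 'rV[R]_d -> R) :
  (forall a u u' v, f (a *: u + u') v = a * f u v + f u' v) ->
  (forall a u v v', f u (a *: v + v') = a * f u v + f u v') ->
  \sum_a f (row a E) (row a E) = \sum_i \sum_j invmx g i j * f (delta_mx 0 i) (delta_mx 0 j).
Proof.
move=> fl fr; under eq_bigr do rewrite (bilinear_sum fl fr).
rewrite exchange_big; apply: eq_bigr => i _ /=; rewrite exchange_big; apply: eq_bigr => j _ /=.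
rewrite -EE mxE mulr_suml; apply: eq_bigr => a _.
by rewrite !mxE.
Qed.

Lemma frame_row w a : inner g (row a E) w = (E *m g *m w^T) a 0.
Proof. by rewrite /inner -!row_mul mxE. Qed.

Lemma frame_sum u v : \sum_a inner g (row a E) u * inner g (row a E) v = inner g u v.
Proof.
have ug := posdef_unit pg.
transitivity (((E *m g *m u^T)^T *m (E *m g *m v^T)) 0 0).
  by rewrite mxE; apply: eq_bigr => a _; rewrite !frame_row [X in _ = X * _]mxE.
by rewrite !trmx_mul trmxK gT !mulmxA -(mulmxA (u *m g)) EE mulmxK.
Qed.

Lemma frame_norm : \sum_a inner g (row a E) (row a E) = d%:R.
Proof.
have ug := posdef_unit pg.
have H a : inner g (row a E) (row a E) = (E *m g *m E^T) a a.
  rewrite frame_row [LHS]mxE [RHS]mxE; apply: eq_bigr => k _.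
  by rewrite !mxE.
rewrite (eq_bigr _ (fun a _ => H a)) -/(\tr (E *m g *m E^T)) mxtrace_mulC mulmxA EE mulVmx//.
by rewrite mxtrace1.
Qed.

Lemma frame_expand w : w = \sum_a inner g (row a E) w *: row a E.
Proof.
have ug := posdef_unit pg.
have -> : \sum_a inner g (row a E) w *: row a E = (E *m g *m w^T)^T *m E.
  apply/rowP => k; rewrite summxE [RHS]mxE; apply: eq_bigr => a _.
  by rewrite frame_row !mxE.
by rewrite !trmx_mul trmxK gT mulmxA -!mulmxA EE !mulmxA mulmxK.
Qed.

Lemma frame_wedge w : \sum_a wedge2 g w (row a E) = (d%:R - 1) * inner g w w.
Proof.
rewrite /wedge2 sumrB -mulr_sumr frame_norm mulrBl mulrC; congr (_ - _); rewrite mul1r -frame_sum.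
by apply: eq_bigr => a _; rewrite (innerC w _ gT) expr2.
Qed.

End Orthonormal.

(** Lagrange's identity: twice the difference of the two sides is the sum over [a], [b] of the
    squared lengths of [c a *: x b - c b *: x a]. *)
Lemma inner_sum_CS (R : realType) d k (A : 'M[R]_d) (c : 'I_k -> R) (x : 'I_k -> 'rV[R]_d) :
  A^T = A -> posdef A ->
  inner A (\sum_b c b *: x b) (\sum_b c b *: x b) <= (\sum_b c b ^+ 2) * (\sum_b inner A (x b) (x b)).
Proof.
move=> AT pA.
have S1 : inner A (\sum_b c b *: x b) (\sum_b c b *: x b) =
    \sum_a \sum_b c a * c b * inner A (x a) (x b).
  rewrite inner_suml; apply: eq_bigr => a _; rewrite inner_sumr; apply: eq_bigr => b _.
  by rewrite innerZl innerZr mulrA.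
have S2 : (\sum_b c b ^+ 2) * (\sum_b inner A (x b) (x b)) =
    \sum_a \sum_b c a ^+ 2 * inner A (x b) (x b).
  by rewrite mulr_suml; apply: eq_bigr => a _; rewrite mulr_sumr.
have S3 : 0 <= \sum_a \sum_b inner A (c a *: x b - c b *: x a) (c a *: x b - c b *: x a).
  by apply: sumr_ge0 => a _; apply: sumr_ge0 => b _; exact: posdef_ge0.
have S4 : \sum_a \sum_b inner A (c a *: x b - c b *: x a) (c a *: x b - c b *: x a) =
   \sum_a \sum_b c a ^+ 2 * inner A (x b) (x b) + \sum_a \sum_b c b ^+ 2 * inner A (x a) (x a)
   - 2 * \sum_a \sum_b c a * c b * inner A (x a) (x b).
  transitivity (\sum_a \sum_b (c a ^+ 2 * inner A (x b) (x b) + c b ^+ 2 * inner A (x a) (x a)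
      - 2 * (c a * c b * inner A (x a) (x b)))).
    apply: eq_bigr => a _; apply: eq_bigr => b _.
    rewrite !(innerBl, innerBr, innerZl, innerZr) (innerC (x b) (x a) AT); ring.
  under eq_bigr do rewrite sumrB big_split /=.
  rewrite sumrB big_split /= mulr_sumr; congr (_ - _); apply: eq_bigr => a _.
  by rewrite mulr_sumr.
move: S3; rewrite S4 [X in _ + X - _]exchange_big /= -S1 -S2; lra.
Qed.

Section Potential.
Context {R : realType}.
Variables (I : set R) (h : R -> R) (t0 : R).
Hypotheses (oI : open I) (itvI : is_interval I) (h_smooth : smooth1_on I h) (It0 : I t0).

Lemma derive1n_eq_on (f f' : R -> R) : (forall t, I t -> f t = f' t) ->
  forall k t, I t -> derive1n k f t = derive1n k f' t.
Proof.
move=> ff; elim=> [|k IH] t It; first by rewrite !derive1n0 ff.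
rewrite !derive1nS !derive1E; apply: near_eq_derive.
have : \forall s \near t, I s by apply: open_nbhs_nbhs.
by apply: filterS => s Is; exact: IH.
Qed.

Lemma smooth1_cont t : I t -> {for t, continuous h}.
Proof.
move=> It; apply: differentiable_continuous; apply/derivable1_diffP.
by have := @h_smooth 0%N t It; rewrite derive1n0.
Qed.

Lemma oriented_integral_der t : I t -> is_derive t 1 (oriented_integral h t0) (h t).
Proof.
move=> It.
have open_le x : I x -> exists2 r : R, 0 < r & I (x - r) /\ I (x + r).
  move=> Ix; have : \forall s \near x, I s by apply: open_nbhs_nbhs.
  move=> /nbhs_ballP[r /= r0 br]; exists (r / 2); first by rewrite divr_gt0.
  have e1 : x - (x - r / 2) = r / 2 by ring.
  have e2 : x - (x + r / 2) = - (r / 2) by ring.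
  have r2 : `|r / 2| < r by rewrite gtr0_norm ?divr_gt0//; lra.
  by split; apply: br; rewrite /ball /= ?e1 ?e2 ?normrN.
have [r1 r10 [l1 u1]] := open_le _ It; have [r2 r20 [l2 u2]] := open_le _ It0.
(* A segment inside [I] with both [t] and [t0] in its interior: on it one primitive [H] serves both
   branches of [oriented_integral], and no one-sided derivative occurs at [t0]. *)
pose a := Num.min (t - r1) (t0 - r2); pose b := Num.max (t + r1) (t0 + r2).
have Ia : I a by rewrite /a minElt; case: ifP.
have Ib : I b by rewrite /b maxElt; case: ifP.
have at' : a < t by rewrite gt_min ltrBlDr ltrDl r10.
have at0 : a < t0 by rewrite gt_min !ltrBlDr !ltrDl r20 orbT.
have tb : t < b by rewrite lt_max ltrDl r10.
have t0b : t0 < b by rewrite lt_max !ltrDl r20 orbT.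
have ab : a < b by exact: lt_trans at' tb.
have Iab x : a <= x <= b -> I x by move=> xab; have H := itvI; move: H; rewrite /is_interval => H; apply: H xab.
have If : lebesgue_measure.-integrable `[a, b] (EFin \o h).
  apply: continuous_compact_integrable; first exact: segment_compact.
  by apply: continuous_in_subspaceT => x /set_mem; rewrite /= in_itv /= => /Iab/smooth1_cont.
have [d1 d2] := continuous_FTC1_closed tb If at' (smooth1_cont It).
set H := fun x => _ in d1 d2.
have sub x y : a <= x -> x <= y -> y <= b -> H y - H x = \int[lebesgue_measure]_(s in `[x, y]) h s.
  move=> ax xy yb; rewrite /H Rintegral_itvB ?bnd_simp//; last first.
    apply: (integrableS _ _ _ If) => //; apply: subset_itvl; rewrite bnd_simp//.
  apply: Rintegral_itv_obnd_cbnd.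
  apply: (integrableS _ _ _ If) => //.
  by move=> z /=; rewrite !in_itv /= => /andP[/ltW xz zy]; rewrite (le_trans ax xz) (le_trans zy yb).
have E : \forall x \near t, H x - H t0 = oriented_integral h t0 x.
  have : \forall x \near t, x \in `]a, b[ by apply: near_in_itvoo; rewrite in_itv /= at' tb.
  apply: filterS => x; rewrite in_itv /= => /andP[ax xb]; rewrite /oriented_integral.
  case: ifPn => [t0x|]; first by rewrite sub// ltW.
  by rewrite -ltNge => /ltW xt0; rewrite -sub ?opprB// ltW.
apply: (der_near E); apply: (der_eq (der_sub _ (der_cst _ _ (H t0)))); last exact: subr0.
by rewrite -d2 derive1E; exact: derivableP.
Qed.

Lemma oriented_integral_smooth : smooth1_on I (oriented_integral h t0).
Proof.
case=> [|k] t It; first by rewrite derive1n0; have [] := oriented_integral_der It.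
have H s : I s -> derive1n k.+1 (oriented_integral h t0) s = derive1n k h s.
  move=> Is; rewrite derive1Sn; apply: derive1n_eq_on => // r Ir.
  by rewrite derive1E (der_val (oriented_integral_der Ir)).
have dk : is_derive t 1 (derive1n k h) (derive1n k.+1 h t).
  by rewrite derive1nS derive1E; apply: derivableP; exact: h_smooth.
suff D : is_derive t 1 (derive1n k.+1 (oriented_integral h t0)) (derive1n k.+1 h t) by case: D.
apply: der_near dk; have : \forall s \near t, I s by apply: open_nbhs_nbhs.
by apply: filterS => s Is; rewrite H.
Qed.

End Potential.

Lemma Ck_on_local (R : realType) d k (U : set 'rV[R]_d) f :
  (forall y, U y -> exists V, V y /\ Ck_on k V f) -> Ck_on k U f.
Proof.
elim: k f => [|k IH] f H.
  by split => // y /H[V [Vy [cf _]]]; exact: cf.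
split; first by move=> y /H[V [Vy [cf _]]]; exact: cf.
move=> i; split; first by move=> y /H[V [Vy [_ /(_ i)[df _]]]]; exact: df.
by apply: IH => y /H[V [Vy [_ /(_ i)[_ Cf]]]]; exists V.
Qed.

Lemma Ck_on_subset (R : realType) d k (V U : set 'rV[R]_d) f : U `<=` V -> Ck_on k V f -> Ck_on k U f.
Proof.
move=> UV; elim: k f => [|k IH] f [cf H]; first by split => // y /UV; exact: cf.
split; first by move=> y /UV; exact: cf.
by move=> i; have [df Cf] := H i; split; [move=> y /UV; exact: df|exact: IH].
Qed.

(** * The soliton in charts *)

Section WarpedImmersion.
Context {R : realType} {m n : nat}.
Variables (I : set R) (h : R -> R).
Hypotheses (oI : open I) (h_gt0 : forall t, I t -> 0 < h t) (h_smooth : smooth1_on I h).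
Variables (P : riemannian_manifold R n) (M : riemannian_manifold R m).
Variable psi : M -> warped_product I h P.
Hypothesis psi_I : forall x : M, I (psi x).1.
Hypothesis psi_iso : isometric_immersion psi.
Implicit Types (i : mg_index M) (j : mg_index P).

Let N := warped_product I h P.

Definition imm_dom i j : set 'rV[R]_m :=
  [set z | mg_image i z /\ mg_dom j (psi (mg_inv i z)).2].

Lemma imm_domE i j : mg_map i @` (mg_dom i `&` psi @^-1` @mg_dom R n.+1 N j) = imm_dom i j.
Proof.
apply/seteqP; split => z /=.
  by move=> [x [ix [_ jx]] <-]; split; [exact: image_map|rewrite inv_map].
by move=> [iz jz]; exists (mg_inv i z); [split; [exact: dom_inv|split]|exact: map_inv].
Qed.

Lemma imm_dom_open i j : open (imm_dom i j).
Proof.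
rewrite openE => z [iz jz].
have n1 := near_image iz.
have c2 : {for z, continuous (fun z => (psi (mg_inv i z)).2)}.
  apply: (@continuous_comp _ _ _ (mg_inv i) (fun x => (psi x).2)); first exact: inv_cont.
  apply: (@continuous_comp _ _ _ psi snd); first by have [[+ _] _] := psi_iso; apply.
  exact: cvg_snd.
have n2 : \forall w \near z, mg_dom j (psi (mg_inv i w)).2.
  by apply: c2; exact: near_dom.
by apply: filterS2 n1 n2 => w; split.
Qed.

Definition immF i j : 'rV[R]_m -> 'rV[R]_(1 + n) := @in_charts R m n.+1 M N psi i j.
Definition immt i (z : 'rV[R]_m) : R := (psi (mg_inv i z)).1.
Definition immp i j (z : 'rV[R]_m) : 'rV[R]_n := mg_map j (psi (mg_inv i z)).2.

Lemma immFE i j z : immF i j z = tp (immt i z) (immp i j z).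
Proof. by []. Qed.

Lemma immF_smooth i j k a : Ck_on k (imm_dom i j) (fun z => immF i j z 0 a).
Proof. by rewrite -imm_domE; exact: (psi_iso.1.2 i j a k). Qed.

Lemma immF_dom i j z : imm_dom i j z -> VN I (mg_image j) (immF i j z).
Proof.
move=> [iz jz]; rewrite /VN immFE; split; rewrite /= ?ht_tp ?hp_tp; [exact: psi_I|exact: image_map].
Qed.

Lemma immtE i j : (fun z => immF i j z 0 (lshift n 0)) = immt i.
Proof. by apply/funext => z; rewrite -htE immFE ht_tp. Qed.

Lemma immpE i j a : (fun z => immF i j z 0 (rshift 1 a)) = (fun z => immp i j z 0 a).
Proof. by apply/funext => z; rewrite -hpE immFE hp_tp. Qed.

Lemma immt_smooth i j k : Ck_on k (imm_dom i j) (immt i).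
Proof. by rewrite -(immtE i j); exact: immF_smooth. Qed.

Lemma immp_smooth i j k a : Ck_on k (imm_dom i j) (fun z => immp i j z 0 a).
Proof. by rewrite -(immpE i j a); exact: immF_smooth. Qed.

Lemma ht_immF i j z u : ht (d1v (immF i j) z u) = d1 (immt i) z u.
Proof. by rewrite htE mxE immtE. Qed.

Lemma hp_immF i j z u : hp (d1v (immF i j) z u) = d1v (immp i j) z u.
Proof. by apply/rowP => a; rewrite hpE [LHS]mxE [RHS]mxE immpE. Qed.

(** [isometric_immersion] gives the metric identity at each point only in the preferred charts of
    that point. To be differentiated it is needed in fixed charts on an open set. The chart changes
    [T] of [M] and [S] of [P] transfer it, the coordinate [t] being common to all charts. *)
Lemma immF_iso i j z u v : imm_dom i j z -> inner (mg_metric i z) u v =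
  inner (GN h (mg_metric j) (immF i j z)) (d1v (immF i j) z u) (d1v (immF i j) z v).
Proof.
move=> zU; have [iz jz] := zU.
set x := mg_inv i z; set i' := mg_at x; set j' := mg_at (psi x).2.
pose T : 'rV[R]_m -> 'rV[R]_m := chart_change i i'.
pose S : 'rV[R]_n -> 'rV[R]_n := chart_change j' j.
pose W := imm_dom i j `&` (imm_dom i j' `&` overlap i i').
have oW : open W by apply: openI; [|apply: openI]; [exact: imm_dom_open|exact: imm_dom_open|exact: overlap_open].
have oD' : open (imm_dom i' j') by exact: imm_dom_open.
have i'x : mg_dom i' x by exact: at_dom.
have j'x : mg_dom j' (psi x).2 by exact: at_dom.
have Wz : W z by split => //; split; [split|apply/overlapP].
have invT w : W w -> mg_inv i' (T w) = mg_inv i w by move=> [_ [_ ov]]; exact: change_inv.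
have WT w : W w -> imm_dom i' j' (T w).
  by move=> Ww; have [_ [[_ j'w] ov]] := Ww; split; [exact: change_image|rewrite invT].
have CT k a : Ck_on k W (fun w => T w 0 a).
  apply: (@Ck_on_subset _ _ k (overlap i i')); last exact: change_smooth.
  by move=> w [_ []].
have dt u' : d1 (immt i) z u' = d1 (immt i') (T z) (d1v T z u').
  rewrite -(d1_comp oW oD' WT CT _ (immt_smooth i' j' 1) Wz).
  by apply: (d1_eq_on _ oW) => // w Ww; rewrite /immt invT.
have oO : open (overlap j' j) by exact: overlap_open.
have PO w : W w -> overlap j' j (immp i' j' (T w)).
  move=> Ww; have [[_ jw] [[_ j'w] ov]] := Ww; rewrite /immp invT//; exact: overlap_map.
have Cp k a : Ck_on k W (fun w => immp i' j' (T w) 0 a).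
  by apply: (Ck_on_comp oW oD' WT (immp_smooth i' j' k a)) => b; exact: CT.
have CS k a : Ck_on k (overlap j' j) (fun w => S w 0 a) by exact: change_smooth.
have dp u' : d1v (immp i j) z u' = d1v S (immp i' j' (T z)) (d1v (immp i' j') (T z) (d1v T z u')).
  rewrite -(d1v_comp oW oD' WT CT (immp_smooth i' j') _ Wz).
  rewrite -(d1v_comp oW oO PO Cp CS _ Wz).
  apply: (d1v_eq_on _ oW) => // w Ww; have [_ [[_ j'w] _]] := Ww.
  by rewrite /immp invT// /S change_map.
have Tz : imm_dom i' j' (T z) by exact: WT.
have iso := (psi_iso.2 x).2.
have iso' u' v' : inner (mg_metric i' (T z)) u' v' =
  inner (GN h (mg_metric j') (immF i' j' (T z))) (d1v (immF i' j') (T z) u') (d1v (immF i' j') (T z) v').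
  rewrite !(d1v_jacobian oD' (immF_smooth i' j'))// -inner_pullback.
  by congr (inner _ _ _); exact: iso.
have Tov : overlap i i' z by case: Wz => _ [].
rewrite (change_inner _ _ Tov) -!(d1v_jacobian (overlap_open (i := i) (j := i')) (fun k a => change_smooth i i' a k))//.
rewrite iso' !inner_GN !immFE !ht_tp !hp_tp !ht_immF !hp_immF -!dt.
have -> : immt i' (T z) = immt i z by rewrite /immt invT.
congr (_ + _ * _); rewrite !dp.
have Pov := PO z Wz.
rewrite (change_inner _ _ Pov) -!(d1v_jacobian oO CS)//.
have -> : chart_change j' j (immp i' j' (T z)) = immp i j z by rewrite /immp invT// change_map.
by [].
Qed.

Variables (c kappa : R).
Hypothesis P_curv : constant_sectional_curvature P kappa.
Hypothesis psi_soliton : mcf_soliton (@warped_field R n I h P) c psi.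

Section AtPoint.
Variable x : M.
Let i := mg_at x.
Let j := mg_at (psi x).2.
Let y := mg_map i x.
Let F := immF i j.
Let g := mg_metric i.
Let G := GN h (mg_metric j).
Let B := Bff F g G.
Let gy := g y.

Lemma imm_dom_at : imm_dom i j y.
Proof.
split; first by apply: image_map; exact: at_dom.
by rewrite inv_map; exact: at_dom.
Qed.

Lemma immF_at : immF i j y = tp (psi x).1 (mg_map j (psi x).2).
Proof. by rewrite immFE /immt /immp inv_map//; exact: at_dom. Qed.

Let oU : open (imm_dom i j). Proof. exact: imm_dom_open. Qed.
Let oV : open (VN I (mg_image j)). Proof. by apply: VN_open => //; exact: image_open. Qed.
Let UV := @immF_dom i j.
Let CF := @immF_smooth i j.
Let Cg k a b : Ck_on k (imm_dom i j) (fun z => g z a b).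
Proof. by apply: (@Ck_on_subset _ _ k (mg_image i)); [move=> w []|exact: metric_smooth]. Qed.
Let symg z : imm_dom i j z -> (g z)^T = g z.
Proof. by move=> [iz _]; exact: metric_sym. Qed.
Let posg z : imm_dom i j z -> posdef (g z).
Proof. by move=> [iz _]; exact: metric_pos. Qed.
Let oP : open (mg_image j). Proof. exact: image_open. Qed.
Let CP k a b : Ck_on k (mg_image j) (fun z => mg_metric j z a b).
Proof. exact: metric_smooth. Qed.
Let symP z : mg_image j z -> (mg_metric j z)^T = mg_metric j z.
Proof. exact: metric_sym. Qed.
Let posP z : mg_image j z -> posdef (mg_metric j z).
Proof. exact: metric_pos. Qed.
Let CG k a b : Ck_on k (VN I (mg_image j)) (fun z => G z a b).
Proof. exact: GN_smooth. Qed.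
Let symG z : VN I (mg_image j) z -> (G z)^T = G z.
Proof. exact: GN_sym. Qed.
Let posG z : VN I (mg_image j) z -> posdef (G z).
Proof. exact: GN_pos. Qed.
Let iso z (zU : imm_dom i j z) u v := @immF_iso i j z u v zU.
Let Uy := imm_dom_at.
Let Vy := UV Uy.
Let GA := G (F y).

Lemma BffDl a u u' v : B y (a *: u + u') v = a *: B y u v + B y u' v.
Proof.
rewrite /B /Bff /Sff; have -> : d2v F y (a *: u + u') v = a *: d2v F y u v + d2v F y u' v.
  by apply/rowP => k; rewrite !mxE /d2 innerDl innerZl.
rewrite d1vD d1vZ GamDl GamZl GamDl GamZl d1vD d1vZ.
by apply/rowP => k; rewrite !mxE; ring.
Qed.

Lemma BffC u v : B y u v = B y v u.
Proof. by rewrite /B /Bff (SffC oU oV UV CF symG)// (GamC oU symg). Qed.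

Lemma BffDr a u v v' : B y u (a *: v + v') = a *: B y u v + B y u v'.
Proof. by rewrite BffC BffDl !(BffC _ u). Qed.

Lemma cov_derivE k l : @cov_deriv R m n.+1 (in_charts_at psi x) (mg_metric (mg_at (psi x))) k l y
  = Sff F G y (delta_mx 0 k) (delta_mx 0 l).
Proof.
apply/rowP => a; rewrite [LHS]mxE [RHS]mxE; congr (_ + _).
  by rewrite [RHS]mxE d2_delta.
rewrite [RHS]mxE innerE; apply: eq_bigr => b _; apply: eq_bigr => b' _.
rewrite !(d1v_jacobian oU CF)// -!rowE !mxE; rewrite -/(jacobian _ _); ring.
Qed.

Lemma normal_partE v : @normal_part R m n.+1 GA (jacobian F y) v =
  v - d1v F y (v *m GA *m (jacobian F y)^T *m invmx gy).
Proof.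
rewrite /normal_part (d1v_jacobian oU CF)//; congr (_ - _ *m _ *m _); congr invmx.
apply/matrixP => a b; rewrite -(inner_delta _ a b) -[RHS]inner_delta inner_pullback.
by rewrite [RHS](iso Uy) !(d1v_jacobian oU CF).
Qed.

(** [normal_part] subtracts a projection written with matrices, [Bff] the tangential part of the
    Gauss formula; [gauss] identifies the coefficients of the projection. *)
Lemma second_ff_atE k l : second_ff_at psi x k l = B y (delta_mx 0 k) (delta_mx 0 l).
Proof.
rewrite /second_ff_at /second_ff cov_derivE [LHS]normal_partE; congr (_ - d1v _ _ _).
have ug := posdef_unit (posg Uy).
suff -> : Sff F G y (delta_mx 0 k) (delta_mx 0 l) *m GA *m (jacobian F y)^T =
    Gam g y (delta_mx 0 k) (delta_mx 0 l) *m gy by rewrite mulmxK.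
apply/rowP => a; have H := gauss oU oV UV CF Cg symg posg CG symG posG iso (delta_mx 0 k) (delta_mx 0 l) (delta_mx 0 a) Uy.
move: H; rewrite (d1v_jacobian oU CF)// /inner trmx_mul !mulmxA trmx_delta -!colE !mxE => ->.
by [].
Qed.

Variable E : 'M[R]_m.
Hypothesis EE : E^T *m E = invmx gy.
Let e a := row a E.
Let gT : gy^T = gy. Proof. exact: symg. Qed.
Let pgy : posdef gy. Proof. exact: posg. Qed.

Lemma sqnorm_frame : second_ff_sqnorm psi x = \sum_a \sum_b inner GA (B y (e a) (e b)) (B y (e a) (e b)).
Proof.
rewrite exchange_big /=.
have H1 b : \sum_a inner GA (B y (e a) (e b)) (B y (e a) (e b)) =
   \sum_k \sum_l invmx gy k l * inner GA (B y (delta_mx 0 k) (e b)) (B y (delta_mx 0 l) (e b)).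
  apply: (frame_trace EE (f := fun u v => inner GA (B y u (e b)) (B y v (e b)))) => a u u' v.
    by rewrite BffDl innerDl innerZl.
  by rewrite BffDl innerDr innerZr.
rewrite (eq_bigr _ (fun b _ => H1 b)) exchange_big; apply: eq_bigr => k _ /=.
transitivity (\sum_l \sum_b invmx gy k l * inner GA (B y (delta_mx 0 k) (e b)) (B y (delta_mx 0 l) (e b))); last by rewrite exchange_big.
rewrite exchange_big /=; apply: eq_bigr => l _; rewrite -mulr_sumr.
have H2 : \sum_b inner GA (B y (delta_mx 0 k) (e b)) (B y (delta_mx 0 l) (e b)) =
   \sum_p \sum_q invmx gy p q * inner GA (B y (delta_mx 0 k) (delta_mx 0 p)) (B y (delta_mx 0 l) (delta_mx 0 q)).
  apply: (frame_trace EE (f := fun u v => inner GA (B y (delta_mx 0 k) u) (B y (delta_mx 0 l) v))) => a u u' v.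
    by rewrite BffDr innerDl innerZl.
  by rewrite BffDr innerDr innerZr.
rewrite H2 mulr_sumr; apply: eq_bigr => p _; rewrite mulr_sumr; apply: eq_bigr => q _.
by rewrite mulrA !second_ff_atE /GA /F immF_at.
Qed.

Lemma soliton_frame : \sum_a B y (e a) (e a) =
  c *: (tp (h (psi x).1) 0 - d1v F y (tp (h (psi x).1) 0 *m GA *m (jacobian F y)^T *m invmx gy)).
Proof.
have := psi_soliton.2 x; rewrite /mean_curvature -normal_partE => S.
transitivity (mean_curvature psi x); last by rewrite /mean_curvature -S /GA /F immF_at.
apply/rowP => k; rewrite !summxE.
rewrite (frame_trace EE (f := fun u v => B y u v 0 k)); last 2 first.
- by move=> a u u' v; rewrite BffDl !mxE.
- by move=> a u v v'; rewrite BffDr !mxE.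
apply: eq_bigr => a _; rewrite summxE; apply: eq_bigr => b _.
by rewrite [RHS]mxE second_ff_atE.
Qed.

Lemma Bff_suml k (a : 'I_k -> R) (u : 'I_k -> 'rV[R]_m) v :
  B y (\sum_b a b *: u b) v = \sum_b a b *: B y (u b) v.
Proof.
have B0 : B y 0 v = 0.
  by have := BffDl (-1) 0 0 v; rewrite scaler0 addr0 scaleN1r addNr.
have BD p q : B y (p + q) v = B y p v + B y q v by rewrite -[p]scale1r BffDl !scale1r.
rewrite (big_morph (fun u => B y u v) BD B0); apply: eq_bigr => b _.
by rewrite -[_ *: u b]addr0 BffDl B0 addr0.
Qed.

(** Expand [w] in the frame and apply Cauchy-Schwarz. This is the source of [|II|^2] in the
    hypothesis. *)
Lemma sum_Bff_le w : \sum_a inner GA (B y w (e a)) (B y w (e a)) <=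
  second_ff_sqnorm psi x * inner gy w w.
Proof.
rewrite sqnorm_frame exchange_big /= mulr_suml; apply: ler_sum => a _.
have {1 2}-> : w = \sum_b inner gy (e b) w *: e b by exact: frame_expand.
rewrite Bff_suml; have := inner_sum_CS (fun b => inner gy (e b) w) (fun b => B y (e b) (e a)) (symG Vy) (posG Vy).
move=> /le_trans; apply; rewrite mulrC ler_wpM2l//.
  by apply: sumr_ge0 => b _; apply: posdef_ge0; exact: posG.
by rewrite -(frame_sum gT pgy EE w w); apply: ler_sum => b _; rewrite expr2.
Qed.

Let tx := (psi x).1.
Let Itx : I tx. Proof. exact: psi_I. Qed.
Let htF : ht (F y) = tx. Proof. by rewrite /F immF_at ht_tp. Qed.

(** The squared area of a tangent plane splits into a mixed and a fibre part, both nonnegative, with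
    curvature factors [k1] and [k2]: the two terms of the minimum. *)
Lemma curvature_N_ge w v : warped_curvature_bound h kappa tx * wedge2 gy w v <=
  inner GA (curvature G (F y) (d1v F y w) (d1v F y v) (d1v F y v)) (d1v F y w).
Proof.
have -> : wedge2 gy w v = wedge2 GA (d1v F y w) (d1v F y v) by rewrite /wedge2 !(iso Uy).
move: (d1v F y w) (d1v F y v) => w' v'.
rewrite /GA /G (curvature_GN oI h_gt0 h_smooth oP CP symP posP _ _ Vy) htF.
have jP : mg_image j (hp (F y)) by have [] := Vy.
rewrite (constant_curvature symP posP (kappa := kappa) _ _ jP); last first.
  move=> p q pq; rewrite /F immF_at hp_tp; exact: P_curv.
rewrite [X in _ * X](_ : _ = h tx ^+ 2 * inner (mg_metric j (hp (F y))) (ht w' *: hp v' - ht v' *: hp w') (ht w' *: hp v' - ht v' *: hp w')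
   + h tx ^+ 4 * wedge2 (mg_metric j (hp (F y))) (hp w') (hp v')); last first.
  rewrite /wedge2 !inner_GN htF !(innerBl, innerBr, innerZl, innerZr).
  rewrite (innerC (hp v') (hp w') (symP jP)); ring.
set A := inner _ _ _; set W := wedge2 _ _ _.
have hx := h_gt0 Itx.
have A0 : 0 <= h tx ^+ 2 * A by rewrite mulr_ge0 ?exprn_ge0 ?(ltW hx)//; apply: posdef_ge0; exact: posP.
have W0 : 0 <= h tx ^+ 4 * W.
  by rewrite mulr_ge0 ?exprn_ge0 ?(ltW hx)// subr_ge0; apply: posdef_CS; [exact: symP|exact: posP].
rewrite /warped_curvature_bound mulrDr.
set k1 := - _; set k2 := _ - _.
have l1 : Num.min k1 k2 * (h tx ^+ 2 * A) <= k1 * (h tx ^+ 2 * A) by rewrite ler_wpM2r// ge_min lexx.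
have l2 : Num.min k1 k2 * (h tx ^+ 4 * W) <= k2 * (h tx ^+ 4 * W) by rewrite ler_wpM2r// ge_min lexx orbT.
apply: le_trans (lerD l1 l2) _; rewrite le_eqVlt; apply/orP; left; apply/eqP.
have hn : h tx != 0 by rewrite gt_eqF.
by rewrite /k1 /k2; field.
Qed.

Variables (t0 : R).
Hypotheses (itvI : is_interval I) (It0 : I t0).
Let eta1 := oriented_integral h t0.
Let f z := eta1 (immt i z).

Lemma potential_smooth k i' : Ck_on k (mg_image i') (fun z => eta1 (immt i' z)).
Proof.
apply: Ck_on_local => z iz; exists (imm_dom i' (mg_at (psi (mg_inv i' z)).2)).
have oD := @imm_dom_open i' (mg_at (psi (mg_inv i' z)).2).
split; first by split => //; exact: at_dom.
have S := oriented_integral_smooth oI itvI h_smooth It0.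
have := @Ck_on_comp1 _ _ k 0 _ I eta1 (immt i') oD S _ (immt_smooth _ _ k).
by rewrite derive1n0; apply=> w _; exact: psi_I.
Qed.

Lemma potential_d1 z u : imm_dom i j z -> d1 f z u = h (immt i z) * d1 (immt i) z u.
Proof.
move=> zU; have L := mder_line z u (0 : R).
have zU0 : imm_dom i j (z + (0 : R) *: u) by rewrite scale0r addr0.
have Cf : Ck_on 1 (imm_dom i j) f.
  by apply: (@Ck_on_subset _ _ 1 (mg_image i)); [move=> w []|exact: potential_smooth].
have h1 := @f_chain _ _ _ (imm_dom i j) f (fun r : R => z + r *: u) 0 1 u oU Cf zU0 L.
have ht' := @f_chain _ _ _ (imm_dom i j) (immt i) (fun r : R => z + r *: u) 0 1 u oU (immt_smooth i j 1) zU0 L.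
have It : I (immt i (z + (0 : R) *: u)) by exact: psi_I.
have h2 := der_compR ht' (oriented_integral_der oI itvI h_smooth It0 It).
by have := der_val h1; rewrite (der_val h2) scale0r addr0.
Qed.

(** As [X = h d/dt], the last term is [<X, II(w, w)>]. The factor [h'] arises twice, from
    differentiating [h] along the curve and from the [t] component of [Gam_GN]; the [t] part and the
    fibre part of the metric so obtained add up to the whole metric. *)
Lemma potential_hess w : d2 f y w w - d1 f y (Gam g y w w) =
  derive1 h tx * inner gy w w + h tx * ht (B y w w).
Proof.
have Uy0 : imm_dom i j (y + (0 : R) *: w) by rewrite scale0r addr0.
have L := mder_line y w (0 : R).
have Cf : Ck_on 2 (imm_dom i j) f.
  by apply: (@Ck_on_subset _ _ 2 (mg_image i)); [move=> z []|exact: potential_smooth].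
have h1 := @d1_der _ _ _ (imm_dom i j) f (fun r : R => y + r *: w) (fun=> w) 0 1 w 0 oU Cf Uy0 L (mder_cst w (0 : R)).
have g1 := @f_chain _ _ _ (imm_dom i j) (immt i) (fun r : R => y + r *: w) 0 1 w oU (immt_smooth i j 1) Uy0 L.
have g2 := @d1_der _ _ _ (imm_dom i j) (immt i) (fun r : R => y + r *: w) (fun=> w) 0 1 w 0 oU (immt_smooth i j 2) Uy0 L (mder_cst w (0 : R)).
have It : I (immt i (y + (0 : R) *: w)) by exact: psi_I.
have h2 := der_mul (der_compR g1 (h_der h_smooth It)) g2.
have E' : \forall r \near (0 : R), d1 f (y + r *: w) w = h (immt i (y + r *: w)) * d1 (immt i) (y + r *: w) w.
  by apply: filterS (near_line w oU Uy) => r Ur; exact: potential_d1.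
have ty : immt i y = tx by rewrite /immt /y inv_map//; exact: at_dom.
have := near_eq_derive (1 : R) E'; rewrite (der_val h1) (der_val h2) !d10 scale0r (addr0 y) ty.
have aux (a b p q : R) : a + 0 = p + q * (b + 0) -> a = p + q * b by rewrite !addr0.
move=> /aux ->.
rewrite potential_d1// ty /B /Bff /Sff.
have -> : ht (d2v F y w w + Gam G (F y) (d1v F y w) (d1v F y w) - d1v F y (Gam g y w w)) =
  d2 (immt i) y w w + ht (Gam G (F y) (d1v F y w) (d1v F y w)) - d1 (immt i) y (Gam g y w w).
  by rewrite -(ht_immF i j) -/F !htE !mxE immtE.
rewrite (Gam_GN oI h_gt0 h_smooth oP CP symP posP _ _ Vy) ht_tp htF /gy (iso Uy) inner_GN htF ht_immF.
ring.
Qed.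

(** Sum the Gauss equation over the frame. By the soliton equation the mean curvature term is
    [c <X, II(w, w)>]; it cancels the normal part of the Hessian, which has no sign. *)
Lemma bakry_emery K w :
  second_ff_sqnorm psi x + c * derive1 h tx - (m%:R - 1) * warped_curvature_bound h kappa tx <= K ->
  c * (d2 f y w w - d1 f y (Gam g y w w)) - \sum_a inner gy (curvature g y w (e a) (e a)) w
    <= K * inner gy w w.
Proof.
move=> hK; rewrite potential_hess.
have ww : 0 <= inner gy w w by exact: posdef_ge0.
have G1 : \sum_a inner gy (curvature g y w (e a) (e a)) w =
  \sum_a inner GA (curvature G (F y) (d1v F y w) (d1v F y (e a)) (d1v F y (e a))) (d1v F y w)
  + \sum_a inner GA (B y (e a) (e a)) (B y w w) - \sum_a inner GA (B y w (e a)) (B y w (e a)).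
  rewrite -big_split -sumrB; apply: eq_bigr => a _.
  exact: (gauss_equation oU oV UV CF Cg symg posg CG symG posG iso).
have G2 : \sum_a inner GA (B y (e a) (e a)) (B y w w) = c * (h tx * ht (B y w w)).
  rewrite -inner_suml soliton_frame innerZl innerBl; congr (_ * _).
  rewrite (innerC (d1v _ _ _) _ (symG Vy)) (Bff_normal oU oV UV CF Cg symg posg CG symG posG iso)// subr0.
  by rewrite /GA inner_GN ht_tp hp_tp inner0l mulr0 addr0.
have G3 := sum_Bff_le w.
have G4 : warped_curvature_bound h kappa tx * ((m%:R - 1) * inner gy w w) <=
   \sum_a inner GA (curvature G (F y) (d1v F y w) (d1v F y (e a)) (d1v F y (e a))) (d1v F y w).
  rewrite -(frame_wedge gT pgy EE) mulr_sumr; apply: ler_sum => a _; exact: curvature_N_ge.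
have G5 := ler_wpM2r ww hK.
rewrite G1 G2; move: G3 G4 G5; set q := inner gy w w; nra.
Qed.

End AtPoint.

End WarpedImmersion.

(** * Second variation of a step *)

Section CvgTools.
Context {R : realType} {d : nat}.
Variables (T : Type) (F : set_system T).
Context {FF : Filter F}.

Lemma inner_cvg (G : T -> 'M[R]_d) (u v : T -> 'rV[R]_d) G0 u0 v0 :
  G @ F --> G0 -> u @ F --> u0 -> v @ F --> v0 ->
  (fun t => inner (G t) (u t) (v t)) @ F --> inner G0 u0 v0.
Proof.
move=> cG cu cv; under eq_fun do rewrite innerE; rewrite innerE.
apply: cvg_bigsum => i _; apply: cvg_bigsum => j _.
by apply: cvgM; [apply: cvgM|]; exact: cvg_coord.
Qed.

Variable U : set 'rV[R]_d.
Hypothesis oU : open U.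
Variables (y : T -> 'rV[R]_d) (y0 : 'rV[R]_d).
Hypotheses (Uy : U y0) (cy : y @ F --> y0).

Lemma Ck_cvg k f : Ck_on k U f -> (fun t => f (y t)) @ F --> f y0.
Proof. by move=> Cf; apply: (cvg_comp y f cy); exact: Ck_on_cont Cf Uy. Qed.

Lemma mx_cvg (a b : nat) (A : 'rV[R]_d -> 'M[R]_(a, b)) : (forall i j, Ck_on 0 U (fun z => A z i j)) ->
  (fun t => A (y t)) @ F --> A y0.
Proof. by move=> CA; apply: cvg_mx => i j; exact: (Ck_cvg (CA i j)). Qed.

Lemma d1_cvg f (w : T -> 'rV[R]_d) w0 : Ck_on 1 U f -> w @ F --> w0 ->
  (fun t => d1 f (y t) (w t)) @ F --> d1 f y0 w0.
Proof.
move=> [_ Cf] cw; apply: cvg_bigsum => k _; apply: cvgM; last exact: cvg_coord.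
by apply: (@Ck_cvg 0); have [] := Cf k.
Qed.

Lemma d1v_cvg e (f : 'rV[R]_d -> 'rV[R]_e) (w : T -> 'rV[R]_d) w0 :
  (forall a, Ck_on 1 U (fun z => f z 0 a)) -> w @ F --> w0 ->
  (fun t => d1v f (y t) (w t)) @ F --> d1v f y0 w0.
Proof.
move=> Cf cw; apply: cvg_mx => i a; rewrite mxE; under eq_fun do rewrite mxE.
exact: d1_cvg.
Qed.

Variable G : 'rV[R]_d -> 'M[R]_d.
Hypothesis CG : forall k i j, Ck_on k U (fun y => G y i j).
Hypothesis posG : forall y, U y -> posdef (G y).
Variables (u v w : T -> 'rV[R]_d) (u0 v0 w0 : 'rV[R]_d).
Hypotheses (cu : u @ F --> u0) (cv : v @ F --> v0) (cw : w @ F --> w0).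

Lemma Gam_cvg : (fun t => Gam G (y t) (u t) (v t)) @ F --> Gam G y0 u0 v0.
Proof.
apply: cvg_mx => i a; rewrite mxE; under eq_fun do rewrite mxE.
by apply: inner_cvg => //; apply: mx_cvg => k l; exact: chr_smooth.
Qed.

Lemma DGam_cvg : (fun t => DGam G (y t) (w t) (u t) (v t)) @ F --> DGam G y0 w0 u0 v0.
Proof.
apply: cvg_mx => i a; rewrite mxE; under eq_fun do rewrite mxE.
apply: inner_cvg => //; apply: cvg_mx => k l; rewrite mxE; under eq_fun do rewrite mxE.
by apply: d1_cvg => //; exact: chr_smooth.
Qed.

End CvgTools.

Section Variation.
Context {R : realType} {d : nat}.

Definition pol (a b c : 'rV[R]_d) (r : R) : 'rV[R]_d := a + r *: b + (r ^+ 2 / 2) *: c.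
Definition lin (b c : 'rV[R]_d) (r : R) : 'rV[R]_d := b + r *: c.

Lemma mder_lin b c (r : R) : mder (lin b c) r 1 c.
Proof. exact: mder_line. Qed.

Lemma mder_pol a b c (r : R) : mder (pol a b c) r 1 (lin b c r).
Proof.
move=> i j; rewrite /pol /lin !mxE; under eq_fun do rewrite !mxE.
have D2 : is_derive r 1 (fun r : R => r ^+ 2 / 2) r.
  have := der_mulc (2^-1) (der_mul (der_id r) (der_id r)).
  move=> D; apply: (der_near _ (der_eq D _)); last by rewrite mul1r mulr1; field.
  by apply: (@filterE _ (nbhs r)) => s; rewrite expr2 mulrC.
apply: (der_eq (der_add (der_add (der_cst _ _ _) (der_mul (der_id _) (der_cst _ _ _))) (der_mul D2 (der_cst _ _ _)))).
by rewrite mul1r !mulr0 !addr0 add0r.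
Qed.

Variables (U : set 'rV[R]_d) (g : 'rV[R]_d -> 'M[R]_d).
Hypothesis oU : open U.
Hypothesis Cg : forall k i j, Ck_on k U (fun y => g y i j).
Hypothesis symg : forall y, U y -> (g y)^T = g y.
Hypothesis posg : forall y, U y -> posdef (g y).

Section Family.
Variables (z v A w V1 DA : 'rV[R]_d).

(** [pol w V1 DA] is the variation field of the curves [pol z v A] when [z], [v], [A] vary by [w],
    [V1], [DA]. [fam_al] is its covariant derivative along the curve, [fam_al1] the coordinate
    derivative of [fam_al], [fam_q] the squared length of the field. *)
Definition fam_al (r : R) : 'rV[R]_d := lin V1 DA r + Gam g (pol z v A r) (lin v A r) (pol w V1 DA r).
Definition fam_al1 (r : R) : 'rV[R]_d := DA + (DGam g (pol z v A r) (lin v A r) (lin v A r) (pol w V1 DA r)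
  + Gam g (pol z v A r) A (pol w V1 DA r) + Gam g (pol z v A r) (lin v A r) (lin V1 DA r)).
Definition fam_q (r : R) := inner (g (pol z v A r)) (pol w V1 DA r) (pol w V1 DA r).
Definition fam_q1 (r : R) := 2 * inner (g (pol z v A r)) (fam_al r) (pol w V1 DA r).
Definition fam_q2 (r : R) := 2 * (inner (g (pol z v A r))
    (fam_al1 r + Gam g (pol z v A r) (lin v A r) (fam_al r)) (pol w V1 DA r)
  + inner (g (pol z v A r)) (fam_al r) (fam_al r)).

Lemma fam_q_der r : U (pol z v A r) -> is_derive r 1 fam_q (fam_q1 r).
Proof.
move=> Ur; have D := cov_der oU Cg symg posg Ur (mder_pol z v A r) (mder_pol w V1 DA r) (mder_pol w V1 DA r).
apply: (der_eq D); rewrite -/(fam_al r) (innerC _ (fam_al r) (symg Ur)) /fam_q1; ring.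
Qed.

Lemma fam_q1_der r : U (pol z v A r) -> is_derive r 1 fam_q1 (fam_q2 r).
Proof.
move=> Ur; have Da : mder fam_al r 1 (fam_al1 r).
  apply: mderD; first exact: mder_lin.
  exact: (Gam_der oU Cg posg Ur (mder_pol z v A r) (mder_lin v A r) (mder_pol w V1 DA r)).
exact: (der_mulc 2 (cov_der oU Cg symg posg Ur (mder_pol z v A r) Da (mder_pol w V1 DA r))).
Qed.

End Family.

Variable phi : 'rV[R]_d -> R.
Hypothesis Cphi : forall k, Ck_on k U phi.
Hypothesis d0 : (0 < d)%N.

(* [zeta] is the gradient of [phi] divided by the dimension, so that [d] steps
   with this acceleration add up to the drift. *)
Definition zeta z : 'rV[R]_d := d%:R^-1 *: ((\row_k partial k phi z) *m invmx (g z)).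

Lemma zeta_smooth k a : Ck_on k U (fun z => zeta z 0 a).
Proof.
apply: (@Ck_on_ext _ _ k U (fun z => d%:R^-1 * \sum_l partial l phi z * invmx (g z) l a) _ oU).
  by move=> z _; rewrite !mxE; congr (_ * _); apply: eq_bigr => l _; rewrite mxE.
apply: Ck_on_mulc => //; apply: Ck_on_sum => // l _; apply: Ck_on_mul => //.
  by have [_ /(_ l)[]] := Cphi k.+1.
by apply: Ck_on_invmx => // y Uy; apply: posdef_unit; exact: posg.
Qed.

Lemma zeta_inner z u : U z -> d%:R * inner (g z) (zeta z) u = d1 phi z u.
Proof.
move=> Uz; have dn : (d%:R : R) != 0 by rewrite pnatr_eq0 -lt0n.
rewrite /zeta innerZl mulrA divff// mul1r /inner mulmxKV ?mxE; last exact: posdef_unit (posg Uz).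
by apply: eq_bigr => k _; rewrite !mxE.
Qed.

(** Derivative of [zeta_inner] in the direction [w]: the covariant derivative of [zeta] is the
    Hessian of [phi] divided by [d]. *)
Lemma zeta_hess z w : U z -> d%:R * inner (g z) (d1v zeta z w + Gam g z w (zeta z)) w =
  d2 phi z w w - d1 phi z (Gam g z w w).
Proof.
move=> Uz; have Uz0 : U (z + (0 : R) *: w) by rewrite scale0r addr0.
have L := mder_line z w (0 : R).
have dz := F_der oU zeta_smooth Uz0 L.
have hL := der_mulc (d%:R) (cov_der oU Cg symg posg Uz0 L dz (mder_cst w (0 : R))).
have hR := @d1_der _ _ _ U phi (fun r : R => z + r *: w) (fun=> w) 0 1 w 0 oU (Cphi 2) Uz0 L (mder_cst w (0 : R)).
have E : \forall r \near (0 : R), d%:R * inner (g (z + r *: w)) (zeta (z + r *: w)) w = d1 phi (z + r *: w) w.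
  by apply: filterS (near_line w oU Uz) => r Ur; exact: zeta_inner.
have := near_eq_derive (1 : R) E; rewrite (der_val hL) (der_val hR) d10 scale0r (addr0 z) add0r.
rewrite -(zeta_inner (Gam g z w w) Uz) mulrDr.
by move: (d2 _ _ _ _) => a; move: (inner _ _ _) (inner _ _ _) => b c; lra.
Qed.

Variable c0 : 'rV[R]_d.
Hypothesis Uc : U c0.

(* [fieldV] extends the vector [e] at [p] to a field that is parallel at [c0] when
   [p = c0]; [fieldA] is the coordinate acceleration making the covariant
   acceleration of [r |-> stepPsi e p r z] at [r = 0] equal to [zeta z].
   [stepD] is the differential of [stepPsi] in [z], and [stepQ], [stepQ1], [stepQ2]
   are the squared length of the image of [w] and its first two derivatives in [r]. *)
Definition fieldV e p z : 'rV[R]_d := e - Gam g c0 (z - p) e.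
Definition fieldV1 e w : 'rV[R]_d := - Gam g c0 w e.
Definition fieldA e p z : 'rV[R]_d := zeta z - Gam g z (fieldV e p z) (fieldV e p z).
Definition fieldDA e p z w : 'rV[R]_d := d1v zeta z w
  - (DGam g z w (fieldV e p z) (fieldV e p z) + Gam g z (fieldV1 e w) (fieldV e p z)
     + Gam g z (fieldV e p z) (fieldV1 e w)).
Definition stepPsi e p (r : R) z : 'rV[R]_d := pol z (fieldV e p z) (fieldA e p z) r.
Definition stepD e p (r : R) z w : 'rV[R]_d := pol w (fieldV1 e w) (fieldDA e p z w) r.
Definition stepQ e p z w := fam_q z (fieldV e p z) (fieldA e p z) w (fieldV1 e w) (fieldDA e p z w).
Definition stepQ1 e p z w := fam_q1 z (fieldV e p z) (fieldA e p z) w (fieldV1 e w) (fieldDA e p z w).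
Definition stepQ2 e p z w := fam_q2 z (fieldV e p z) (fieldA e p z) w (fieldV1 e w) (fieldDA e p z w).

Lemma fieldV_at e p : fieldV e p p = e.
Proof. by rewrite /fieldV subrr Gam0l subr0. Qed.

(** The second variation formula. The field is parallel at [c0], so the squared covariant derivative
    of the variation field drops out; commuting derivatives turns the rest into the derivative of
    the prescribed acceleration minus curvature. *)
Lemma stepQ2_center e w : stepQ2 e c0 c0 w 0 =
  2 * (inner (g c0) (d1v zeta c0 w + Gam g c0 w (zeta c0)) w - inner (g c0) (curvature g c0 w e e) w).
Proof.
rewrite /stepQ2 /fam_q2 /fam_al1 /fam_al /pol /lin expr0n mul0r !scale0r !addr0.
rewrite /fieldDA /fieldA !fieldV_at /fieldV1.
have GC a b : Gam g c0 a b = Gam g c0 b a by apply: (GamC oU symg).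
have GN1 a b : Gam g c0 (- a) b = - Gam g c0 a b by rewrite -scaleN1r GamZl scaleN1r.
have GN2 a b : Gam g c0 a (- b) = - Gam g c0 a b by rewrite -scaleN1r GamZr scaleN1r.
rewrite (GC e w) addNr inner0l Gam0r !addr0 curvatureE; congr (2 * _).
have DC : DGam g c0 e e w = DGam g c0 e w e.
  apply/rowP => k; rewrite !mxE; apply: innerC; apply/matrixP => i j; rewrite !mxE.
  apply: (d1_eq_on _ oU) => // z Uz.
  by have := chr_sym oU symg k Uz => /matrixP/(_ j i); rewrite mxE.
rewrite DC -innerBl; congr (inner _ _ _).
rewrite GamDl !GN1 !GN2 (GC (Gam g c0 w e) e) (GC (zeta c0) w) (GC (Gam g c0 e e) w).
by apply/rowP => k; rewrite !mxE; ring.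
Qed.

End Variation.

Lemma pol0 (R : realType) d (a b c : 'rV[R]_d) : pol a b c 0 = a.
Proof. by rewrite /pol expr0n mul0r !scale0r !addr0. Qed.

Section VariationCvg.
Context {R : realType} {d : nat}.
Variables (U : set 'rV[R]_d) (g : 'rV[R]_d -> 'M[R]_d).
Hypothesis oU : open U.
Hypothesis Cg : forall k i j, Ck_on k U (fun y => g y i j).
Hypothesis posg : forall y, U y -> posdef (g y).
Variable phi : 'rV[R]_d -> R.
Hypothesis Cphi : forall k, Ck_on k U phi.
Variable c0 : 'rV[R]_d.
Hypothesis Uc : U c0.
Variables (T : Type) (F : set_system T).
Context {FF : Filter F}.
Variables (r : T -> R) (c z p e w : T -> 'rV[R]_d) (e0 w0 : 'rV[R]_d).
Hypotheses (cr : r @ F --> (0 : R)) (cc : c @ F --> c0) (cz : z @ F --> c0) (cp : p @ F --> c0)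
  (ce : e @ F --> e0) (cw : w @ F --> w0).

Lemma fieldV_cvg : (fun t => fieldV g (c t) (e t) (p t) (z t)) @ F --> fieldV g c0 e0 c0 c0.
Proof.
apply: cvgB => //; apply: (@Gam_cvg _ _ T F _ U oU c c0 Uc) => //.
exact: cvgB.
Qed.

Lemma fieldA_cvg : (fun t => fieldA g phi (c t) (e t) (p t) (z t)) @ F --> fieldA g phi c0 e0 c0 c0.
Proof.
apply: cvgB; last by apply: (@Gam_cvg _ _ T F _ U oU z c0 Uc) => //; exact: fieldV_cvg.
by apply: (mx_cvg Uc cz) => i a; rewrite (ord1 i); exact: (zeta_smooth oU Cg posg Cphi).
Qed.

Lemma fieldV1_cvg : (fun t => fieldV1 g (c t) (e t) (w t)) @ F --> fieldV1 g c0 e0 w0.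
Proof.
by apply: cvgN; apply: (@Gam_cvg _ _ T F _ U oU c c0 Uc).
Qed.

Lemma fieldDA_cvg : (fun t => fieldDA g phi (c t) (e t) (p t) (z t) (w t)) @ F --> fieldDA g phi c0 e0 c0 c0 w0.
Proof.
have cV := fieldV_cvg; have cV1 := fieldV1_cvg.
apply: cvgB; first by apply: (d1v_cvg Uc cz _ cw) => a; exact: (zeta_smooth oU Cg posg Cphi).
apply: cvgD; [apply: cvgD|].
- exact: (@DGam_cvg _ _ T F _ U oU z c0 Uc).
- exact: (@Gam_cvg _ _ T F _ U oU z c0 Uc).
- exact: (@Gam_cvg _ _ T F _ U oU z c0 Uc).
Qed.

Lemma pol_cvg (a b c' : T -> 'rV[R]_d) a0 b0 c1 : a @ F --> a0 -> b @ F --> b0 -> c' @ F --> c1 ->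
  (fun t => pol (a t) (b t) (c' t) (r t)) @ F --> pol a0 b0 c1 0.
Proof.
move=> ca cb cc'; apply: cvgD; first by apply: cvgD => //; exact: cvgZ.
by apply: cvgZ => //; apply: cvgMl; rewrite expr2; under eq_fun do rewrite expr2; exact: cvgM.
Qed.

Lemma lin_cvg (b c' : T -> 'rV[R]_d) b0 c1 : b @ F --> b0 -> c' @ F --> c1 ->
  (fun t => lin (b t) (c' t) (r t)) @ F --> lin b0 c1 0.
Proof. by move=> cb cc'; apply: cvgD => //; exact: cvgZ. Qed.


Lemma stepPsi_cvg : (fun t => stepPsi g phi (c t) (e t) (p t) (r t) (z t)) @ F --> c0.
Proof.
rewrite -[X in _ --> X](pol0 c0 (fieldV g c0 e0 c0 c0) (fieldA g phi c0 e0 c0 c0)).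
by apply: pol_cvg => //; [exact: fieldV_cvg|exact: fieldA_cvg].
Qed.

Lemma fam_q2_cvg (v A V1 DA : T -> 'rV[R]_d) v0 A0 V10 DA0 :
  v @ F --> v0 -> A @ F --> A0 -> V1 @ F --> V10 -> DA @ F --> DA0 ->
  (fun t => fam_q2 g (z t) (v t) (A t) (w t) (V1 t) (DA t) (r t)) @ F --> fam_q2 g c0 v0 A0 w0 V10 DA0 0.
Proof.
move=> cV cA cV1 cD; have cP := pol_cvg cz cV cA; rewrite pol0 in cP.
have cw' := pol_cvg cw cV1 cD.
have cv' := lin_cvg cV cA; have cw1 := lin_cvg cV1 cD.
have cg : (fun t => g (pol (z t) (v t) (A t) (r t))) @ F --> g c0.
  by apply: (mx_cvg Uc cP) => i j; exact: Cg.
have cal : (fun t => fam_al g (z t) (v t) (A t) (w t) (V1 t) (DA t) (r t)) @ F -->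
   fam_al g c0 v0 A0 w0 V10 DA0 0.
  by rewrite /fam_al pol0; apply: (cvgD cw1 (Gam_cvg oU Uc cP Cg posg cv' cw')).
rewrite /fam_q2 pol0; apply: cvgM; first exact: cvg_cst.
apply: cvgD; last exact: (inner_cvg cg cal cal).
apply: (inner_cvg cg _ cw'); apply: (cvgD _ (Gam_cvg oU Uc cP Cg posg cv' cal)).
rewrite /fam_al1 pol0; apply: (cvgD cD); apply: (cvgD (cvgD _ _)).
- exact: (DGam_cvg oU Uc cP Cg posg cv' cw' cv').
- exact: (Gam_cvg oU Uc cP Cg posg cA cw').
- exact: (Gam_cvg oU Uc cP Cg posg cv' cw1).
Qed.

(** All parameters move at once, the centre [c] of the transport included: this lets one estimate
    hold uniformly for all centres near [c0]. *)
Lemma stepQ2_cvg : (fun t => stepQ2 g phi (c t) (e t) (p t) (z t) (w t) (r t)) @ F --> stepQ2 g phi c0 e0 c0 c0 w0 0.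
Proof. exact: (fam_q2_cvg fieldV_cvg fieldA_cvg fieldV1_cvg fieldDA_cvg). Qed.

End VariationCvg.

(** * Coupling of steps at distinct points *)

Section UniformNear.
Context {R : realType} {d : nat}.
Variable c0 : 'rV[R]_d.
Variable Pr : 'M[R]_d -> 'rV[R]_d -> R -> 'rV[R]_d -> 'rV[R]_d -> 'rV[R]_d -> R -> Prop.

(* Bounded frames and unit vectors form a compact set, which turns sequential
   convergence of the parameters into a uniform statement near [c0]. *)
Lemma uniform_near (M1 : R) :
  (forall (T : Type) (F : set_system T) (FF : Filter F) (E : T -> 'M[R]_d) (w : T -> 'rV[R]_d)
    (r : T -> R) (z p c : T -> 'rV[R]_d) (a : T -> R) (E0 : 'M[R]_d) (w0 : 'rV[R]_d),
    E @ F --> E0 -> w @ F --> w0 -> r @ F --> (0 : R) -> z @ F --> c0 -> p @ F --> c0 -> c @ F --> c0 ->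
    a @ F --> (0 : R)^'+ -> `|w0| = 1 -> \forall t \near F, Pr (E t) (w t) (r t) (z t) (p t) (c t) (a t)) ->
  exists a r, [/\ 0 < a, 0 < r & forall E w s z p c, `|E| <= M1 -> `|w| = 1 -> `|s| <= r ->
    `|z - c0| <= r -> `|p - c0| <= r -> `|c - c0| <= r -> Pr E w s z p c a].
Proof.
move=> H.
pose X := ('rV[R]_(d * d) * 'rV[R]_d)%type.
pose C : set X := [set x : 'rV[R]_(d * d) | `|x - 0| <= M1] `*` [set w : 'rV[R]_d | `|w| = 1].
have cC : compact C by apply: compact_setX; [exact: compact_ball_rV|exact: compact_sphere].
pose J := ((R * ('rV[R]_d * ('rV[R]_d * 'rV[R]_d))) * R)%type.
(* The tolerance is a parameter as well, tending to 0 from the right; one positive value is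
   extracted at the end and serves all the others. *)
pose F : set_system J := filter_prod (nbhs ((0 : R), (c0, (c0, c0)))) ((0 : R)^'+).
have FF : Filter F by exact: filter_prod_filter.
have [] : \forall t \near F, C `<=` (fun x => Pr (vec_mx x.1) x.2 t.1.1 t.1.2.1 t.1.2.2.1 t.1.2.2.2 t.2).
  apply: (compact_near_coveringP C).1 => // -[x0 w0] [/= _ w01].
  pose T := (X * J)%type.
  pose G : set_system T := filter_prod (nbhs ((x0, w0) : X)) F.
  have FG : Filter G by exact: filter_prod_filter.
  have c1 : (fun s : T => s.1) @ G --> ((x0, w0) : X) by exact: cvg_fst.
  have c2 : (fun s : T => s.2) @ G --> F by exact: cvg_snd.
  have c3 : (fun s : T => s.2.1) @ G --> ((0 : R), (c0, (c0, c0))).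
    by apply: (cvg_comp (fun s : T => s.2) fst c2); exact: cvg_fst.
  have c4 : (fun s : T => s.2.2) @ G --> (0 : R)^'+.
    by apply: (cvg_comp (fun s : T => s.2) snd c2); exact: cvg_snd.
  have c5 : (fun s : T => s.2.1.2) @ G --> (c0, (c0, c0)).
    by apply: (cvg_comp (fun s : T => s.2.1) snd c3); exact: cvg_snd.
  have c6 : (fun s : T => s.2.1.2.2) @ G --> (c0, c0).
    by apply: (cvg_comp (fun s : T => s.2.1.2) snd c5); exact: cvg_snd.
  apply: (H T G FG (fun s => vec_mx s.1.1) (fun s => s.1.2) (fun s => s.2.1.1) (fun s => s.2.1.2.1)
    (fun s => s.2.1.2.2.1) (fun s => s.2.1.2.2.2) (fun s => s.2.2) (vec_mx x0) w0) => //.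
  - apply: cvg_mx => i j; rewrite mxE; under eq_fun do rewrite mxE.
    apply: (@cvg_coord _ _ G _ _ _ (fun s : T => s.1.1) x0).
    by apply: (cvg_comp (fun s : T => s.1) fst c1); exact: cvg_fst.
  - by apply: (cvg_comp (fun s : T => s.1) snd c1); exact: cvg_snd.
  - by apply: (cvg_comp (fun s : T => s.2.1) fst c3); exact: cvg_fst.
  - by apply: (cvg_comp (fun s : T => s.2.1.2) fst c5); exact: cvg_fst.
  - by apply: (cvg_comp (fun s : T => s.2.1.2.2) fst c6); exact: cvg_fst.
  - by apply: (cvg_comp (fun s : T => s.2.1.2.2) snd c6); exact: cvg_snd.
move=> [A B] [/= nA nB] AB.
have nB0 := nbhs_right_gt (0 : R).
have [a [Ba a0]] := @filter_ex _ _ (at_right_proper_filter (0 : R)) _ (filterI nB nB0).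
move: nA => /nbhs_ballP[r /= r0 bA].
exists a, (r / 2); split=> //; first by rewrite divr_gt0.
have rr : r / 2 < r by lra.
move=> E w s z p c EM w1 sr zr pr cr.
have Ast : A (s, (z, (p, c))).
  apply: bA; split; [|split; [|split]] => /=.
  - by rewrite /ball /= sub0r normrN; exact: le_lt_trans sr rr.
  - by rewrite -ball_normE /= distrC; exact: le_lt_trans zr rr.
  - by rewrite -ball_normE /= distrC; exact: le_lt_trans pr rr.
  - by rewrite -ball_normE /= distrC; exact: le_lt_trans cr rr.
have := AB ((s, (z, (p, c))), a) (conj Ast Ba) (mxvec E, w); rewrite /= mxvecK; apply.
split => //=; rewrite subr0; apply: norm_mx_le; first exact: le_trans (normr_ge0 _) EM.
move=> i k; rewrite (ord1 i); case/mxvec_indexP: k => a' b'; rewrite mxvecE.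
exact: le_trans (norm_coord _ _ _) EM.
Qed.

End UniformNear.

Section LocalCoupling.
Context {R : realType} {d : nat}.
Variables (U : set 'rV[R]_d) (g : 'rV[R]_d -> 'M[R]_d).
Hypothesis oU : open U.
Hypothesis Cg : forall k i j, Ck_on k U (fun y => g y i j).
Hypothesis symg : forall y, U y -> (g y)^T = g y.
Hypothesis posg : forall y, U y -> posdef (g y).
Variable phi : 'rV[R]_d -> R.
Hypothesis Cphi : forall k, Ck_on k U phi.
Hypothesis d0 : (0 < d)%N.
Variable c0 : 'rV[R]_d.
Hypothesis Uc : U c0.
Variable K : R.
Hypothesis BE : forall w (E : 'M[R]_d), E^T *m E = invmx (g c0) ->
  d2 phi c0 w w - d1 phi c0 (Gam g c0 w w)
  - \sum_a inner (g c0) (curvature g c0 w (row a E) (row a E)) w <= K * inner (g c0) w w.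

Let V := fieldV g c0.
Let Psi := stepPsi g phi c0.
Let DPsi := stepD g phi c0.

(** Defect of orthonormality at [z] of the frame [E] given at [p] and transported with centre
    [c]. *)
Definition gerr c (E : 'M[R]_d) p z : R := \sum_a \sum_b
  `|inner (g z) (fieldV g c (row a E) p z) (fieldV g c (row b E) p z) - (a == b)%:R|.

Lemma row_cvg (T : Type) (F : set_system T) (FF : Filter F) (E : T -> 'M[R]_d) (E0 : 'M[R]_d) a :
  E @ F --> E0 -> (fun t => row a (E t)) @ F --> row a E0.
Proof.
move=> cE; apply: cvg_mx => i j; rewrite mxE; under eq_fun do rewrite mxE.
exact: (@cvg_coord _ _ F).
Qed.

Lemma gerr_frame c (E : 'M[R]_d) z : gerr c E z z = 0 -> E^T *m E = invmx (g z).
Proof.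
rewrite /gerr => /eqP; rewrite psumr_eq0; last by move=> a _; exact: sumr_ge0.
move=> /allP H; have on a b : inner (g z) (row a E) (row b E) = (a == b)%:R.
  have := H a (mem_index_enum a); rewrite /= psumr_eq0 // => /allP/(_ b (mem_index_enum b)).
  by rewrite /= normr_eq0 subr_eq0 !fieldV_at => /eqP.
have EgE : (E *m g z) *m E^T = 1%:M.
  apply/matrixP => a b; rewrite [RHS]mxE -on frame_row [LHS]mxE [RHS]mxE; apply: eq_bigr => k _.
  by rewrite !mxE.
have := mulmx1C EgE; rewrite mulmxA => H1.
have ug : g z \in unitmx by case/mulmx1_unit: H1.
by rewrite -[LHS](mulmxK ug) H1 mul1mx.
Qed.

(** The [+ 1] is room: at [c0], for an orthonormal frame, [BE] gives the bound with [2 * K], so the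
    inequality is strict for [w != 0] and persists nearby. Limit frames that are not orthonormal
    need no bound, since their defect ends up above the tolerance, which tends to 0. *)
Lemma local_cover (M1 : R) : exists a r, [/\ 0 < a, 0 < r & forall E w s z p c, `|E| <= M1 -> `|w| = 1 -> `|s| <= r ->
    `|z - c0| <= r -> `|p - c0| <= r -> `|c - c0| <= r -> gerr c E p z <= a ->
    (forall a, U (stepPsi g phi c (row a E) p s z)) /\
    \sum_a stepQ2 g phi c (row a E) p z w s <= (2 * K + 1) * inner (g z) w w].
Proof.
apply: (@uniform_near R d c0 (fun E w s z p c a => gerr c E p z <= a -> (forall a, U (stepPsi g phi c (row a E) p s z)) /\
    \sum_a stepQ2 g phi c (row a E) p z w s <= (2 * K + 1) * inner (g z) w w)).
move=> T F FF E w r z p c a E0 w0 cE cw cr cz cp cc ca w01.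
have cg : (fun t => g (z t)) @ F --> g c0 by apply: (mx_cvg Uc cz) => i j; exact: Cg.
have cV b : (fun t => fieldV g (c t) (row b (E t)) (p t) (z t)) @ F --> row b E0.
  rewrite -[X in _ --> X](fieldV_at g c0 _ c0).
  by apply: (fieldV_cvg oU Cg posg Uc cc cz cp); exact: row_cvg.
have cge : (fun t => gerr (c t) (E t) (p t) (z t)) @ F --> gerr c0 E0 c0 c0.
  apply: cvg_bigsum => i _; apply: cvg_bigsum => j _; apply: cvg_norm.
  by apply: cvgB; [rewrite !fieldV_at; exact: inner_cvg|exact: cvg_cst].
have nU : \forall t \near F, forall b, U (stepPsi g phi (c t) (row b (E t)) (p t) (r t) (z t)).
  apply: filter_forall => b.
  have cP := stepPsi_cvg oU Cg posg Cphi Uc cr cc cz cp (row_cvg (a := b) FF cE).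
  by apply: cP; exact: open_nbhs_nbhs.
have ge0 : 0 <= gerr c0 E0 c0 c0 by apply: sumr_ge0 => i _; exact: sumr_ge0.
have [z0|] := eqVneq (gerr c0 E0 c0 c0) 0; last first.
  move=> n0; have g0 : 0 < gerr c0 E0 c0 c0 by rewrite lt_neqAle eq_sym n0.
  have n1 : \forall t \near F, gerr c0 E0 c0 c0 / 2 < gerr (c t) (E t) (p t) (z t).
    by apply: (cvgr_gt _ cge); lra.
  have n2 : \forall t \near F, a t < gerr c0 E0 c0 c0 / 2.
    have p2 : 0 < gerr c0 E0 c0 c0 / 2 by rewrite divr_gt0.
    exact: (ca _ (nbhs_right_lt p2)).
  apply: filterS2 n1 n2 => t t1 t2 t3; exfalso; lra.
have on := gerr_frame z0.
have cQ : (fun t => (2 * K + 1) * inner (g (z t)) (w t) (w t) -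
    \sum_b stepQ2 g phi (c t) (row b (E t)) (p t) (z t) (w t) (r t)) @ F -->
   (2 * K + 1) * inner (g c0) w0 w0 - \sum_b stepQ2 g phi c0 (row b E0) c0 c0 w0 0.
  apply: cvgB; first by apply: cvgM; [exact: cvg_cst|exact: inner_cvg].
  apply: cvg_bigsum => b _.
  exact: (stepQ2_cvg oU Cg posg Cphi Uc cr cc cz cp (row_cvg (a := b) FF cE) cw).
have pos : 0 < (2 * K + 1) * inner (g c0) w0 w0 - \sum_b stepQ2 g phi c0 (row b E0) c0 c0 w0 0.
  have w00 : w0 != 0 by rewrite -normr_gt0 w01.
  have := BE w0 on; rewrite -(zeta_hess oU Cg symg posg Cphi d0 w0 Uc) => B1.
  have -> : \sum_b stepQ2 g phi c0 (row b E0) c0 c0 w0 0 =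
    2 * (d%:R * inner (g c0) (d1v (zeta g phi) c0 w0 + Gam g c0 w0 (zeta g phi c0)) w0
     - \sum_b inner (g c0) (curvature g c0 w0 (row b E0) (row b E0)) w0).
    rewrite (eq_bigr _ (fun b _ => stepQ2_center oU symg phi Uc (row b E0) w0)).
    rewrite -mulr_sumr sumrB; congr (2 * (_ - _)).
    by rewrite sumr_const card_ord mulr_natl.
  have := posg Uc w00; lra.
have n3 := cvgr_gt _ cQ _ pos.
apply: filterS2 nU (n3 FF) => t t1; rewrite subr_gt0 => /ltW t2 _.
exact: (conj t1 t2).
Qed.

Definition gn y v := Num.sqrt (inner (g y) v v).

Lemma gn_hom y s v : gn y (s *: v) = `|s| * gn y v.
Proof. by rewrite /gn innerZl innerZr mulrA -expr2 sqrtrM ?sqr_ge0// sqrtr_sqr. Qed.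

Lemma stepD_hom e p r z s w : DPsi e p r z (s *: w) = s *: DPsi e p r z w.
Proof.
have D1 : fieldV1 g c0 e (s *: w) = s *: fieldV1 g c0 e w by rewrite /fieldV1 GamZl scalerN.
have D2 : fieldDA g phi c0 e p z (s *: w) = s *: fieldDA g phi c0 e p z w.
  rewrite /fieldDA D1 d1vZ GamZl GamZr.
  have -> u v : DGam g z (s *: w) u v = s *: DGam g z w u v.
    apply/rowP => k; rewrite !mxE !innerE mulr_sumr; apply: eq_bigr => i _.
    by rewrite mulr_sumr; apply: eq_bigr => j _; rewrite !mxE d1Z; ring.
  by apply/rowP => k; rewrite !mxE; ring.
rewrite /DPsi /stepD D1 D2 /pol; apply/rowP => k; rewrite !mxE; ring.
Qed.

(** The tangent of the square root at [G]; it turns a bound on a sum of squared lengths into one on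
    the sum of lengths. *)
Lemma amgm_sqrt (q G : R) : 0 < G -> 0 <= q -> Num.sqrt q <= (q + G) / (2 * Num.sqrt G).
Proof.
move=> G0 q0; have s0 : 0 < Num.sqrt G by rewrite sqrtr_gt0.
rewrite ler_pdivlMr ?mulr_gt0//.
have := sqr_ge0 (Num.sqrt q - Num.sqrt G); rewrite sqrrB !sqr_sqrtr ?(ltW G0)//; lra.
Qed.

Section Speed.
Variables (a r : R) (E : 'M[R]_d) (z p : 'rV[R]_d).
Hypothesis Uz : U z.
Hypothesis near : forall w s, `|w| = 1 -> `|s| <= r ->
    (forall a, U (Psi (row a E) p s z)) /\
    \sum_a stepQ2 g phi c0 (row a E) p z w s <= (2 * K + 1) * inner (g z) w w.

(** Steps by [s] and [- s] are paired, so the first variation cancels: [P0] has derivative [P1],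
    which vanishes at 0 and is nondecreasing by the bound on [stepQ2]. Hence the sum of squared
    lengths grows at most like [s ^+ 2], and [amgm_sqrt] passes to lengths. *)
Lemma local_speed1 (s : R) w : 0 <= s <= r -> `|w| = 1 ->
  \sum_a (gn (Psi (row a E) p s z) (DPsi (row a E) p s z w)
        + gn (Psi (row a E) p (- s) z) (DPsi (row a E) p (- s) z w))
  <= (2 * d%:R + (K + 2^-1) * s ^+ 2) * gn z w.
Proof.
move=> /andP[s0 sr] w1.
have w0 : w != 0 by rewrite -normr_gt0 w1.
pose G := inner (g z) w w; have G0 : 0 < G by exact: posg.
pose Q a := stepQ g phi c0 (row a E) p z w.
pose Q1 a := stepQ1 g phi c0 (row a E) p z w.
pose Q2 a := stepQ2 g phi c0 (row a E) p z w.
have nr (t : R) : 0 <= t <= s -> `|t| <= r /\ `|- t| <= r.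
  by move=> /andP[t0 ts]; rewrite normrN ger0_norm//; split; apply: le_trans ts sr.
have dQ b (t : R) : `|t| <= r -> is_derive t 1 (Q b) (Q1 b t).
  by move=> tr; apply: (fam_q_der oU Cg symg posg); exact: (near w1 tr).1.
have dQ1 b (t : R) : `|t| <= r -> is_derive t 1 (Q1 b) (Q2 b t).
  by move=> tr; apply: (fam_q1_der oU Cg symg posg); exact: (near w1 tr).1.
have dN (t : R) : is_derive t 1 (fun t : R => - t) (-1) by exact: der_opp (der_id t).
pose P1 (t : R) := 2 * (2 * K + 1) * G * t - \sum_b (Q1 b t - Q1 b (- t)).
pose P0 (t : R) := (2 * K + 1) * G * (t * t) - \sum_b (Q b t + Q b (- t)).
have dP0 (t : R) : 0 <= t <= s -> is_derive t 1 P0 (P1 t).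
  move=> /nr[t1 t2].
  have D : is_derive t 1 (fun t : R => \sum_b (Q b t + Q b (- t))) (\sum_b (Q1 b t + Q1 b (- t) * -1)).
    by apply: der_sum => b _; exact: (der_add (dQ b t t1) (der_compR (dN t) (dQ b (- t) t2))).
  apply: (der_eq (der_sub (der_mulc ((2 * K + 1) * G) (der_mul (der_id t) (der_id t))) D)).
  rewrite /P1; congr (_ - _); first by rewrite mul1r mulr1; ring.
  by apply: eq_bigr => b _; rewrite mulrN1.
have dP1 (t : R) : 0 <= t <= s -> is_derive t 1 P1 (2 * (2 * K + 1) * G - \sum_b (Q2 b t + Q2 b (- t))).
  move=> /nr[t1 t2].
  have e2 b : is_derive t 1 (fun t : R => Q1 b (- t)) (Q2 b (- t) * -1).
    exact: (der_compR (dN t) (dQ1 b (- t) t2)).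
  have e3 b : is_derive t 1 (fun t : R => Q1 b t - Q1 b (- t)) (Q2 b t - Q2 b (- t) * -1).
    exact: (der_sub (dQ1 b t t1) (e2 b)).
  have D := @der_sum _ _ _ (index_enum 'I_d) xpredT _ _ _ _ (fun b _ => e3 b).
  apply: (der_eq (der_sub (der_mulc (2 * (2 * K + 1) * G) (der_id t)) D)).
  congr (_ - _); first by rewrite mulr1.
  by apply: eq_bigr => b _; rewrite mulrN1 opprK.
have P1ge (t : R) : 0 <= t <= s -> 0 <= P1 t.
  move=> /andP[t0 ts].
  have -> : 0 = P1 0.
    rewrite /P1 mulr0 sub0r; apply/esym/eqP; rewrite oppr_eq0; apply/eqP.
    by apply: big1 => b _; rewrite oppr0 subrr.
  apply: (der_ge0_ndecr t0 (f := fun t => 2 * (2 * K + 1) * G - \sum_b (Q2 b t + Q2 b (- t)))).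
    by move=> x /andP[x0 xt]; apply: dP1; rewrite x0 (le_trans xt).
  move=> x /andP[x0 xt]; have [x1 x2] := nr x (introT andP (conj x0 (le_trans xt ts))).
  rewrite big_split /=; have [_ h1] := near w1 x1; have [_ h2] := near w1 x2.
  rewrite -/G in h1 h2; rewrite /Q2; lra.
have P0ge := der_ge0_ndecr s0 dP0 P1ge.
have Q0 b : Q b 0 = G by rewrite /Q /stepQ /fam_q !pol0.
have S : \sum_b (Q b s + Q b (- s)) <= (2 * d%:R + (2 * K + 1) * s ^+ 2) * G.
  move: P0ge; rewrite /P0 (eq_bigr (fun=> G + G)); last by move=> b _; rewrite oppr0 !Q0.
  rewrite sumr_const card_ord -mulr_natl mulr0 mulr0 sub0r expr2; lra.
have sG : 0 < Num.sqrt G by rewrite sqrtr_gt0.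
have Qge b (t : R) : `|t| <= r -> 0 <= Q b t.
  by move=> tr; apply: posdef_ge0; apply: posg; exact: (near w1 tr).1.
have [s1 s2] := nr s (introT andP (conj s0 (lexx s))).
apply: (@le_trans _ _ (\sum_b ((Q b s + G) / (2 * Num.sqrt G) + (Q b (- s) + G) / (2 * Num.sqrt G)))).
  by apply: ler_sum => b _; apply: lerD; apply: amgm_sqrt => //; apply: Qge.
rewrite (eq_bigr (fun b => (Q b s + Q b (- s) + 2 * G) / (2 * Num.sqrt G))); last first.
  by move=> b _; rewrite -mulrDl; congr (_ * _); ring.
rewrite -mulr_suml big_split /= sumr_const card_ord -[_ *+ d]mulr_natl ler_pdivrMr ?mulr_gt0//.
have -> : (2 * d%:R + (K + 2^-1) * s ^+ 2) * gn z w * (2 * Num.sqrt G) =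
   (4 * d%:R + (2 * K + 1) * s ^+ 2) * G.
  by rewrite /gn -/G -[in RHS](sqr_sqrtr (ltW G0)); field.
lra.
Qed.

Lemma local_speed (s : R) w : 0 <= s <= r ->
  \sum_a (gn (Psi (row a E) p s z) (DPsi (row a E) p s z w)
        + gn (Psi (row a E) p (- s) z) (DPsi (row a E) p (- s) z w))
  <= (2 * d%:R + (K + 2^-1) * s ^+ 2) * gn z w.
Proof.
move=> sr; have [->|w0] := eqVneq w 0.
  have g00 y : gn y 0 = 0 by rewrite /gn inner0l sqrtr0.
  have D0 e q t : DPsi e q t z 0 = 0.
    by rewrite -[X in DPsi _ _ _ _ X](scale0r (0 : 'rV[R]_d)) stepD_hom scale0r.
  by rewrite g00 mulr0 big1// => b _; rewrite !D0 !g00 addr0.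
have n0 : `|w| != 0 by rewrite normr_eq0.
have -> : w = `|w| *: (`|w|^-1 *: w) by rewrite scalerA divff// scale1r.
have u1 : `| `|w|^-1 *: w | = 1 by rewrite normrZ ger0_norm ?invr_ge0// mulVf.
rewrite gn_hom mulrCA.
have := ler_wpM2l (normr_ge0 `|w|) (local_speed1 sr u1); apply: le_trans.
by rewrite mulr_sumr; apply: ler_sum => b _; rewrite !stepD_hom !gn_hom mulrDr.
Qed.

End Speed.

Lemma fieldV_line e p z u (s : R) : mder (fun s : R => V e p (z + s *: u)) s 1 (fieldV1 g c0 e u).
Proof.
have -> : (fun s : R => V e p (z + s *: u)) = lin (V e p z) (fieldV1 g c0 e u).
  apply/funext => r; rewrite /lin /V /fieldV /fieldV1.
  have -> : z + r *: u - p = (z - p) + r *: u by rewrite addrAC.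
  by rewrite GamDl GamZl opprD addrA scalerN.
exact: mder_lin.
Qed.

Definition gramD e e' p z u :=
  inner (g z) (fieldV1 g c0 e u + Gam g z u (V e p z)) (V e' p z)
  + inner (g z) (V e p z) (fieldV1 g c0 e' u + Gam g z u (V e' p z)).

Lemma gram_line e e' p z u (s : R) : U (z + s *: u) ->
  is_derive s 1 (fun s : R => inner (g (z + s *: u)) (V e p (z + s *: u)) (V e' p (z + s *: u)))
    (gramD e e' p (z + s *: u) u).
Proof.
move=> Us; exact: (cov_der oU Cg symg posg Us (mder_line z u s) (fieldV_line e p z u s) (fieldV_line e' p z u s)).
Qed.

Lemma gramD_hom e e' p z s u : gramD e e' p z (s *: u) = s * gramD e e' p z u.
Proof.
by rewrite /gramD /fieldV1 !GamZl -!scalerN -!scalerDr innerZl innerZr mulrDr.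
Qed.

(** The fields are parallel at [c0] when [p = c0], so the derivative of their Gram matrix vanishes
    in the limit; [uniform_near] makes this uniform. *)
Lemma gramD_small (M1 lam : R) : 0 < lam -> exists2 r : R, 0 < r & forall (E : 'M[R]_d) (w z p : 'rV[R]_d), `|E| <= M1 -> `|w| = 1 ->
    `|z - c0| <= r -> `|p - c0| <= r -> forall a b, `|gramD (row a E) (row b E) p z w| <= lam.
Proof.
move=> lam0.
have [|a [r [_ r0 H]]] := @uniform_near R d c0 (fun E w s z p c a => forall a b, `|gramD (row a E) (row b E) p z w| <= lam) M1; last first.
  by exists r => // E w z p EM w1 zr pr; apply: (H E w 0 z p c0) => //; rewrite ?subrr normr0 ltW.
move=> T F FF E w r z p c a E0 w0 cE cw cr cz cp cc ca w01.
apply: filter_forall => b; apply: filter_forall => b'.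
have cg : (fun t => g (z t)) @ F --> g c0 by apply: (mx_cvg Uc cz) => i j; exact: Cg.
have cV b1 : (fun t => V (row b1 (E t)) (p t) (z t)) @ F --> row b1 E0.
  rewrite -[X in _ --> X](fieldV_at g c0 _ c0).
  by apply: (fieldV_cvg oU Cg posg Uc (cvg_cst c0) cz cp); exact: row_cvg.
have c1 b1 : (fun t => fieldV1 g c0 (row b1 (E t)) (w t) + Gam g (z t) (w t) (V (row b1 (E t)) (p t) (z t))) @ F --> (0 : 'rV[R]_d).
  have -> : 0 = fieldV1 g c0 (row b1 E0) w0 + Gam g c0 w0 (row b1 E0) by rewrite /fieldV1 addNr.
  apply: cvgD; last exact: (Gam_cvg oU Uc cz Cg posg cw (cV b1)).
  exact: (fieldV1_cvg oU Cg posg Uc (cvg_cst c0) (row_cvg FF cE) cw).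
have c2 : (fun t => gramD (row b (E t)) (row b' (E t)) (p t) (z t) (w t)) @ F --> (0 : R).
  have -> : (0 : R) = inner (g c0) 0 (row b' E0) + inner (g c0) (row b E0) 0 by rewrite inner0l inner0r addr0.
  by apply: cvgD; apply: inner_cvg.
by apply: (cvgr0_norm_le _ c2).
Qed.

(** Mean value theorem for each of the [d * d] entries, with [lam] shared equally among them. The
    slope can be made arbitrarily small, so transport over a long chain of short links stays nearly
    isometric. *)
Lemma gram_lipschitz (M1 lam : R) : 0 < lam -> exists2 r : R, 0 < r & forall (E : 'M[R]_d) (z p : 'rV[R]_d), `|E| <= M1 ->
    `|z - c0| <= r -> `|p - c0| <= r -> gerr c0 E p z <= gerr c0 E p p + lam * `|z - p|.
Proof.
move=> lam0; have k0 : 0 < (d%:R * d%:R)^-1 * lam :> R by rewrite mulr_gt0// invr_gt0 mulr_gt0 ?ltr0n.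
have [r1 r10 H] := gramD_small M1 k0.
have : \forall z \near c0, U z by exact: open_nbhs_nbhs.
move=> /nbhs_ballP[r2 /= r20 bU].
exists (Num.min r1 (r2 / 2)); first by rewrite lt_min r10 divr_gt0.
move=> E z p EM; rewrite !le_min => /andP[z1 z2] /andP[p1 p2].
have seg (s : R) : 0 <= s <= 1 -> U (p + s *: (z - p)) /\ `|p + s *: (z - p) - c0| <= r1.
  move=> s01; split; last exact: segment_in_ball.
  apply: bU; rewrite -ball_normE /= distrC; have := segment_in_ball s01 p2 z2; lra.
pose k := (d%:R * d%:R)^-1 * lam * `|z - p|.
have one a b : `|inner (g z) (V (row a E) p z) (V (row b E) p z) - (a == b)%:R| <=
   `|inner (g p) (V (row a E) p p) (V (row b E) p p) - (a == b)%:R| + k.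
  have D (s : R) : 0 <= s <= 1 -> _ := fun s01 => gram_line (row a E) (row b E) p (seg s s01).1.
  have [s s01 Es] := MVT_der D.
  rewrite scale1r scale0r addr0 (addrC p (z - p)) subrK in Es.
  set X := inner _ _ _ in Es *; set Y := inner _ _ _ in Es *.
  have -> : X - (a == b)%:R = (Y - (a == b)%:R) + (X - Y) by ring.
  apply: le_trans (ler_normD _ _) _; rewrite lerD2l Es.
  have [zp|zp] := eqVneq (z - p) 0.
    by rewrite /k zp -(scale0r (0 : 'rV[R]_d)) gramD_hom mul0r normr0 scale0r normr0 mulr0.
  have n0 : `|z - p| != 0 by rewrite normr_eq0.
  have -> : gramD (row a E) (row b E) p (p + s *: (z - p)) (z - p) =
     `|z - p| * gramD (row a E) (row b E) p (p + s *: (z - p)) (`|z - p|^-1 *: (z - p)).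
    by rewrite -gramD_hom scalerA divff// scale1r.
  rewrite /k normrM normr_id mulrC ler_wpM2r//.
  by apply: H => //; [rewrite normrZ ger0_norm ?invr_ge0// mulVf|exact: (seg s s01).2].
rewrite /gerr; apply: (@le_trans _ _ (\sum_a \sum_b (`|inner (g p) (V (row a E) p p) (V (row b E) p p) - (a == b)%:R| + k))).
  by apply: ler_sum => a _; apply: ler_sum => b _; exact: one.
have dn : (d%:R : R) != 0 by rewrite pnatr_eq0 -lt0n.
have aux (x y D : R) : D != 0 -> D * (D * ((D * D)^-1 * x * y)) = x * y by move=> D0; field.
have kE : k *+ d *+ d = lam * `|z - p|.
  by rewrite -[k *+ d]mulr_natl -[(_ * k) *+ d]mulr_natl; exact: aux.
under eq_bigr do rewrite big_split /= sumr_const card_ord.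
by rewrite big_split /= sumr_const card_ord kE.
Qed.

End LocalCoupling.

(** Peano form of the remainder, by the mean value theorem for [L]: the first derivative is required
    to be differentiable at 0 only, which is what a [C^2] function along a curve provides. *)
Lemma taylor2 (R : realType) (f f1 : R -> R) (c : R) :
  (\forall s \near (0 : R), is_derive (s : R) (1 : R) f (f1 s)) -> is_derive (0 : R) (1 : R) f1 c ->
  forall th : R, 0 < th -> \forall s \near (0 : R), `|f s - f 0 - s * f1 0 - c / 2 * s ^+ 2| <= th * s ^+ 2.
Proof.
move=> df df1 th th0.
have n1 : \forall s \near (0 : R), `|f1 s - f1 0 - c * s| <= th * `|s|.
  have [dv ev] := df1.
  have cv : (fun t : R => t^-1 *: (f1 (t *: 1 + 0) - f1 0)) @ (0 : R)^' --> c by rewrite -ev; exact: dv.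
  move/cvgrPdist_le: cv => /(_ th th0) n.
  have n' : \forall t \near (0 : R), t != 0 -> `|c - t^-1 *: (f1 (t *: 1 + 0) - f1 0)| <= th by exact: n.
  apply: filterS n' => s H; have [->|s0] := eqVneq s 0.
    by rewrite subrr mulr0 subrr normr0 mulr0.
  have := H s0; rewrite addr0 -[s *: 1]/(s * 1) mulr1 -[_ *: _]/(_ * _) => H1.
  have -> : f1 s - f1 0 - c * s = - (s * (c - s^-1 * (f1 s - f1 0))) by field.
  by rewrite normrN normrM mulrC ler_wpM2r.
have n2 : \forall s \near (0 : R), is_derive (s : R) (1 : R) f (f1 s) /\ `|f1 s - f1 0 - c * s| <= th * `|s|.
  by apply: filterS2 df n1 => s.
move: n2 => /nbhs_ballP[r /= r0 br].
have : \forall s \near (0 : R), ball 0 r s by exact: nbhsx_ballx.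
apply: filterS => s; rewrite /ball /= sub0r normrN => sr.
have ts (t : R) : 0 <= t <= 1 -> is_derive (t * s) 1 f (f1 (t * s)) /\ `|f1 (t * s) - f1 0 - c * (t * s)| <= th * `|t * s|.
  move=> /andP[t0 t1]; apply: br; rewrite /ball /= sub0r normrN normrM ger0_norm//.
  by apply: le_lt_trans sr; rewrite ler_piMl.
pose L t := f (t * s) - f 0 - t * s * f1 0 - c / 2 * (t * s * (t * s)).
have dL (t : R) : 0 <= t <= 1 -> is_derive t 1 L (s * (f1 (t * s) - f1 0 - c * (t * s))).
  move=> t01; have [d1 _] := ts t t01.
  have dts : is_derive t 1 (fun t : R => t * s) s.
    by apply: (der_eq (der_mul (der_id t) (der_cst t 1 s))); rewrite mul1r mulr0 addr0.
  apply: (der_eq (der_sub (der_sub (der_sub (der_compR dts d1) (der_cst t 1 (f 0)))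
     (der_mul dts (der_cst t 1 (f1 0)))) (der_mulc (c / 2) (der_mul dts dts)))).
  by field.
have [t t01 Et] := MVT_der dL.
have [_ b] := ts t t01; have /andP[t0 t1] := t01.
have L0 : L 0 = 0 by rewrite /L !mul0r mulr0 !subr0 subrr.
have -> : f s - f 0 - s * f1 0 - c / 2 * s ^+ 2 = L 1 - L 0 by rewrite L0 subr0 /L !mul1r expr2.
rewrite Et normrM -real_normK ?num_real//.
apply: le_trans (ler_wpM2l (normr_ge0 s) b) _.
rewrite normrM (ger0_norm t0) expr2; have ss : 0 <= th * (`|s| * `|s|) by rewrite mulr_ge0 ?(ltW th0)// mulr_ge0.
have -> : `|s| * (th * (t * `|s|)) = t * (th * (`|s| * `|s|)) by ring.
by rewrite ler_piMl.
Qed.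

Lemma mderN (R : realType) (a b : nat) (A : R -> 'M[R]_(a, b)) (s : R) A' :
  mder A s 1 A' -> mder (fun r => - A r) s 1 (- A').
Proof. by move=> H i j; rewrite mxE; under eq_fun do rewrite mxE; exact: der_opp (H i j). Qed.

Lemma mderZ (R : realType) (a b : nat) (A : R -> 'M[R]_(a, b)) (c s : R) A' :
  mder A s 1 A' -> mder (fun r => c *: A r) s 1 (c *: A').
Proof. by move=> H i j; rewrite mxE; under eq_fun do rewrite mxE; exact: der_mulc (H i j). Qed.

Section StepLift.
Context {R : realType} {d : nat}.
Variables (U : set 'rV[R]_d) (g : 'rV[R]_d -> 'M[R]_d).
Hypothesis oU : open U.
Hypothesis Cg : forall k i j, Ck_on k U (fun y => g y i j).
Hypothesis posg : forall y, U y -> posdef (g y).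
Variable phi : 'rV[R]_d -> R.
Hypothesis Cphi : forall k, Ck_on k U phi.
Variable c0 : 'rV[R]_d.
Hypothesis Uc : U c0.

Lemma fieldV_mder e p (y : R -> 'rV[R]_d) (s : R) w : mder y s 1 w ->
  mder (fun r => fieldV g c0 e p (y r)) s 1 (fieldV1 g c0 e w).
Proof.
move=> yw; rewrite /fieldV1 -[X in mder _ _ _ X]add0r; apply: mderD; first exact: mder_cst.
apply: mderN.
have yp : mder (fun r => y r - p) s 1 w.
  by rewrite -[w]addr0 -oppr0; apply: mderD => //; apply: mderN; exact: mder_cst.
have := Gam_der oU Cg posg Uc (mder_cst c0 s) yp (mder_cst e s).
rewrite Gam0r addr0; have -> u v : DGam g c0 0 u v = 0; last by rewrite add0r.
apply/rowP => k; rewrite !mxE innerE big1// => i _; rewrite big1// => j _.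
by rewrite !mxE d10 mulr0 mul0r.
Qed.

Lemma stepPsi_mder e p (r : R) (y : R -> 'rV[R]_d) (s : R) w : U (y s) -> mder y s 1 w ->
  mder (fun t => stepPsi g phi c0 e p r (y t)) s 1 (stepD g phi c0 e p r (y s) w).
Proof.
move=> Us yw; have dV := fieldV_mder e p yw.
apply: mderD; first by apply: mderD => //; exact: mderZ.
apply: mderZ; apply: mderD; first exact: (F_der oU (zeta_smooth oU Cg posg Cphi) Us yw).
by apply: mderN; exact: (Gam_der oU Cg posg Us yw dV dV).
Qed.

Lemma stepD_cont e p (r : R) (y w : R -> 'rV[R]_d) (s : R) : U (y s) ->
  {for s, continuous y} -> {for s, continuous w} ->
  {for s, continuous (fun t => stepD g phi c0 e p r (y t) (w t))}.
Proof.
move=> Us cy cw.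
have cV1 : fieldV1 g c0 e (w t) @[t --> s] --> fieldV1 g c0 e (w s).
  apply: cvgN; apply: (Gam_cvg oU Uc _ Cg posg cw); [exact: cvg_cst|exact: cvg_cst].
have cV : fieldV g c0 e p (y t) @[t --> s] --> fieldV g c0 e p (y s).
  apply: cvgB; first exact: cvg_cst.
  apply: (Gam_cvg oU Uc _ Cg posg _ (cvg_cst e)); first exact: cvg_cst.
  by apply: cvgB => //; exact: cvg_cst.
apply: cvgD; first by apply: cvgD => //; apply: cvgZ => //; exact: cvg_cst.
apply: cvgZ; first exact: cvg_cst.
apply: cvgB; first by apply: (d1v_cvg Us cy _ cw) => a; exact: (zeta_smooth oU Cg posg Cphi).
apply: cvgD; [apply: cvgD|].
- exact: (DGam_cvg oU Us cy Cg posg cV cV cw).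
- exact: (Gam_cvg oU Us cy Cg posg cV1 cV).
- exact: (Gam_cvg oU Us cy Cg posg cV cV1).
Qed.

End StepLift.

Section Coupling.
Context {R : realType} {d : nat}.
Variable M : riemannian_manifold R d.
Variable phi : M -> R.
Hypothesis Cphi : forall (i : mg_index M) k, Ck_on k (mg_image i) (fun z => phi (mg_inv i z)).
Hypothesis d0 : (0 < d)%N.
Variable K : R.
Hypothesis K0 : 0 <= K.
Hypothesis BE : forall (x : M) (E : 'M[R]_d) w, let i := mg_at x in let y := mg_map i x in
  let g := mg_metric i in let f := fun z => phi (mg_inv i z) in
  E^T *m E = invmx (g y) ->
  d2 f y w w - d1 f y (Gam g y w w)
  - \sum_a inner (g y) (curvature g y w (row a E) (row a E)) w <= K * inner (g y) w w.
Implicit Types (i k : mg_index M) (x p q : M).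

Definition phic i z := phi (mg_inv i z).
(** Coordinate acceleration whose covariant counterpart is [zeta]. Only the behaviour of a step to
    second order matters, so a parabola in the chart can replace the solution of a differential
    equation. *)
Definition accel i z v : 'rV[R]_d := zeta (mg_metric i) (phic i) z - Gam (mg_metric i) z v v.
Definition mstep i x v (s : R) : M := mg_inv i (pol (mg_map i x) v (accel i (mg_map i x) v) s).

(* Defect of orthonormality: transported frames are only almost orthonormal. *)
Definition frame_err i x (E : 'M[R]_d) : R := \sum_a \sum_b
  `|inner (mg_metric i (mg_map i x)) (row a E) (row b E) - (a == b)%:R|.

(** Only the total over the frame and both signs is bounded, as the hypothesis controls a Ricci
    trace and not single curvatures. The strict bounds [r1], [r2] can be added along a chain by
    [dlt_tri]. *)
Definition coupled i p (E : 'M[R]_d) k q (E' : 'M[R]_d) (s L : R) : Prop :=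
  exists r1 r2 : 'I_d -> R,
  [/\ forall a, (distance (mstep i p (row a E) s) (mstep k q (row a E') s) < (r1 a)%:E)%E,
      forall a, (distance (mstep i p (row a E) (- s)) (mstep k q (row a E') (- s)) < (r2 a)%:E)%E &
      \sum_a (r1 a + r2 a) <= L].

Lemma coupled_tri i p E k q E' l q' E'' s L L' : coupled i p E k q E' s L ->
  coupled k q E' l q' E'' s L' -> coupled i p E l q' E'' s (L + L').
Proof.
move=> [r1 [r2 [h1 h2 hL]]] [t1 [t2 [g1 g2 gL]]].
exists (fun a => r1 a + t1 a), (fun a => r2 a + t2 a); split.
- by move=> a; exact: dlt_tri (h1 a) (g1 a).
- by move=> a; exact: dlt_tri (h2 a) (g2 a).
apply: le_trans (lerD hL gL); rewrite -big_split /=; apply: ler_sum => a _.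
by rewrite addrACA.
Qed.

Lemma coupled_le i p E k q E' s L L' : L <= L' -> coupled i p E k q E' s L -> coupled i p E k q E' s L'.
Proof. by move=> LL [r1 [r2 [h1 h2 hL]]]; exists r1, r2; split=> //; exact: le_trans hL LL. Qed.

(** The diagonal entries of the Gram matrix are at most 2, so the rows have length at most 2; [C]
    converts this to coordinates. *)
Lemma frame_bound i c0 rho C x (E : 'M[R]_d) : good_ball i c0 rho C -> `|mg_map i x - c0| <= rho ->
  frame_err i x E <= 1 -> `|E| <= 2 * C.
Proof.
move=> [rho0 C1 gb] xr fe; have [ix H] := gb _ xr.
apply: norm_mx_le; first lra.
move=> a b; have -> : E a b = row a E 0 b by rewrite mxE.
apply: le_trans (norm_coord _ _ _) _; have [h1 _] := H (row a E).
apply: le_trans h1 _; rewrite mulrC ler_wpM2r//; first lra.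
have e1 : `|inner (mg_metric i (mg_map i x)) (row a E) (row a E) - 1| <= 1.
  apply: le_trans fe; rewrite /frame_err (bigD1 a)//= (bigD1 a)//= eqxx -addrA lerDl.
  by rewrite addr_ge0//; apply: sumr_ge0 => *; rewrite ?sumr_ge0.
have := ler_norm (inner (mg_metric i (mg_map i x)) (row a E) (row a E) - 1) => e2.
rewrite /nrm -(ger0_norm (ler0n _ 2)) -sqrtr_sqr; apply: ler_wsqrtr.
apply: (@le_trans _ _ 2); first lra.
by rewrite expr2; lra.
Qed.

Section Local.
Variable i : mg_index M.
Variable c0 : 'rV[R]_d.
Hypothesis Uc : mg_image i c0.
Let g := mg_metric i.
Let U := mg_image i.
Let f := phic i.
Let oU : open U. Proof. exact: image_open. Qed.
Let Cg (k : nat) a b : Ck_on k U (fun z => g z a b). Proof. exact: metric_smooth. Qed.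
Let symg z : U z -> (g z)^T = g z. Proof. exact: metric_sym. Qed.
Let posg z : U z -> posdef (g z). Proof. exact: metric_pos. Qed.
Let Cf (k : nat) : Ck_on k U f. Proof. exact: Cphi. Qed.

(* First-order parallel transport of a frame, which replaces transport along a
   minimising geodesic. *)
Definition transport (E : 'M[R]_d) p q : 'M[R]_d :=
  \matrix_(a, b) fieldV g c0 (row a E) (mg_map i p) (mg_map i q) 0 b.

(** Moving every point of [gam] by the same step sweeps out, for each [a] and each sign, a curve
    between the moved endpoints; its speed is the length of [stepD] at the velocity of [gam]. The
    bound on these speeds is integrated along the path, and [tau] makes the bounds on distances
    strict. *)
Lemma path_coupled (E : 'M[R]_d) p q (s : R) gam ell (tau : R) : 0 <= s -> 0 < tau ->
  path p q gam ell -> mg_dom i p ->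
  (forall t, 0 <= t <= 1 -> mg_dom i (gam t)) ->
  (forall t a, 0 <= t <= 1 -> U (stepPsi g f c0 (row a E) (mg_map i p) s (mg_map i (gam t))) /\
     U (stepPsi g f c0 (row a E) (mg_map i p) (- s) (mg_map i (gam t)))) ->
  (forall t w, 0 <= t <= 1 ->
   \sum_a (gn g (stepPsi g f c0 (row a E) (mg_map i p) s (mg_map i (gam t))) (stepD g f c0 (row a E) (mg_map i p) s (mg_map i (gam t)) w)
        + gn g (stepPsi g f c0 (row a E) (mg_map i p) (- s) (mg_map i (gam t))) (stepD g f c0 (row a E) (mg_map i p) (- s) (mg_map i (gam t)) w))
   <= (2 * d%:R + (K + 2^-1) * s ^+ 2) * gn g (mg_map i (gam t)) w) ->
  coupled i p E i q (transport E p q) s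
    ((2 * d%:R + (K + 2^-1) * s ^+ 2) * (ell 1 - ell 0) + tau).
Proof.
move=> s0 tau0 pth ip dom HU Hs; have [Cgam gp gq dl] := pth.
have all01 (Q : R -> Prop) : (forall t, 0 <= t <= 1 -> Q t) ->
    (forall t, t <= 0 -> gam t = gam 0) -> forall t : R, exists t', [/\ 0 <= t' <= 1, gam t = gam t' & Q t'].
  move=> HQ _ t; have [t0|t0] := leP t 0.
    by exists 0; split; [rewrite lexx ler01|rewrite gp// gp|apply: HQ; rewrite lexx ler01].
  have [t1|t1] := leP t 1; first by exists t; split=> //; [rewrite ltW|apply: HQ; rewrite ltW].
  by exists 1; split; [rewrite ler01 lexx|rewrite (gq t (ltW t1)) gq|apply: HQ; rewrite ler01 lexx].
have clamp (t : R) : exists2 t', 0 <= t' <= 1 & gam t = gam t'.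
  by have [t' [h1 h2 _]] := all01 (fun=> True) (fun _ _ => I) (fun t h => etrans (gp t h) (esym (gp 0 (lexx 0)))) t; exists t'.
have domA t : mg_dom i (gam t) by have [t' h ->] := clamp t; exact: dom.
pose y : R -> 'rV[R]_d := mg_map i \o gam; pose v : R -> 'rV[R]_d := derive1 y.
have yv t : vder y t (v t) by exact: C1_vder.
have Uy t : U (y t) by exact: image_map.
have cy t : {for t, continuous y} by exact: vder_cont (yv t).
have cv t : {for t, continuous v} by have [_ /(_ i t (domA t))[]] := Cgam.
pose zp := mg_map i p.
pose lift a (r : R) t := stepPsi g f c0 (row a E) zp r (y t).
pose liftD a (r : R) t := stepD g f c0 (row a E) zp r (y t) (v t).
have C1 a (r : R) : r = s \/ r = - s -> C1_curve (mg_inv i \o lift a r) /\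
    forall t, speed (mg_inv i \o lift a r) t = nrm i (lift a r t) (liftD a r t).
  move=> rs; apply: chart_C1.
  - move=> t; have [t' h E1] := clamp t; rewrite /lift /y /= E1.
    by have [h1 h2] := HU t' a h; case: rs => ->.
  - move=> t k; have yv' : mder y t 1 (v t) by move=> i' j'; rewrite (ord1 i'); exact: yv.
    exact: (stepPsi_mder oU Cg posg Cf Uc (row a E) zp r (Uy t) yv').
  - move=> k t; have H : {for t, continuous (liftD a r)}.
      exact: (stepD_cont oU Cg posg Cf Uc (Uy t) (cy t) (cv t)).
    by move: H => /(@cvg_coord _ _ (nbhs t) _ _ _ _ _ 0 k).
have ex a (r : R) : r = s \/ r = - s -> exists l : R -> R, forall t : R, 0 <= t <= 1 -> is_derive t 1 l (nrm i (lift a r t) (liftD a r t)).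
  move=> /(C1 a)[Cc sp]; have [l dl'] := primitive (speed_cont Cc).
  exists l => t /andP[t0 t1]; rewrite -sp; apply: dl'; apply/andP; split.
    by apply: lt_le_trans t0; rewrite ltrN10.
  by apply: le_lt_trans t1 _; rewrite ltr1n.
have [l1 dl1] := choice (fun a => ex a s (or_introl erefl)).
have [l2 dl2] := choice (fun a => ex a (- s) (or_intror erefl)).
pose c := 2 * d%:R + (K + 2^-1) * s ^+ 2.
have key : \sum_a ((l1 a 1 - l1 a 0) + (l2 a 1 - l2 a 0)) <= c * (ell 1 - ell 0).
  pose P0 t := c * ell t - \sum_a (l1 a t + l2 a t).
  pose P1 t := c * speed gam t - \sum_a (nrm i (lift a s t) (liftD a s t) + nrm i (lift a (- s) t) (liftD a (- s) t)).
  have dP0 (t : R) : 0 <= t <= 1 -> is_derive t 1 P0 (P1 t).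
    move=> t01; have e3 a : is_derive t 1 (fun t : R => l1 a t + l2 a t) (nrm i (lift a s t) (liftD a s t) + nrm i (lift a (- s) t) (liftD a (- s) t)).
      exact: (der_add (dl1 a t t01) (dl2 a t t01)).
    exact: (der_sub (der_mulc c (dl t)) (@der_sum _ _ _ (index_enum 'I_d) xpredT _ _ _ _ (fun a _ => e3 a))).
  have P1ge (t : R) : 0 <= t <= 1 -> 0 <= P1 t.
    move=> t01; rewrite subr_ge0 (speed_chart (Cgam.1 t) (domA t) (yv t)).
    exact: (Hs t (v t) t01).
  have := der_ge0_ndecr ler01 dP0 P1ge; rewrite /P0 big_split /= [in X in _ <= X]big_split /= => H.
  by rewrite big_split /= !sumrB; lra.
have dn : 0 < (d%:R : R) by rewrite ltr0n.
(* The share of [tau] for each of the [2 * d] distances. *)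
pose t' := tau / (2 * d%:R); have t'0 : 0 < t' by rewrite divr_gt0// mulr_gt0.
have rowE a : row a (transport E p q) = fieldV g c0 (row a E) zp (mg_map i q).
  by apply/rowP => b; rewrite !mxE.
have ends a (r : R) : (mg_inv i \o lift a r) 0 = mstep i p (row a E) r /\
   (mg_inv i \o lift a r) 1 = mstep i q (row a (transport E p q)) r.
  have y0 : y 0 = zp by rewrite /y /= gp.
  have y1 : y 1 = mg_map i q by rewrite /y /= gq.
  split.
    change (mg_inv i (lift a r 0) = mg_inv i (pol zp (row a E) (accel i zp (row a E)) r)).
    by congr (mg_inv i _); rewrite /lift y0 /stepPsi /fieldA fieldV_at.
  rewrite rowE; change (mg_inv i (lift a r 1) = mg_inv i (pol (mg_map i q) (fieldV g c0 (row a E) zp (mg_map i q)) (accel i (mg_map i q) (fieldV g c0 (row a E) zp (mg_map i q))) r)).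
  have E1 : lift a r 1 = stepPsi g f c0 (row a E) zp r (mg_map i q) by rewrite /lift y1.
  rewrite E1 /stepPsi /fieldA /accel; reflexivity.
have dist a (r : R) l : r = s \/ r = - s -> (forall t : R, 0 <= t <= 1 -> is_derive t 1 l (nrm i (lift a r t) (liftD a r t))) ->
   (distance (mstep i p (row a E) r) (mstep i q (row a (transport E p q)) r) < (l 1 - l 0 + t')%:E)%E.
  move=> rs Hl; have [<- <-] := ends a r; have [Cc sp] := C1 a r rs.
  have := @distance_le _ _ M (mg_inv i \o lift a r) l Cc.
  move=> H; apply: le_lt_trans (H _) _; last by rewrite lte_fin ltrDl.
  by move=> t t01; rewrite sp; exact: Hl.
exists (fun a => l1 a 1 - l1 a 0 + t'), (fun a => l2 a 1 - l2 a 0 + t'); split.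
- by move=> a; exact: (dist a s (l1 a) (or_introl erefl) (dl1 a)).
- by move=> a; exact: (dist a (- s) (l2 a) (or_intror erefl) (dl2 a)).
rewrite (eq_bigr (fun a => (l1 a 1 - l1 a 0 + (l2 a 1 - l2 a 0)) + (t' + t'))); last by move=> a _; rewrite addrACA.
rewrite big_split /= sumr_const card_ord lerD// -[_ *+ d]mulr_natl.
by rewrite le_eqVlt; apply/orP; left; apply/eqP; rewrite /t'; field; rewrite gt_eqF.
Qed.

Lemma frame_err_transport (E : 'M[R]_d) p q :
  frame_err i q (transport E p q) = gerr g c0 E (mg_map i p) (mg_map i q).
Proof.
apply: eq_bigr => a _; apply: eq_bigr => b _.
have rowE a' : row a' (transport E p q) = fieldV g c0 (row a' E) (mg_map i p) (mg_map i q).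
  by apply/rowP => b'; rewrite !mxE.
by rewrite !rowE.
Qed.

Lemma frame_errE (E : 'M[R]_d) p : frame_err i p E = gerr g c0 E (mg_map i p) (mg_map i p).
Proof. by apply: eq_bigr => a _; apply: eq_bigr => b _; rewrite !fieldV_at. Qed.

End Local.

End Coupling.

(** The order of quantifiers matters: the tolerance [a] and the step bound [r] depend on [x0] only,
    while the link length [rho] may depend on the accuracy [lam] and on the centre [y0]. Thus a
    tolerance can be fixed on a compact set before [lam] is chosen in terms of it. *)
Lemma step_local (R : realType) d (M : riemannian_manifold R d) (phi : M -> R)
  (Cphi : forall (i : mg_index M) k, Ck_on k (mg_image i) (fun z => phi (mg_inv i z)))
  (d0 : (0 < d)%N) (K : R) (K0 : 0 <= K)
  (BE : forall (x : M) (E : 'M[R]_d) w, let i := mg_at x in let y := mg_map i x in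
    let g := mg_metric i in let f := fun z => phi (mg_inv i z) in
    E^T *m E = invmx (g y) ->
    d2 f y w w - d1 f y (Gam g y w w)
    - \sum_a inner (g y) (curvature g y w (row a E) (row a E)) w <= K * inner (g y) w w)
  (x0 : M) (i := mg_at x0) : exists a r rho1 : R, [/\ 0 < a, 0 < r, 0 < rho1 &
  forall y0, (distance x0 y0 < rho1%:E)%E -> mg_dom i y0 /\ forall lam : R, 0 < lam ->
  exists2 rho : R, 0 < rho & forall p q (E : 'M[R]_d),
  (distance y0 p < rho%:E)%E -> (distance p q < rho%:E)%E -> frame_err i p E <= a / 2 ->
  [/\ mg_dom i p, mg_dom i q, frame_err i q (transport i (mg_map i y0) E p q) <= frame_err i p E + lam * dd p q &
    forall s tau : R, 0 <= s <= r -> 0 < tau ->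
    coupled phi i p E i q (transport i (mg_map i y0) E p q) s ((2 * d%:R + (K + 2^-1) * s ^+ 2) * dd p q + tau)]].
Proof.
pose c0 := mg_map i x0.
pose g := mg_metric i. pose U := mg_image i. pose f := phic phi i.
have oU : open U by exact: image_open.
have Cg (k : nat) a b : Ck_on k U (fun z => g z a b) by exact: metric_smooth.
have symg z : U z -> (g z)^T = g z by exact: metric_sym.
have posg z : U z -> posdef (g z) by exact: metric_pos.
have Cf (k : nat) : Ck_on k U f by exact: Cphi.
have ix0 : mg_dom i x0 by exact: at_dom.
have Uc : U c0 by exact: image_map.
have [C [rho0 [C1 gb]]] := good_chart x0.
have [rho00 _ gbi] := gb.
have CC : 0 < C by lra.
have [a1 [r1 [a10 r10 H1]]] := local_cover oU Cg symg posg Cf d0 Uc (fun w E => @BE x0 E w) (2 * C).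
pose a := Num.min a1 1; have a0 : 0 < a by rewrite lt_min a10 ltr01.
pose rho1 := Num.min (r1 / (2 * C)) (rho0 / (2 * C)).
have rho10 : 0 < rho1 by rewrite lt_min !divr_gt0 ?mulr_gt0.
have rho11 : 2 * (C * rho1) <= r1.
  have : rho1 <= r1 / (2 * C) by rewrite ge_min lexx.
  by rewrite ler_pdivlMr ?mulr_gt0//; lra.
have rho12 : 2 * (C * rho1) <= rho0.
  have : rho1 <= rho0 / (2 * C) by rewrite ge_min lexx orbT.
  by rewrite ler_pdivlMr ?mulr_gt0//; lra.
exists a, r1, rho1; split=> // y0 xy.
have pre1 : `|mg_map i x0 - c0| + C * rho1 < rho0 by rewrite subrr normr0; lra.
have [iy0 yc] := dist_lower gb ix0 xy pre1; rewrite -/c0 in yc.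
split=> // lam lam0; pose c1 := mg_map i y0.
have Uc1 : U c1 by exact: image_map.
have [r2 r20 H2] := gram_lipschitz oU Cg symg posg d0 Uc1 (2 * C) (divr_gt0 lam0 CC).
pose r3 := Num.min (Num.min (r1 / 2) r2) (rho0 / 2).
have r30 : 0 < r3 by rewrite !lt_min r20 !divr_gt0.
have [r31 r32 r33] : [/\ r3 <= r1 / 2, r3 <= r2 & r3 <= rho0 / 2] by rewrite !ge_min !lexx !orbT.
(* A path of length at most [2 * rho] from a point within [rho] of [y0] stays in the coordinate ball
   of radius [r3], and the defect [a / 2] at its start grows to [a] at most. *)
pose rho := Num.min (r3 / (4 * C)) (a / (4 * lam)).
have rhop : 0 < rho by rewrite lt_min !divr_gt0 ?mulr_gt0.
have rC : 4 * (C * rho) <= r3.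
  have : rho <= r3 / (4 * C) by rewrite ge_min lexx.
  by rewrite ler_pdivlMr ?mulr_gt0//; lra.
have rl : 4 * (lam * rho) <= a.
  have : rho <= a / (4 * lam) by rewrite ge_min lexx orbT.
  by rewrite ler_pdivlMr ?mulr_gt0//; lra.
have Cr : 0 < C * rho by rewrite mulr_gt0.
exists rho => // p q E xp pq feE.
have pre0 : `|mg_map i y0 - c0| + C * rho < rho0 by rewrite -/c1 in yc *; lra.
have [ip pc] := dist_lower gb iy0 xp pre0; rewrite -/c1 in pc yc.
have cc1 z : `|z - c0| <= `|z - c1| + C * rho1.
  have -> : z - c0 = (z - c1) + (c1 - c0) by rewrite addrA subrK.
  by apply: le_trans (ler_normD _ _) _; lra.
have pc0 := cc1 (mg_map i p).
have cpq := lt_conn pq; have dpq := lt_dd pq.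
have D0 : 0 <= dd p q by exact: dd_ge0.
have pre2 (e : R) : dd p q + e <= 2 * rho -> `|mg_map i p - c0| + C * (dd p q + e) < rho0.
  by move=> h; have := ler_wpM2l (ltW CC) h; lra.
have qp : mg_dom i q /\ `|mg_map i q - mg_map i p| <= C * dd p q.
  split.
    have [|//] := dist_lower (a := dd p q + rho) gb ip (dd_adherent cpq rhop).
    by apply: pre2; move: dpq; clear; lra.
  apply/ler_addgt0Pr => e e0; pose e' := Num.min (e / C) rho.
  have e'0 : 0 < e' by rewrite lt_min divr_gt0.
  have e'1 : e' <= e / C by rewrite ge_min lexx.
  have e'2 : e' <= rho by rewrite ge_min lexx orbT.
  have [|_] := dist_lower (a := dd p q + e') gb ip (dd_adherent cpq e'0).
    by apply: pre2; move: dpq e'2; clear; lra.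
  by move: e'1; rewrite ler_pdivlMr// mulrDr; clear; lra.
have [iq qpC] := qp.
have fe1 : frame_err i p E <= 1.
  have al1 : a <= 1 by rewrite ge_min lexx orbT.
  by apply: le_trans feE _; lra.
have Cr1 : 0 < C * rho1 by rewrite mulr_gt0.
have EM : `|E| <= 2 * C by apply: (frame_bound gb _ fe1); move: pc pc0 rC r33 rho12 Cr; clear; lra.
have gl z : `|z - c1| <= r3 -> gerr g c1 E (mg_map i p) z <= frame_err i p E + lam / C * `|z - mg_map i p|.
  move=> zr; rewrite (frame_errE i c1); apply: H2; [exact: EM|exact: le_trans zr r32|].
  by move: pc rC r32 Cr; clear; lra.
split=> //.
  rewrite frame_err_transport; apply: le_trans (gl _ _) _.
    have -> : mg_map i q - c1 = (mg_map i q - mg_map i p) + (mg_map i p - c1) by rewrite addrA subrK.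
    apply: le_trans (ler_normD _ _) _; have := ler_wpM2l (ltW CC) (ltW dpq); move: qpC pc rC Cr; clear; lra.
  rewrite lerD2l -mulrA; apply: ler_wpM2l; first exact: ltW.
  by rewrite mulrC ler_pdivrMr//; move: qpC; clear; lra.
move=> s tau /andP[s0 sr] tau0.
pose c := 2 * d%:R + (K + 2^-1) * s ^+ 2.
have dn : 0 < (d%:R : R) by rewrite ltr0n.
have Ks : 0 <= (K + 2^-1) * s ^+ 2 by apply: mulr_ge0; [move: K0; clear; lra|exact: sqr_ge0].
have c0' : 0 < c by rewrite /c; move: dn Ks; clear; lra.
pose t' := Num.min rho (tau / (2 * c)).
have t'0 : 0 < t' by rewrite lt_min rhop divr_gt0// mulr_gt0.
have t'1 : t' <= rho by rewrite ge_min lexx.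
have t'2 : t' * (2 * c) <= tau by rewrite -ler_pdivlMr ?mulr_gt0// ge_min lexx orbT.
have [gam [ell [pth len]]] := path_exists (dd_adherent cpq t'0).
have len2 : ell 1 - ell 0 <= 2 * rho by move: len dpq t'1; clear; lra.
have Clen := ler_wpM2l (ltW CC) len2.
have pre3 : `|mg_map i p - c0| + C * (ell 1 - ell 0) < rho0.
  by move: pc pc0 rC r33 rho12 Cr Clen rho00; clear; lra.
have stay := path_stays gb pth ip pre3.
have mono (t : R) : 0 <= t <= 1 -> ell t <= ell 1.
  move=> /andP[t0 t1]; apply: (der_ge0_ndecr t1 (f := speed gam)).
    by move=> x _; exact: path_len pth x.
  by move=> x _; exact: speed_ge0.
have stay2 (t : R) : 0 <= t <= 1 -> [/\ mg_dom i (gam t), `|mg_map i (gam t) - mg_map i p| <= C * (2 * rho) & `|mg_map i (gam t) - c1| <= r3].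
  move=> t01; have [it ht] := stay t t01; have mt := mono t t01.
  have h1 : `|mg_map i (gam t) - mg_map i p| <= C * (2 * rho).
    by apply: le_trans ht _; apply: ler_wpM2l; [exact: ltW|move: mt len2; clear; lra].
  split; [exact: it|exact: h1|]; have -> : mg_map i (gam t) - c1 = (mg_map i (gam t) - mg_map i p) + (mg_map i p - c1) by rewrite addrA subrK.
  by apply: le_trans (ler_normD _ _) _; move: h1 pc rC Cr; clear; lra.
have near (t : R) : 0 <= t <= 1 -> forall w s', `|w| = 1 -> `|s'| <= r1 ->
    (forall a, U (stepPsi g f c1 (row a E) (mg_map i p) s' (mg_map i (gam t)))) /\
    \sum_a stepQ2 g f c1 (row a E) (mg_map i p) (mg_map i (gam t)) w s' <= (2 * K + 1) * inner (g (mg_map i (gam t))) w w.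
  move=> t01 w s' w1 s'r; have [it h1 h2] := stay2 t t01.
  have g1 := cc1 (mg_map i (gam t)).
  apply: H1; [exact: EM|exact: w1|exact: s'r|..].
  - by move: g1 h2 r31 rho11; clear; lra.
  - by move: pc0 pc rC r31 rho11 Cr; clear; lra.
  - by move: yc rho11 Cr1; clear; lra.
  apply: le_trans (gl _ h2) _; apply: (@le_trans _ _ (a / 2 + lam * (2 * rho))).
    apply: lerD; first exact: feE.
    rewrite -mulrA; apply: ler_wpM2l; first exact: ltW.
    by rewrite mulrC ler_pdivrMr//; move: h1; clear; lra.
  have : a <= a1 by rewrite ge_min lexx.
  by move: rl; clear; lra.
have domU (t : R) : 0 <= t <= 1 -> U (mg_map i (gam t)) by move=> /stay2[it _ _]; exact: image_map.
have s1 : `|s| <= r1 by rewrite ger0_norm.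
have s2 : `|- s| <= r1 by rewrite normrN.
(* In [near] the membership in [U] is packed with an estimate for unit vectors, so one such vector
   is needed to extract it. *)
have unitw : exists w : 'rV[R]_d, `|w| = 1.
  pose u : 'rV[R]_d := const_mx 1; have u0 : u != 0.
    by apply/eqP => /rowP/(_ (Ordinal d0)); rewrite !mxE => /eqP; rewrite oner_eq0.
  by exists (`|u|^-1 *: u); rewrite normrZ ger0_norm ?invr_ge0// mulVf// normr_eq0.
have [w0 w01] := unitw.
apply: (coupled_le _ (@path_coupled _ _ M phi Cphi d0 K i c1 Uc1 E p q s gam ell (tau / 2) s0 _ pth ip _ _ _)).
- rewrite -/c; have cl : c * (ell 1 - ell 0) <= c * (dd p q + t') by apply: ler_wpM2l; [exact: ltW|move: len; clear; lra].
  by move: cl t'2; rewrite mulrDr; clear; lra.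
- by rewrite divr_gt0.
- by move=> t /stay2[].
- by move=> t b t01; split; [exact: (near t t01 w0 s w01 s1).1|exact: (near t t01 w0 (- s) w01 s2).1].
- move=> t w t01; apply: (local_speed oU Cg symg posg (domU t t01) (near t t01)).
  by rewrite s0.
Qed.

Lemma near0_forall (R : realType) (I : finType) (P : I -> R -> Prop) :
  (forall i, \forall s \near (0 : R), P i s) -> \forall s \near (0 : R), forall i, P i s.
Proof. by move=> H; exact: (@filter_forall _ _ P (nbhs (0 : R)) (nbhs_filter (0 : R)) H). Qed.

(** * Steps seen in different charts *)

Section ChartSwitch.
Context {R : realType} {d : nat}.
Variable M : riemannian_manifold R d.
Variable phi : M -> R.
Hypothesis Cphi : forall (i : mg_index M) k, Ck_on k (mg_image i) (fun z => phi (mg_inv i z)).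
Hypothesis d0 : (0 < d)%N.
Implicit Types (x p q : M).

Lemma near_oppR (P : R -> Prop) : (\forall s \near (0 : R), P s) -> \forall s \near (0 : R), P (- s).
Proof.
move=> /nbhs_ballP[r /= r0 br].
have : \forall s \near (0 : R), ball 0 r s by exact: nbhsx_ballx.
by apply: filterS => s; rewrite /ball /= sub0r normrN => sr; apply: br; rewrite /ball /= sub0r opprK.
Qed.

Lemma mder_near_cont (y : R -> 'rV[R]_d) (s : R) w : mder y s 1 w -> {for s, continuous y}.
Proof. by move=> yw; apply: (@vder_cont _ _ y s w) => k; exact: yw. Qed.

Variables (i k : mg_index M) (x : M).
Hypotheses (ix : mg_dom i x) (kx : mg_dom k x).
Let T : 'rV[R]_d -> 'rV[R]_d := chart_change i k.
Let z := mg_map i x.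
Let O := overlap i k.
Let oO : open O. Proof. exact: overlap_open. Qed.
Let oi : open (mg_image i). Proof. exact: image_open. Qed.
Let ok : open (mg_image k). Proof. exact: image_open. Qed.
Let Oz : O z. Proof. exact: overlap_map. Qed.
Let Tz : T z = mg_map k x. Proof. exact: change_map. Qed.
Let TO w : O w -> mg_image k (T w). Proof. exact: change_image. Qed.
Let CT (n : nat) a : Ck_on n O (fun w => T w 0 a). Proof. exact: change_smooth. Qed.
Let Oi w : O w -> mg_image i w. Proof. by move=> /overlapP[]. Qed.
Let Cgi (n : nat) a b : Ck_on n (mg_image i) (fun w => mg_metric i w a b). Proof. exact: metric_smooth. Qed.
Let Cgk (n : nat) a b : Ck_on n (mg_image k) (fun w => mg_metric k w a b). Proof. exact: metric_smooth. Qed.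
Let CgO (n : nat) a b : Ck_on n O (fun w => mg_metric i w a b). Proof. exact: Ck_on_subset Oi (Cgi n a b). Qed.
Let symO w : O w -> (mg_metric i w)^T = mg_metric i w. Proof. by move=> /Oi; exact: metric_sym. Qed.
Let posO w : O w -> posdef (mg_metric i w). Proof. by move=> /Oi; exact: metric_pos. Qed.
Let symk w : mg_image k w -> (mg_metric k w)^T = mg_metric k w. Proof. exact: metric_sym. Qed.
Let posk w : mg_image k w -> posdef (mg_metric k w). Proof. exact: metric_pos. Qed.
Let posi w : mg_image i w -> posdef (mg_metric i w). Proof. exact: metric_pos. Qed.
Let isoT w (Ow : O w) u v : inner (mg_metric i w) u v = inner (mg_metric k (T w)) (d1v T w u) (d1v T w v).
Proof. by rewrite (change_inner _ _ Ow) !(d1v_jacobian oO CT). Qed.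
Let Uk : mg_image k (T z). Proof. exact: TO. Qed.

(** [zeta_inner] characterises [zeta] by its products with all vectors, and these do not depend on
    the chart. *)
Lemma zeta_change : d1v T z (zeta (mg_metric i) (phic phi i) z) = zeta (mg_metric k) (phic phi k) (T z).
Proof.
set ze := zeta _ _ z; set zk := zeta _ _ (T z).
have dn : (d%:R : R) != 0 by rewrite pnatr_eq0 -lt0n.
have H w : inner (mg_metric k (T z)) (d1v T z ze - zk) (d1v T z w) = 0.
  apply: (mulfI dn); rewrite mulr0 innerBl mulrBr -(isoT Oz).
  rewrite (zeta_inner posi (phic phi i) d0 w (Oi Oz)) (zeta_inner posk (phic phi k) d0 _ Uk).
  rewrite -(d1_comp oO ok TO CT _ (Cphi k 1) Oz); apply/eqP; rewrite subr_eq0; apply/eqP.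
  by apply: (d1_eq_on _ oO) => // w' Ow'; rewrite /phic /T change_inv.
have [w Ew] := local_isometry_onto oO CT posO isoT (d1v T z ze - zk) Oz.
apply/eqP; rewrite -subr_eq0; apply/negPn/negP => n0.
by have := posk Uk n0; rewrite {2}Ew H ltxx.
Qed.

Lemma accel_change v : d2v T z v v + d1v T z (accel phi i z v) = accel phi k (T z) (d1v T z v).
Proof.
have := isometry_Gam oO ok TO CT CgO symO posO Cgk symk posk isoT v v Oz.
have -> : d1v T z (accel phi i z v) = d1v T z (zeta (mg_metric i) (phic phi i) z) - d1v T z (Gam (mg_metric i) z v v).
  by rewrite /accel d1vD; congr (_ + _); rewrite -scaleN1r d1vZ scaleN1r.
rewrite /accel zeta_change => <-; rewrite /Sff.
by apply/rowP => a; rewrite !mxE; ring.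
Qed.

(** The two parabolas, seen in the chart [k], start with the same velocity and, by [accel_change],
    the same second derivative; hence they differ by [o(s ^+ 2)], in distance too. *)
Lemma switch_step v (th : R) : 0 < th -> \forall s \near (0 : R), s != 0 ->
  (distance (mstep phi i x v s) (mstep phi k x (d1v T z v) s) < (th * s ^+ 2)%:E)%E.
Proof.
move=> th0; have [C [C1 nC]] := metric_bounds (image_map kx).
have [rho gb] := @filter_ex _ _ (at_right_proper_filter (0 : R)) _ nC.
have [rho0 _ _] := gb.
have CC : 0 < C by lra.
pose A := accel phi i z v; pose v' := d1v T z v; pose A' := accel phi k (T z) v'.
pose c : R -> 'rV[R]_d := pol z v A; pose X : R -> 'rV[R]_d := pol (T z) v' A'.
have c0E : c 0 = z by exact: pol0.
have dc (s : R) : mder c s 1 (lin v A s) by exact: mder_pol.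
have nO : \forall s \near (0 : R), O (c s).
  have cc : {for (0 : R), continuous c} by exact: mder_near_cont (dc 0).
  by apply: cc; rewrite c0E; exact: near_open.
pose Y s := T (c s).
have dY (s : R) : O (c s) -> mder Y s 1 (d1v T (c s) (lin v A s)).
  by move=> Os; exact: (F_der oO CT Os (dc s)).
have lin0 : lin v A 0 = v by rewrite /lin scale0r addr0.
have O0 : O (c 0) by rewrite c0E.
have dY1 : mder (fun s : R => d1v T (c s) (lin v A s)) 0 1 A'.
  have := d1v_der oO CT O0 (dc 0) (mder_lin v A 0).
  by rewrite c0E lin0 accel_change.
have th'0 : 0 < th / (2 * C) by rewrite divr_gt0// mulr_gt0.
have coord b : \forall s \near (0 : R), `|(Y s - X s) 0 b| <= th / (2 * C) * s ^+ 2.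
  have df : \forall s \near (0 : R), is_derive (s : R) (1 : R) (fun s : R => Y s 0 b - X s 0 b) (d1v T (c s) (lin v A s) 0 b - lin v' A' s 0 b).
    by apply: filterS nO => s Os; exact: (der_sub (dY s Os 0 b) (mder_pol (T z) v' A' s 0 b)).
  have df1 : is_derive (0 : R) (1 : R) (fun s : R => d1v T (c s) (lin v A s) 0 b - lin v' A' s 0 b) 0.
    by apply: (der_eq (der_sub (dY1 0 b) (mder_lin v' A' 0 0 b))); rewrite subrr.
  have := taylor2 df df1 th'0; apply: filterS => s.
  have -> : Y 0 0 b - X 0 0 b = 0 by rewrite /Y c0E /X pol0 subrr.
  have -> : d1v T (c 0) (lin v A 0) 0 b - lin v' A' 0 0 b = 0.
    by rewrite c0E lin0 /lin scale0r addr0 subrr.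
  by rewrite mulr0 !subr0 !mul0r subr0 [X in _ -> `|X| <= _]mxE [X in _ -> `|_ + X| <= _]mxE.
have nall : \forall s \near (0 : R), forall b, `|(Y s - X s) 0 b| <= th / (2 * C) * s ^+ 2.
  exact: (near0_forall (P := fun b s => `|(Y s - X s) 0 b| <= th / (2 * C) * s ^+ 2) coord).
have nX : \forall s \near (0 : R), `|X s - mg_map k x| <= rho.
  have cX : X @ (0 : R) --> X 0 by exact: mder_near_cont (mder_pol _ _ _ _).
  move: cX => /cvgrPdist_le/(_ rho rho0).
  by apply: filterS => s; rewrite /X pol0 Tz distrC.
have nY : \forall s \near (0 : R), `|Y s - mg_map k x| <= rho.
  have cY : Y @ (0 : R) --> Y 0 by exact: mder_near_cont (dY 0 O0).
  move: cY => /cvgrPdist_le/(_ rho rho0).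
  by apply: filterS => s; rewrite {1}/Y c0E Tz distrC.
have n1 : \forall s \near (0 : R), O (c s) /\ forall b, `|(Y s - X s) 0 b| <= th / (2 * C) * s ^+ 2.
  by apply: filterS2 nO nall => s.
have n2 : \forall s \near (0 : R), `|X s - mg_map k x| <= rho /\ `|Y s - mg_map k x| <= rho.
  by apply: filterS2 nX nY => s.
apply: filterS2 n1 n2 => s [Os cs] [Xs Ys] s0.
have s2 : 0 < s ^+ 2 by rewrite exprn_even_gt0.
have -> : mstep phi i x v s = mg_inv k (Y s) by rewrite /Y /T change_inv.
have -> : mstep phi k x (d1v T z v) s = mg_inv k (X s) by rewrite /mstep -Tz.
apply: le_lt_trans (dist_upper gb Ys Xs) _; rewrite lte_fin.
have : `|X s - Y s| <= th / (2 * C) * s ^+ 2.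
  apply: norm_mx_le; first by rewrite mulr_ge0 ?ltW.
  by move=> a b; rewrite (ord1 a); have := cs b; rewrite -opprB mxE normrN.
move=> h; apply: (@le_lt_trans _ _ (C * (th / (2 * C) * s ^+ 2))); first by apply: ler_wpM2l => //; exact: ltW.
have -> : C * (th / (2 * C) * s ^+ 2) = th * s ^+ 2 / 2 by field; rewrite gt_eqF.
have := mulr_gt0 th0 s2; lra.
Qed.

Definition frame_change (E : 'M[R]_d) : 'M[R]_d := E *m Jch i k z.

Lemma row_frame_change E a : row a (frame_change E) = d1v T z (row a E).
Proof. by rewrite /frame_change row_mul (d1v_jacobian oO CT). Qed.

Lemma frame_err_change E : frame_err k x (frame_change E) = frame_err i x E.
Proof.
apply: eq_bigr => a _; apply: eq_bigr => b _.
by rewrite !row_frame_change -Tz -(isoT Oz).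
Qed.

Lemma coupled_switch (E : 'M[R]_d) (th : R) : 0 < th -> \forall s \near (0 : R), s != 0 ->
  coupled phi i x E k x (frame_change E) s (th * s ^+ 2).
Proof.
move=> th0; have dn : 0 < (d%:R : R) by rewrite ltr0n.
have th'0 : 0 < th / (2 * d%:R) by rewrite divr_gt0// mulr_gt0.
have n1 : \forall s \near (0 : R), forall a, s != 0 ->
    (distance (mstep phi i x (row a E) s) (mstep phi k x (d1v T z (row a E)) s) < (th / (2 * d%:R) * s ^+ 2)%:E)%E.
  by apply: (near0_forall (P := fun a s => s != 0 -> (distance (mstep phi i x (row a E) s) (mstep phi k x (d1v T z (row a E)) s) < (th / (2 * d%:R) * s ^+ 2)%:E)%E)) => a; exact: switch_step.
have n2 := near_oppR n1.
apply: filterS2 n1 n2 => s h1 h2 s0.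
exists (fun=> th / (2 * d%:R) * s ^+ 2), (fun=> th / (2 * d%:R) * s ^+ 2); split.
- by move=> a; rewrite row_frame_change; exact: h1.
- by move=> a; rewrite row_frame_change; have := h2 a; rewrite oppr_eq0 sqrrN; apply.
rewrite sumr_const card_ord -[_ *+ d]mulr_natl le_eqVlt; apply/orP; left; apply/eqP.
by field; rewrite gt_eqF.
Qed.

End ChartSwitch.

Section Chain.
Context {R : realType} {d : nat}.
Variable M : riemannian_manifold R d.
Hypothesis M_complete : complete_manifold M.
Variable phi : M -> R.
Hypothesis Cphi : forall (i : mg_index M) k, Ck_on k (mg_image i) (fun z => phi (mg_inv i z)).
Hypothesis d0 : (0 < d)%N.
Variable K : R.
Hypothesis K0 : 0 <= K.
Hypothesis BE : forall (x : M) (E : 'M[R]_d) w, let i := mg_at x in let y := mg_map i x in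
  let g := mg_metric i in let f := fun z => phi (mg_inv i z) in
  E^T *m E = invmx (g y) ->
  d2 f y w w - d1 f y (Gam g y w w)
  - \sum_a inner (g y) (curvature g y w (row a E) (row a E)) w <= K * inner (g y) w w.
Implicit Types (i k : mg_index M) (x p q : M).

Definition step_to i p (E : 'M[R]_d) q lam r := exists E' : 'M[R]_d,
  frame_err i q E' <= frame_err i p E + lam * dd p q /\
  forall s tau : R, 0 <= s <= r -> 0 < tau ->
    coupled phi i p E i q E' s ((2 * d%:R + (K + 2^-1) * s ^+ 2) * dd p q + tau).

Definition step_near (a lam rho : R) p := exists i r, [/\ 0 < r, mg_dom i p &
  forall q E, (distance p q < rho%:E)%E -> frame_err i p E <= a / 2 -> mg_dom i q /\ step_to i p E q lam r].

(** Two compactness arguments: the first fixes [a], and only then, for a given [lam], does the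
    second fix [rho]. *)
Lemma uniform_step (A : set M) : compact A -> exists2 a : R, 0 < a & forall lam : R, 0 < lam ->
  exists2 rho : R, 0 < rho & forall p, A p -> step_near a lam rho p.
Proof.
move=> cA.
pose P1 (a : R) y0 := forall lam : R, 0 < lam -> exists2 rho : R, 0 < rho &
  forall p, (distance y0 p < rho%:E)%E -> step_near a lam rho p.
have n1 : \forall a \near (0 : R)^'+, A `<=` P1 a.
  apply: ((compact_near_coveringP A).1 cA) => // x Ax.
  have [a [r [rho1 [a0 r0 rho10 H]]]] := step_local Cphi d0 K0 BE x.
  exists ([set y | (distance x y < rho1%:E)%E], [set a' | a' < a]).
    by split; [exact: ball_nbhs|exact: nbhs_right_lt].
  move=> [y a'] [/= xy a'a] lam lam0; have [iy Hy] := H y xy; have [rho rho0 Hr] := Hy lam lam0.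
  have [rho' rho'0 Hd] := nbhs_ball_dist (near_dom iy).
  exists (Num.min rho rho'); first by rewrite lt_min rho0.
  have weak (u v : M) : (distance u v < (Num.min rho rho')%:E)%E -> (distance u v < rho%:E)%E /\ (distance u v < rho'%:E)%E.
    move=> h; split; apply: lt_le_trans h _; rewrite lee_fin ge_min lexx ?orbT//.
  move=> p /weak[yp yp']; exists (mg_at x), r; split => //; first exact: Hd.
  move=> q E /weak[pq _] fe.
  have [|ip iq f1 f2] := Hr p q E yp pq; first by apply: le_trans fe _; lra.
  by split => //; eexists; split; [exact: f1|exact: f2].
have n0 := nbhs_right_gt (0 : R).
have [a [Aa a0]] := @filter_ex _ _ (at_right_proper_filter (0 : R)) _ (filterI n1 n0).
exists a => // lam lam0.
have n2 : \forall rho \near (0 : R)^'+, A `<=` step_near a lam rho.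
  apply: ((compact_near_coveringP A).1 cA) => // x Ax.
  have [rho rho0 H] := Aa x Ax lam lam0.
  exists ([set y | (distance x y < rho%:E)%E], [set r | r < rho]).
    by split; [exact: ball_nbhs|exact: nbhs_right_lt].
  move=> [y r'] [/= xy r'rho]; have [i [r [r0 iy Hy]]] := H y xy.
  exists i, r; split => // q E yq; apply: Hy; apply: lt_trans yq _; by rewrite lte_fin.
have [rho [Arho rho0]] := @filter_ex _ _ (at_right_proper_filter (0 : R)) _ (filterI n2 n0).
by exists rho.
Qed.

(** The error is [o(s ^+ 2)]: the radius may depend on [th] and on the whole chain, so that finitely
    many links can be added without a uniform bound. *)
Definition coupled_at i0 x E0 k p E (L : R) := forall th : R, 0 < th -> exists2 r : R, 0 < r &
  forall s : R, 0 < s < r -> coupled phi i0 x E0 k p E s ((2 * d%:R + (K + 2^-1) * s ^+ 2) * L + th * s ^+ 2).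

(** Three errors of [th / 3]: the chain so far, the change from its last chart to that of the next
    link, and the link itself, whose slack [tau] is taken proportional to [s ^+ 2]. *)
Lemma coupled_at_step i0 x E0 k p (E : 'M[R]_d) L a lam rho q :
  coupled_at i0 x E0 k p E L -> mg_dom k p -> frame_err k p E <= a / 2 ->
  step_near a lam rho p -> (distance p q < rho%:E)%E ->
  exists i E', [/\ mg_dom i q, frame_err i q E' <= frame_err k p E + lam * dd p q &
    coupled_at i0 x E0 i q E' (L + dd p q)].
Proof.
move=> cpl kp fe [i [r [r0 ip H]]] pq.
have fe' : frame_err i p (frame_change k i p E) <= a / 2 by rewrite frame_err_change.
have [iq [E' [fE' cE']]] := H q (frame_change k i p E) pq fe'.
exists i, E'; split => //; first by rewrite frame_err_change in fE'.
move=> th th0; have th3 : 0 < th / 3 by rewrite divr_gt0.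
have [r1 r10 H1] := cpl _ th3.
have /nbhs_ballP[r2 /= r20 H2] := coupled_switch Cphi d0 kp ip E th3.
exists (Num.min (Num.min r1 r2) r); first by rewrite !lt_min r10 r20.
move=> s /andP[s0]; rewrite !lt_min => /andP[/andP[sr1 sr2] sr].
have s2 : 0 < s ^+ 2 by rewrite exprn_gt0.
have c1 := H1 s (introT andP (conj s0 sr1)).
have c2 : coupled phi k p E i p (frame_change k i p E) s (th / 3 * s ^+ 2).
  by apply: (H2 s); rewrite ?gt_eqF// /ball /= sub0r normrN gtr0_norm.
have c3 : coupled phi i p (frame_change k i p E) i q E' s ((2 * d%:R + (K + 2^-1) * s ^+ 2) * dd p q + th / 3 * s ^+ 2).
  by apply: cE'; [rewrite ltW//= ltW|rewrite mulr_gt0].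
apply: coupled_le (coupled_tri (coupled_tri c1 c2) c3).
by rewrite le_eqVlt; apply/orP; left; apply/eqP; field.
Qed.

Lemma coupled_at_refl i x E : coupled_at i x E i x E 0.
Proof.
move=> th th0; exists 1 => // s /andP[s0 _].
have dn : 0 < (d%:R : R) by rewrite ltr0n.
have p0 : 0 < th * s ^+ 2 / (2 * d%:R) by rewrite divr_gt0 ?mulr_gt0// exprn_gt0.
exists (fun=> th * s ^+ 2 / (2 * d%:R)), (fun=> th * s ^+ 2 / (2 * d%:R)); split.
- by move=> a; exact: dlt_refl.
- by move=> a; exact: dlt_refl.
rewrite sumr_const card_ord -[_ *+ d]mulr_natl le_eqVlt; apply/orP; left; apply/eqP.
by field; rewrite gt_eqF.
Qed.

(* The defect of orthonormality gained along the chain is at most [lam] times the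
   length, and [lam] is as small as we like. *)
Lemma coupling_chain i0 x q (E0 : 'M[R]_d) : mg_dom i0 x -> conn x q -> frame_err i0 x E0 = 0 ->
  exists k E, [/\ mg_dom k q, frame_err k q E <= 1 & coupled_at i0 x E0 k q E (dd x q)].
Proof.
move=> ix cxq fe0; set D := dd x q; have D0 : 0 <= D by exact: dd_ge0.
have cB : compact (cball x D) by exact: compact_cball.
have [a a0 Ha] := uniform_step cB.
pose b := Num.min (a / 2) 1; have b0 : 0 < b by rewrite lt_min ltr01 divr_gt0.
have b1 : b <= a / 2 by rewrite ge_min lexx.
have b2 : b <= 1 by rewrite ge_min lexx orbT.
have D1 : 0 < D + 1 by lra.
(* A total defect of at most [b] over the whole chain keeps every link within the tolerance [a / 2]
   and the last frame within 1. *)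
pose lam := b / (D + 1); have lam0 : 0 < lam by rewrite divr_gt0.
have lamD t : 0 <= t -> t <= D -> lam * t <= b.
  by move=> t0 tD; rewrite /lam mulrAC ler_pdivrMr//; apply: ler_wpM2l; [exact: ltW|lra].
have [rho rho0 Hr] := Ha lam lam0.
pose sg := rho / 2; have sg0 : 0 < sg by rewrite divr_gt0.
have sgr : sg < rho by rewrite /sg; lra.
have inA p : conn x p -> dd x p <= D -> cball x D p by move=> c h; apply/cballP.
(* The equation [dd x p + dd p q = D] keeps the points on a discrete geodesic, so the link lengths
   add up to [D] exactly; the maximum with 0 absorbs the last, shorter link. *)
have ind n : exists p k E, [/\ conn x p /\ conn p q, dd x p + dd p q = D, dd p q <= Num.max 0 (D - n%:R * sg) &
    [/\ mg_dom k p, frame_err k p E <= lam * dd x p & coupled_at i0 x E0 k p E (dd x p)]].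
  elim: n => [|n [p [k [E [[cxp cpq] sD le [kp fe cpl]]]]]].
    exists x, i0, E0; rewrite dd_refl; split.
    - by split=> //; exact: conn_refl.
    - by rewrite add0r.
    - by rewrite mul0r subr0 le_max lexx orbT.
    - by rewrite fe0 mulr0; split=> //; exact: coupled_at_refl.
  have P0 := dd_ge0 p q; have X0 := dd_ge0 x p.
  have xpD : dd x p <= D by lra.
  pose t := Num.min sg (dd p q).
  have t0 : 0 <= t by rewrite le_min P0 ltW.
  have tq : t <= dd p q by rewrite ge_min lexx orbT.
  have tsg : t <= sg by rewrite ge_min lexx.
  have [p' [cpp' cp'q e1 e2]] := intermediate_point M_complete cpq (introT andP (conj t0 tq)).
  have pp' : (distance p p' < rho%:E)%E by rewrite dd_lt// e1; exact: le_lt_trans tsg sgr.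
  have fe2 : frame_err k p E <= a / 2 by apply: le_trans fe _; apply: le_trans (lamD _ X0 xpD) b1.
  have [i [E' [ip' fE' cE']]] := coupled_at_step cpl kp fe2 (Hr p (inA p cxp xpD)) pp'.
  have cxp' := conn_tri cxp cpp'.
  have e3 : dd x p' = dd x p + t.
    apply/eqP; rewrite eq_le; have h1 := dd_tri cxp cpp'; have h2 := dd_tri cxp' cp'q.
    by rewrite -e1 h1 /=; rewrite -/D in h2; lra.
  exists p', i, E'; split.
  - by split.
  - by rewrite e3 e2 -sD; ring.
  - rewrite e2 /t; case: (leP sg (dd p q)) => [h|h]; last by rewrite subrr le_max lexx.
    rewrite le_max; apply/orP; right.
    have h' : 0 < dd p q by apply: lt_le_trans h.
    move: le; rewrite le_max => /orP[|]; first by move=> h2; exfalso; lra.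
    by rewrite -natr1 mulrDl mul1r; lra.
  - split => //; last by rewrite e3 -e1.
    by rewrite e3 mulrDr -[in X in _ + X]e1; apply: le_trans fE' _; rewrite lerD2r.
have [n hn] : exists n : nat, D < n%:R * sg.
  exists (Num.Def.archi_bound (D / sg)); rewrite -ltr_pdivrMr//; apply: Num.Theory.archi_boundP.
  by rewrite divr_ge0 ?(ltW sg0).
have [p [k [E [[cxp cpq] sD le [kp fe cpl]]]]] := ind n.
have P0 := dd_ge0 p q; have X0 := dd_ge0 x p.
(* A last link of length 0 leads from [p] to [q], so it need not be shown that they coincide. *)
have pq0 : dd p q = 0.
  by apply/eqP; rewrite eq_le P0 andbT; apply: le_trans le _; rewrite ge_max lexx /= subr_le0 ltW.
have pq : (distance p q < rho%:E)%E by rewrite dd_lt// pq0.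
have xpD : dd x p <= D by lra.
have fe2 : frame_err k p E <= a / 2 by apply: le_trans fe _; apply: le_trans (lamD _ X0 xpD) b1.
have [i [E' [iq fE' cE']]] := coupled_at_step cpl kp fe2 (Hr p (inA p cxp xpD)) pq.
exists i, E'; split=> //.
  apply: le_trans fE' _; rewrite pq0 mulr0 addr0; apply: le_trans fe _.
  exact: le_trans (lamD _ X0 xpD) b2.
by rewrite sD in cE'.
Qed.

End Chain.

(** * The maximum principle *)

(** Gram-Schmidt by ranks: fewer than [d] vectors have a common nonzero orthogonal vector, in the
    kernel of [G *m E^T], which is then normalised. *)
Lemma orthonormal_frame (R : realType) d (G : 'M[R]_d) : G^T = G -> posdef G ->
  exists E : 'M[R]_d, E *m G *m E^T = 1%:M.
Proof.
move=> GT pG.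
suff H k : (k <= d)%N -> exists E : 'M[R]_(k, d), E *m G *m E^T = 1%:M by exact: H (leqnn d).
elim: k => [|k IH] kd.
  by exists 0; apply/matrixP => -[].
have [E HE] := IH (ltnW kd).
have : kermx (G *m E^T) != 0.
  rewrite -mxrank_eq0 mxrank_ker subn_eq0 -ltnNge.
  exact: leq_ltn_trans (rank_leq_col _) kd.
move=> /rowV0Pn[v /sub_kermxP vk v0].
have vv := pG v v0.
pose w := (Num.sqrt (inner G v v))^-1 *: v.
have sn : Num.sqrt (inner G v v) != 0 by rewrite gt_eqF// sqrtr_gt0.
have w1 : w *m G *m w^T = 1%:M.
  apply/matrixP => a b; rewrite (ord1 a) (ord1 b) -/(inner G w w) /w innerZl innerZr !mxE eqxx /=.
  by rewrite -[X in _ * (_ * X)](sqr_sqrtr (ltW vv)); field.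
have w2 : w *m G *m E^T = 0 by rewrite /w -!scalemxAl -mulmxA vk scaler0.
have w3 : E *m G *m w^T = 0.
  by apply: trmx_inj; rewrite !trmx_mul trmxK GT trmx0 mulmxA.
rewrite -addn1; exists (col_mx E w).
by rewrite tr_col_mx mul_col_mx mul_col_row HE w1 w2 w3 -scalar_mx_block.
Qed.

Lemma frame_of_orthonormal (R : realType) d (G E : 'M[R]_d) : E *m G *m E^T = 1%:M ->
  E^T *m E = invmx G.
Proof.
move=> H; have := mulmx1C H; rewrite mulmxA => H1.
have ug : G \in unitmx by case/mulmx1_unit: H1.
by rewrite -[LHS](mulmxK ug) H1 mul1mx.
Qed.

(** If no maximum is attained, every value is below the supremum, and compactness with
    semicontinuity puts all values below one [t'] less than the supremum. Semicontinuity is relative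
    to [A], because [dd] is meaningful for connected points only. *)
Lemma usc_max (R : realType) (X : topologicalType) (A : set X) (f : X -> R) : compact A -> A !=set0 ->
  (forall x, A x -> forall e : R, 0 < e -> \forall y \near x, A y -> f y <= f x + e) ->
  exists2 x, A x & forall y, A y -> f y <= f x.
Proof.
move=> cA [a0 Aa0] usc; apply: contrapT => nomax.
have nm x : A x -> exists2 y, A y & f x < f y.
  move=> Ax; apply: contrapT => H; apply: nomax; exists x => // y Ay.
  by rewrite leNgt; apply/negP => h; apply: H; exists y.
have cover := (compact_near_coveringP A).1 cA.
have [t Ht] : exists t : R, forall x, A x -> f x < t.
  have n1 : \forall t \near +oo, A `<=` (fun x => A x -> f x < t).
    apply: cover => // x Ax.
    exists ([set y | A y -> f y <= f x + 1], [set t | f x + 1 < t]).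
      by split; [exact: usc|apply: nbhs_pinfty_gt; exact: num_real].
    by move=> [y t] [/= h1 h2] Ay; apply: le_lt_trans (h1 Ay) h2.
  have [t Ht] := @filter_ex _ _ proper_pinfty_nbhs _ n1.
  by exists t => x Ax; exact: Ht.
pose S := [set f x | x in A].
have S0 : S !=set0 by exists (f a0), a0.
have ubS : has_ubound S by exists t => _ [x Ax <-]; exact: ltW (Ht x Ax).
have hs : has_sup S by [].
have lts x : A x -> f x < sup S.
  move=> Ax; have [y Ay h] := nm x Ax; apply: lt_le_trans h _.
  by apply: ub_le_sup => //; exists y.
have n2 : \forall t \near (sup S)^'-, A `<=` (fun x => A x -> f x < t).
  apply: cover => // x Ax; have h := lts x Ax.
  exists ([set y | A y -> f y <= f x + (sup S - f x) / 2], [set t | f x + (sup S - f x) / 2 < t]).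
    split; first by apply: usc => //; rewrite divr_gt0// subr_gt0.
    by apply: nbhs_left_gt; lra.
  by move=> [y t'] [/= h1 h2] Ay; apply: le_lt_trans (h1 Ay) h2.
have n3 := nbhs_left_lt (sup S).
have [t' [Ht' t's]] := @filter_ex _ _ (at_left_proper_filter (sup S)) _ (filterI n2 n3).
have : sup S <= t' by apply: ge_sup => // _ [x Ax <-]; exact: ltW (Ht' x Ax Ax).
by rewrite leNgt t's.
Qed.

Lemma ln_increment (R : realType) (a b : R) : 0 < a -> 0 < b -> ln b <= ln a + (b - a) / a.
Proof.
move=> a0 b0; have h : ln (1 + (b / a - 1)) <= b / a - 1.
  by apply: le_ln1Dx; rewrite ltrBrDr addNr divr_gt0.
have e1 : 1 + (b / a - 1) = b / a by ring.
rewrite e1 ln_div ?posrE// in h.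
have e2 : (b - a) / a = b / a - 1 by field; rewrite gt_eqF.
rewrite e2; lra.
Qed.

Section SecondOrder.
Context {R : realType} {d : nat}.
Variable M : riemannian_manifold R d.
Variable phi : M -> R.
Hypothesis Cphi : forall (i : mg_index M) k, Ck_on k (mg_image i) (fun z => phi (mg_inv i z)).
Hypothesis d0 : (0 < d)%N.

(** Second derivative at 0 of [w] along a step from [z] with velocity [v]. *)
Definition step_rate (i : mg_index M) (w : 'rV[R]_d -> R) z v : R := d2 w z v v + d1 w z (accel phi i z v).

(** [taylor2] for [s] and [- s]: the first-order terms cancel. *)
Lemma second_order (i : mg_index M) (w : 'rV[R]_d -> R) z (E : 'M[R]_d) (th : R) :
  Ck_on 2 (mg_image i) w -> mg_image i z -> 0 < th ->
  \forall s \near (0 : R), forall a : 'I_d,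
   `|w (pol z (row a E) (accel phi i z (row a E)) s) + w (pol z (row a E) (accel phi i z (row a E)) (- s))
    - 2 * w z - s ^+ 2 * step_rate i w z (row a E)| <= th * s ^+ 2.
Proof.
move=> Cw iz th0; apply: (near0_forall (P := fun a s => `|w (pol z (row a E) (accel phi i z (row a E)) s) + w (pol z (row a E) (accel phi i z (row a E)) (- s))
    - 2 * w z - s ^+ 2 * step_rate i w z (row a E)| <= th * s ^+ 2)) => a.
set v := row a E; set A := accel phi i z v; pose c : R -> 'rV[R]_d := pol z v A.
have oi : open (mg_image i) by exact: image_open.
have c0E : c 0 = z by exact: pol0.
have dc (s : R) : mder c s 1 (lin v A s) by exact: mder_pol.
have nO : \forall s \near (0 : R), mg_image i (c s).
  have cc : {for (0 : R), continuous c} by exact: mder_near_cont (dc 0).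
  by apply: cc; rewrite c0E; exact: near_open.
have lin0 : lin v A 0 = v by rewrite /lin scale0r addr0.
have O0 : mg_image i (c 0) by rewrite c0E.
have df : \forall s \near (0 : R), is_derive (s : R) (1 : R) (fun s : R => w (c s)) (d1 w (c s) (lin v A s)).
  by apply: filterS nO => s Os; exact: (f_chain oi (Ck_onW Cw) Os (dc s)).
have df1 : is_derive (0 : R) (1 : R) (fun s : R => d1 w (c s) (lin v A s)) (step_rate i w z v).
  apply: (der_eq (d1_der oi Cw O0 (dc 0) (mder_lin v A 0))).
  by rewrite c0E lin0.
have th2 : 0 < th / 2 by rewrite divr_gt0.
have n1 := taylor2 df df1 th2; have n2 := near_oppR n1.
apply: filterS2 n1 n2 => s; rewrite c0E sqrrN => h1 h2.
have -> : w (c s) + w (c (- s)) - 2 * w z - s ^+ 2 * step_rate i w z v =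
  (w (c s) - w z - s * d1 w z (lin v A 0) - step_rate i w z v / 2 * s ^+ 2)
  + (w (c (- s)) - w z - - s * d1 w z (lin v A 0) - step_rate i w z v / 2 * s ^+ 2) by field.
apply: le_trans (ler_normD _ _) _; lra.
Qed.

(** With the Christoffel part of the acceleration the trace over the frame is the Laplacian; the [d]
    copies of [zeta] add up to the gradient of [phi]. *)
Lemma step_rate_sum (i : mg_index M) (w : 'rV[R]_d -> R) z (E : 'M[R]_d) : mg_image i z ->
  E^T *m E = invmx (mg_metric i z) ->
  \sum_a step_rate i w z (row a E) =
  \sum_(k < d) \sum_(l < d) invmx (mg_metric i z) k l * hessian (mg_metric i) w k l z
  + inner (mg_metric i z) (grad (mg_metric i) (fun z => phi (mg_inv i z)) z) (grad (mg_metric i) w z).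
Proof.
move=> iz EE; set g := mg_metric i.
have dn : (d%:R : R) != 0 by rewrite pnatr_eq0 -lt0n.
have ug : g z \in unitmx by apply: posdef_unit; exact: metric_pos.
have gs : (g z)^T = g z by exact: metric_sym.
have E1 v : step_rate i w z v = (d2 w z v v - d1 w z (Gam g z v v)) + d1 w z (zeta g (phic phi i) z).
  rewrite /step_rate; have -> : d1 w z (accel phi i z v) = d1 w z (zeta g (phic phi i) z) - d1 w z (Gam g z v v).
    rewrite /accel d1D; congr (_ + _); move: (Gam _ _ _ _) => x.
    have -> : - x = (-1) *: x by rewrite scaleN1r.
    by rewrite d1Z mulN1r.
  by rewrite addrCA addrC.
rewrite (eq_bigr _ (fun a _ => E1 (row a E))) big_split /=; congr (_ + _).
  rewrite (frame_trace EE (f := fun u v => d2 w z u v - d1 w z (Gam g z u v))).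
  - apply: eq_bigr => k _; apply: eq_bigr => l _; congr (_ * _).
    rewrite d2_delta; congr (_ - _); apply: eq_bigr => p _.
    by rewrite mxE inner_delta mxE mulrC.
  - by move=> a u u' v; rewrite /d2 innerDl innerZl GamDl GamZl d1D d1Z; ring.
  - by move=> a u v v'; rewrite /d2 innerDr innerZr GamDr GamZr d1D d1Z; ring.
rewrite sumr_const card_ord -[_ *+ d]mulr_natl /zeta d1Z mulrA divff// mul1r.
rewrite /grad -/g {1}/inner trmx_mul trmx_inv gs !mulmxA mulmxKV// -mulmxA.
rewrite (_ : _ *m (_ *m _) = (\row_k partial k (phic phi i) z *m invmx (g z)) *m (\row_k partial k w z)^T); last by rewrite mulmxA.
by rewrite /d1 [RHS]mxE; apply: eq_bigr => k _; rewrite [X in _ = _ * X]mxE [X in _ = _ * X]mxE mulrC.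
Qed.

End SecondOrder.

(** [s] stands for the square of the step size; [su] and [sb] are the summed second differences of
    [u] and of the coordinate penalty, [sr] the sum of the bounds on the moved distances. After
    division by [s], the hypotheses [h1] and [h2] leave at most [e0 / 2 + e0 / 4] against [e0]. *)
Lemma budget_contradiction (R : realType) (n e0 dl A b K th s D su sb sr : R) :
  0 <= n -> 0 < e0 -> 0 < dl -> 0 <= A -> 0 <= K -> 0 < th -> 0 < s -> 0 <= D ->
  dl * (A * b + K + 2) <= e0 / 2 -> th * (n + dl * (A * n + 2)) <= e0 / 4 ->
  s * e0 - n * th * s <= su -> su <= dl * (A * sb + (sr - 2 * n * D) / (1 + D)) ->
  sb <= s * b + n * th * s -> sr <= (2 * n + (K + 2^-1) * s) * D + 2 * th * s -> False.
Proof.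
move=> n0 e00 dl0 A0 K0 th0 s0 D0 h1 h2 h3 h4 h5 h6.
have D1 : 0 < 1 + D by lra.
have g1 : (sr - 2 * n * D) / (1 + D) <= (K + 2^-1 + 2 * th) * s.
  rewrite ler_pdivrMr//; apply: (@le_trans _ _ ((K + 2^-1) * s * D + 2 * th * s)); first lra.
  have p1 : 0 <= (K + 2^-1) * s by apply: mulr_ge0; lra.
  have p2 : 0 <= 2 * th * s * D by apply: mulr_ge0 => //; apply: mulr_ge0; lra.
  by rewrite mulrDl mulrDr mulr1; move: p1 p2; lra.
have g2 : A * sb <= A * (s * b + n * th * s) by apply: ler_wpM2l.
have g3 : dl * (A * sb + (sr - 2 * n * D) / (1 + D)) <=
   dl * (A * (s * b + n * th * s) + (K + 2^-1 + 2 * th) * s) by apply: ler_wpM2l; [exact: ltW|exact: lerD].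
have g4 : dl * (A * (s * b + n * th * s) + (K + 2^-1 + 2 * th) * s) =
  s * (dl * (A * b + K + 2) - dl * (2 - 2^-1) + th * (dl * (A * n + 2))) by ring.
have g5 : s * (e0 - n * th) <= s * (dl * (A * b + K + 2) - dl * (2 - 2^-1) + th * (dl * (A * n + 2))).
  by rewrite -g4; apply: le_trans (le_trans h4 g3); apply: le_trans h3; rewrite mulrBr; lra.
have g6 : e0 - n * th <= dl * (A * b + K + 2) - dl * (2 - 2^-1) + th * (dl * (A * n + 2)).
  by move: g5; rewrite ler_pM2l.
rewrite mulrDr in h2.
have g7 : 0 < dl * (2 - 2^-1) by apply: mulr_gt0 => //; lra.
by move: h1 h2 g6 g7; rewrite (mulrC n th); lra.
Qed.

(* Concavity of [ln], linearised at [1 + D]. *)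
Lemma penalised_step (R : realType) (ux u0 dl A sq sq0 d1 D r : R) : 0 < dl -> 0 <= D -> 0 <= d1 -> d1 < r ->
  ux - dl * (A * sq + ln (1 + d1)) <= u0 - dl * (A * sq0 + ln (1 + D)) ->
  ux - u0 <= dl * (A * (sq - sq0) + (r - D) / (1 + D)).
Proof.
move=> dl0 D0 d10 dr H.
have D1 : 0 < 1 + D by rewrite ltr_wpDr.
have D2 : 0 < 1 + d1 by rewrite ltr_wpDr.
have L := ln_increment D1 D2.
have L2 : (1 + d1 - (1 + D)) / (1 + D) <= (r - D) / (1 + D) by rewrite ler_pM2r ?invr_gt0//; lra.
have L3 : dl * (A * sq + ln (1 + d1)) <= dl * (A * sq + (ln (1 + D) + (r - D) / (1 + D))).
  by apply: ler_wpM2l; [exact: ltW|rewrite lerD2l; lra].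
have R1 : dl * (A * (sq - sq0) + (r - D) / (1 + D)) =
  dl * (A * sq + (ln (1 + D) + (r - D) / (1 + D))) - dl * (A * sq0 + ln (1 + D)) by ring.
by rewrite R1; lra.
Qed.

Section DistanceSquare.
Context {R : realType} {d : nat}.
Variables (U : set 'rV[R]_d) (z0 : 'rV[R]_d).
Hypothesis oU : open U.

(** The norm of ['rV] is a maximum and not smooth; the Euclidean square is smooth and dominates its
    square by [sqdist_ge]. *)
Definition sqdist (z : 'rV[R]_d) : R := \sum_k (z 0 k - z0 0 k) * (z 0 k - z0 0 k).

Lemma sqdist_smooth k : Ck_on k U sqdist.
Proof.
apply: Ck_on_sum => // j _; have C : Ck_on k U (fun z => z 0 j - z0 0 j).
  by apply: Ck_on_sub => //; [exact: Ck_on_coord|exact: Ck_on_cst].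
exact: Ck_on_mul.
Qed.

Lemma sqdist_ge z : `|z - z0| ^+ 2 <= sqdist z.
Proof.
have s0 : 0 <= sqdist z by apply: sumr_ge0 => k _; rewrite -expr2 sqr_ge0.
rewrite -[leRHS](sqr_sqrtr s0) ler_pXn2r ?nnegrE ?sqrtr_ge0 ?normr_ge0//.
apply: norm_mx_le; first exact: sqrtr_ge0.
move=> i k; rewrite (ord1 i) !mxE -sqrtr_sqr; apply: ler_wsqrtr.
rewrite /sqdist (bigD1 k)//= expr2 lerDl; apply: sumr_ge0 => l _.
by rewrite -expr2 sqr_ge0.
Qed.

Lemma sqdist0 : sqdist z0 = 0.
Proof. by rewrite /sqdist big1// => k _; rewrite subrr mulr0. Qed.

End DistanceSquare.

Section Final.
Context {R : realType} {d : nat}.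
Variable M : riemannian_manifold R d.
Hypothesis M_complete : complete_manifold M.
Variable phi : M -> R.
Hypothesis Cphi : forall (i : mg_index M) k, Ck_on k (mg_image i) (fun z => phi (mg_inv i z)).
Hypothesis d0 : (0 < d)%N.
Variable K : R.
Hypothesis K0 : 0 <= K.
Hypothesis BE : forall (x : M) (E : 'M[R]_d) w, let i := mg_at x in let y := mg_map i x in
  let g := mg_metric i in let f := fun z => phi (mg_inv i z) in
  E^T *m E = invmx (g y) ->
  d2 f y w w - d1 f y (Gam g y w w)
  - \sum_a inner (g y) (curvature g y w (row a E) (row a E)) w <= K * inner (g y) w w.
Implicit Types (x p q : M).
Variable u : M -> R.
Hypothesis Cu : C2 u.

Lemma C2_continuous x : {for x, continuous u}.
Proof.
have ix := at_dom x.
apply: (@near_continuous _ _ ((u \o mg_inv (mg_at x)) \o mg_map (mg_at x))).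
  by apply: filterS (near_dom ix) => y iy; rewrite /= inv_map.
apply: continuous_comp; first exact: map_cont.
exact: Ck_on_cont (Cu (mg_at x)) (image_map ix).
Qed.

Section Maximum.
Variables (o : M) (C rho0 r dl A Rb : R).
Let i0 := mg_at o.
Let z0 := mg_map i0 o.
Hypotheses (gb : good_ball i0 z0 rho0 C) (r0 : 0 < r) (rrho : r <= rho0) (dl0 : 0 < dl) (A0 : 0 <= A).
Let P := ('rV[R]_d * M)%type.
Let G (t : P) : R := u t.2 - dl * (A * sqdist z0 t.1 + ln (1 + dd (mg_inv i0 t.1) t.2)).
Let B : set P := [set z | `|z - z0| <= r] `*` cball o Rb.

Lemma ball_conn z : `|z - z0| <= r -> conn o (mg_inv i0 z) /\ dd o (mg_inv i0 z) <= C * r.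
Proof.
have [rho00 C1 _] := gb.
move=> zr; have io : mg_inv i0 z0 = o by rewrite inv_map//; exact: at_dom.
have h0 : `|z0 - z0| <= rho0 by rewrite subrr normr0 ltW.
have := dist_upper gb h0 (le_trans zr rrho); rewrite io => h.
have c : conn o (mg_inv i0 z) by apply: le_lt_trans h _; exact: ltry.
split=> //; move: h; rewrite distE// lee_fin => /le_trans; apply.
by apply: ler_wpM2l => //; lra.
Qed.

Lemma penalised_max : 0 <= Rb -> exists2 t, B t & forall t', B t' -> G t' <= G t.
Proof.
move=> Rb0; apply: usc_max.
- by apply: compact_setX; [exact: compact_ball_rV|exact: compact_cball].
- exists (z0, o); split => /=; first by rewrite subrr normr0 ltW.
  by apply/cballP; split; [exact: conn_refl|rewrite dd_refl].
move=> [z x] [/= zr /cballP[cx xr]] e e0.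
have [cq qr] := ball_conn zr.
have iz : mg_image i0 z by have [_ _ H] := gb; exact: (H z (le_trans zr rrho)).1.
(* One quarter of [e] for [u] and three for the penalty: one for [sqdist], two for the two ends of
   the distance. *)
pose e1 := e / 4; have e10 : 0 < e1 by rewrite divr_gt0.
pose e2 := e1 / dl; have e20 : 0 < e2 by rewrite divr_gt0.
have A1 : 0 < A + 1 by apply: ltr_wpDl.
pose e3 := e2 / (A + 1); have e30 : 0 < e3 by rewrite divr_gt0.
have oi : open (mg_image i0) by exact: image_open.
have nz1 : \forall z' \near z, `|sqdist z0 z - sqdist z0 z'| <= e3.
  have cs : {for z, continuous (sqdist z0)} := Ck_on_cont (sqdist_smooth z0 oi 0) iz.
  by move: cs => /cvgrPdist_le/(_ e3 e30).
have nz2 : \forall z' \near z, (distance (mg_inv i0 z) (mg_inv i0 z') < e2%:E)%E.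
  by have nb := @ball_nbhs _ _ M (mg_inv i0 z) e2 e20; exact: (inv_cont iz nb).
have nx1 : \forall x' \near x, `|u x - u x'| <= e1.
  have cu := @C2_continuous x.
  by move: cu => /cvgrPdist_le/(_ e1 e10).
have nx2 : \forall x' \near x, (distance x x' < e2%:E)%E by exact: ball_nbhs.
exists ([set z' | `|sqdist z0 z - sqdist z0 z'| <= e3 /\ (distance (mg_inv i0 z) (mg_inv i0 z') < e2%:E)%E],
        [set x' | `|u x - u x'| <= e1 /\ (distance x x' < e2%:E)%E]).
  by split; [apply: filterS2 nz1 nz2 => z'|apply: filterS2 nx1 nx2 => x'].
move=> [z' x'] [/= [h1 h2] [h3 h4]] [/= zr' /cballP[cx' xr']].
have [cq' qr'] := ball_conn zr'.
rewrite /G /=; set q := mg_inv i0 z in h2 cq *; set q' := mg_inv i0 z' in h2 cq' *.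
have cqx : conn q x := conn_tri (conn_sym cq) cx.
have cqx' : conn q' x' := conn_tri (conn_sym cq') cx'.
have cqq' : conn q q' := lt_conn h2.
have cxx' : conn x' x := conn_sym (lt_conn h4).
have t1 := dd_tri cqq' (conn_tri cqx' cxx'); have t2 := dd_tri cqx' cxx'.
have l2 := lt_dd h2; have l4 := lt_dd h4; rewrite (dd_sym (lt_conn h4)) in l4.
have D0 := dd_ge0 q' x'.
have D1 : 0 < 1 + dd q' x' by lra.
have D2 : 0 < 1 + dd q x by have := dd_ge0 q x; lra.
have L := ln_increment D1 D2.
have L2 : (1 + dd q x - (1 + dd q' x')) / (1 + dd q' x') <= 2 * e2.
  rewrite ler_pdivrMr//; apply: (@le_trans _ _ (2 * e2)); first lra.
  by rewrite ler_peMr; lra.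
have S1 : A * (sqdist z0 z - sqdist z0 z') <= e2.
  apply: (@le_trans _ _ (A * e3)).
    by apply: ler_wpM2l => //; apply: le_trans h1; exact: ler_norm.
  by rewrite /e3 mulrA ler_pdivrMr// mulrC; apply: ler_wpM2l; [exact: ltW|rewrite lerDl].
have U1 : u x' - u x <= e1 by apply: le_trans h3; rewrite distrC; exact: ler_norm.
have E1 : dl * e2 = e1 by rewrite /e2 mulrCA divff ?mulr1// gt_eqF.
have F : dl * (A * sqdist z0 z + ln (1 + dd q x)) - dl * (A * sqdist z0 z' + ln (1 + dd q' x')) <= dl * (3 * e2).
  by rewrite -mulrBr; apply: ler_wpM2l; [exact: ltW|move: S1 L L2; rewrite mulrBr; lra].
have : dl * (3 * e2) = 3 * e1 by rewrite -E1; ring.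
by move: F U1; rewrite /e1; lra.
Qed.

End Maximum.

Lemma unit_vector : exists w : 'rV[R]_d, `|w| = 1.
Proof.
pose w : 'rV[R]_d := const_mx 1; have w0 : w != 0.
  by apply/eqP => /rowP/(_ (Ordinal d0)); rewrite !mxE => /eqP; rewrite oner_eq0.
by exists (`|w|^-1 *: w); rewrite normrZ ger0_norm ?invr_ge0// mulVf// normr_eq0.
Qed.

(** [uniform_near] is used with the tolerance inverted: the rates converge, so the bound [a^-1]
    holds eventually as [a] tends to 0, and the extracted [a] gives [b]. Thus [b] depends on the
    chart at [o] and on [M1], not on the constants chosen later. *)
Lemma penalty_rate (o : M) (M1 : R) : exists b r : R, [/\ 0 < b, 0 < r &
  forall (E : 'M[R]_d) z, `|E| <= M1 -> `|z - mg_map (mg_at o) o| <= r ->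
  \sum_a step_rate phi (mg_at o) (sqdist (mg_map (mg_at o) o)) z (row a E) <= b].
Proof.
set i := mg_at o; set z0 := mg_map i o.
have iz0 : mg_image i z0 by apply: image_map; exact: at_dom.
have oi : open (mg_image i) by exact: image_open.
have [|a [r [a0 r0 H]]] := @uniform_near R d z0
  (fun E w s z (y c : 'rV[R]_d) a => \sum_b step_rate phi i (sqdist z0) z (row b E) <= a^-1) M1; last first.
  exists a^-1, r; split; rewrite ?invr_gt0// => E z EM zr; have [w w1] := unit_vector.
  by apply: (H E w 0 z z0 z0) => //; rewrite ?subrr normr0 ltW.
move=> T F FF E w s z y c a E0 w0 cE cw cs cz cp cc ca w01.
have cR : (fun t => \sum_b step_rate phi i (sqdist z0) (z t) (row b (E t))) @ F -->
    \sum_b step_rate phi i (sqdist z0) z0 (row b E0).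
  apply: cvg_bigsum => b _; have cb := row_cvg (a := b) FF cE.
  have CS n : Ck_on n (mg_image i) (sqdist z0) by exact: sqdist_smooth.
  have Cg (k : nat) a' b' : Ck_on k (mg_image i) (fun z => mg_metric i z a' b') by exact: metric_smooth.
  have pg w' : mg_image i w' -> posdef (mg_metric i w') by exact: metric_pos.
  apply: cvgD.
    apply: inner_cvg => //; apply: (mx_cvg iz0 cz) => k l; exact: hessm_C1 (CS 2).
  apply: (d1_cvg iz0 cz (CS 1)); apply: cvgB.
    apply: (mx_cvg iz0 cz) => k l; rewrite (ord1 k).
    exact: (zeta_smooth oi Cg pg (fun n => Cphi i n)).
  exact: (Gam_cvg oi iz0 cz Cg pg cb cb).
set L := \sum_b _ in cR.
have n1 : \forall t \near F, \sum_b step_rate phi i (sqdist z0) (z t) (row b (E t)) < `|L| + 1.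
  by apply: (cvgr_lt _ cR); have := ler_norm L; lra.
have L1 : 0 < `|L| + 1 by have := normr_ge0 L; lra.
have n2 : \forall t \near F, a t < (`|L| + 1)^-1.
  have p : 0 < (`|L| + 1)^-1 by rewrite invr_gt0.
  exact: (ca _ (nbhs_right_lt p)).
have n3 : \forall t \near F, 0 < a t by exact: (ca _ (nbhs_right_gt (0 : R))).
apply: filterS3 n1 n2 n3 => t h1 h2 h3; apply: ltW; apply: lt_le_trans h1 _.
by rewrite -[leLHS]invrK lef_pV2 ?posrE ?invr_gt0// ltW.
Qed.

End Final.

Lemma near0_positive (R : realType) (P : R -> Prop) : (\forall s \near (0 : R), P s) ->
  exists2 s, 0 < s & P s.
Proof.
move=> /nbhs_ballP[r /= r0 br]; exists (r / 2); first by rewrite divr_gt0.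
by apply: br; rewrite /ball /= sub0r normrN gtr0_norm ?divr_gt0//; lra.
Qed.

(* The term in [sqdist] keeps the maximising [z] inside the chart at [o]; the distance
   is only controlled through the coupling, never differentiated. *)
Lemma no_strict_subsolution (R : realType) d (M : riemannian_manifold R d) (phi u : M -> R)
    (K gam e0 ub : R) (o : M) :
  complete_manifold M ->
  (forall (i : mg_index M) k, Ck_on k (mg_image i) (fun z => phi (mg_inv i z))) ->
  (0 < d)%N -> 0 <= K ->
  (forall (x : M) (E : 'M[R]_d) w, let i := mg_at x in let y := mg_map i x in
    let g := mg_metric i in let f := fun z => phi (mg_inv i z) in
    E^T *m E = invmx (g y) ->
    d2 f y w w - d1 f y (Gam g y w w)
    - \sum_a inner (g y) (curvature g y w (row a E) (row a E)) w <= K * inner (g y) w w) ->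
  C2 u -> gam < u o -> (forall x, u x <= ub) -> 0 < e0 ->
  (forall x, gam < u x -> e0 <= laplacian u x + grad_inner phi u x) -> False.
Proof.
move=> M_complete Cphi d0 K0 BE Cu uo u_le e00 Lu.
set i0 := mg_at o; set z0 := mg_map i0 o.
have io : mg_dom i0 o by exact: at_dom.
have oi : open (mg_image i0) by exact: image_open.
have [C [rho0 [C1 gb]]] := good_chart o; have [rho00 _ gbi] := gb.
have [b [r1 [b0 r10 Hb]]] := penalty_rate Cphi d0 o (2 * C).
pose r := Num.min rho0 r1; have r0 : 0 < r by rewrite lt_min rho00.
have rr : r <= rho0 by rewrite ge_min lexx.
have rr1 : r <= r1 by rewrite ge_min lexx orbT.
have CC : 0 < C by exact: lt_le_trans C1.
(* Larger than [C / r], so that on the sphere of radius [r] the penalty [A * r ^+ 2] exceeds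
   [C * r], the most that the distance can save by moving [q] away from [o]. *)
pose A := C / r + 1; have A0 : 0 < A by rewrite ltr_wpDl// divr_ge0 ?ltW.
have Ar : C * r < A * r ^+ 2.
  rewrite /A mulrDl mul1r expr2 mulrA divfK ?gt_eqF// ltrDl mulr_gt0//.
(* Rate of the penalty relative to [dl]: [A * b] from the coordinates, and [K] with some slack from
   the logarithm of the distance. *)
pose S := A * b + K + 2; have S0 : 0 < S.
  by rewrite /S; have := mulr_gt0 A0 b0; have := K0; clear; lra.
pose dl := e0 / (2 * S); have dl0 : 0 < dl by rewrite divr_gt0 ?mulr_gt0.
have hdl : dl * S <= e0 / 2.
  by rewrite le_eqVlt; apply/orP; left; apply/eqP; rewrite /dl; field; rewrite gt_eqF.
pose n : R := d%:R; have n0 : 0 < n by rewrite ltr0n.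
pose N := n + dl * (A * n + 2).
have N0 : 0 < N.
  have An := mulr_gt0 A0 n0; have An2 : 0 < A * n + 2 by move: An; clear; lra.
  by rewrite /N; have := mulr_gt0 dl0 An2; move: n0; clear; lra.
pose th := e0 / (4 * N); have th0 : 0 < th by rewrite divr_gt0 ?mulr_gt0.
have hth : th * N <= e0 / 4.
  by rewrite le_eqVlt; apply/orP; left; apply/eqP; rewrite /th; field; rewrite gt_eqF.
(* Beyond this radius the logarithm alone outweighs [ub - u o], so that the maximum over the compact
   set is global on the component of [o]. *)
pose Rb := C * r + expR ((ub - u o) / dl).
have Cr0 : 0 < C * r by rewrite mulr_gt0.
have Rb0 : 0 <= Rb by rewrite /Rb addr_ge0 ?expR_ge0 ?(ltW Cr0).
pose inB z := `|z - z0| <= r.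
have bc z : inB z -> conn o (mg_inv i0 z) /\ dd o (mg_inv i0 z) <= C * r.
  by move=> h; exact: (ball_conn gb rr h).
pose G z x := u x - dl * (A * sqdist z0 z + ln (1 + dd (mg_inv i0 z) x)).
have invz0 : mg_inv i0 z0 = o by rewrite inv_map.
have Goo : G z0 o = u o.
  by rewrite /G sqdist0 invz0 dd_refl mulr0 add0r addr0 ln1 mulr0 subr0.
have sq0 z : 0 <= sqdist z0 z by apply: le_trans (sqdist_ge z0 z); rewrite sqr_ge0.
have ln0 p q : 0 <= ln (1 + dd p q) by apply: ln_ge0; rewrite lerDl; exact: dd_ge0.
have [[zs xs] [/= zsB /cballP[cxs xsR]] Gmax] := penalised_max M_complete Cu gb r0 rr dl0 (ltW A0) Rb0.
rewrite -/i0 -/z0 in zsB Gmax.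
have Gle z x : inB z -> conn o x -> G z x <= G zs xs.
  move=> zB cx; have [h|h] := leP (dd o x) Rb.
    by apply: (Gmax (z, x)); split => //=; apply/cballP.
  apply: (@le_trans _ _ (u o)); last first.
    rewrite -Goo; apply: (Gmax (z0, o)); split => /=; first by rewrite subrr normr0 ltW.
    by apply/cballP; split; [exact: conn_refl|rewrite dd_refl].
  have [cq qr] := bc z zB.
  have t1 := dd_tri cq (conn_tri (conn_sym cq) cx).
  have ex : expR ((ub - u o) / dl) < 1 + dd (mg_inv i0 z) x.
    by move: h; rewrite /Rb; move: t1 qr; clear; lra.
  have lx : (ub - u o) / dl <= ln (1 + dd (mg_inv i0 z) x).
    rewrite -[leLHS]expRK ler_ln ?posrE ?expR_gt0//; first exact: ltW.
    exact: lt_trans (expR_gt0 _) ex.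
  have ux : ub - u o <= dl * ln (1 + dd (mg_inv i0 z) x).
    by rewrite mulrC -ler_pdivrMr.
  have s0 : 0 <= dl * (A * sqdist z0 z) by apply: mulr_ge0; [exact: ltW|apply: mulr_ge0; [exact: ltW|exact: sq0]].
  by rewrite /G mulrDr; have := u_le x; move: s0 ux; clear; lra.
have [cqs qsr] := bc zs zsB.
set qs := mg_inv i0 zs in cqs qsr.
have cqx : conn qs xs := conn_tri (conn_sym cqs) cxs.
pose D := dd xs qs; have D0 : 0 <= D by exact: dd_ge0.
have Dsym : dd qs xs = D by exact: dd_sym.
(* If [zs] were on the sphere, returning to [z0] would lengthen the distance by at most [C * r] and
   save [A * r ^+ 2]. *)
have zs_in : `|zs - z0| < r.
  rewrite lt_neqAle zsB andbT; apply/eqP => E.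
  have h1 := Gle z0 xs; rewrite /inB subrr normr0 in h1; move: (h1 (ltW r0) cxs).
  rewrite /G sqdist0 invz0 mulr0 add0r -/qs Dsym lerD2l lerN2 ler_pM2l//.
  have D1 : 0 < 1 + D by rewrite ltr_wpDr.
  have D2 : 0 < 1 + dd o xs by rewrite ltr_wpDr// dd_ge0.
  have L := ln_increment D1 D2; have t1 := dd_tri cqs cqx; rewrite Dsym in t1.
  have L2 : (1 + dd o xs - (1 + D)) / (1 + D) <= C * r.
    rewrite ler_pdivrMr//; apply: (@le_trans _ _ (C * r)); first by move: t1 qsr; clear; lra.
    by rewrite ler_peMr ?lerDl// ltW.
  have s1 : A * r ^+ 2 <= A * sqdist z0 zs.
    by apply: ler_wpM2l; [exact: ltW|rewrite -E; exact: sqdist_ge].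
  by move: L L2 s1 Ar; clear; lra.
have uxs : gam < u xs.
  apply: lt_le_trans uo _; rewrite -Goo; apply: (@le_trans _ _ (G zs xs)).
    by apply: Gle; [rewrite /inB subrr normr0 ltW|exact: conn_refl].
  rewrite /G gerBl; apply: mulr_ge0; first exact: ltW.
  by apply: addr_ge0; [apply: mulr_ge0; [exact: ltW|exact: sq0]|exact: ln0].
have LL := Lu xs uxs.
have izs : mg_image i0 zs by exact: (gbi zs (le_trans zsB rr)).1.
have iqs : mg_dom i0 qs by exact: dom_inv.
have mqs : mg_map i0 qs = zs by exact: map_inv.
set ix := mg_at xs; set zx := mg_map ix xs.
have dx : mg_dom ix xs by exact: at_dom.
have izx : mg_image ix zx by exact: image_map.
have [E0 HE0] := orthonormal_frame (metric_sym izx) (metric_pos izx).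
have fe0 : frame_err ix xs E0 = 0.
  apply: big1 => a _; apply: big1 => a' _; apply/eqP; rewrite normr_eq0 subr_eq0; apply/eqP.
  have /matrixP/(_ a a') := HE0; rewrite [in X in _ = X -> _]mxE => <-.
  by rewrite frame_row [LHS]mxE [RHS]mxE; apply: eq_bigr => k' _; rewrite !mxE.
(* The chain starts at [xs] with an exact frame, because the operator is traced there. It ends at
   [qs] in some chart [k], from which the frame is moved to the chart at [o] in which the penalty is
   written. *)
have [k [E [kq feq cpl]]] := coupling_chain M_complete Cphi d0 K0 BE dx (conn_sym cqx) fe0.
pose E1 := frame_change k i0 qs E.
have E1M : `|E1| <= 2 * C.
  apply: (frame_bound (x := qs) gb); first by rewrite mqs; exact: le_trans zsB rr.
  by rewrite frame_err_change.
have [r2 r20 cpl1] := cpl th th0.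
have cpl2 := coupled_switch Cphi d0 kq iqs E th0.
have so1 := second_order phi E0 (Cu ix) izx th0.
have CS : Ck_on 2 (mg_image i0) (sqdist z0) by exact: sqdist_smooth.
have so2 := second_order phi E1 CS izs th0.
pose zp a (s : R) := pol zs (row a E1) (accel phi i0 zs (row a E1)) s.
have nz : \forall s \near (0 : R), forall a, inB (zp a s).
  apply: (near0_forall (P := fun a s => inB (zp a s))) => a.
  have cz : zp a @ (0 : R) --> zp a 0 by exact: mder_near_cont (mder_pol _ _ _ _).
  have p0 : 0 < r - `|zs - z0| by rewrite subr_gt0.
  move: cz => /cvgrPdist_le/(_ _ p0); apply: filterS => s; rewrite /zp pol0 => h.
  have -> : inB (zp a s) = inB (zs - (zs - zp a s)) by rewrite opprB addrCA subrr addr0.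
  rewrite /inB addrAC; apply: le_trans (ler_normB _ _) _; move: h; rewrite /zp; clear; lra.
have nz' := near_oppR nz.
have : \forall s \near (0 : R), ball 0 r2 s by exact: nbhsx_ballx.
move=> nb.
have nall : \forall s \near (0 : R), [/\ ball 0 r2 s, s != 0 -> coupled phi k qs E i0 qs E1 s (th * s ^+ 2),
    (forall a, inB (zp a s)) /\ (forall a, inB (zp a (- s))) & 
   (forall a : 'I_d, `|(u \o mg_inv ix) (pol zx (row a E0) (accel phi ix zx (row a E0)) s) + (u \o mg_inv ix) (pol zx (row a E0) (accel phi ix zx (row a E0)) (- s))
    - 2 * (u \o mg_inv ix) zx - s ^+ 2 * step_rate phi ix (u \o mg_inv ix) zx (row a E0)| <= th * s ^+ 2) /\
   (forall a : 'I_d, `|sqdist z0 (zp a s) + sqdist z0 (zp a (- s)) - 2 * sqdist z0 zs - s ^+ 2 * step_rate phi i0 (sqdist z0) zs (row a E1)| <= th * s ^+ 2)].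
  have m1 : \forall s \near (0 : R), ball 0 r2 s /\ (s != 0 -> coupled phi k qs E i0 qs E1 s (th * s ^+ 2)).
    by apply: filterS2 nb cpl2 => s.
  have m2 : \forall s \near (0 : R), (forall a, inB (zp a s)) /\ (forall a, inB (zp a (- s))).
    by apply: filterS2 nz nz' => s.
  by apply: filterS2 (filterI m1 m2) (filterI so1 so2) => s [[h1 h2] h3] [h4 h5].
have [s s0 [sb sc [sz sz'] [su sq]]] := near0_positive nall.
have s2 : 0 < s ^+ 2 by rewrite exprn_gt0.
have sr2 : 0 < s < r2 by move: sb; rewrite /ball /= sub0r normrN gtr0_norm// => ->; rewrite s0.
have [ra [rb [ha hb hL]]] := coupled_tri (cpl1 s sr2) (sc (lt0r_neq0 s0)).
have inv_u : (u \o mg_inv ix) zx = u xs by rewrite /= inv_map.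
(* Maximality at [(zs, xs)] against a single pair of coupled steps; an upper bound on the new
   distance is all that enters. *)
have one a (t ra' : R) : inB (zp a t) ->
   (distance (mstep phi ix xs (row a E0) t) (mstep phi i0 qs (row a E1) t) < ra'%:E)%E ->
   (u \o mg_inv ix) (pol zx (row a E0) (accel phi ix zx (row a E0)) t) - u xs <=
   dl * (A * (sqdist z0 (zp a t) - sqdist z0 zs) + (ra' - D) / (1 + D)).
  move=> zB dlt; pose q' := mg_inv i0 (zp a t); pose x' := mstep phi ix xs (row a E0) t.
  have q'E : mstep phi i0 qs (row a E1) t = q' by rewrite /mstep mqs.
  rewrite q'E -/x' in dlt; have [cq' _] := bc _ zB.
  have cx' : conn o x' := conn_tri cq' (conn_sym (lt_conn dlt)).
  have := Gle _ _ zB cx'; rewrite /G -/q' -/qs Dsym.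
  have dq : dd q' x' < ra' by rewrite dd_sym; [exact: lt_dd|exact: conn_sym (lt_conn dlt)].
  by move=> H; exact: (penalised_step dl0 D0 (dd_ge0 q' x') dq H).
pose SU := \sum_a ((u \o mg_inv ix) (pol zx (row a E0) (accel phi ix zx (row a E0)) s) + (u \o mg_inv ix) (pol zx (row a E0) (accel phi ix zx (row a E0)) (- s)) - 2 * u xs).
pose SB := \sum_a (sqdist z0 (zp a s) + sqdist z0 (zp a (- s)) - 2 * sqdist z0 zs).
pose SR := \sum_a (ra a + rb a).
have EE0 := frame_of_orthonormal HE0.
apply: (@budget_contradiction R n e0 dl A b K th (s ^+ 2) D SU SB SR) => //; try exact: ltW.
- have rate := step_rate_sum phi d0 (u \o mg_inv ix) izx EE0.
  have LLe : e0 <= \sum_a step_rate phi ix (u \o mg_inv ix) zx (row a E0).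
    by rewrite rate; exact: LL.
  apply: (@le_trans _ _ (\sum_a (s ^+ 2 * step_rate phi ix (u \o mg_inv ix) zx (row a E0) - th * s ^+ 2))).
    rewrite sumrB -mulr_sumr sumr_const card_ord -[_ *+ d]mulr_natl -/n [n * (th * _)]mulrA.
    by apply: lerB; [rewrite ler_pM2l|exact: lexx].
  apply: ler_sum => a _; have := su a; rewrite inv_u ler_norml => /andP[+ _]; clear; lra.
- have key : SU <= \sum_a (dl * (A * (sqdist z0 (zp a s) - sqdist z0 zs) + (ra a - D) / (1 + D))
     + dl * (A * (sqdist z0 (zp a (- s)) - sqdist z0 zs) + (rb a - D) / (1 + D))).
    apply: ler_sum => a _; have := one a s (ra a) (sz a) (ha a); have := one a (- s) (rb a) (sz' a) (hb a).
    by clear; lra.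
  apply: le_trans key _; rewrite le_eqVlt; apply/orP; left; apply/eqP.
  have -> : SR - 2 * n * D = \sum_a (ra a + rb a - 2 * D).
    rewrite sumrB sumr_const card_ord -[_ *+ d]mulr_natl -/n /SR; congr (_ - _); ring.
  rewrite /SB mulr_sumr mulr_suml -big_split /= mulr_sumr; apply: eq_bigr => a _.
  by rewrite mulrBl; field; rewrite gt_eqF// ltr_wpDr.
- have hb' := Hb E1 zs E1M (le_trans zsB rr1).
  apply: (@le_trans _ _ (\sum_a (s ^+ 2 * step_rate phi i0 (sqdist z0) zs (row a E1) + th * s ^+ 2))).
    by apply: ler_sum => a _; have := sq a; rewrite ler_norml => /andP[_ +]; clear; lra.
  rewrite big_split /= -mulr_sumr sumr_const card_ord -[_ *+ d]mulr_natl -/n [n * (th * _)]mulrA.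
  by apply: lerD; [rewrite ler_pM2l|exact: lexx].
- by move: hL; rewrite -/SR -/n -/D; clear; lra.
Qed.

Section ScaledPotential.
Context {R : realType} {d : nat}.
Variables (U : set 'rV[R]_d) (f : 'rV[R]_d -> R) (c : R).
Hypotheses (oU : open U) (Cf : Ck_on 2 U f).

Lemma partial_mulc k y : U y -> partial k (fun z => c * f z) y = c * partial k f y.
Proof.
move=> Uy; have [_ /(_ k)[df _]] := Cf.
exact: der_val (der_mulc c (derivableP (df y Uy))).
Qed.

Lemma d1_mulc y u : U y -> d1 (fun z => c * f z) y u = c * d1 f y u.
Proof.
by move=> Uy; rewrite /d1 mulr_sumr; apply: eq_bigr => k _; rewrite partial_mulc// mulrA.
Qed.

Lemma d2_mulc y u v : U y -> d2 (fun z => c * f z) y u v = c * d2 f y u v.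
Proof.
move=> Uy; rewrite !d2E mulr_sumr; apply: eq_bigr => i _; rewrite mulr_sumr; apply: eq_bigr => j _.
have -> : partial i (partial j (fun z => c * f z)) y = c * partial i (partial j f) y.
  rewrite (@partial_eq_near _ _ _ (fun z => c * partial j f z)); last first.
    by apply: filterS (near_open oU Uy) => z Uz; exact: partial_mulc.
  have [_ /(_ j)[_ [_ /(_ i)[df _]]]] := Cf.
  exact: der_val (der_mulc c (derivableP (df y Uy))).
by rewrite !mulrA.
Qed.

End ScaledPotential.

Theorem theorem6p1 (R : realType) (m n : nat) (hm : (2 <= m)%N)
    (I : set R) (I_open : open I) (I_itv : is_interval I)
    (h : R -> R) (h_gt0 : forall t, I t -> 0 < h t) (h_smooth : smooth1_on I h)
    (P : riemannian_manifold R n) (M : riemannian_manifold R m)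
    (psi : M -> warped_product I h P) (psi_I : forall x : M, I (psi x).1)
    (c : R) (psi_soliton : mcf_soliton (@warped_field R n I h P) c psi)
    (M_complete : complete_manifold M)
    (t0 : R) (t0_I : I t0)
    (kappa : R) (P_curv : constant_sectional_curvature P kappa)
    (Lambda_fin :
      (((m%:R - 1)^-1)%:E *
       ereal_sup [set (second_ff_sqnorm psi x + c * derive1 h (psi x).1
                       - (m%:R - 1) *
                         warped_curvature_bound h kappa (psi x).1)%:E
                 | x in [set: M]] < +oo)%E) :
  let eta := fun x : M => oriented_integral h t0 (psi x).1 in
  weak_maximum_principle (drift_laplacian c eta).
Proof.
move=> eta u Cu sup_fin gam gam_lt; rewrite leNgt; apply/negP => inf_pos.
have d0 : (0 < m)%N by exact: ltnW.
have [_ [ o _ <-] uo'] := ereal_sup_gt gam_lt; have uo : gam < u o by rewrite -lte_fin.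
have [ub u_le] : exists ub : R, forall x, u x <= ub.
  exists (fine (ereal_sup [set (u x)%:E | x in [set: M]])) => x.
  have h1 : ((u x)%:E <= ereal_sup [set (u x)%:E | x in [set: M]])%E by apply: ereal_sup_ubound; exists x.
  rewrite -lee_fin fineK// fin_real// sup_fin andbT.
  by apply: lt_le_trans h1; exact: ltNyr.
have [e0 e00 Lu] : exists2 e0 : R, 0 < e0 & forall x, gam < u x -> e0 <= drift_laplacian c eta u x.
  have lb x : gam < u x -> (ereal_inf [set (drift_laplacian c eta u x)%:E | x in [set x : M | (gam < u x)%R]] <= (drift_laplacian c eta u x)%:E)%E.
    by move=> ux; apply: ereal_inf_lbound; exists x.
  move: inf_pos lb; case: (ereal_inf _) => [e| |] //.
  - by rewrite lte_fin => e0 lb; exists e => // x ux; have := lb x ux; rewrite lee_fin.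
  (* An infinite infimum would mean that no point satisfies [gam < u x]; any positive value of [e0]
     then does. *)
  - by move=> _ lb; exists 1 => // x ux; have := lb x ux; rewrite leye_eq.
have [K1 HK1] : exists K1 : R, forall x, second_ff_sqnorm psi x + c * derive1 h (psi x).1
     - (m%:R - 1) * warped_curvature_bound h kappa (psi x).1 <= K1.
  set S := ereal_sup _ in Lambda_fin.
  (* Positive because [m] is at least 2; hence an infinite supremum would make the product
     infinite. *)
  have m1 : 0 < ((m%:R - 1)^-1 : R) by rewrite invr_gt0 subr_gt0 ltr1n.
  have hx x : ((second_ff_sqnorm psi x + c * derive1 h (psi x).1
     - (m%:R - 1) * warped_curvature_bound h kappa (psi x).1)%:E <= S)%E by apply: ereal_sup_ubound; exists x.
  have Sy : (S < +oo)%E.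
    rewrite ltey; apply/eqP => SE; move: Lambda_fin; rewrite SE gt0_muley ?lte_fin//.
  exists (fine S) => x; rewrite -lee_fin fineK ?fin_real// Sy andbT.
  by apply: lt_le_trans (hx x); exact: ltNyr.
have psi_iso := psi_soliton.1.
pose phi x := c * eta x.
have Ceta (i : mg_index M) k : Ck_on k (mg_image i) (fun z => eta (mg_inv i z)).
  exact: (potential_smooth I_open h_smooth psi_I psi_iso I_itv t0_I).
have Cphi (i : mg_index M) k : Ck_on k (mg_image i) (fun z => phi (mg_inv i z)).
  by apply: Ck_on_mulc; [exact: image_open|exact: Ceta].
(* Enlarging the bound to a nonnegative one is harmless, and keeps the growth rate of coupled
   distances nonnegative. *)
have K0 : 0 <= Num.max 0 K1 by rewrite le_max lexx.
apply: (no_strict_subsolution M_complete Cphi d0 K0 _ Cu uo u_le e00).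
  move=> x E w i y g f EE.
  have iy : mg_image i y by apply: image_map; exact: at_dom.
  have oi : open (mg_image i) by exact: image_open.
  rewrite /f /phi (d2_mulc c oi (Ceta i 2) w w iy) (d1_mulc c (Ceta i 2) _ iy) -mulrBr.
  have hK : second_ff_sqnorm psi x + c * derive1 h (psi x).1
     - (m%:R - 1) * warped_curvature_bound h kappa (psi x).1 <= Num.max 0 K1.
    by rewrite le_max HK1 orbT.
  exact: (bakry_emery I_open h_gt0 h_smooth psi_I psi_iso P_curv psi_soliton EE I_itv t0_I w hK).
move=> x ux; have := Lu x ux; rewrite /drift_laplacian; congr (_ <= _ + _).
set i := mg_at x; have ix : mg_image i (mg_map i x) by apply: image_map; exact: at_dom.
rewrite /grad_inner -/i -innerZl; congr (inner _ _ _).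
rewrite /grad scalemxAl; congr (_ *m _); apply/rowP => k; rewrite !mxE.
by rewrite (partial_mulc c (Ceta i 2) k ix).
Qed.
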